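(* Let $G$ be a connected semisimple real Lie group with finite center, and let $\pi:G\to\mathcal U(\mathcal H)$ be an infinite-dimensional irreducible strongly continuous unitary representation on a separable Hilbert space $\mathcal H$. For every $0<\varepsilon<1$, there exist $0\neq\phi\in\mathcal H$ and a countable set $\Gamma\subset G$ such that $$(1-\varepsilon)^2\|f\|^2\leq \sum_{\gamma\in\Gamma}|\langle f,\pi(\gamma)\phi\rangle|^2\leq (1+\varepsilon)^2\|f\|^2\qquad(f\in\mathcal H).$$ If $q:G\to G/\operatorname{pker}(\pi)$ is the quotient map, then $\Gamma$ may be chosen so that $q|_\Gamma$ is injective and $q(\Gamma)$ is left relatively separated.
   Context: $\mathcal U(\mathcal H)$ is the unitary group of the complex Hilbert space $\mathcal H$, and $\mathbb T=\{z\in\mathbb C:|z|=1\}$. The projective kernel of $\pi$ is the closed normal subgroup $\operatorname{pker}(\pi)=\{g\in G:\pi(g)\in\mathbb T I_{\mathcal H}\}$. A subset $\Lambda$ of a locally compact group $Q$ is left relatively separated if for some relatively compact identity neighborhood $V\subset Q$ one has $\sup_{x\in Q}\#(\Lambda\cap xV)<\infty$. *)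

(* Defs.v *)
From HB Require Import structures.
From mathcomp Require Import all_boot all_order all_algebra.
From mathcomp Require Import all_classical all_reals all_analysis.
From mathcomp Require Import complex.

Set Implicit Arguments.
Unset Strict Implicit.
Unset Printing Implicit Defensive.

Import Order.TTheory GRing.Theory Num.Theory.
Import numFieldNormedType.Exports.

Local Open Scope classical_set_scope.
Local Open Scope ring_scope.

HB.structure Definition PreTopologicalGroup := {G of Topological G & Group G}.

HB.mixin Record isTopologicalGroup G of PreTopologicalGroup G := {
  mulg_continuous : continuous (fun p : G * G => (p.1 * p.2)%g) ;
  invg_continuous : continuous (fun x : G => (x^-1)%g)
}.

#[short(type="topologicalGroupType")]
HB.structure Definition TopologicalGroup :=
  {G of PreTopologicalGroup G & isTopologicalGroup G}.

Definition group_center (G : groupType) : set G :=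
  [set z | forall g : G, commute z g].
Arguments group_center G : clear implicits.

Section QuotientGroup.
Variable G : topologicalGroupType.
Local Open Scope quotient_scope.
Local Open Scope group_scope.

Record normalSubgroup := NormalSubgroup {
  nsg_set : set G ;
  nsg1 : nsg_set 1 ;
  nsgM : forall x y, nsg_set x -> nsg_set y -> nsg_set (x * y) ;
  nsgV : forall x, nsg_set x -> nsg_set x^-1 ;
  nsgJ : forall x y, nsg_set x -> nsg_set (x ^ y)
}.

Variable N : normalSubgroup.

Definition coset_rel (x y : G) : bool := `[< nsg_set N (x^-1 * y) >].

Lemma coset_rel_refl : reflexive coset_rel.
Proof. by move=> x; apply/asboolP; rewrite mulVg; exact: nsg1. Qed.

Lemma coset_rel_sym : symmetric coset_rel.
Proof.
have imp x y : coset_rel x y -> coset_rel y x.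
  move=> /asboolP /nsgV; rewrite invgM invgK => h; exact/asboolP.
by move=> x y; apply/idP/idP; exact: imp.
Qed.

Lemma coset_rel_trans : transitive coset_rel.
Proof.
move=> y x z /asboolP h /asboolP k; apply/asboolP.
by have := nsgM h k; rewrite mulgA mulgK.
Qed.

Canonical coset_equiv :=
  EquivRel coset_rel coset_rel_refl coset_rel_sym coset_rel_trans.

Definition quotient_group : Type := quotient_topology {eq_quot coset_rel}.

HB.instance Definition _ := Topological.on quotient_group.
HB.instance Definition _ := Quotient.on quotient_group.

Definition quotient_map (x : G) : quotient_group := \pi_quotient_group x.


Lemma quotient_map_eq x y :
  quotient_map x = quotient_map y <-> nsg_set N (x^-1 * y).
Proof.
split=> [/(@eqquotP _ _ {eq_quot coset_rel})/asboolP //|h].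
by apply/(@eqquotP _ _ {eq_quot coset_rel})/asboolP.
Qed.

Lemma quotient_map_repr (u : quotient_group) : quotient_map (repr u) = u.
Proof. exact: reprK. Qed.

Lemma quotient_map_surj (u : quotient_group) : exists x, u = quotient_map x.
Proof. by exists (repr u); rewrite quotient_map_repr. Qed.

Definition quotient_mul (u v : quotient_group) : quotient_group :=
  quotient_map (repr u * repr v).
Definition quotient_inv (u : quotient_group) : quotient_group :=
  quotient_map (repr u)^-1.

Lemma quotient_mulE x y :
  quotient_mul (quotient_map x) (quotient_map y) = quotient_map (x * y).
Proof.
apply/quotient_map_eq; set a := repr _; set b := repr _.
have ha : nsg_set N (a^-1 * x) by apply/quotient_map_eq; rewrite quotient_map_repr.
have hb : nsg_set N (b^-1 * y) by apply/quotient_map_eq; rewrite quotient_map_repr.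
suff -> : (a * b)^-1 * (x * y) = (a^-1 * x) ^ b * (b^-1 * y).
  by apply: nsgM => //; exact: nsgJ.
by rewrite /conjg invgM !mulgA mulgK.
Qed.

Lemma quotient_invE x : quotient_inv (quotient_map x) = quotient_map x^-1.
Proof.
apply/quotient_map_eq; set a := repr _.
have ha : nsg_set N (x^-1 * a) by apply/quotient_map_eq; rewrite quotient_map_repr.
suff -> : a^-1^-1 * x^-1 = (x^-1 * a) ^ x^-1 by exact: nsgJ.
by rewrite /conjg !invgK !mulgA mulgV mul1g.
Qed.

Fact quotient_mulA : associative quotient_mul.
Proof.
move=> u v w; have [[x ->] [y ->] [z ->]] :=
  And3 (quotient_map_surj u) (quotient_map_surj v) (quotient_map_surj w).
by rewrite !quotient_mulE mulgA.
Qed.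

Fact quotient_mul1g : left_id (quotient_map 1) quotient_mul.
Proof. by move=> u; have [x ->] := quotient_map_surj u; rewrite quotient_mulE mul1g. Qed.

Fact quotient_mulg1 : right_id (quotient_map 1) quotient_mul.
Proof. by move=> u; have [x ->] := quotient_map_surj u; rewrite quotient_mulE mulg1. Qed.

Fact quotient_mulVg : left_inverse (quotient_map 1) quotient_inv quotient_mul.
Proof.
move=> u; have [x ->] := quotient_map_surj u.
by rewrite quotient_invE quotient_mulE mulVg.
Qed.

Fact quotient_mulgV : right_inverse (quotient_map 1) quotient_inv quotient_mul.
Proof.
move=> u; have [x ->] := quotient_map_surj u.
by rewrite quotient_invE quotient_mulE mulgV.
Qed.

HB.instance Definition _ := isGroup.Build quotient_group quotient_mulA
  quotient_mul1g quotient_mulg1 quotient_mulVg quotient_mulgV.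

Lemma quotient_map_continuous : continuous quotient_map.
Proof. exact: pi_continuous. Qed.

Lemma quotient_map_open (A : set G) : open A -> open (quotient_map @` A).
Proof.
move=> oA; rewrite /open/= /quotient_open.
rewrite (_ : _ @^-1` _ =
    \bigcup_(n in nsg_set N) ((fun x => x * n) @^-1` A)).
  apply: bigcup_open => n _; apply: open_comp => // x _.
  apply: (@continuous_comp _ (G * G)%type _ (fun x => (x, n))
    (fun p : G * G => p.1 * p.2)); last exact: mulg_continuous.
  by apply: cvg_pair => /=; [exact: cvg_id|exact: cvg_cst].
apply/seteqP; split=> x /=.
  move=> [a Aa] /esym/quotient_map_eq h; exists (x^-1 * a) => //=.
  by rewrite mulgA mulgV mul1g.
move=> [n Nn /= Axn]; exists (x * n) => //; apply/esym/quotient_map_eq.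
by rewrite mulgA mulVg mul1g.
Qed.

Lemma quotient_map_nbhs x (A : set G) :
  nbhs x A -> nbhs (quotient_map x) (quotient_map @` A).
Proof.
rewrite nbhsE => -[B [oB Bx] BA].
apply: (@filterS _ _ _ (quotient_map @` B)); first exact: image_subset.
by apply: open_nbhs_nbhs; split; [exact: quotient_map_open|exists x].
Qed.

Fact quotient_mul_continuous :
  continuous (fun p : quotient_group * quotient_group => p.1 * p.2).
Proof.
move=> [u v]; have [[x ->] [y ->]] := (quotient_map_surj u, quotient_map_surj v).
move=> W /=; rewrite [_ * _]quotient_mulE => /quotient_map_continuous /=.
move=> /(@mulg_continuous G (x, y)) [[A B] /= [nA nB] AB].
exists (quotient_map @` A, quotient_map @` B).
  by split; exact: quotient_map_nbhs.
move=> [_ _] [/= [a Aa <-] [b Bb <-]].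
by rewrite /preimage/= [_ * _]quotient_mulE; exact: (AB (a, b)).
Qed.

Fact quotient_inv_continuous : continuous (fun u : quotient_group => u^-1).
Proof.
move=> u; have [x ->] := quotient_map_surj u.
move=> W /=; rewrite [_^-1]quotient_invE => /quotient_map_continuous /=.
move=> /(@invg_continuous G x) h; have := quotient_map_nbhs h.
apply: filterS => _ [a /= Wa <-].
by rewrite /preimage/= [_^-1]quotient_invE.
Qed.

HB.instance Definition _ := isTopologicalGroup.Build quotient_group
  quotient_mul_continuous quotient_inv_continuous.

End QuotientGroup.

Definition left_relatively_separated (Q : topologicalGroupType) (L : set Q) :=
  exists V : set Q, [/\ nbhs 1%g V, compact (closure V) &
    exists k : nat, forall x : Q,
      (L `&` [set (x * v)%g | v in V] #<= `I_k)%card].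

(* For finite-dimensional V and open A this is C^k in the usual sense: all
   iterated partial derivatives up to order k exist and are continuous. *)
Fixpoint Ck {R : realType} {V W : normedModType R} (k : nat)
    (A : set V) (f : V -> W) : Prop :=
  {within A, continuous f} /\
  (if k is k'.+1 then
     forall v : V, (forall x, A x -> derivable f x v) /\ Ck k' A ('D_v f)
   else True).

Definition smooth {R : realType} {V W : normedModType R}
    (A : set V) (f : V -> W) : Prop := forall k, Ck k A f.

Record chart (M E : topologicalType) := Chart {
  cdom : set M ;
  ccod : set E ;
  cmap : M -> E ;
  cinv : E -> M ;
  cdom_open : open cdom ;
  ccod_open : open ccod ;
  cmap_to : forall p, cdom p -> ccod (cmap p) ;
  cinv_to : forall x, ccod x -> cdom (cinv x) ;
  cmapK : forall p, cdom p -> cinv (cmap p) = p ;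
  cinvK : forall x, ccod x -> cmap (cinv x) = x ;
  cmap_continuous : {within cdom, continuous cmap} ;
  cinv_continuous : {within ccod, continuous cinv}
}.

HB.mixin Record isSmoothManifold (R : realType) (n : nat) M of Topological M := {
  atlas : set (chart M 'rV[R]_n) ;
  atlas_cover : forall p : M, exists2 c, atlas c & cdom c p ;
  atlas_smooth : forall c d, atlas c -> atlas d ->
    smooth [set x | ccod c x /\ cdom d (cinv c x)]
           (fun x => cmap d (cinv c x)) ;
  manifold_hausdorff : hausdorff_space M ;
  manifold_second_countable : @second_countable M
}.

#[short(type="smoothManifoldType")]
HB.structure Definition SmoothManifold (R : realType) (n : nat) :=
  {M of Topological M & isSmoothManifold R n M}.

HB.structure Definition PreLieGroup (R : realType) (n : nat) :=
  {G of SmoothManifold R n G & TopologicalGroup G}.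

HB.mixin Record isLieGroup (R : realType) (n : nat) G of PreLieGroup R n G := {
  mulg_smooth : forall c d e : chart G 'rV[R]_n,
    atlas c -> atlas d -> atlas e ->
    smooth [set p : 'rV[R]_n * 'rV[R]_n |
              [/\ ccod c p.1, ccod d p.2 & cdom e (cinv c p.1 * cinv d p.2)%g]]
           (fun p => cmap e (cinv c p.1 * cinv d p.2)%g) ;
  invg_smooth : forall c d : chart G 'rV[R]_n, atlas c -> atlas d ->
    smooth [set x | ccod c x /\ cdom d (cinv c x)^-1%g]
           (fun x => cmap d (cinv c x)^-1%g)
}.

#[short(type="lieGroupType")]
HB.structure Definition LieGroup (R : realType) (n : nat) :=
  {G of PreLieGroup R n G & isLieGroup R n G}.

Section LieAlgebra.
Variables (R : realType) (n : nat) (G : lieGroupType R n).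
Local Notation E := 'rV[R]_n.

Definition vf_bracket (v w : E -> E) (x : E) : E :=
  'D_(v x) w x - 'D_(w x) v x.

Variable c : chart G E.

(* The left-invariant vector field on G with value X at the identity, read in
   the chart c, which is assumed to contain the identity: its value at
   g = cinv c x is the differential at 1 of the left translation by g,
   applied to X. *)
Definition left_invariant_vf (X : E) (x : E) : E :=
  'D_X (fun y => cmap c (cinv c x * cinv c y)%g) (cmap c 1%g).

(* The bracket of the Lie algebra T_1 G, identified with R^n by the chart c. *)
Definition lie_bracket (X Y : E) : E :=
  vf_bracket (left_invariant_vf X) (left_invariant_vf Y) (cmap c 1%g).

Definition lie_ideal (I : {vspace E}) : Prop :=
  forall X Y, Y \in I -> lie_bracket X Y \in I.

(* [I, I]; as the bracket is bilinear, the brackets of basis vectors span it. *)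
Definition derived_algebra (I : {vspace E}) : {vspace E} :=
  <<[seq lie_bracket X Y | X <- vbasis I, Y <- vbasis I]>>%VS.

Definition lie_solvable (I : {vspace E}) : Prop :=
  exists k, iter k derived_algebra I = 0%VS.

End LieAlgebra.

(* The Lie algebra of G has zero radical. The choice of the chart at the
   identity does not matter, the resulting Lie algebras being isomorphic. *)
Definition semisimple {R : realType} {n : nat} (G : lieGroupType R n) : Prop :=
  forall c : chart G 'rV[R]_n, atlas c -> cdom c 1%g ->
  forall I : {vspace 'rV[R]_n},
    lie_ideal c I -> lie_solvable c I -> I = 0%VS.

HB.mixin Record isHilbert (R : realType) H of CompleteNormedModule R[i] H := {
  inner : {dot H for Num.conj} ;
  inner_norm : forall x : H, `|x| ^+ 2 = inner x x
}.

#[short(type="hilbertType")]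
HB.structure Definition Hilbert (R : realType) :=
  {H of CompleteNormedModule R[i] H & isHilbert R H}.

(* The norm of a vector space over R[i] takes its (real) values in R[i]. *)
Definition rnorm {R : realType} {V : normedZmodType R[i]} (x : V) : R :=
  complex.Re `|x|.

Definition separable (T : topologicalType) : Prop :=
  exists2 D : set T, countable D & dense D.

Definition infinite_dimensional {K : fieldType} (V : lmodType K) : Prop :=
  forall (m : nat) (e : 'I_m -> V),
    exists v, forall a : 'I_m -> K, v <> \sum_(i < m) a i *: e i.

Definition unitary {R : realType} {H : hilbertType R} (U : {linear H -> H}) :=
  (forall x y, inner (U x) (U y) = inner x y) /\ (forall y, exists x, U x = y).

Record unitary_representation {R : realType}
    (G : topologicalGroupType) (H : hilbertType R) := UnitaryRepresentation {
  rep_op :> G -> {linear H -> H} ;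
  rep_unitary : forall g, unitary (rep_op g) ;
  repM : forall g h x, rep_op (g * h)%g x = rep_op g (rep_op h x) ;
  rep_strongly_continuous : forall x, continuous (fun g => rep_op g x)
}.

Section Representation.
Context {R : realType} {G : topologicalGroupType} {H : hilbertType R}.
Variable pi : unitary_representation G H.

Definition irreducible : Prop :=
  (exists x : H, x != 0) /\
  forall S : set H, closed S -> S 0 ->
    (forall (a : R[i]) x y, S x -> S y -> S (a *: x + y)) ->
    (forall g x, S x -> S (pi g x)) ->
    S = [set 0] \/ S = setT.

Definition pker_set : set G :=
  [set g | exists2 z : R[i], `|z| = 1 & forall x, pi g x = z *: x].

Lemma rep_inj g : injective (pi g).
Proof.
move=> x y e; apply/eqP; rewrite -subr_eq0 -normr_eq0 -sqrf_eq0 inner_norm.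
by rewrite -(rep_unitary pi g).1 linearB e subrr -inner_norm normr0 expr0n.
Qed.

Lemma rep1 x : pi 1%g x = x.
Proof. by apply: (@rep_inj 1%g); rewrite -repM mulg1. Qed.

Lemma repV_scale g z x : `|z| = 1 -> pi g x = z *: x -> pi g^-1%g x = z^-1 *: x.
Proof.
move=> z1 e; have z0 : z != 0 by rewrite -normr_eq0 z1 oner_neq0.
apply: (@rep_inj g); rewrite -repM mulgV rep1 linearZ_LR e.
by rewrite scalerA mulVf // scale1r.
Qed.

Fact pker1 : pker_set 1%g.
Proof. by exists 1; [exact: normr1|move=> x; rewrite rep1 scale1r]. Qed.

Fact pkerM g h : pker_set g -> pker_set h -> pker_set (g * h)%g.
Proof.
move=> [z z1 hz] [w w1 hw]; exists (z * w); first by rewrite normrM z1 w1 mulr1.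
by move=> x; rewrite repM hw linearZ_LR hz scalerA mulrC.
Qed.

Fact pkerV g : pker_set g -> pker_set g^-1%g.
Proof.
move=> [z z1 hz]; exists z^-1; first by rewrite normfV z1 invr1.
by move=> x; exact: repV_scale.
Qed.

Fact pkerJ g h : pker_set g -> pker_set (g ^ h)%g.
Proof.
move=> [z z1 hz]; exists z => // x.
by rewrite /conjg !repM hz linearZ_LR -repM mulVg rep1.
Qed.

Definition pker : normalSubgroup G := NormalSubgroup pker1 pkerM pkerV pkerJ.

End Representation.

(* Main.v *)
(* Let k be the ideal of the Lie algebra on which the derived representation
   vanishes, and c its orthogonal for the Killing form. If Ad(G) is unbounded
   on c, then renormalised images of vectors of c accumulate at a nonzero
   ad-nilpotent element of c. By Jacobson-Morozov it belongs to an sl2-triple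
   acting nontrivially on H, and Mautner's argument shows that the matrix
   coefficients of pi tend to 0 along the unipotent subgroup u and along the
   diagonal subgroup of the triple; the latter contains h_k with
   h_k u_t h_k^-1 -> 1 for every t. If Ad(G) is bounded on c, then the orbits
   of pi are totally bounded: an element with Ad close to 1 on the Lie algebra
   is, up to the finite center, close to 1. A convex combination of rank one
   projections on an orbit of minimal Hilbert-Schmidt norm is then a compact
   operator commuting with pi, and H has finite dimension.

   In the first case let (e_k) be an orthonormal basis and
     phi = delta x0 + sum_k N_k^(-1/2) pi(h_k^-1) e_k,
     gamma_(k,i) = h_k u_(t_i) = v_(k,i) h_k  for i < N_k,
   where v_(k,i) = h_k u_(t_i) h_k^-1 is close to 1 and the h_k are chosen one
   after the other. Then pi(gamma_(k,i)) phi is N_k^(-1/2) e_k, plus an almost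
   orthogonal family of norm about delta, plus a small remainder. The first
   terms give Parseval's identity and the other two perturb it by at most eps;
   moreover the vectors pi(gamma) phi are nearly orthogonal to each other,
   which separates the gammas modulo the projective kernel. *)
Require Import Defs.
From HB Require Import structures.
From mathcomp Require Import all_boot all_order all_algebra.
From mathcomp Require Import all_classical all_reals all_analysis.
From mathcomp Require Import complex.
From mathcomp Require Import ring lra zify.
Import Order.TTheory GRing.Theory Num.Theory.
Import numFieldNormedType.Exports.
Local Open Scope classical_set_scope.
Local Open Scope ring_scope.
Local Open Scope complex_scope.

Set Implicit Arguments.
Unset Strict Implicit.
Unset Printing Implicit Defensive.

(** * Hilbert spaces *)

(** A frame must reproduce every [e_k] from one vector, but [phi] cannot contain all
    [pi(h_k^-1) e_k] at full size. The weight [N_k^(-1/2)] makes these pieces summable, and the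
    [N_k] elements [gamma_(k,i)] restore the lost mass, each contributing one [N_k]-th of
    [|<f, e_k>|^2]. The price is that [delta x0] is moved [N_k] times as well; mixing along [u]
    keeps its images almost orthogonal, so that their joint Bessel bound stays near [delta^2]
    instead of growing with [N_k]. The term [delta x0] also bounds the norm of [phi] from below, and
    its images separate the [gamma_(k,i)], whose contributions [N_k^(-1/2) e_k] coincide within a
    stage. The values are [delta = eps/4] and a tolerance [kappa = delta/100] for the remaining
    errors. The group structure enters through the second-order expansion of the product in a chart:
    its bilinear part gives the bracket, and limits of powers give the exponential map. The ideal
    [k] is described by the action of one-parameter subgroups, so that no vector of [H] has to be
    differentiated. *)

Section Rnorm.
Context {R : realType} {V : normedZmodType R[i]}.
Implicit Types x y : V.

Lemma rnormE x : `|x| = (rnorm x)%:C.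
Proof.
rewrite /rnorm; have := normr_ge0 x; case: `|x| => a b /=.
by rewrite lecE /= => /andP[/eqP -> _].
Qed.

Lemma rnorm_ge0 x : 0 <= rnorm x.
Proof. by rewrite -ler0c -rnormE. Qed.

Lemma gen_rnorm0 : rnorm (0 : V) = 0.
Proof. by rewrite /rnorm normr0. Qed.

Lemma gen_rnorm_eq0 x : (rnorm x == 0) = (x == 0).
Proof. by rewrite -[RHS]normr_eq0 rnormE (inj_eq (@complexI R) _ 0). Qed.

Lemma gen_rnorm_gt0 x : (0 < rnorm x) = (x != 0).
Proof. by rewrite lt_def gen_rnorm_eq0 rnorm_ge0 andbT. Qed.

Lemma gen_rnormN x : rnorm (- x) = rnorm x.
Proof. by rewrite /rnorm normrN. Qed.

Lemma gen_rdistC x y : rnorm (x - y) = rnorm (y - x).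
Proof. by rewrite /rnorm distrC. Qed.

Lemma gen_rnormD x y : rnorm (x + y) <= rnorm x + rnorm y.
Proof. by have := ler_normD x y; rewrite !rnormE -rmorphD lecR. Qed.

Lemma gen_rnormB x y : rnorm (x - y) <= rnorm x + rnorm y.
Proof. by rewrite -(gen_rnormN y) gen_rnormD. Qed.

Lemma gen_rdistD z x y : rnorm (x - y) <= rnorm (x - z) + rnorm (z - y).
Proof. by rewrite (le_trans _ (gen_rnormD _ _)) // addrA subrK. Qed.

Lemma gen_rnorm_sum I (r : seq I) (P : pred I) (F : I -> V) :
  rnorm (\sum_(i <- r | P i) F i) <= \sum_(i <- r | P i) rnorm (F i).
Proof.
elim/big_rec2: _ => [|i u v _ h]; first by rewrite gen_rnorm0.
by rewrite (le_trans (gen_rnormD _ _)) // lerD2l.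
Qed.

End Rnorm.

Section Hilbert.
Context {R : realType} {H : hilbertType R}.
Implicit Types x y z f : H.
Local Notation C := R[i].

Lemma rnorm0 : rnorm (0 : H) = 0. Proof. exact: gen_rnorm0. Qed.
Lemma rnorm_eq0 x : (rnorm x == 0) = (x == 0). Proof. exact: gen_rnorm_eq0. Qed.
Lemma rnorm_gt0 x : (0 < rnorm x) = (x != 0). Proof. exact: gen_rnorm_gt0. Qed.
Lemma rnormN x : rnorm (- x) = rnorm x. Proof. exact: gen_rnormN. Qed.
Lemma rdistC x y : rnorm (x - y) = rnorm (y - x). Proof. exact: gen_rdistC. Qed.
Lemma rnormD x y : rnorm (x + y) <= rnorm x + rnorm y. Proof. exact: gen_rnormD. Qed.
Lemma rnormB x y : rnorm (x - y) <= rnorm x + rnorm y. Proof. exact: gen_rnormB. Qed.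
Lemma rdistD z x y : rnorm (x - y) <= rnorm (x - z) + rnorm (z - y).
Proof. exact: gen_rdistD. Qed.
Lemma cnorm0 : rnorm (0 : C) = 0. Proof. exact: gen_rnorm0. Qed.
Lemma cnorm_eq0 (a : C) : (rnorm a == 0) = (a == 0). Proof. exact: gen_rnorm_eq0. Qed.
Lemma cnormN (a : C) : rnorm (- a) = rnorm a. Proof. exact: gen_rnormN. Qed.
Lemma cnormD (a b : C) : rnorm (a + b) <= rnorm a + rnorm b. Proof. exact: gen_rnormD. Qed.
Lemma cnormB (a b : C) : rnorm (a - b) <= rnorm a + rnorm b. Proof. exact: gen_rnormB. Qed.
Lemma cnorm_sum I (r : seq I) (P : pred I) (F : I -> C) :
  rnorm (\sum_(i <- r | P i) F i) <= \sum_(i <- r | P i) rnorm (F i).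
Proof. exact: gen_rnorm_sum. Qed.

Lemma rnormZ (a : C) x : rnorm (a *: x) = rnorm a * rnorm x.
Proof. by have := normrZ a x; rewrite !rnormE -rmorphM => /complexI. Qed.

Lemma rnormM (a b : C) : rnorm (a * b) = rnorm a * rnorm b.
Proof. by have := normrM a b; rewrite !rnormE -rmorphM => /complexI. Qed.

Lemma rnormC (a : R) : rnorm (a%:C : C) = `|a|.
Proof. by rewrite /rnorm normc_def /= expr0n addr0 sqrtr_sqr. Qed.

Lemma rnormCr (r : R) : 0 <= r -> rnorm (r%:C : C) = r.
Proof. by move=> r0; rewrite rnormC ger0_norm. Qed.

Lemma rnorm_conj (a : C) : rnorm (a^*)%C = rnorm a.
Proof. by rewrite /rnorm !normc_def; case: a => a b /=; rewrite sqrrN. Qed.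

Lemma conjcM (a b : C) : ((a * b)^*)%C = (a^*)%C * (b^*)%C.
Proof. exact: rmorphM. Qed.

Lemma sqr_rnormC (a : C) : ((rnorm a ^+ 2)%:C) = a * (a^*)%C.
Proof. by rewrite rmorphXn /= -rnormE sqr_normc. Qed.

Lemma sqr_rnorm x : (rnorm x ^+ 2)%:C = inner x x.
Proof. by rewrite rmorphXn /= -rnormE inner_norm. Qed.

Lemma innerC x y : inner x y = ((inner y x)^*)%C.
Proof. by rewrite hermC expr0 mul1r. Qed.

Lemma rnorm_innerC x y : rnorm (inner x y) = rnorm (inner y x).
Proof. by rewrite innerC rnorm_conj. Qed.

Lemma innerDl x y z : inner (x + y) z = inner x z + inner y z.
Proof. exact: linearDl. Qed.
Lemma innerBl x y z : inner (x - y) z = inner x z - inner y z.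
Proof. exact: linearBl. Qed.
Lemma innerDr x y z : inner z (x + y) = inner z x + inner z y.
Proof. exact: linearDr. Qed.
Lemma innerBr x y z : inner z (x - y) = inner z x - inner z y.
Proof. exact: linearBr. Qed.
Lemma innerZl (a : C) x y : inner (a *: x) y = a * inner x y.
Proof. exact: linearZl_LR. Qed.
Lemma innerZr (a : C) x y : inner x (a *: y) = (a^*)%C * inner x y.
Proof. by rewrite linearZr_LR. Qed.
Lemma inner0l x : inner 0 x = 0.
Proof. exact: linear0l. Qed.
Lemma inner0r x : inner x 0 = 0.
Proof. exact: linear0r. Qed.
Lemma inner_suml I (r : seq I) (P : pred I) (F : I -> H) z :
  inner (\sum_(i <- r | P i) F i) z = \sum_(i <- r | P i) inner (F i) z.
Proof. exact: (linear_sum (applyr (@inner R H) z)). Qed.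
Lemma inner_sumr I (r : seq I) (P : pred I) (F : I -> H) z :
  inner z (\sum_(i <- r | P i) F i) = \sum_(i <- r | P i) inner z (F i).
Proof. exact: linear_sum. Qed.

Lemma sqr_rnormD x y :
  rnorm (x + y) ^+ 2 = rnorm x ^+ 2 + rnorm y ^+ 2 + 2 * complex.Re (inner x y).
Proof.
have E z : rnorm z ^+ 2 = complex.Re (inner z z) by rewrite -sqr_rnorm.
rewrite !E innerDl !innerDr (innerC y x).
case: (inner x x) => ? ?; case: (inner y y) => ? ?; case: (inner x y) => ? ? /=.
by ring.
Qed.

Lemma sqr_rnormB x y :
  rnorm (x - y) ^+ 2 = rnorm x ^+ 2 + rnorm y ^+ 2 - 2 * complex.Re (inner x y).
Proof.
rewrite sqr_rnormD rnormN -mulrN; congr (_ + 2 * _).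
by rewrite linearNr /=; case: (inner x y).
Qed.

Lemma Re_le_rnorm (a : C) : `|complex.Re a| <= rnorm a.
Proof.
case: a => a b /=; rewrite /rnorm normc_def /= -sqrtr_sqr ler_wsqrtr //.
by rewrite lerDl sqr_ge0.
Qed.

Lemma innerxx x : inner x x = (rnorm x ^+ 2)%:C.
Proof. by rewrite sqr_rnorm. Qed.

Lemma rnorm_innerxx x : rnorm (inner x x) = rnorm x ^+ 2.
Proof. by rewrite innerxx rnormCr // sqr_ge0. Qed.

(** Expanding the square of the norm of [|y|^2 x - <x, y> y], a choice that avoids division, gives
    the inequality multiplied by [|y|^2]. *)
Lemma cauchy_schwarz x y : rnorm (inner x y) <= rnorm x * rnorm y.
Proof.
have [->|y0] := eqVneq y 0; first by rewrite inner0r cnorm0 rnorm0 mulr0.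
have ny : 0 < rnorm y by rewrite rnorm_gt0.
pose a := inner x y; pose r := rnorm y ^+ 2.
have r0 : 0 < r by rewrite exprn_gt0.
have : 0 <= rnorm (r%:C *: x - a *: y) ^+ 2 by rewrite sqr_ge0.
rewrite sqr_rnormB !rnormZ (rnormCr (ltW r0)) innerZl innerZr -/a.
rewrite [(a^*)%C * a]mulrC -sqr_rnormC -rmorphM /= !exprMn -/r => h.
rewrite -(@ler_pXn2r _ 2) ?nnegrE ?mulr_ge0 ?rnorm_ge0 //.
rewrite exprMn -/r -/a -(ler_pM2l r0) -subr_ge0; nra.
Qed.

End Hilbert.

Section HilbertTopology.
Context {R : realType} {H : hilbertType R}.
Implicit Types x y z f : H.

Lemma nbhs_rnormP x (A : set H) :
  nbhs x A <-> exists2 e : R, 0 < e & forall y, rnorm (x - y) < e -> A y.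
Proof.
split => [/nbhs_ballP[e e0 h]|[e e0 h]].
  have e0' : 0 < complex.Re e by move: e0; rewrite /= ltcE /= => /andP[].
  exists (complex.Re e) => // y yx; apply: h.
  rewrite -ball_normE /= rnormE; move: e0; rewrite /= !ltcE /=.
  by case: e e0' yx => a b /= _ -> /andP[/eqP -> _]; rewrite eqxx.
apply/nbhs_ballP; exists (e%:C) => /=; first by rewrite ltcR.
by move=> y; rewrite -ball_normE /= rnormE ltcR; exact: h.
Qed.

Lemma cvg_rnormP {T : Type} {F : set_system T} {FF : Filter F} (f : T -> H) l :
  f @ F --> l <-> forall e : R, 0 < e -> \forall t \near F, rnorm (l - f t) < e.
Proof.
split=> [h e e0|h A /nbhs_rnormP[e e0 eA]].
  by apply: (h [set y | rnorm (l - y) < e]); apply/nbhs_rnormP; exists e.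
by apply: filterS (h e e0) => t; exact: eA.
Qed.

Lemma closed_rnorm (S : set H) x : closed S ->
  (forall e : R, 0 < e -> exists2 s, S s & rnorm (x - s) < e) -> S x.
Proof.
move=> cS h; apply: cS => A /nbhs_rnormP[e e0 eA].
by have [s Ss xs] := h e e0; exists s; split => //; exact: eA.
Qed.

Lemma rnorm_closed (S : set H) :
  (forall x, (forall e : R, 0 < e -> exists2 s, S s & rnorm (x - s) < e) -> S x) ->
  closed S.
Proof.
move=> h x cx; apply: h => e e0.
have [|s [Ss xs]] := cx [set y | rnorm (x - y) < e]; last by exists s.
by apply/nbhs_rnormP; exists e.
Qed.

Lemma rnorm_complete (u : nat -> H) :
  (forall e : R, 0 < e ->
     exists N, forall m n, (N <= m)%N -> (N <= n)%N -> rnorm (u m - u n) < e) ->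
  exists l : H, forall e : R, 0 < e ->
     exists N, forall n, (N <= n)%N -> rnorm (l - u n) < e.
Proof.
move=> h; have cu : cauchy (u @ \oo).
  apply/cauchyP => /= e; rewrite ltcE /= => /andP[/eqP ie e0].
  have [N hN] := h _ e0; exists (u N); exists N => //= n Nn.
  rewrite /= -ball_normE /= rnormE ltcE /= ie eqxx /=; exact: hN.
have cvu : cvg (u @ \oo) by apply: cauchy_cvg.
exists (lim (u @ \oo)) => e e0.
have /cvg_rnormP/(_ e e0)[N _ hN] := cvu.
by exists N => n; exact: hN.
Qed.

Lemma le_of_forall_lt (a b : R) : (forall e : R, 0 < e -> a <= b + e) -> a <= b.
Proof. by move=> h; apply/ler_addgt0Pr. Qed.

Lemma parallelogram x y :
  rnorm (x + y) ^+ 2 + rnorm (x - y) ^+ 2 = 2 * rnorm x ^+ 2 + 2 * rnorm y ^+ 2.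
Proof. by rewrite sqr_rnormD sqr_rnormB; ring. Qed.

Lemma invn_lt (e : R) : 0 < e -> exists N, forall n, (N <= n)%N -> n.+1%:R^-1 < e :> R.
Proof.
by move=> e0; have [N _ hN] := near_infty_natSinv_lt (PosNum e0); exists N => n; exact: hN.
Qed.

Definition subspace (S : set H) : Prop :=
  S 0 /\ forall (a : R[i]) x y, S x -> S y -> S (a *: x + y).

Section Subspace.
Variables (S : set H) (sS : subspace S).

Lemma subspaceD x y : S x -> S y -> S (x + y).
Proof. by move=> ? ?; rewrite -[x]scale1r; apply: sS.2. Qed.
Lemma subspaceZ (a : R[i]) x : S x -> S (a *: x).
Proof. by move=> ?; rewrite -[_ *: _]addr0; apply: sS.2 => //; exact: sS.1. Qed.
End Subspace.

(** Minimality against the single coefficient [<x, y> / |y|^2] suffices: it lowers the squared norm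
    by [|<x, y>|^2 / |y|^2], which must therefore vanish. *)
Lemma inner_eq0_min x y :
  (forall a : R[i], rnorm x <= rnorm (x - a *: y)) -> inner x y = 0.
Proof.
move=> h; apply/eqP; rewrite -cnorm_eq0; apply/eqP.
have [->|y0] := eqVneq y 0; first by rewrite inner0r cnorm0.
set r := rnorm y ^+ 2; have r0 : 0 < r by rewrite exprn_gt0 // rnorm_gt0.
have := h ((r^-1)%:C * inner x y).
rewrite -(@ler_pXn2r _ 2) ?nnegrE ?rnorm_ge0 // sqr_rnormB rnormZ rnormM.
have ri : 0 <= r^-1 by rewrite invr_ge0 ltW.
rewrite (rnormCr ri) innerZr.
rewrite conjcM conjc_real -[X in complex.Re X]mulrA [(inner x y)^*%C * _]mulrC.
rewrite -sqr_rnormC -rmorphM /= exprMn -/r.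
rewrite [(r^-1 * _) ^+ 2]exprMn [r^-1 ^+ 2]expr2 mulrAC -[r^-1 * r^-1 * r]mulrA mulVf ?gt_eqF// mulr1.
set m := rnorm (inner x y).
rewrite -addrA lerDl subr_ge0 mulr_natl mulr2n gerDl => hm.
have : r^-1 * m ^+ 2 = 0.
  by apply/le_anti; rewrite hm mulr_ge0 ?sqr_ge0 ?invr_ge0 ?ltW.
by move/eqP; rewrite mulf_eq0 invr_eq0 gt_eqF //= sqrf_eq0 => /eqP.
Qed.

Lemma projection (S : set H) x : closed S -> subspace S ->
  exists2 p : H, S p & forall s, S s -> inner (x - p) s = 0.
Proof.
move=> cS sS.
pose E := [set rnorm (x - s) | s in S]; pose d : R := inf E.
have E0 : E !=set0 by exists (rnorm (x - 0)); exists 0 => //; exact: sS.1.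
have lE : has_lbound E by exists 0 => _ [s _ <-]; exact: rnorm_ge0.
have dE s : S s -> d <= rnorm (x - s) by move=> Ss; apply: ge_inf => //; exists s.
have d0 : 0 <= d by apply: lb_le_inf => // _ [s _ <-]; exact: rnorm_ge0.
have /choice[u hu] : forall n : nat, exists s : H, S s /\ rnorm (x - s) < d + n.+1%:R^-1 :> R.
  move=> n; have [|_ [s Ss <-] hs] := @inf_adherent _ E n.+1%:R^-1 _ (conj E0 lE).
    by rewrite invr_gt0.
  by exists s.
(* The midpoint of [u m] and [u n] lies in [S], hence at distance at least [d] from [x]; the
   parallelogram law turns this into a Cauchy estimate. *)
have key m n : rnorm (u m - u n) ^+ 2 <=
    2 * rnorm (x - u m) ^+ 2 + 2 * rnorm (x - u n) ^+ 2 - 4 * d ^+ 2.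
  have := parallelogram (x - u m) (x - u n).
  have -> : x - u m - (x - u n) = u n - u m by rewrite opprB addrC addrA subrK addrC addrC.
  rewrite rdistC => e.
  have : 4 * d ^+ 2 <= rnorm (x - u m + (x - u n)) ^+ 2.
    have -> : x - u m + (x - u n) = (2%:C : R[i]) *: (x - (2^-1%:C : R[i]) *: (u m + u n)).
      rewrite scalerBr scalerA -rmorphM /= divff ?pnatr_eq0 // scale1r.
      rewrite (_ : 2%:C = 2%:R); last by rewrite rmorph_nat.
      by rewrite scaler_nat mulr2n addrACA -opprD.
    rewrite rnormZ rnormCr // exprMn (_ : 2 ^+ 2 = 4); last by ring.
    rewrite ler_pM2l // ler_pXn2r ?nnegrE ?rnorm_ge0 //; apply: dE.
    by apply: subspaceZ => //; apply: subspaceD => //; case: (hu m); case: (hu n).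
  lra.
have [|p hp] := @rnorm_complete u.
  (* With [t = 1/(k+1)], [(d + t)^2 - d^2 <= t (2d + 1)], so [t < e^2 / (4 (2d + 1))] makes each of
     the two excesses smaller than [e^2 / 4]. *)
  move=> e e0; have c0 : 0 < 4 * (2 * d + 1) :> R by rewrite mulr_gt0 // ltr_wpDl // mulr_ge0.
  have [N hN] := invn_lt (divr_gt0 (exprn_gt0 2 e0) c0); exists N => m n Nm Nn.
  rewrite -(@ltr_pXn2r _ 2) ?nnegrE ?rnorm_ge0 ?ltW //; apply: le_lt_trans (key m n) _.
  have sm k : (N <= k)%N -> rnorm (x - u k) ^+ 2 - d ^+ 2 < e ^+ 2 / 4.
    move=> Nk; have [Su lu] := hu k; have dk := dE _ Su.
    have iN := hN k Nk; have i1 : k.+1%:R^-1 <= 1 :> R by rewrite invf_le1 // ler1n.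
    have i0 : 0 < k.+1%:R^-1 :> R by rewrite invr_gt0.
    move: iN; rewrite ltr_pdivlMr // => iN.
    move: lu dk iN i1 i0; move: (k.+1%:R^-1) (rnorm _) => t q; nra.
  have := sm m Nm; have := sm n Nn; lra.
have Sp : S p.
  apply: closed_rnorm => // e e0; have [N hN] := hp e e0.
  by exists (u N); [case: (hu N)|exact: hN].
exists p => // s Ss; apply: inner_eq0_min => a.
have pd : rnorm (x - p) <= d.
  apply: le_of_forall_lt => e e0; have e2 : 0 < e / 2 by lra.
  have [N1 h1] := hp _ e2; have [N2 h2] := invn_lt e2.
  have l1 := h1 (maxn N1 N2) (leq_maxl _ _); have l2 := h2 (maxn N1 N2) (leq_maxr _ _).
  have [_ l3] := hu (maxn N1 N2); have := rdistD (u (maxn N1 N2)) x p.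
  have l5 : rnorm (x - u (maxn N1 N2)) < d + e / 2 by apply: lt_trans l3 _; rewrite ltrD2l.
  by rewrite [rnorm (u _ - p)]rdistC; lra.
apply: le_trans pd _; rewrite -addrA -opprD; apply: dE.
by apply: subspaceD => //; apply: subspaceZ.
Qed.

Lemma subspace_full (S : set H) : closed S -> subspace S ->
  (forall y, (forall s, S s -> inner y s = 0) -> y = 0) -> forall x, S x.
Proof.
move=> cS sS h x; have [p Sp hp] := projection x cS sS.
by have /eqP := h _ hp; rewrite subr_eq0 => /eqP ->.
Qed.

End HilbertTopology.

(** * Gram-Schmidt systems and Bessel's inequality *)

Section GramSchmidt.
Context {R : realType} {H : hilbertType R}.
Implicit Types (x y u v : H) (e : nat -> H).

Definition orthosys e :=
  (forall k, e k = 0 \/ rnorm (e k) = 1) /\ (forall k l, k != l -> inner (e k) (e l) = 0).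

Definition normalize u : H := ((rnorm u)^-1)%:C *: u.

Lemma normalizeP u : normalize u = 0 \/ rnorm (normalize u) = 1.
Proof.
have [->|u0] := eqVneq u 0; first by left; rewrite /normalize scaler0.
right; rewrite /normalize rnormZ rnormCr ?invr_ge0 ?rnorm_ge0 // mulVf //.
by rewrite rnorm_eq0.
Qed.

Lemma normalize_scale u : inner u (normalize u) *: normalize u = u.
Proof.
have [->|u0] := eqVneq u 0; first by rewrite inner0l scale0r.
rewrite /normalize innerZr innerxx scalerA conjc_real -!rmorphM /=.
have n0 : rnorm u != 0 by rewrite rnorm_eq0.
have -> : (rnorm u)^-1 * rnorm u ^+ 2 * (rnorm u)^-1 = 1 by field.
by rewrite scale1r.
Qed.

Variable v : nat -> H.

(** The whole list of earlier vectors is carried along, since the next one needs all of them while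
    the recursion is structural in [k]. *)
Fixpoint gs_seq (k : nat) : seq H :=
  if k is k'.+1 then
    rcons (gs_seq k') (normalize (v k' - \sum_(x <- gs_seq k') inner (v k') x *: x))
  else [::].

Definition gram_schmidt k : H := nth 0 (gs_seq k.+1) k.
Local Notation e := gram_schmidt.
Arguments gram_schmidt : simpl never.

Let size_gs k : size (gs_seq k) = k.
Proof. by elim: k => //= k ih; rewrite size_rcons ih. Qed.

Let gs_seqE k : gs_seq k = [seq e j | j <- iota 0 k].
Proof.
elim: k => // k ih; rewrite -addn1 iotaD map_cat /= -ih addn1 add0n /e /=.
by rewrite nth_rcons size_gs ltnn eqxx cats1.
Qed.

Let eE k : e k = normalize (v k - \sum_(j < k) inner (v k) (e j) *: e j).
Proof.
rewrite {1}/e /= nth_rcons size_gs ltnn eqxx gs_seqE big_map -(subn0 k) big_mkord.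
by rewrite subn0.
Qed.

Let inner_unit k x : inner x (e k) * inner (e k) (e k) = inner x (e k).
Proof.
rewrite eE; case: (normalizeP (v k - \sum_(j < k) inner (v k) (e j) *: e j)) => [->|h].
  by rewrite inner0r mul0r.
by rewrite [inner (normalize _) _]innerxx h expr1n mulr1.
Qed.

Let perp k : forall j, (j < k)%N -> inner (e k) (e j) = 0.
Proof.
elim/ltn_ind: k => k ih j jk; rewrite {1}eE /normalize innerZl [X in _ * X](_ : _ = 0) ?mulr0 // innerBl inner_suml.
rewrite (bigD1 (Ordinal jk)) //= innerZl inner_unit big1 => [|i ij].
  by rewrite addr0 subrr.
rewrite innerZl; have [lt|gt|eq] := ltngtP i j.
- by rewrite [inner (e i) _]innerC (ih j jk) // conjc0 mulr0.
- by rewrite (ih i (ltn_ord i) _ gt) mulr0.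
- by move: ij; rewrite -val_eqE /= eq eqxx.
Qed.

Lemma gram_schmidt_orthosys : orthosys e.
Proof.
split=> [k|k l]; first by rewrite eE; exact: normalizeP.
rewrite neq_ltn => /orP[kl|lk]; last exact: perp.
by rewrite innerC perp // conjc0.
Qed.

Lemma gram_schmidtE i : v i = \sum_(k < i.+1) inner (v i) (e k) *: e k.
Proof.
set u := v i - \sum_(j < i) inner (v i) (e j) *: e j.
have eu : e i = normalize u by rewrite eE.
rewrite big_ord_recr /=; have -> : inner (v i) (e i) *: e i = u.
  rewrite -[RHS](normalize_scale u) -eu; congr (_ *: _).
  rewrite /u innerBl inner_suml big1 ?subr0 // => j _.
  by rewrite innerZl [inner (e j) _]innerC perp // conjc0 mulr0.
by rewrite /u addrC subrK.
Qed.

End GramSchmidt.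

Section Bessel.
Context {R : realType} {H : hilbertType R}.
Variables (e : nat -> H) (oe : orthosys e).
Implicit Types (x y : H).

Definition proj_sum N x : H := \sum_(k < N) inner x (e k) *: e k.

Lemma orthosys_unit k x : inner x (e k) * inner (e k) (e k) = inner x (e k).
Proof.
case: (oe.1 k) => [->|h]; first by rewrite inner0r mul0r.
by rewrite [inner (e k) _]innerxx h expr1n mulr1.
Qed.

Lemma inner_proj_sum N x k : (k < N)%N -> inner (proj_sum N x) (e k) = inner x (e k).
Proof.
move=> kN; rewrite /proj_sum inner_suml (bigD1 (Ordinal kN)) //= innerZl orthosys_unit.
rewrite big1 ?addr0 // => i ik; rewrite innerZl oe.2 ?mulr0 //.
Qed.

Lemma inner_proj_sum_perp N x y : inner (x - proj_sum N x) (proj_sum N y) = 0.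
Proof.
rewrite {2}/proj_sum inner_sumr big1 // => k _.
by rewrite innerZr innerBl inner_proj_sum // subrr mulr0.
Qed.

Lemma sqr_proj_sum N x : rnorm (proj_sum N x) ^+ 2 = \sum_(k < N) rnorm (inner x (e k)) ^+ 2.
Proof.
suff : (rnorm (proj_sum N x) ^+ 2)%:C = (\sum_(k < N) rnorm (inner x (e k)) ^+ 2)%:C :> R[i].
  by move=> /eqP; rewrite eq_complex /= => /andP[/eqP].
rewrite sqr_rnorm {2}/proj_sum inner_sumr raddf_sum /=; apply: eq_bigr => k _.
by rewrite innerZr inner_proj_sum // sqr_rnormC mulrC.
Qed.

Lemma pythagoras N x :
  rnorm x ^+ 2 = rnorm (proj_sum N x) ^+ 2 + rnorm (x - proj_sum N x) ^+ 2.
Proof.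
have := sqr_rnormD (x - proj_sum N x) (proj_sum N x).
by rewrite subrK inner_proj_sum_perp /= => ->; ring.
Qed.

Lemma bessel N x : \sum_(k < N) rnorm (inner x (e k)) ^+ 2 <= rnorm x ^+ 2.
Proof. by rewrite -sqr_proj_sum (pythagoras N x) lerDl sqr_ge0. Qed.

(** The norm of [proj_sum N x] increases with [N] and already equals that of [x] at [M]; Pythagoras
    then leaves no remainder. *)
Lemma proj_sum_stable M N x : (M <= N)%N -> proj_sum M x = x -> proj_sum N x = x.
Proof.
move=> MN hM; apply/eqP; rewrite eq_sym -subr_eq0 -rnorm_eq0 -sqrf_eq0 eq_le sqr_ge0 andbT.
have h : rnorm x ^+ 2 <= rnorm (proj_sum N x) ^+ 2.
  rewrite -{1}hM !sqr_proj_sum -(subnKC MN) big_split_ord /= lerDl sumr_ge0 // => k _.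
  exact: sqr_ge0.
by have := pythagoras N x; lra.
Qed.

End Bessel.

(** * Nilpotent matrices and replicas *)

Section ComplexMatrices.
Variable (C : numClosedFieldType) (n' : nat).
Local Notation n := n'.+1.
Implicit Types (A : 'M[C]_n) (p q : {poly C}).

Lemma trig_mxM (A B : 'M[C]_n) : is_trig_mx A -> is_trig_mx B ->
  is_trig_mx (A *m B) /\ forall i, (A *m B) i i = A i i * B i i.
Proof.
move=> /is_trig_mxP hA /is_trig_mxP hB; split.
  apply/is_trig_mxP => i j ij; rewrite mxE big1 // => k _.
  have [ik|ki] := ltnP i k; first by rewrite hA // mul0r.
  by rewrite hB ?mulr0 // (leq_ltn_trans ki ij).
move=> i; rewrite mxE (bigD1 i) //= big1 ?addr0 // => k ki.
have [ik|ik] := ltnP i k; first by rewrite hA // mul0r.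
by rewrite hB ?mulr0 // ltn_neqAle ik andbT.
Qed.

Lemma trig_horner (A : 'M[C]_n) p : is_trig_mx A ->
  is_trig_mx (horner_mx A p) /\ forall i, (horner_mx A p) i i = p.[A i i].
Proof.
move=> tA; elim/poly_ind: p => [|p c [tp ip]].
  by rewrite rmorph0; split=> [|i]; rewrite ?mx0_is_trig // mxE horner0.
rewrite rmorphD rmorphM /= horner_mx_X horner_mx_C.
have [t1 i1] := trig_mxM tp tA; split.
  apply/is_trig_mxP => i j ij; move/is_trig_mxP: t1 => t1.
  by rewrite mxE t1 // add0r mxE -val_eqE /= ltn_eqF.
by move=> i; rewrite mxE i1 ip mxE eqxx mulr1n !hornerE.
Qed.

(** Schur's triangular form provides [t] as its diagonal: a polynomial in a triangular matrix is
    triangular with [p] applied to the diagonal, and characteristic polynomial and trace are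
    invariant under conjugation. *)
Lemma trigonalize (A : 'M[C]_n) : exists t : 'I_n -> C,
  char_poly A = \prod_i ('X - (t i)%:P) /\
  forall p, \tr (horner_mx A p) = \sum_i p.[t i].
Proof.
have [P /unitarymx_unit uP] := Schur A isT.
rewrite /similar_to /= conjumx // => tT; set T := P *m A *m invmx P in tT.
have AT : A = invmx P *m T *m P by rewrite /T !mulmxA mulVmx // mul1mx mulmxKV.
clearbody T; exists (fun i => T i i); split.
  rewrite -char_poly_trig // /char_poly /char_poly_mx AT.
  set Q := map_mx polyC P; set Q' := map_mx polyC (invmx P).
  have QQ : Q' *m Q = 1%:M by rewrite -map_mxM mulVmx // map_mx1.
  rewrite !map_mxM -/Q -/Q' -[X in X - _]scalemx1 -QQ.
  rewrite (_ : _ - _ = Q' *m ('X%:M - map_mx polyC T) *m Q); last first.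
    by rewrite mulmxBr mulmxBl mul_mx_scalar -scalemxAl.
  by rewrite !det_mulmx mulrC mulrA -det_mulmx (mulmx1C QQ) det1 mul1r.
move=> p; rewrite {1}AT horner_mx_uconjC // mxtrace_mulC mulmxA mulmxV // mul1mx.
by apply: eq_bigr => i _; have [_ ->] := trig_horner p tT.
Qed.

Lemma mxtrace_nilpotent (A : 'M[C]_n) k : A ^+ k = 0 -> \tr A = 0.
Proof.
move=> Ak; have [t [ch tr]] := trigonalize A.
have t0 i : t i = 0.
  have : root (char_poly A) (t i).
    by rewrite ch rootE horner_prod (bigD1 i) //= hornerXsubC subrr mul0r.
  rewrite -eigenvalue_root_char => /eigenvalueP[v vA v0].
  have vAk j : v *m A ^+ j = t i ^+ j *: v.
    elim: j => [|j ih]; first by rewrite mulmx1 scale1r.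
    by rewrite exprSr -mulmxE mulmxA ih -scalemxAl vA scalerA exprSr.
  have := vAk k; rewrite Ak mulmx0 => /esym/eqP; rewrite scaler_eq0 (negPf v0) orbF.
  by rewrite expf_eq0 => /andP[_ /eqP].
have := tr 'X; rewrite horner_mx_X => ->.
by rewrite big1 // => i _; rewrite hornerX t0.
Qed.

Lemma horner_mxM A p q : horner_mx A (p * q) = horner_mx A p *m horner_mx A q.
Proof. by rewrite rmorphM. Qed.

Lemma coprimep_XsubC_prod N (z : C) l : z \notin l ->
  coprimep (('X - z%:P) ^+ N) (\prod_(x <- l) ('X - x%:P) ^+ N).
Proof.
move=> zl; rewrite big_seq; elim/big_ind: _ => [|p q|x xl]; first exact: coprimep1.
  by rewrite coprimepMr => -> ->.
rewrite coprimep_expl // coprimep_expr // coprimep_XsubC root_XsubC.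
by apply: contraNneq zl => <-.
Qed.

(** Bounding every multiplicity by the length lets the characteristic polynomial divide a product of
    equal powers over the distinct eigenvalues, the form that [gen_eigen_ind] takes. *)
Lemma prod_XsubC_dvd (r : seq C) :
  \prod_(x <- r) ('X - x%:P) %| \prod_(z <- undup r) ('X - z%:P) ^+ size r.
Proof.
have : {subset r <= undup r} by move=> x; rewrite mem_undup.
elim: {1 3 5}r => [|x s ih] /= sr; first by rewrite big_nil dvd1p.
rewrite big_cons [X in _ %| X](eq_bigr (fun z => ('X - z%:P) * ('X - z%:P) ^+ size s)); last first.
  by move=> z _; rewrite exprS.
rewrite big_split /= dvdp_mul ?ih //; last by move=> y ys; rewrite sr ?inE ?ys ?orbT.
by rewrite (big_rem x) ?sr ?inE ?eqxx //= dvdp_mulr.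
Qed.

(** Primary decomposition phrased as an induction principle: a Bezout relation between one factor
    and the product of the others splits [v] into a generalised eigenvector and a vector killed by
    that product. *)
Lemma gen_eigen_ind A N (P : 'rV[C]_n -> Prop) (l : seq C) :
  (forall v w, P v -> P w -> P (v + w)) -> P 0 ->
  (forall z v, z \in l -> v *m horner_mx A (('X - z%:P) ^+ N) = 0 -> P v) ->
  uniq l ->
  forall v, v *m horner_mx A (\prod_(z <- l) ('X - z%:P) ^+ N) = 0 -> P v.
Proof.
move=> PD P0; elim: l => [|z l ih] Pl.
  by move=> _ v; rewrite big_nil rmorph1 mulmx1 => ->.
move=> /= /andP[zl ul] v; rewrite big_cons => h.
have /Bezout_eq1_coprimepP[[u w] /= e] := coprimep_XsubC_prod N zl.
move: h e; set q := ('X - z%:P) ^+ N; set M := \prod_(x <- l) _ => h e.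
have hv : v = v *m horner_mx A (w * M) + v *m horner_mx A (u * q).
  by rewrite -mulmxDr -rmorphD addrC e rmorph1 mulmx1.
rewrite hv; apply: PD.
  apply: (Pl z); first by rewrite inE eqxx.
  rewrite -/q -mulmxA -horner_mxM (_ : w * M * q = q * M * w); last by ring.
  by rewrite horner_mxM mulmxA h mul0mx.
apply: ih => // [x y xl|]; first by apply: Pl; rewrite inE xl orbT.
rewrite -/M -mulmxA -horner_mxM (_ : u * q * M = q * M * u); last by ring.
by rewrite horner_mxM mulmxA h mul0mx.
Qed.

(** Chinese remainders: [p] acts as the scalar [f z] on the vectors killed by the [N]-th power of
    [X - z]. With [f] the conjugation this is the polynomial behind [replica]. *)
Lemma chinese_poly N (f : C -> C) (l : seq C) : uniq l ->
  exists p, forall z, z \in l -> ('X - z%:P) ^+ N %| p - (f z)%:P.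
Proof.
elim: l => [|z l ih] /=; first by exists 0.
move=> /andP[zl /ih[q hq]].
have /Bezout_eq1_coprimepP[[u w] /= e] := coprimep_XsubC_prod N zl.
exists (q + w * (\prod_(x <- l) ('X - x%:P) ^+ N) * ((f z)%:P - q)) => x.
rewrite inE; case/orP => [/eqP ->|xl].
  have -> : w * (\prod_(y <- l) ('X - y%:P) ^+ N) = 1 - u * ('X - z%:P) ^+ N.
    by apply/eqP; rewrite eq_sym subr_eq addrC e.
  set r := ('X - z%:P) ^+ N; rewrite (_ : _ - _ = r * (u * (q - (f z)%:P))); last by ring.
  by rewrite dvdp_mulr.
rewrite addrAC dvdp_add ?hq // -mulrA dvdp_mull // dvdp_mulr // (big_rem x) //=.
exact: dvdp_mulr.
Qed.

End ComplexMatrices.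

Section Replica.
Variable R : realType.
Local Notation C := R[i].
Local Notation toC := (map_mx (@real_complex_def R (Phant R))).

Lemma real_imag_mx m k (X Y X' Y' : 'M[R]_(m, k)) :
  toC X + 'i%C *: toC Y = toC X' + 'i%C *: toC Y' -> X = X'.
Proof.
move=> h; apply/matrixP => i j; have /matrixP/(_ i j) := h.
by rewrite !mxE => /eqP; simpc; rewrite eq_complex /= => /andP[/eqP].
Qed.

Lemma poly_real_imag (p : {poly C}) : exists p1 p2 : {poly R},
  p = map_poly (real_complex R) p1 + 'i%C%:P * map_poly (real_complex R) p2.
Proof.
exists (map_poly (@complex.Re R) p), (map_poly (@complex.Im R) p).
by apply/polyP => i; rewrite coefD coefCM !coef_map [LHS]complexE.
Qed.

Variables (n : nat) (a : 'rV[R]_n -> 'M[R]_n).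
Hypothesis aD : forall v w, a (v + w) = a v + a w.
Hypothesis aZ : forall c v, a (c *: v) = c *: a v.

(** The complex-linear extension of [a], needed because a real matrix may have complex eigenvalues;
    [complex_ext_rect] computes it on real and imaginary parts. *)
Definition complex_ext (v : 'rV[C]_n) : 'M[C]_n :=
  \sum_i v 0 i *: toC (a (delta_mx 0 i)).

Lemma complex_extD v w : complex_ext (v + w) = complex_ext v + complex_ext w.
Proof.
by rewrite -big_split /=; apply: eq_bigr => i _; rewrite mxE scalerDl.
Qed.

Lemma complex_extZ c v : complex_ext (c *: v) = c *: complex_ext v.
Proof. by rewrite scaler_sumr; apply: eq_bigr => i _; rewrite mxE scalerA. Qed.

Lemma complex_ext_real v : complex_ext (toC v) = toC (a v).
Proof.
have a_sum (r : seq 'I_n) (F : 'I_n -> 'rV[R]_n) :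
    a (\sum_(i <- r) F i) = \sum_(i <- r) a (F i).
  elim: r => [|i r ih]; last by rewrite !big_cons aD ih.
  by rewrite !big_nil; have := aZ 0 0; rewrite !scale0r.
rewrite [in RHS](row_sum_delta v) a_sum map_mx_sum.
by apply: eq_bigr => i _; rewrite aZ map_mxZ mxE.
Qed.

Lemma complex_ext_rect v w :
  complex_ext (toC v + 'i%C *: toC w) = toC (a v) + 'i%C *: toC (a w).
Proof. by rewrite complex_extD complex_extZ !complex_ext_real. Qed.

End Replica.

(* [S] is the semisimple part of [D] with its eigenvalues replaced by their
   real parts; it is a polynomial in [D], and a derivation when [D] is one. *)
Lemma replica (R : realType) (n : nat) (D : 'M[R]_n) : exists S : 'M[R]_n,
  [/\ forall U : {vspace 'rV[R]_n}, (forall v, v \in U -> v *m D \in U) ->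
        forall v, v \in U -> v *m S \in U,
      (forall j, \tr (D ^+ j.+1) = 0) -> \tr (S *m D) = 0,
      \tr (S *m D) = 0 -> exists k, D ^+ k = 0 &
      forall a : 'rV[R]_n -> 'M[R]_n, (forall v w, a (v + w) = a v + a w) ->
        (forall c v, a (c *: v) = c *: a v) ->
        (forall v, a v *m D = a (v *m D) + D *m a v) ->
        forall v, a v *m S = a (v *m S) + S *m a v].
Proof.
case: n D => [|n'] D.
  exists 0; split=> [U h v vU|_|_|a aD aZ h v].
  - by rewrite mulmx0 mem0v.
  - by rewrite mul0mx mxtrace0.
  - by exists 0%N; apply/matrixP => -[].
  - by apply/matrixP => -[].
pose n := n'.+1; pose toC m k : 'M[R]_(m, k) -> _ := map_mx (real_complex R).
pose Dc : 'M[R[i]]_n := toC _ _ D.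
have [t [ch tr]] := trigonalize Dc.
pose l0 := undup [seq t i | i <- enum 'I_n].
(* Sums [t i + t j] are included because [a] pairs the generalised eigenspaces of [x] and [y] into
   that of [x + y]; the exponent there is at most [n + n], whence the modulus in [hp]. *)
pose l := undup ([seq t i | i <- enum 'I_n] ++ [seq t i + t j | i <- enum 'I_n, j <- enum 'I_n]).
have [p hp] := chinese_poly (n + n) (@conjc R) (undup_uniq _ : uniq l).
have tl i : t i \in l by rewrite mem_undup mem_cat map_f // mem_enum.
have ttl i j : t i + t j \in l.
  rewrite mem_undup mem_cat; apply/orP; right; apply/allpairsP.
  by exists (i, j); rewrite !mem_enum.
have [p1 [p2 pE]] := poly_real_imag p.
pose S1 := horner_mx D p1; pose S2 := horner_mx D p2.
have ScE : horner_mx Dc p = toC _ _ S1 + 'i%C *: toC _ _ S2.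
  rewrite pE rmorphD rmorphM /= horner_mx_C -!map_horner_mx.
  by rewrite -[_ * _]/(_ *m _) mul_scalar_mx.
have pti i : p.[t i] = (t i)^*%C.
  have /dvdpP[q /eqP] := hp _ (tl i); rewrite subr_eq => /eqP ->.
  rewrite hornerD hornerM horner_exp hornerXsubC subrr hornerC.
  by rewrite addnS expr0n /= mulr0 add0r.
exists S1; split.
- move=> U UD v vU; rewrite /S1; elim/poly_ind: (p1) => [|q c ih].
    by rewrite rmorph0 mulmx0 mem0v.
  rewrite rmorphD rmorphM /= horner_mx_X horner_mx_C mulmxDr -[_ * D]/(_ *m D) mulmxA.
  by rewrite mul_mx_scalar rpredD ?UD // rpredZ.
- move=> tr0; rewrite /S1 -[X in _ *m X]expr1.
  elim/poly_ind: (p1) (0%N) => [|q c ih] j; first by rewrite rmorph0 mul0mx mxtrace0.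
  rewrite rmorphD rmorphM /= horner_mx_X horner_mx_C mulmxDl mxtraceD mul_scalar_mx mxtraceZ tr0.
  by rewrite mulr0 addr0 -mulmxA -[D *m _]/(D * _) -exprS; exact: ih.
(* As [p] takes at [t i] the value conjugate to [t i], the trace of [p(Dc) Dc] is the sum of the
   [|t i|^2]. Its real part is the trace assumed to be zero, so all eigenvalues vanish and
   Cayley-Hamilton reads [D ^+ n = 0]. *)
- move=> tr0; exists n.
  have trE : \tr (horner_mx Dc p *m Dc) = \sum_i (t i)^*%C * t i.
    have := tr (p * 'X); rewrite rmorphM /= horner_mx_X -[_ * _]/(_ *m _) => ->.
    by apply: eq_bigr => i _; rewrite hornerM hornerX pti.
  have : complex.Re (\sum_i (t i)^*%C * t i) = 0.
    rewrite -trE ScE mulmxDl -scalemxAl mxtraceD mxtraceZ -!map_mxM !trace_map_mx /=.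
    by rewrite tr0; simpc.
  have -> : \sum_i (t i)^*%C * t i = (\sum_i rnorm (t i) ^+ 2)%:C.
    by rewrite rmorph_sum; apply: eq_bigr => i _; rewrite mulrC -sqr_rnormC.
  move=> /= /eqP; rewrite psumr_eq0 => [/allP t0|i _]; last exact: sqr_ge0.
  have {}t0 i : t i = 0.
    have := t0 i (mem_index_enum _); rewrite sqrf_eq0 cnorm_eq0.
    by move=> /eqP.
  have : horner_mx Dc (char_poly Dc) = 0 by exact: Cayley_Hamilton.
  rewrite ch (eq_bigr (fun=> 'X)) => [|i _]; last by rewrite t0 subr0.
  rewrite prodr_const card_ord rmorphXn /= horner_mx_X.
  rewrite -[Dc]/(map_mx (real_complex R) D) -rmorphXn /= => /matrixP h.
  by apply/matrixP => i j; have := h i j; rewrite !mxE => /eqP; rewrite eq_complex /= => /andP[/eqP].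
- move=> a aD aZ aDer v.
  pose ac := complex_ext a.
  have acDer u : ac u *m Dc = ac (u *m Dc) + Dc *m ac u.
    rewrite (_ : u = toC _ _ (map_mx (@complex.Re R) u) + 'i%C *: toC _ _ (map_mx (@complex.Im R) u)).
      set x := map_mx _ u; set y := map_mx _ u.
      have -> : (toC _ _ x + 'i%C *: toC _ _ y) *m Dc = toC _ _ (x *m D) + 'i%C *: toC _ _ (y *m D).
        by rewrite mulmxDl -scalemxAl -!map_mxM.
      rewrite /ac !complex_ext_rect // mulmxDl mulmxDr -scalemxAl -scalemxAr -!map_mxM.
      by rewrite !aDer !map_mxD scalerDr addrACA.
    by apply/matrixP => i j; rewrite !mxE -complexE.
  have acD x y : ac (x + y) = ac x + ac y by exact: complex_extD.
  have ac0 : ac 0 = 0 by have := complex_extZ a 0 0; rewrite !scale0r.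
  (* Moving one factor [Dc - (x + y)] through the derivation rule lowers either the exponent of [u]
     or that of [w], so induction on a bound of their sum applies. *)
  have gen k : forall (u w : 'rV[R[i]]_n) (x y : R[i]) b c, (b + c <= k)%N ->
      u *m (Dc - x%:M) ^+ b = 0 -> w *m (Dc - y%:M) ^+ c = 0 ->
      w *m ac u *m (Dc - (x + y)%:M) ^+ k = 0.
    elim: k => [|k ih] u w x y [|b] [|c] //= bc.
    + by rewrite expr0 mulmx1 => -> _; rewrite ac0 mulmx0 mul0mx.
    + by rewrite expr0 mulmx1 => -> _; rewrite ac0 mulmx0 mul0mx.
    + by rewrite expr0 mulmx1 => -> _; rewrite ac0 mulmx0 mul0mx.
    + by rewrite expr0 mulmx1 => _ ->; rewrite !mul0mx.
    rewrite !exprS -!mulmxE !mulmxA => hu hw.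
    have acB : ac (u *m (Dc - x%:M)) = ac (u *m Dc) - x *: ac u.
      by rewrite mulmxBr mul_mx_scalar -scaleNr /ac complex_extD complex_extZ scaleNr.
    have -> : w *m ac u *m (Dc - (x + y)%:M) =
        w *m ac (u *m (Dc - x%:M)) + w *m (Dc - y%:M) *m ac u.
      rewrite acB !mulmxBr !mulmxBl !mul_mx_scalar -(mulmxA w) acDer mulmxDr.
      by rewrite -scalemxAr -!scalemxAl scalerDl opprD mulmxA addrACA.
    have b1 : (b + c.+1 <= k)%N by rewrite -ltnS -addSn.
    have b2 : (b.+1 + c <= k)%N by rewrite -ltnS -addnS.
    have hu' : u *m (Dc - x%:M) ^+ b.+1 = 0 by rewrite exprS -mulmxE mulmxA.
    have hw' : w *m (Dc - y%:M) ^+ c.+1 = 0 by rewrite exprS -mulmxE mulmxA.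
    by rewrite mulmxDl (ih _ _ _ _ _ _ b1 hu hw') (ih _ _ _ _ _ _ b2 hu' hw) addr0.
  have conj_eig z k (u : 'rV[R[i]]_n) : z \in l -> (k <= n + n)%N -> u *m (Dc - z%:M) ^+ k = 0 ->
      u *m horner_mx Dc p = z^*%C *: u.
    move=> zl kn hu; have /dvdpP[q /eqP] := hp _ zl; rewrite subr_eq => /eqP ->.
    rewrite rmorphD /= horner_mx_C mulmxDr mul_mx_scalar mulrC rmorphM rmorphXn /=.
    rewrite rmorphB /= horner_mx_X horner_mx_C -(subnKC kn) exprD -!mulmxE !mulmxA hu.
    by rewrite !mul0mx add0r.
  have killed (u : 'rV[R[i]]_n) : u *m horner_mx Dc (\prod_(z <- l0) ('X - z%:P) ^+ n) = 0.
    have : char_poly Dc %| \prod_(z <- l0) ('X - z%:P) ^+ n.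
      have := prod_XsubC_dvd [seq t i | i <- enum 'I_n].
      by rewrite size_map size_enum_ord big_map big_enum ch.
    move=> /dvdpP[q ->]; rewrite mulrC rmorphM /= Cayley_Hamilton.
    by rewrite mul0r mulmx0.
  have ul0 : uniq l0 by rewrite undup_uniq.
  have l0P z : z \in l0 -> exists i, z = t i by rewrite mem_undup => /mapP[i _ ->]; exists i.
  (* The derivation rule for [p(Dc)] is checked on pairs of generalised eigenvectors, where it says
     that the conjugate of a sum is the sum of the conjugates. [gen_eigen_ind] is applied to [u] and
     then to [w]. *)
  pose E0 (w u : 'rV[R[i]]_n) := w *m (ac u *m horner_mx Dc p) =
    w *m (ac (u *m horner_mx Dc p) + horner_mx Dc p *m ac u).
  have E u w : E0 w u.
    apply: (@gen_eigen_ind _ _ Dc n (E0 w) l0 _ _ _ ul0 u (killed u)); rewrite /E0.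
    + by move=> u1 u2 h1 h2; rewrite acD mulmxDl mulmxDr h1 h2 -mulmxDr; congr (_ *m _); rewrite mulmxDl acD mulmxDr addrACA.
    + by rewrite !(mul0mx, ac0, mulmx0, addr0).
    move=> z {}u /l0P[i ->]; rewrite rmorphXn rmorphB /= horner_mx_X horner_mx_C => hu.
    apply: (@gen_eigen_ind _ _ Dc n (E0^~ u) l0 _ _ _ ul0 w (killed w)); rewrite /E0.
    + by move=> w1 w2 h1 h2; rewrite mulmxDl h1 h2 -mulmxDl.
    + by rewrite !mul0mx.
    move=> z' {}w /l0P[j ->]; rewrite rmorphXn rmorphB /= horner_mx_X horner_mx_C => hw.
    rewrite mulmxDr (conj_eig _ _ _ (tl i) (leq_addr _ _) hu) /ac complex_extZ -/ac.
    rewrite !mulmxA (conj_eig _ _ _ (tl j) (leq_addr _ _) hw).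
    have gz := gen _ _ _ _ _ _ _ (leqnn (n + n)) hu hw.
    have -> := conj_eig _ _ _ (ttl i j) (leqnn (n + n)) gz.
    by rewrite -scalemxAr -scalemxAl -scalerDl rmorphD.
  have {}E u : ac u *m horner_mx Dc p = ac (u *m horner_mx Dc p) + horner_mx Dc p *m ac u.
    by apply/row_matrixP => i; rewrite !rowE; exact: E.
  have h1 : ac (toC _ _ v) = toC _ _ (a v) by exact: complex_ext_real.
  have h2 : toC _ _ v *m horner_mx Dc p = toC _ _ (v *m S1) + 'i%C *: toC _ _ (v *m S2).
    by rewrite ScE mulmxDr -scalemxAr -!map_mxM.
  have := E (toC _ _ v); rewrite h2 /ac complex_ext_rect // -/ac h1 ScE.
  rewrite mulmxDl mulmxDr -scalemxAl -scalemxAr -!map_mxM addrACA -scalerDr -!map_mxD.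
  exact: real_imag_mx.
Qed.

(** * Nilpotent matrices and traces of products *)

Section NilpotentTrace.
Variables (R : realType) (n : nat).
Implicit Types A B C X : 'M[R]_n.

Lemma mxtrace_nilpotent_real A k : A ^+ k = 0 -> \tr A = 0.
Proof.
case: n A => [A _|n' A Ak]; first by rewrite /mxtrace big_ord0.
have : map_mx (real_complex R) A ^+ k = 0 by rewrite -rmorphXn Ak /= map_mx0.
by move/mxtrace_nilpotent; rewrite trace_map_mx => -[].
Qed.

Lemma comm_mx_pow A B C k : A *m B - B *m A = C -> A *m C = C *m A ->
  A ^+ k.+1 *m B - B *m A ^+ k.+1 = k.+1%:R *: (A ^+ k *m C).
Proof.
move=> hC AC; elim: k => [|k ih]; first by rewrite !expr1 scale1r mul1mx.
have e : A ^+ k.+1 *m B = B *m A ^+ k.+1 + k.+1%:R *: (A ^+ k *m C).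
  by rewrite -ih addrC subrK.
have AkC : A ^+ k *m C *m A = A ^+ k.+1 *m C by rewrite -mulmxA -AC mulmxA exprSr.
rewrite [A ^+ k.+2]exprS -[A * _]/(A *m _) -mulmxA e mulmxDr -scalemxAr.
rewrite [A *m (A ^+ k *m C)]mulmxA -[A *m A ^+ k]/(A * A ^+ k) -exprS.
have -> : A *m (B *m A ^+ k.+1) = B *m (A *m A ^+ k.+1) + C *m A ^+ k.+1.
  by rewrite !mulmxA -mulmxDl -hC addrC subrK.
have -> : C *m A ^+ k.+1 = A ^+ k.+1 *m C.
  elim: (k.+1) => [|j ihj]; first by rewrite mulmx1 mul1mx.
  by rewrite exprSr -[_ * A]/(_ *m A) mulmxA ihj -!mulmxA AC.
rewrite -[A *m A ^+ k.+1]/(A * A ^+ k.+1) -exprS; set D := A ^+ k.+1 *m C.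
by rewrite -(addrA (_ *m _) D) [X in X - _]addrC addrK -[X in X + _]scale1r -scalerDl nat1r.
Qed.

(* The derivation [X |-> AX - XA] applied [k] times to [B^k] gives [k! C^k]. *)
Lemma double_comm_nilpotent A B C m : A *m B - B *m A = C -> A *m C = C *m A ->
  A ^+ m = 0 -> exists k, C ^+ k = 0.
Proof.
move=> hC AC Am; pose d X := A *m X - X *m A.
have dM X Y : d (X *m Y) = d X *m Y + X *m d Y.
  by rewrite /d mulmxBl mulmxBr !mulmxA addrA subrK.
have dD X Y : d (X + Y) = d X + d Y by rewrite /d mulmxDl mulmxDr opprD addrACA.
have dZ (a : R) X : d (a *: X) = a *: d X by rewrite /d -scalemxAl -scalemxAr scalerBr.
have d0 : d 0 = 0 by rewrite /d mulmx0 mul0mx subr0.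
have dC : d C = 0 by rewrite /d AC subrr.
have dk0 k : iter k d 0 = 0 by elim: k => //= k ->.
have leib k X : iter k.+1 d (B *m X) = B *m iter k.+1 d X + k.+1%:R *: (C *m iter k d X).
  elim: k => [|k ih] /=; first by rewrite dM -/(d B) {1}/d hC scale1r addrC.
  rewrite -[d (d _)]/(d (iter k.+1 d (B *m X))) ih dD dM dZ dM dC mul0mx add0r.
  rewrite {1}/d hC [C *m _ + _]addrC -addrA; congr (_ + _).
  by rewrite -[X in X + _]scale1r -scalerDl nat1r.
have key k : iter k d (B ^+ k) = (k`!)%:R *: C ^+ k /\ iter k.+1 d (B ^+ k) = 0.
  elim: k => [|k [ih1 ih2]].
    by split; rewrite /= ?scale1r // /d mulmx1 mul1mx subrr.
  rewrite exprS -[B * _]/(B *m _); split.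
    rewrite leib ih2 mulmx0 add0r ih1 -scalemxAr scalerA -natrM -factS.
    by rewrite -[C *m _]/(C * _) -exprS.
  by rewrite leib -[iter k.+2 d _]/(d (iter k.+1 d _)) ih2 d0 !mulmx0 scaler0 addr0.
have nil N X a b : (m + m <= a + b + N)%N -> A ^+ a *m iter N d X *m A ^+ b = 0.
  elim: N a b => [|N ih] a b; rewrite ?addn0 => h.
    have [ma|am] := leqP m a.
      by rewrite -(subnKC ma) exprD Am -[0 * _]/(0 *m _) !mul0mx.
    have mb : (m <= b)%N by rewrite leqNgt; apply: contraL h => bm; rewrite -ltnNge -addnS leq_add // ltnW.
    by rewrite -(subnKC mb) exprD Am -[0 * _]/(0 *m _) mul0mx mulmx0.
  rewrite [iter N.+1 d X]/= {1}/d mulmxBr mulmxBl !mulmxA.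
  rewrite -[A ^+ a *m A]/(A ^+ a * A) -exprSr ih; last by rewrite addSn addSn -addnS.
  rewrite -(mulmxA _ A) -[A *m A ^+ b]/(A * A ^+ b) -exprS ih ?subr0 //.
  by rewrite addnS addSn -addnS.
exists (m + m)%N; have := nil (m + m)%N (B ^+ (m + m)) 0%N 0%N (leqnn _).
rewrite !expr0 mul1mx mulmx1 (key _).1 => /eqP.
by rewrite scaler_eq0 pnatr_eq0 eqn0Ngt fact_gt0 => /eqP.
Qed.

(** The matrix [B A] is nilpotent, hence of trace zero. For a row [X] killed by [A ^+ j.+1],
    applying [(B A) ^+ i] and then [A ^+ j] gives a multiple of [X A ^+ j C ^+ i], with [C] the
    commutator, which is nilpotent by [double_comm_nilpotent]. So a power of [B A] sends the rows
    killed by [A ^+ j.+1] to rows killed by [A ^+ j], and [m] such steps reach 0. *)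
Lemma double_comm_trace A B m : A ^+ m = 0 ->
  A *m (A *m B - B *m A) = (A *m B - B *m A) *m A -> \tr (A *m B) = 0.
Proof.
move=> Am AC; set C := A *m B - B *m A in AC.
have [k Ck] := double_comm_nilpotent (erefl C) AC Am.
rewrite mxtrace_mulC; apply: (@mxtrace_nilpotent_real _ (k * m)%N).
have e2 j : B *m A ^+ j.+1 = A ^+ j.+1 *m B - j.+1%:R *: (A ^+ j *m C).
  by rewrite -(comm_mx_pow j (erefl C) AC) opprB addrC subrK.
have stab j X : X *m A ^+ j = 0 -> X *m (B *m A) *m A ^+ j = 0.
  case: j => [|j XA]; first by rewrite expr0 !mulmx1 => ->; rewrite mul0mx.
  have e1 : A ^+ j *m C *m A = A ^+ j.+1 *m C by rewrite -mulmxA -AC mulmxA exprSr.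
  rewrite -!mulmxA -[A *m _]/(A * _) -exprS exprSr -[_ * A]/(_ *m A) (mulmxA B) e2.
  by rewrite mulmxBl -scalemxAl e1 mulmxBr -scalemxAr !mulmxA XA !mul0mx scaler0 subr0.
have low j i X : X *m A ^+ j.+1 = 0 ->
    X *m (B *m A) ^+ i *m A ^+ j = (- j.+1%:R) ^+ i *: (X *m A ^+ j *m C ^+ i).
  elim: i X => [|i ih] X XA; first by rewrite !expr0 !mulmx1 scale1r.
  rewrite exprS -[_ * _]/(_ *m _) mulmxA ih; last exact: stab.
  have -> : X *m (B *m A) *m A ^+ j = - (j.+1%:R *: (X *m (A ^+ j *m C))).
    rewrite -!mulmxA -[A *m _]/(A * _) -exprS e2 mulmxBr (mulmxA X _ B) XA mul0mx sub0r.
    by rewrite -scalemxAr.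
  rewrite -scaleNr -scalemxAl scalerA [C ^+ i.+1]exprS -[C * _]/(C *m _).
  by rewrite -exprSr !mulmxA.
have step j X : X *m A ^+ j.+1 = 0 -> X *m (B *m A) ^+ k *m A ^+ j = 0.
  by move=> /low ->; rewrite Ck mulmx0 scaler0.
have : forall j X, X *m A ^+ j = 0 -> X *m (B *m A) ^+ (k * j) = 0.
  elim=> [|j ih] X XA; first by rewrite muln0 expr0.
  by rewrite mulnS exprD -[_ * _]/(_ *m _) mulmxA; apply: ih; exact: step.
by move=> /(_ m 1%:M); rewrite Am mulmx0 mul1mx => ->.
Qed.

End NilpotentTrace.

(** * Cartan's criterion and sl2-triples *)

Section LieAlgebra.
Variables (R : realType) (n : nat) (br : 'rV[R]_n -> 'rV[R]_n -> 'rV[R]_n).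
Local Notation V := 'rV[R]_n.
Implicit Types (x y z v w : V) (I J K U W : {vspace V}).

Hypothesis brDl : forall x y z, br (x + y) z = br x z + br y z.
Hypothesis brZl : forall a x z, br (a *: x) z = a *: br x z.
Hypothesis brC : forall x y, br x y = - br y x.
Hypothesis jacobi : forall x y z, br x (br y z) = br (br x y) z + br y (br x z).

Lemma brDr x y z : br z (x + y) = br z x + br z y.
Proof. by rewrite brC brDl opprD -!(brC z). Qed.
Lemma brZr a x z : br z (a *: x) = a *: br z x.
Proof. by rewrite brC brZl -scalerN -brC. Qed.
Lemma brNl x y : br (- x) y = - br x y.
Proof. by rewrite -scaleN1r brZl scaleN1r. Qed.
Lemma brNr x y : br x (- y) = - br x y.
Proof. by rewrite -scaleN1r brZr scaleN1r. Qed.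
Lemma brBr x y z : br z (x - y) = br z x - br z y.
Proof. by rewrite brDr brNr. Qed.
Lemma br0l x : br 0 x = 0.
Proof. by have := brZl 0 0 x; rewrite !scale0r. Qed.
Lemma br0r x : br x 0 = 0.
Proof. by rewrite brC br0l oppr0. Qed.
Lemma brxx x : br x x = 0.
Proof.
have /eqP := brC x x; rewrite -addr_eq0 -mulr2n -scaler_nat scaler_eq0.
by rewrite pnatr_eq0 /= => /eqP.
Qed.
Lemma br_suml (T : Type) (r : seq T) (F : T -> V) x :
  br (\sum_(i <- r) F i) x = \sum_(i <- r) br (F i) x.
Proof. by elim/big_rec2: _ => [|i u v _ <-]; rewrite ?br0l ?brDl. Qed.
Lemma br_sumr (T : Type) (r : seq T) (F : T -> V) x :
  br x (\sum_(i <- r) F i) = \sum_(i <- r) br x (F i).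
Proof. by elim/big_rec2: _ => [|i u v _ <-]; rewrite ?br0r ?brDr. Qed.

(** Vectors are rows and matrices act on the right, so that products appear reversed; this accounts
    for the sign in [ad_br]. *)
Definition ad x : 'M[R]_n := \matrix_(i < n) br x (delta_mx 0 i).

Lemma mul_ad y x : y *m ad x = br x y.
Proof.
rewrite {2}(row_sum_delta y) br_sumr mulmx_sum_row; apply: eq_bigr => i _.
by rewrite rowK brZr.
Qed.

Lemma adP (A : 'M[R]_n) x : (forall y, y *m A = br x y) -> A = ad x.
Proof. by move=> h; apply/row_matrixP => i; rewrite rowE h -mul_ad -rowE. Qed.

Lemma adD x y : ad (x + y) = ad x + ad y.
Proof. by apply/esym/adP => z; rewrite mulmxDr !mul_ad brDl. Qed.
Lemma adZ a x : ad (a *: x) = a *: ad x.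
Proof. by apply/esym/adP => z; rewrite -scalemxAr mul_ad brZl. Qed.
Lemma adN x : ad (- x) = - ad x.
Proof. by rewrite -scaleN1r adZ scaleN1r. Qed.
Lemma ad0 : ad 0 = 0.
Proof. by have := adZ 0 0; rewrite !scale0r. Qed.
Lemma ad_sum (T : Type) (r : seq T) (F : T -> V) :
  ad (\sum_(i <- r) F i) = \sum_(i <- r) ad (F i).
Proof. by elim/big_rec2: _ => [|i u v _ <-]; rewrite ?ad0 ?adD. Qed.

Lemma ad_br x y : ad (br x y) = ad y *m ad x - ad x *m ad y.
Proof.
apply/esym/adP => z; rewrite mulmxBr !mulmxA !mul_ad jacobi.
by rewrite addrK.
Qed.

Lemma ad_deriv x y : ad y *m ad x = ad (y *m ad x) + ad x *m ad y.
Proof. by rewrite mul_ad ad_br subrK. Qed.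

Definition killing x y : R := \tr (ad x *m ad y).

Lemma killingC x y : killing x y = killing y x.
Proof. exact: mxtrace_mulC. Qed.
Lemma killingDl x y z : killing (x + y) z = killing x z + killing y z.
Proof. by rewrite /killing adD mulmxDl mxtraceD. Qed.
Lemma killingZl a x z : killing (a *: x) z = a * killing x z.
Proof. by rewrite /killing adZ -scalemxAl mxtraceZ. Qed.
Lemma killingDr x y z : killing z (x + y) = killing z x + killing z y.
Proof. by rewrite killingC killingDl !(killingC z). Qed.
Lemma killingZr a x z : killing z (a *: x) = a * killing z x.
Proof. by rewrite killingC killingZl (killingC z). Qed.

Lemma killing_inv x y z : killing (br x y) z = killing x (br y z).
Proof.
rewrite /killing !ad_br mulmxBl mulmxBr !linearB /= mulmxA; congr (_ - _).
  by rewrite mxtrace_mulC !mulmxA mxtrace_mulC mulmxA mxtrace_mulC mulmxA.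
by rewrite mulmxA.
Qed.

Definition ideal I := forall x y, y \in I -> br x y \in I.
Definition derived I : {vspace V} :=
  <<[seq br x y | x <- vbasis I, y <- vbasis I]>>%VS.
Definition subalgebra K := forall x y, x \in K -> y \in K -> br x y \in K.

Lemma mem_derived I x y : x \in I -> y \in I -> br x y \in derived I.
Proof.
move=> xI yI; rewrite (coord_vbasis xI) (coord_vbasis yI) br_suml.
apply: rpred_sum => i _; rewrite br_sumr; apply: rpred_sum => j _.
rewrite brZl brZr; do 2!apply: rpredZ; apply: memv_span.
by apply: allpairs_f; apply: mem_nth; rewrite size_tuple.
Qed.

Lemma derived_sub I U : (forall x y, x \in I -> y \in I -> br x y \in U) ->
  (derived I <= U)%VS.
Proof.
move=> h; apply/span_subvP => _ /allpairsP[[x y] /= [xI yI ->]].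
by apply: h; exact: vbasis_mem.
Qed.

Lemma derived_subv I : ideal I -> (derived I <= I)%VS.
Proof. by move=> hI; apply: derived_sub => x y _; exact: hI. Qed.

Lemma derived_ideal I : ideal I -> ideal (derived I).
Proof.
move=> hI x y; rewrite -(mul_ad y).
suff : (derived I <= (linfun (mulmxr (ad x)) @^-1: derived I))%VS.
  by move=> /subvP h /h; rewrite -memv_preim lfunE.
apply: derived_sub => u v uI vI; rewrite -memv_preim lfunE /= mul_ad jacobi.
by apply: rpredD; apply: mem_derived => //; exact: hI.
Qed.

(** A proper subalgebra of largest dimension. If [x] normalises it, adding [x] yields a larger
    subalgebra, which can only be [K]; this step serves both [engel] and [isotropic_ideal_eq0]. *)
Lemma max_subalgebra K : K != 0%VS -> exists K',
  [/\ subalgebra K', (K' <= K)%VS, K' != K & subalgebra K -> forall x, x \in K ->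
     x \notin K' -> (forall y, y \in K' -> br y x \in K') -> K = (K' + <[x]>)%VS].
Proof.
move=> K0.
pose P m := `[< exists K', [/\ subalgebra K', (K' <= K)%VS, K' != K & \dim K' = m] >].
have exP : exists m, P m.
  exists 0%N; apply/asboolP; exists 0%VS; split; rewrite ?sub0v ?dimv0 1?eq_sym //.
  by move=> x y; rewrite !memv0 => /eqP -> _; rewrite br0l.
have [|m /asboolP[K' [sK' K'K K'neK dimK']] maxm] := @ex_maxnP P (\dim K) exP.
  by move=> m /asboolP[K' [_ /dimvS h _ <-]].
exists K'; split=> // sK x xK xK' hx.
have sub : (K' + <[x]> <= K)%VS by rewrite subv_add K'K -memvE.
apply/eqP; rewrite eq_sym; apply: contraT => neq.
have : (\dim (K' + <[x]>)%VS <= m)%N.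
  apply: maxm; apply/asboolP; exists (K' + <[x]>)%VS; split=> //.
  move=> _ _ /memv_addP[a aK' [_ /vlineP[s ->] ->]] /memv_addP[b bK' [_ /vlineP[t ->] ->]].
  apply: (subvP (addvSl _ _)); rewrite brDl !brDr !brZl !brZr brxx !scaler0 addr0.
  apply: rpredD; first by apply: rpredD; [exact: sK'|apply: rpredZ; exact: hx].
  by apply: rpredZ; rewrite brC rpredN; exact: hx.
rewrite -dimK' => le; have := dimv_leqif_eq (addvSl K' <[x]>) => h.
have : K' == (K' + <[x]>)%VS by rewrite -(geq_leqif h).
by move=> /eqP e; move: xK'; rewrite e (subvP (addvSr _ _)) // memv_line.
Qed.

(** Engel's theorem relative to two invariant subspaces [W <= U], which spares the quotient [U / W].
    Induction on the dimension of [K] uses a maximal subalgebra twice, acting on [K] modulo itself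
    and on [U] modulo [W]. *)
Lemma engel K U W : subalgebra K ->
  (forall x, x \in K -> exists k, ad x ^+ k = 0) ->
  (forall x v, x \in K -> v \in W -> br x v \in W) ->
  (forall x v, x \in K -> v \in U -> br x v \in U) ->
  (W <= U)%VS -> W != U ->
  exists2 v, v \in U & v \notin W /\ forall x, x \in K -> br x v \in W.
Proof.
have [d] := ubnP (\dim K); elim: d K U W => // d ih K U W dK sK nK KW KU WU WneU.
have [v0 v0U v0W] : exists2 v, v \in U & v \notin W.
  apply: contrapT => h; move/eqP: WneU; apply; apply/eqP; rewrite eqEsubv WU /=.
  by apply/subvP => v vU; apply: contrapT => /negP vW; apply: h; exists v.
have [K0|K0] := eqVneq K 0%VS.
  exists v0 => //; split=> // x; rewrite K0 memv0 => /eqP ->.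
  by rewrite br0l mem0v.
have [K' [sK' K'K K'neK maxK']] := max_subalgebra K0.
have ltK' : (\dim K' < d)%N.
  have dK' : (\dim K <= d)%N := dK.
  apply: leq_trans dK'; rewrite ltn_neqAle dimvS // andbT.
  by apply: contra K'neK => h; rewrite -(dimv_leqif_eq K'K).
have nK' x : x \in K' -> exists k, ad x ^+ k = 0 by move=> /(subvP K'K)/nK.
(* Applied to [K'] acting on [K] modulo [K'], the induction hypothesis gives an element normalising
   [K'], so that [K = K' + <x>]. *)
have [||x xK [xK' hx]] := ih K' K K' ltK' sK' nK' _ _ K'K K'neK.
- by move=> x v; exact: sK'.
- by move=> x v /(subvP K'K) xK vK; exact: sK.
have KE := maxK' sK x xK xK' hx.
have [||v vU [vW hv]] := ih K' U W ltK' sK' nK' _ _ WU WneU.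
- by move=> y w /(subvP K'K); exact: KW.
- by move=> y w /(subvP K'K); exact: KU.
have inv j : v *m ad x ^+ j \in U /\ forall k, k \in K' -> br k (v *m ad x ^+ j) \in W.
  elim: j => [|j [jU jW]]; first by rewrite mulmx1.
  rewrite exprSr -mulmxE mulmxA mul_ad; split=> [|k kK']; first exact: KU.
  rewrite jacobi rpredD // ?jW ?hx //; apply: KW => //; exact: jW.
(* The last iterate of [v] under [ad x] outside [W] is still killed modulo [W] by [K'], and now also
   by [x]. *)
have exW : exists j, v *m ad x ^+ j \in W.
  by have [k kx] := nK x xK; exists k; rewrite kx mulmx0 mem0v.
have := ex_minnP exW; case=> -[|j]; first by rewrite mulmx1 (negPf vW).
move=> jW minj; have [jU jK'] := inv j; exists (v *m ad x ^+ j) => //; split.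
  by apply/negP => /minj; rewrite ltnn.
move=> y; rewrite KE => /memv_addP[a aK' [_ /vlineP[s ->] ->]].
rewrite brDl brZl rpredD ?jK' // rpredZ // -mul_ad.
by rewrite exprSr -mulmxE mulmxA in jW.
Qed.

(** * Cartan's criterion and orthogonal ideals *)

Section Cartan.
Hypothesis semisimple_br : forall I, ideal I ->
  (exists k, iter k derived I = 0%VS) -> I = 0%VS.

(** Cartan's criterion. The replica [S] of [ad x] is again a derivation preserving [J], and for a
    bracket [x = [a, b]] the trace of [S] times [ad x] is, up to the order of the arguments, the
    Killing form of [a S] and [b], both in [J]. So it vanishes, which by [replica] forces [ad x] to
    be nilpotent. *)
Lemma ad_nilpotent J x : ideal J -> (forall u v, u \in J -> v \in J -> killing u v = 0) ->
  x \in derived J -> exists k, ad x ^+ k = 0.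
Proof.
move=> iJ kJ xJ; have [S [stS _ trS derS]] := replica (ad x).
apply: trS; have {}derS := derS ad adD adZ (ad_deriv x).
have JS v : v \in J -> v *m S \in J.
  by apply: stS => u uJ; rewrite mul_ad brC rpredN; exact: iJ (subvP (derived_subv iJ) _ xJ).
have {}xJ : x \in <<in_tuple [seq br x y | x <- vbasis J, y <- vbasis J]>>%VS := xJ.
rewrite (coord_span xJ) ad_sum mulmx_sumr raddf_sum /= big1 // => i _.
rewrite adZ -scalemxAr mxtraceZ.
have /allpairsP[[a b] /= [/vbasis_mem aJ /vbasis_mem bJ ->]] :
  (in_tuple [seq br x y | x <- vbasis J, y <- vbasis J])`_i
    \in [seq br x y | x <- vbasis J, y <- vbasis J] by exact: mem_nth.
rewrite ad_br mulmxBr linearB /= mulmxA mxtrace_mulC mulmxA (derS a) mulmxDl linearD /=.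
by rewrite mulmxA addrK -/(killing _ _) kJ ?scaler0 ?mulr0 // JS.
Qed.

(** The derived series of [I] stabilises at some [J = [J, J]], whose elements are all ad-nilpotent.
    If [J] were nonzero, Engel would give a proper subalgebra [K] and an [x] normalising it with
    [J = K + <x>], hence [[J, J] <= K]. So [I] is solvable and semisimplicity applies. *)
Lemma isotropic_ideal_eq0 I : ideal I ->
  (forall x y, x \in I -> y \in I -> killing x y = 0) -> I = 0%VS.
Proof.
move=> iI kI; pose J k := iter k derived I.
have iJ k : ideal (J k) by elim: k => [//|k ih]; exact: derived_ideal.
have JS k : (J k.+1 <= J k)%VS by exact: derived_subv.
have JI k : (J k <= I)%VS by elim: k => [|k ih]; [exact: subvv|exact: subv_trans (JS k) ih].
have [k Jk] : exists k, J k.+1 = J k.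
  apply: contrapT => h.
  have dJ k : (\dim (J k) + k <= \dim I)%N.
    elim: k => [|k ih]; first by rewrite addn0.
    rewrite (leq_trans _ ih) // addnS ltn_add2r ltn_neqAle dimvS // andbT.
    apply: contra_notN h => /eqP e; exists k; apply/eqP.
    by rewrite -(dimv_leqif_eq (JS k)) e.
  by have := dJ (\dim I).+1; rewrite addnS ltnNge leq_addl.
apply: semisimple_br => //; exists k; apply/eqP; apply: contraT => J0.
have sJ : subalgebra (J k) by move=> x y _; exact: iJ.
have nJ x : x \in J k -> exists m, ad x ^+ m = 0.
  rewrite -Jk => xJ; apply: (@ad_nilpotent (J k)) => // u v /(subvP (JI k)) uI /(subvP (JI k)).
  exact: kI.
have [K [sK KJ KneJ maxK]] := max_subalgebra J0.
have nK x : x \in K -> exists m, ad x ^+ m = 0 by move=> /(subvP KJ)/nJ.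
have [||x xJ [xK hx]] := engel sK nK _ _ KJ KneJ.
- by move=> x v; exact: sK.
- by move=> x v _; exact: iJ.
have JE := maxK sJ x xJ xK hx.
have : (derived (J k) <= K)%VS.
  rewrite -[J k]/(iter k derived I) JE; apply: derived_sub => a b.
  move=> /memv_addP[{}a aK [_ /vlineP[s ->] ->]] /memv_addP[{}b bK [_ /vlineP[t ->] ->]].
  rewrite brDl !brDr !brZl !brZr brxx !scaler0 addr0.
  apply: rpredD; first by apply: rpredD; [exact: sK|apply: rpredZ; exact: hx].
  by apply: rpredZ; rewrite brC rpredN; exact: hx.
rewrite -[derived _]/(J k.+1) Jk => JK; move: KneJ; by rewrite eqEsubv KJ JK.
Qed.

Definition killing_mx : 'M[R]_n :=
  \matrix_(i, j) killing (delta_mx 0 i) (delta_mx 0 j).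

Lemma killingE x y : killing x y = (x *m killing_mx *m y^T) 0 0.
Proof.
rewrite {1}(row_sum_delta x) {1}(row_sum_delta y) /killing ad_sum mulmx_suml raddf_sum /=.
rewrite -mulmxA mxE; apply: eq_bigr => i _.
rewrite adZ -scalemxAl linearZ /=; congr (_ * _).
rewrite ad_sum mulmx_sumr raddf_sum mxE /=; apply: eq_bigr => j _.
by rewrite adZ -scalemxAr mxtraceZ !mxE mulrC.
Qed.

(** Written as a kernel, so that [dim_orth] is the rank-nullity theorem. *)
Definition orth U : {vspace V} :=
  lker (linfun (mulmxr (killing_mx *m (\matrix_(i < \dim U) (vbasis U)`_i)^T))).

Lemma mem_orth U x : reflect (forall y, y \in U -> killing x y = 0) (x \in orth U).
Proof.
rewrite memv_ker lfunE /= mulmxA; set B := (\matrix_i _).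
have E i : (x *m killing_mx *m B^T) 0 i = killing x (vbasis U)`_i.
  by rewrite killingE !mxE; apply: eq_bigr => j _; rewrite !mxE.
apply: (iffP eqP) => [h y yU|h].
  rewrite (coord_vbasis yU); elim/big_rec: _ => [|i z _ ih].
    by have := killingZr 0 0 x; rewrite scale0r mul0r.
  by rewrite killingDr killingZr ih -E h mxE mulr0 addr0.
apply/rowP => i; rewrite E mxE h //; apply: vbasis_mem; apply: mem_nth.
by rewrite size_tuple.
Qed.

Lemma dim_orth U : (n <= \dim U + \dim (orth U))%N.
Proof.
have := limg_ker_dim (linfun (mulmxr (killing_mx *m (\matrix_(i < \dim U) (vbasis U)`_i)^T)) : 'Hom('rV[R]_n, 'rV[R]_(\dim U))) fullv.
rewrite (_ : (fullv :&: _)%VS = orth U); last by apply/capv_idPr; exact: subvf.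
rewrite dimvf /dim /= mul1n => {1}<-.
rewrite addnC leq_add2r (leq_trans (dimvS (subvf _))) // dimvf /dim /= mul1n.
by [].
Qed.

Lemma orth_ideal I : ideal I -> ideal (orth I).
Proof.
move=> iI x y /mem_orth h; apply/mem_orth => z zI.
by rewrite brC -scaleN1r killingZl killing_inv h ?mulr0 //; apply: iI.
Qed.

Lemma ideal_orth_cap I : ideal I -> (I :&: orth I = 0)%VS.
Proof.
move=> iI; apply: isotropic_ideal_eq0 => [x y|x y].
  by rewrite !memv_cap => /andP[? ?]; rewrite iI //= orth_ideal.
by rewrite !memv_cap => /andP[? /mem_orth h] /andP[yI _]; exact: h.
Qed.

Lemma ideal_orth_add I : ideal I -> (I + orth I = fullv)%VS.
Proof.
move=> iI; apply/eqP; rewrite eqEdim subvf /= dimvf /dim /= mul1n.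
by rewrite dimv_disjoint_sum ?ideal_orth_cap ?dim_orth.
Qed.

Lemma br_ideal_orth I x y : ideal I -> x \in I -> y \in orth I -> br x y = 0.
Proof.
move=> iI xI yI; apply/eqP; rewrite -memv0 -(ideal_orth_cap iI) memv_cap.
by rewrite orth_ideal // andbT brC rpredN iI.
Qed.

Lemma killing_nondeg x : (forall y, killing x y = 0) -> x = 0.
Proof.
move=> h; have iF : ideal fullv by move=> *; exact: memvf.
by apply/eqP; rewrite -memv0 -(ideal_orth_cap iF) memv_cap memvf; apply/mem_orth.
Qed.

End Cartan.

(** * The Jacobson-Morozov theorem *)

Section JacobsonMorozov.
Hypothesis killing_nd : forall x, (forall y, killing x y = 0) -> x = 0.

Lemma killing_mx_unit : killing_mx \in unitmx.
Proof.
rewrite -row_free_unit -kermx_eq0; apply/eqP/row_matrixP => i; rewrite row0.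
apply: killing_nd => y; rewrite killingE.
have /sub_kermxP -> : (row i (kermx killing_mx) <= kermx killing_mx)%MS by exact: row_sub.
by rewrite mul0mx mxE.
Qed.

Lemma killing_mx_sym : killing_mx^T = killing_mx.
Proof. by apply/matrixP => i j; rewrite !mxE killingC. Qed.

(** Otherwise some linear form vanishes on the image of [(ad y)^2] but not at [y]. Nondegeneracy
    represents it by a vector [v], invariance gives [[y, [y, v]] = 0], and then [double_comm_trace]
    says that the form vanishes at [y]. *)
Lemma nilpotent_double_ad y m : ad y ^+ m = 0 -> exists z, br y (br y z) = y.
Proof.
move=> nil; set A := ad y; pose M := A *m A.
suff /submxP[z hz] : (y <= M)%MS by exists z; rewrite -!mul_ad -mulmxA -hz.
apply: contraT => yM.
have [c Mc yc] : exists2 c : 'cV[R]_n, M *m c = 0 & y *m c != 0.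
  have : y *m cokermx M != 0 by apply: contraNneq yM; rewrite submxE => ->.
  case/rV0Pn => j yj; exists (cokermx M *m delta_mx j 0).
    by rewrite mulmxA mulmx_coker mul0mx.
  by rewrite mulmxA -colE; apply/cV0Pn; exists 0; rewrite mxE.
pose v := c^T *m invmx killing_mx.
have kv x : killing x v = (x *m c) 0 0.
  rewrite killingE /v trmx_mul trmxK trmx_inv killing_mx_sym mulmxA mulmxK //.
  exact: killing_mx_unit.
have vA : br y (br y v) = 0.
  have mv u x : killing (br y u) x = - killing u (br y x).
    by rewrite brC -killing_inv -scaleN1r killingZl mulN1r.
  apply: killing_nd => x; rewrite !mv opprK killingC kv -!mul_ad -/A -(mulmxA x) -/M.
  by rewrite -mulmxA Mc mulmx0 mxE.
have := @double_comm_trace _ _ A (ad v) m nil; rewrite -/(killing y v) kv => tr0.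
move: yc; apply/contraNT => _; apply/eqP/matrixP => i j; rewrite !ord1 tr0 ?mxE //.
have : ad (br y (br y v)) = 0 by rewrite vA ad0.
rewrite !ad_br -/A => /eqP; rewrite subr_eq0 => /eqP e.
by rewrite -[A *m ad v - _]opprB mulmxN mulNmx e.
Qed.

Definition eigen_sum h x := exists2 s : seq (R * V), x = \sum_(p <- s) p.2 &
  forall p, p \in s -> br h p.2 = p.1 *: p.2.

Lemma eigen_sumD h x y : eigen_sum h x -> eigen_sum h y -> eigen_sum h (x + y).
Proof.
move=> [s -> hs] [t -> ht]; exists (s ++ t); first by rewrite big_cat.
by move=> p; rewrite mem_cat => /orP[/hs|/ht].
Qed.

Lemma eigen_sum1 h a x : br h x = a *: x -> eigen_sum h x.
Proof.
by move=> e; exists [:: (a, x)]; rewrite ?big_seq1 // => p; rewrite inE => /eqP ->.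
Qed.

Lemma eigen_sum0 h : eigen_sum h 0.
Proof. by exists [::]; rewrite ?big_nil. Qed.

Section Triple.
Variables (y z0 h : V) (m : nat).
Hypotheses (hy : br h y = 2 *: y) (yz : br y z0 = h) (nil : ad y ^+ m = 0).
Let A := ad y.

Lemma ad_hA : ad h *m A = A *m ad h - 2 *: A.
Proof. by have := ad_br h y; rewrite hy adZ -/A => ->; rewrite opprB addrC subrK. Qed.

Lemma ad_zA k : ad z0 *m A ^+ k.+1 - A ^+ k.+1 *m ad z0 =
  k.+1%:R *: (A ^+ k *m ad h - k%:R *: A ^+ k).
Proof.
elim: k => [|k ih].
  by rewrite expr1 expr0 mul1mx !scale1r scale0r subr0 -yz ad_br.
have -> : ad z0 *m A ^+ k.+2 - A ^+ k.+2 *m ad z0 =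
    (ad z0 *m A ^+ k.+1 - A ^+ k.+1 *m ad z0) *m A +
    A ^+ k.+1 *m (ad z0 *m A - A *m ad z0).
  by rewrite [A ^+ k.+2]exprSr -[_ * A]/(_ *m A) mulmxBl mulmxBr !mulmxA addrA subrK.
rewrite ih -[X in _ + _ *m X]ad_br yz -scalemxAl mulmxBl -(mulmxA _ _ A) ad_hA.
rewrite mulmxBr -scalemxAr -scalemxAl mulmxA.
rewrite -[A ^+ k *m A]/(A ^+ k * A) -exprSr.
set P := A ^+ k.+1 *m _; set Q := A ^+ k.+1.
by apply/matrixP => i j; rewrite !mxE; ring.
Qed.

Lemma ker_im_step k (u : V) : u *m A ^+ k.+1 = 0 ->
  exists u' : V, (u *m A ^+ k) *m ad h - k%:R *: (u *m A ^+ k) = u' *m A ^+ k.+1.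
Proof.
move=> uA; exists (k.+1%:R^-1 *: (u *m ad z0)).
have := congr1 (fun M => k.+1%:R^-1 *: (u *m M)) (ad_zA k).
rewrite mulmxBr [u *m (A ^+ _ *m _)]mulmxA uA mul0mx subr0 -scalemxAr scalerA mulVf ?pnatr_eq0 //.
by rewrite scale1r mulmxBr -scalemxAr -scalemxAl !mulmxA => ->.
Qed.

(** On vectors of [ker A] in the image of [A ^+ k], [ad h - k] takes values in the image of
    [A ^+ k.+1], by [ker_im_step]. Descending from [A ^+ m = 0], they split into eigenvectors of
    [ad h] with eigenvalues [k], ..., [m - 1]. *)
Lemma ker_eigen_dec d k (u : V) : (k + d)%N = m -> u *m A ^+ k.+1 = 0 ->
  exists f : nat -> V, [/\ u *m A ^+ k = \sum_(k <= i < m) f i,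
    forall i, f i *m ad h = i%:R *: f i & forall i, f i *m A = 0].
Proof.
elim: d k u => [|d ih] k u kd uA.
  rewrite addn0 in kd; exists (fun=> 0); split=> [|i|i]; rewrite ?mul0mx ?scaler0 //.
  by rewrite kd big_geq // nil mulmx0.
have [u' hu'] := ker_im_step uA; set x := u *m A ^+ k in hu' *.
have xA : x *m A = 0 by rewrite /x -mulmxA -[_ *m A]/(_ * A) -exprSr uA.
have u'A : u' *m A ^+ k.+2 = 0.
  rewrite exprSr -[_ * A]/(_ *m A) mulmxA -hu' mulmxBl -scalemxAl xA scaler0 subr0.
  by rewrite -mulmxA ad_hA mulmxBr mulmxA -scalemxAr xA mul0mx scaler0 subr0.
have [f [f1 f2 f3]] := ih k.+1 u' (etrans (addSnnS _ _) kd) u'A.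
have km : (k < m)%N by rewrite -kd addnS ltnS leq_addr.
(* Dividing by [i - k] inverts [ad h - k] on the part of eigenvalue [i > k], so that [x0] below
   satisfies the eigenvector equation for [k]. *)
pose g i := if (k < i)%N then (i%:R - k%:R)^-1 *: f i else 0.
have gh i : g i *m ad h = i%:R *: g i.
  rewrite /g; case: ifP => _; last by rewrite mul0mx scaler0.
  by rewrite -scalemxAl f2 !scalerA mulrC.
have gA i : g i *m A = 0.
  by rewrite /g; case: ifP => _; rewrite ?mul0mx // -scalemxAl f3 scaler0.
pose x0 := x - \sum_(k.+1 <= i < m) g i.
exists (fun i => if i == k then x0 else g i); split=> [|i|i].
- rewrite big_ltn // eqxx (eq_big_nat _ _ (F2 := g)) ?subrK // => i /andP[ki _].
  by rewrite gtn_eqF.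
- case: eqP => [->|_]; last exact: gh.
  have e : x0 *m ad h - k%:R *: x0 = 0.
    have sub4 (a b c d' : V) : (a - b) - (c - d') = (a - c) - (b - d').
      by rewrite !opprB addrACA [RHS]addrACA [- c + _]addrC.
    rewrite /x0 mulmxBl scalerBr sub4 hu' f1 mulmx_suml scaler_sumr -sumrB.
    rewrite (eq_big_nat _ _ (F2 := fun i => g i *m ad h - k%:R *: g i)) ?subrr //.
    move=> j /andP[kj _]; rewrite gh -scalerBl /g kj scalerA divff ?scale1r //.
    by rewrite subr_eq0 eqr_nat gtn_eqF.
  by apply/eqP; rewrite -subr_eq0 e.
- case: eqP => [_|_]; last exact: gA.
  by rewrite /x0 mulmxBl xA sub0r mulmx_suml big1 ?oppr0 // => j _; exact: gA.
Qed.

Lemma ker_eigen_dec0 (w : V) : w *m A = 0 ->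
  exists f : nat -> V, [/\ w = \sum_(0 <= i < m) f i,
    forall i, f i *m ad h = i%:R *: f i & forall i, f i *m A = 0].
Proof.
move=> wA; have [|f [f1 f2 f3]] := @ker_eigen_dec m 0%N w (add0n _); first by rewrite expr1.
by exists f; split=> //; rewrite -f1 expr0 mulmx1.
Qed.

(** The defect [w = [h, z0] + 2 z0] is killed by [ad y], and there [ad h] has eigenvalues [i >= 0].
    So [ad h + 2] is invertible on it, and subtracting the preimage [x] of [w] corrects [z0] without
    changing [[y, z0]]. *)
Lemma complete_triple : exists z, br y z = h /\ br h z = - (2 *: z).
Proof.
pose w := br h z0 + 2 *: z0.
have wA : w *m A = 0.
  rewrite mul_ad brDr brZr yz jacobi yz brxx addr0 (brC y) hy brNl brZl yz.
  by rewrite addrC subrr.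
have [f [f1 f2 f3]] := ker_eigen_dec0 wA.
pose x := \sum_(0 <= i < m) (i%:R + 2)^-1 *: f i.
have xA : br y x = 0.
  by rewrite -mul_ad mulmx_suml big1 // => i _; rewrite -scalemxAl f3 scaler0.
have hx : br h x + 2 *: x = w.
  rewrite f1 -mul_ad mulmx_suml scaler_sumr -big_split /=; apply: eq_bigr => i _.
  rewrite -scalemxAl f2 !scalerA -scalerDl mulrC -mulrDl divff ?scale1r //.
exists (z0 - x); rewrite brBr yz xA subr0; split=> //.
have hx' : br h x = w - 2 *: x by rewrite -hx addrK.
have hz0 : br h z0 = w - 2 *: z0 by rewrite /w addrK.
rewrite brBr hx' hz0.
have sub3 (a b c : V) : a - 2 *: b - (a - 2 *: c) = - (2 *: (b - c)).
  by apply/rowP => i; rewrite !mxE; ring.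
exact: sub3.
Qed.

Hypothesis hz : br h z0 = - (2 *: z0).

Lemma ad_hB k : ad h *m ad z0 ^+ k = ad z0 ^+ k *m ad h + (2 * k%:R) *: ad z0 ^+ k.
Proof.
elim: k => [|k ih]; first by rewrite mulr0 scale0r addr0 mulmx1 mul1mx.
have e : ad h *m ad z0 = ad z0 *m ad h + 2 *: ad z0.
  by have := ad_br h z0; rewrite hz adN adZ => /eqP; rewrite eq_sym subr_eq addrC -subr_eq opprK => /eqP.
rewrite exprSr -[_ * ad z0]/(_ *m ad z0) mulmxA ih mulmxDl -(mulmxA _ (ad h)) e.
rewrite mulmxDr -scalemxAr -scalemxAl mulmxA.
set P := _ *m _ *m ad h; set Q := _ *m ad z0.
by apply/matrixP => i j; rewrite !mxE; ring.
Qed.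

(** The usual sl2 computation at weight [i]: raising after the [j.+1]-st lowering multiplies by
    [j.+1 (i - j)], which is nonzero as long as [j < i]. *)
Lemma lower_raise (f : V) i j : f *m ad h = i%:R *: f -> f *m A = 0 -> (j <= i)%N ->
  exists2 c : R, c != 0 & f *m ad z0 ^+ j *m A ^+ j = c *: f.
Proof.
move=> fh fA ji.
have fB k : f *m ad z0 ^+ k *m ad h = (i%:R - 2 * k%:R) *: (f *m ad z0 ^+ k).
  have := congr1 (fun M => f *m M) (ad_hB k).
  rewrite mulmxDr !mulmxA fh -scalemxAr -scalemxAl scalerBl => ->.
  by rewrite addrK.
have BA : ad z0 *m A = ad h + A *m ad z0 by rewrite -yz ad_br subrK.
have fBA k : f *m ad z0 ^+ k.+1 *m A = (k.+1%:R * (i%:R - k%:R)) *: (f *m ad z0 ^+ k).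
  elim: k => [|k ih].
    by rewrite expr1 expr0 mulmx1 -mulmxA BA mulmxDr mulmxA fA mul0mx addr0 fh subr0 mul1r.
  rewrite exprSr -[_ * ad z0]/(_ *m ad z0) mulmxA -(mulmxA _ (ad z0)) BA mulmxDr fB.
  rewrite mulmxA ih -scalemxAl -mulmxA -[_ *m ad z0]/(_ * ad z0) -exprSr -scalerDl.
  by congr (_ *: _); ring.
elim: j ji => [|j ih] ji; first by exists 1; rewrite ?oner_eq0 // scale1r !mulmx1.
have [c c0 e] := ih (ltnW ji).
exists (j.+1%:R * (i%:R - j%:R) * c).
  by rewrite !mulf_neq0 ?pnatr_eq0 // subr_eq0 eqr_nat gtn_eqF.
by rewrite [A ^+ _]exprS -[A * _]/(A *m _) mulmxA fBA -scalemxAl e scalerA.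
Qed.

(** Induction along the kernels of the powers of [A]. The vector [u A ^+ j] splits into eigenvectors
    killed by [A]; lowering each [j] times and rescaling gives [u1], a sum of eigenvectors with the
    same image under [A ^+ j], so that [u - u1] is one level lower. *)
Lemma ad_h_diagonalizable v : eigen_sum h v.
Proof.
suff H j (u : V) : (j <= m)%N -> u *m A ^+ j = 0 -> eigen_sum h u.
  by apply: (H m v (leqnn _)); rewrite nil mulmx0.
elim: j u => [|j ih] u jm uA.
  by move: uA; rewrite expr0 mulmx1 => ->; exact: eigen_sum0.
have [f [f1 f2 f3]] := ker_eigen_dec (subnKC (ltnW jm)) uA.
have /choice[c hc] : forall i, exists c : R, (j <= i)%N -> f i *m ad z0 ^+ j *m A ^+ j = c *: f i /\ c != 0.
  move=> i; have [ji|_] := leqP j i; last by exists 0.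
  by have [c c0 e] := lower_raise (f2 i) (f3 i) ji; exists c.
pose u1 := \sum_(j <= i < m) (c i)^-1 *: (f i *m ad z0 ^+ j).
have e1 : eigen_sum h u1.
  rewrite /u1; elim/big_ind: _ => [|a b|i _]; [exact: eigen_sum0|exact: eigen_sumD|].
  apply: (@eigen_sum1 _ (i%:R - 2 * j%:R)); rewrite -mul_ad -scalemxAl.
  have := congr1 (fun M => f i *m M) (ad_hB j).
  rewrite mulmxDr !mulmxA f2 -scalemxAr -scalemxAl => /eqP; rewrite -subr_eq => /eqP <-.
  by rewrite -scalerBl !scalerA mulrC.
rewrite -(subrK u1 u); apply: eigen_sumD e1; apply: ih; first exact: ltnW.
rewrite mulmxBl f1 mulmx_suml [X in _ - X](eq_big_nat _ _ (F2 := f)) ?subrr // => i /andP[ji _].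
by have [e c0] := hc i ji; rewrite -scalemxAl e scalerA mulVf // scale1r.
Qed.

End Triple.

Lemma jacobson_morozov y m : ad y ^+ m = 0 -> exists h z,
  [/\ br h y = 2 *: y, br h z = - (2 *: z), br y z = h & forall x, eigen_sum h x].
Proof.
move=> nil; have [z1 yz1] := nilpotent_double_ad nil.
(* The factor [-2] turns [[y, [y, z1]] = y] into [[h, y] = 2 y]. *)
pose z0 := (- 2) *: z1; pose h := br y z0.
have hy : br h y = 2 *: y.
  by rewrite brC /h /z0 !brZr yz1 -scaleNr opprK.
have [z [yz hz]] := complete_triple hy (erefl h) nil.
by exists h, z; split=> // x; apply: (ad_h_diagonalizable hy yz nil hz).
Qed.

End JacobsonMorozov.

End LieAlgebra.

(** * Directional derivatives and the group law in a chart *)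

Section RowNorm.
Variables (R : realType).

Lemma mx_norm_coord m n (x : 'M[R]_(m, n)) i j : `|x i j| <= `|x|.
Proof.
rewrite [leRHS]/Num.norm /= mx_normrE.
exact: (le_bigmax _ (fun ij : 'I_m * 'I_n => `|x ij.1 ij.2|) (i, j)).
Qed.

Lemma mx_norm_le m n (x : 'M[R]_(m, n)) c : 0 <= c ->
  (forall i j, `|x i j| <= c) -> `|x| <= c.
Proof.
move=> c0 h; rewrite [leLHS]/Num.norm /= mx_normrE; apply/bigmax_leP; split=> // -[i j] _.
Qed.

End RowNorm.

Section DirectionalDerivative.
Variables (R : realType) (V W : normedModType R).
Implicit Types (f : V -> W) (p v : V) (l : W).

(** Little-o form of the directional derivative, valid at [h = 0] too; it combines with estimates
    more directly than a quotient over a punctured neighbourhood, and [has_derivP] shows the two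
    equivalent. *)
Definition has_deriv f p v l := forall eps : R, 0 < eps ->
  exists2 r : R, 0 < r & forall h : R, `|h| < r ->
    `|f (p + h *: v) - f p - h *: l| <= eps * `|h|.

Lemma has_derivP f p v l : has_deriv f p v l <-> derivable f p v /\ 'D_v f p = l.
Proof.
have quot (h : R) : h != 0 ->
    `|l - h^-1 *: ((f \o shift p) (h *: v) - f p)| =
    `|h|^-1 * `|f (p + h *: v) - f p - h *: l|.
  move=> h0; rewrite -normfV -normrZ distrC; congr `|_|.
  rewrite /= [h *: v + p]addrC (scalerBr _ (f _ - f p)) scalerA mulVf // scale1r.
  by [].
split=> [hl|[df <-]].
  have cl : h^-1 *: ((f \o shift p) (h *: v) - f p) @[h --> 0^'] --> l.
    apply/cvgrPdist_le => eps eps0; have [r r0 hr] := hl _ eps0.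
    apply/nbhs_ballP; exists r => //= h; rewrite /ball /= sub0r normrN => hr0 h0.
    by rewrite quot // mulrC ler_pdivrMr ?normr_gt0 // hr.
  by split; [apply/cvg_ex; exists l | apply/cvg_lim].
move=> eps eps0.
have : h^-1 *: ((f \o shift p) (h *: v) - f p) @[h --> 0^'] --> 'D_v f p by exact: df.
move=> /cvgrPdist_le/(_ _ eps0)/nbhs_ballP[r /= r0 hr]; exists r => // h hh.
have [->|h0] := eqVneq h 0.
  by rewrite !scale0r addr0 subrr subr0 !normr0 mulr0.
have /hr/(_ h0) : ball (0 : R) r h by rewrite /ball /= sub0r normrN.
have {}quot : `|'D_v f p - h^-1 *: ((f \o shift p) (h *: v) - f p)| =
    `|h|^-1 * `|f (p + h *: v) - f p - h *: 'D_v f p|.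
  rewrite -normfV -normrZ distrC; congr `|_|.
  by rewrite /= [h *: v + p]addrC (scalerBr _ (f _ - f p)) scalerA mulVf // scale1r.
by rewrite quot mulrC ler_pdivrMr ?normr_gt0.
Qed.

Lemma has_deriv_derive f p v l : has_deriv f p v l -> 'D_v f p = l.
Proof. by move=> /has_derivP[]. Qed.

Lemma derivable_has_deriv f p v : derivable f p v -> has_deriv f p v ('D_v f p).
Proof. by move=> h; apply/has_derivP. Qed.

Lemma has_derivZ f p v l (a : R) : has_deriv f p v l -> has_deriv f p (a *: v) (a *: l).
Proof.
move=> hl eps eps0; have a1 : 0 < `|a| + 1 by rewrite ltr_wpDl.
have [|r r0 hr] := hl (eps / (`|a| + 1)); first exact: divr_gt0.
exists (r / (`|a| + 1)); first exact: divr_gt0.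
move=> h; rewrite ltr_pdivlMr // => hh; rewrite !scalerA.
have hha : `|h * a| <= `|h| * (`|a| + 1) by rewrite normrM ler_wpM2l // lerDl.
apply: (le_trans (hr _ (le_lt_trans hha hh))).
apply: (le_trans (ler_wpM2l _ hha)); first by rewrite divr_ge0 // ltW.
by rewrite [X in _ * X]mulrC mulrA divfK ?gt_eqF.
Qed.

Lemma has_deriv_near f g p v l : (\forall x \near p, f x = g x) ->
  has_deriv f p v l -> has_deriv g p v l.
Proof.
move=> fg hl eps eps0; have [r r0 hr] := hl _ eps0.
have gp : f p = g p by exact: nbhs_singleton fg.
move: fg => /nbhs_ballP[d /= d0 hd].
exists (Num.min r (d / (`|v| + 1))).
  by rewrite lt_min r0 divr_gt0 // ltr_wpDl.
move=> h; rewrite lt_min ltr_pdivlMr ?ltr_wpDl // => /andP[hr0 hh].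
rewrite -gp -(hd (p + h *: v)) ?hr //; rewrite -ball_normE /= opprD addrA subrr sub0r normrN normrZ.
by apply: le_lt_trans hh; rewrite ler_wpM2l // lerDl.
Qed.

End DirectionalDerivative.

Section LineDerivative.
Variables (R : realType) (V : normedModType R) (k : nat).
Implicit Types (f : V -> 'rV[R]_k) (p v : V).

Lemma has_deriv_line f p v (s : R) l j : has_deriv f (p + s *: v) v l ->
  has_deriv (fun t : R => f (p + t *: v) 0 j : R^o) s 1 (l 0 j).
Proof.
move=> hl eps eps0; have [r r0 hr] := hl _ eps0; exists r => // h /hr.
apply: le_trans; apply: le_trans (mx_norm_coord _ 0 j).
by rewrite !mxE [h *: 1]mulr1 scalerDl addrA.
Qed.

(** The mean value theorem is applied to one real coordinate, so the intermediate point [s] depends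
    on [j]. *)
Lemma mvt_line f p v (D : R -> 'rV[R]_k) :
  (forall s : R, 0 <= s <= 1 -> has_deriv f (p + s *: v) v (D s)) ->
  forall j, exists2 s : R, 0 <= s <= 1 & f (p + v) 0 j - f p 0 j = D s 0 j.
Proof.
move=> df j; pose g (t : R) : R := f (p + t *: v) 0 j.
have dg (x : R) : 0 <= x <= 1 -> is_derive x 1 g (D x 0 j).
  move=> x01; have /has_derivP[d <-] := has_deriv_line j (df x x01).
  exact: DeriveDef.
have [||s s01] := @MVT R g (fun x => D x 0 j) 0 1 ltr01.
- by move=> x; rewrite in_itv /= => /andP[/ltW ? /ltW ?]; apply: dg; apply/andP.
- apply: derivable_within_continuous => x; rewrite in_itv /= => x01.
  by case: (dg x x01).
rewrite /g scale0r addr0 scale1r subr0 mulr1 => es; exists s; last exact: es.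
by move: s01; rewrite in_itv /= => /andP[/ltW -> /ltW ->].
Qed.

(** The increment goes first along [h u] and then along [h v]; the second part is handled by the
    mean value theorem at points near [p]. This makes the derivative additive in the direction,
    which a definition by separate directional derivatives does not provide. *)
Lemma has_derivD f p u v (D : V -> 'rV[R]_k) l :
  (\forall x \near p, has_deriv f x v (D x)) -> {for p, continuous D} ->
  has_deriv f p u l -> has_deriv f p (u + v) (l + D p).
Proof.
move=> df cD hl eps eps0.
have e2 : 0 < eps / 2 by rewrite divr_gt0.
have [r r0 hr] := hl _ e2.
have /cvgrPdist_le/(_ _ e2) hD := cD.
have hD' : \forall x \near p, `|D p - D x| <= eps / 2 by exact: hD.
have /nbhs_ballP[d /= d0 hd] : \forall x \near p,
    has_deriv f x v (D x) /\ `|D p - D x| <= eps / 2.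
  by apply: filterS2 df hD' => x.
have uv1 : 0 < `|u| + `|v| + 1 by rewrite ltr_wpDl // addr_ge0.
exists (Num.min r (d / (`|u| + `|v| + 1))); first by rewrite lt_min r0 divr_gt0.
move=> h; rewrite lt_min ltr_pdivlMr // => /andP[/hr hr0 hh].
have near (s : R) : 0 <= s <= 1 -> ball p d (p + h *: u + s *: (h *: v)).
  move=> /andP[s0 s1].
  rewrite -ball_normE /= distrC -(addrA p) [X in X - _]addrC addrK.
  apply: le_lt_trans (ler_normD _ _) _; rewrite !normrZ (ger0_norm s0).
  apply: le_lt_trans hh; rewrite mulrDr mulr1 mulrDr -addrA lerD2l.
  by rewrite -[leLHS]addr0 lerD // ler_piMl // mulr_ge0.
have e : f (p + h *: (u + v)) - f p - h *: (l + D p) =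
    (f (p + h *: u) - f p - h *: l) +
    (f (p + h *: u + h *: v) - f (p + h *: u) - h *: D p).
  by rewrite !scalerDr addrA; apply/rowP => j; rewrite !mxE; ring.
rewrite e (le_trans (ler_normD _ _)) // (splitr eps) mulrDl lerD //.
apply: mx_norm_le; first by rewrite mulr_ge0 // ltW.
move=> i j; rewrite ord1 {i}.
have [|s s01 es] := @mvt_line f (p + h *: u) (h *: v)
    (fun s => h *: D (p + h *: u + s *: (h *: v))) _ j.
  by move=> s s01; apply: has_derivZ; have [] := hd _ (near s s01).
rewrite mxE [X in X + _]mxE [X in _ + X + _]mxE es !mxE -mulrBr normrM mulrC.
rewrite ler_wpM2r //; have [_] := hd _ (near s s01); apply: le_trans.
by rewrite distrC; apply: le_trans (mx_norm_coord _ 0 j); rewrite !mxE.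
Qed.

Lemma has_deriv_sum f p m (u : 'I_m -> V) (D : 'I_m -> V -> 'rV[R]_k) :
  (forall i, \forall x \near p, has_deriv f x (u i) (D i x)) ->
  (forall i, {for p, continuous (D i)}) ->
  has_deriv f p (\sum_i u i) (\sum_i D i p).
Proof.
elim: m u D => [|m ih] u D df cD.
  rewrite !big_ord0 => eps eps0; exists 1 => // h _.
  by rewrite !scaler0 addr0 subrr subr0 normr0 mulr_ge0 // ltW.
rewrite !big_ord_recr /=; apply: has_derivD => //.
by apply: (ih _ (fun i => D (widen_ord (leqnSn m) i))).
Qed.

End LineDerivative.

Section DerivativeRules.
Variables (R : realType) (V W : normedModType R).
Implicit Types (f g : V -> W) (p v : V) (l : W).

Lemma has_deriv_shift f p v l a : has_deriv f (p + a) v l ->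
  has_deriv (fun z => f (z + a)) p v l.
Proof.
by move=> hl eps eps0; have [r r0 hr] := hl _ eps0; exists r => // h /hr; rewrite (addrAC p).
Qed.

Lemma has_deriv_lin f g p v l l' (a : R) : has_deriv f p v l -> has_deriv g p v l' ->
  has_deriv (fun z => a *: f z + g z) p v (a *: l + l').
Proof.
move=> /has_derivP[df <-] /has_derivP[dg <-]; apply/has_derivP.
have daf : derivable (a \*: f) p v by exact: derivableZ.
by split; [exact: (derivableD daf dg) | rewrite (deriveD daf dg) deriveZ].
Qed.

Lemma has_deriv_sumf m (f : 'I_m -> V -> W) p v (l : 'I_m -> W) (a : 'I_m -> R) :
  (forall i, has_deriv (f i) p v (l i)) ->
  has_deriv (fun z => \sum_i a i *: f i z) p v (\sum_i a i *: l i).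
Proof.
elim: m f l a => [|m ih] f l a hf.
  rewrite big_ord0 => eps eps0; exists 1 => // h _.
  by rewrite !big_ord0 scaler0 !subr0 normr0 mulr_ge0 // ltW.
rewrite big_ord_recl (_ : (fun z => _) =
    fun z => a ord0 *: f ord0 z + \sum_i a (lift ord0 i) *: f (lift ord0 i) z).
  by apply: has_deriv_lin => //; apply: ih.
by apply/funext => z; rewrite big_ord_recl.
Qed.

End DerivativeRules.

Lemma row_sum_norm_le (R : realType) n (x : 'rV[R]_n) :
  \sum_i `|x 0 i| <= n%:R * `|x|.
Proof.
rewrite mulr_natl -[X in _ *+ X]card_ord -sumr_const; apply: ler_sum => i _.
exact: mx_norm_coord.
Qed.

Section PairSums.
Variables (V W : nmodType).

Lemma pair_sumr m (f : 'I_m -> W) : ((0, \sum_i f i) : V * W) = \sum_i (0, f i).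
Proof.
apply: (big_morph (fun y : W => (0, y) : V * W)) => // a b.
by rewrite -[RHS]/(0 + 0, a + b) addr0.
Qed.

Lemma pair_suml m (f : 'I_m -> V) : ((\sum_i f i, 0) : V * W) = \sum_i (f i, 0).
Proof.
apply: (big_morph (fun y : V => (y, 0) : V * W)) => // a b.
by rewrite -[RHS]/(a + b, 0 + 0) addr0.
Qed.

End PairSums.

Lemma bilinear_sum_close (R : realType) n (x y : 'rV[R]_n) (K K' : 'I_n -> 'I_n -> 'rV[R]_n)
    (e : R) l : 0 <= e ->
  (forall i j, `|K i j - K' i j| <= e / (n%:R * n%:R + 1)) ->
  `|(\sum_i \sum_j (x 0 i * y 0 j) *: K i j) 0 l -
    (\sum_i \sum_j (x 0 i * y 0 j) *: K' i j) 0 l| <= e * `|x| * `|y|.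
Proof.
move=> e0 hK; set N : R := _ + 1 in hK.
have N0 : 0 < N by rewrite ltr_wpDl // mulr_ge0.
have -> : (\sum_i \sum_j (x 0 i * y 0 j) *: K i j) 0 l -
    (\sum_i \sum_j (x 0 i * y 0 j) *: K' i j) 0 l =
    \sum_i \sum_j (x 0 i * y 0 j) * (K i j - K' i j) 0 l.
  rewrite !summxE -sumrB; apply: eq_bigr => i _.
  by rewrite !summxE -sumrB; apply: eq_bigr => j _; rewrite !mxE mulrBr.
have sumxy : \sum_i \sum_j (`|x 0 i| * `|y 0 j|) * (e / N) <= e * `|x| * `|y|.
  have -> : \sum_i \sum_j (`|x 0 i| * `|y 0 j|) * (e / N) =
      (\sum_i `|x 0 i|) * (\sum_j `|y 0 j|) * (e / N).
    rewrite !mulr_suml; apply: eq_bigr => i _.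
    by rewrite mulr_sumr mulr_suml.
  rewrite mulrA ler_pdivrMr // mulrC -!mulrA ler_wpM2l //.
  apply: le_trans (ler_pM _ _ (row_sum_norm_le x) (row_sum_norm_le y)) _.
  - exact: sumr_ge0.
  - exact: sumr_ge0.
  rewrite mulrACA mulrC mulrA ler_wpM2l ?mulr_ge0 // /N lerDl //.
apply: le_trans sumxy; apply: le_trans (ler_norm_sum _ _ _) _; apply: ler_sum => i _.
apply: le_trans (ler_norm_sum _ _ _) _; apply: ler_sum => j _.
rewrite !normrM ler_wpM2l ?mulr_ge0 //; apply: le_trans (hK i j).
exact: mx_norm_coord.
Qed.

(** * Second-order expansion of the product in a chart *)

Section ChartAtIdentity.
Variables (R : realType) (n : nat) (G : lieGroupType R n).
Local Notation E := 'rV[R]_n.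
Local Notation e_ i := (delta_mx 0 i : E).
Variable c : chart G E.
Hypotheses (atlas_c : atlas c) (c1 : cdom c 1%g).

Let x0 := cmap c 1%g.
Let z0 : E * E := (x0, x0).
Let M (z : E * E) : E := cmap c (cinv c z.1 * cinv c z.2)%g.
Let A : set (E * E) :=
  [set z | [/\ ccod c z.1, ccod c z.2 & cdom c (cinv c z.1 * cinv c z.2)%g]].

Definition chart_pt (x : E) : G := cinv c (x0 + x).
Definition chart_co (g : G) : E := cmap c g - x0.
Local Notation p := chart_pt.
Local Notation q := chart_co.

Let ccod0 : ccod c x0. Proof. exact: cmap_to. Qed.

Lemma chart_pt0 : p 0 = 1%g.
Proof. by rewrite /p addr0 cmapK. Qed.

Let cinv_cont x : ccod c x -> {for x, continuous (cinv c)}.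
Proof.
move=> cx; have := @cinv_continuous _ _ c; rewrite continuous_open_subspace.
  by apply; rewrite inE.
exact: ccod_open.
Qed.

Let cmap_cont g : cdom c g -> {for g, continuous (cmap c)}.
Proof.
move=> cx; have := @cmap_continuous _ _ c; rewrite continuous_open_subspace.
  by apply; rewrite inE.
exact: cdom_open.
Qed.

Lemma chart_ball : exists2 r : R, 0 < r & forall x : E, `|x| < r ->
  q (p x) = x /\ {for x, continuous p}.
Proof.
have /nbhs_ballP[r /= r0 hr] : nbhs x0 (ccod c).
  by apply: open_nbhs_nbhs; split => //; exact: ccod_open.
exists r => // x xr; have cx : ccod c (x0 + x).
  by apply: hr; rewrite -ball_normE /= opprD addrA subrr sub0r normrN.
split; first by rewrite /q /p cinvK // [x0 + x]addrC addrK.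
apply: continuous_comp; last exact: cinv_cont.
exact: (@continuousD _ _ _ (cst x0) id _ (@cst_continuous _ _ x0 _) (fun _ h => h)).
Qed.

Lemma chart_near1 eps : 0 < eps -> \forall g \near (1%g : G), `|q g| < eps /\ p (q g) = g.
Proof.
move=> eps0; near=> g; split; last first.
  rewrite /p /q [x0 + _]addrC subrK cmapK //; near: g.
  by apply: open_nbhs_nbhs; split => //; exact: cdom_open.
rewrite /q; near: g; have /cvgrPdist_lt/(_ _ eps0) := cmap_cont c1.
by apply: filterS => g; rewrite distrC.
Unshelve. all: by end_near. Qed.

Let A_open : open A.
Proof.
rewrite openE => -[x y] [/= cx cy cxy]; rewrite /interior.
have cM : (cinv c z.1 * cinv c z.2)%g @[z --> (x, y)] --> (cinv c x * cinv c y)%g.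
  apply: (@continuous2_cvg _ _ _ _ _ _ (fun z : E * E => cinv c z.1) (fun z => cinv c z.2)
     (fun a b => (a * b)%g)).
  - exact: (@mulg_continuous G (cinv c x, cinv c y)).
  - apply: (@cvg_comp _ _ _ (fun z : E * E => z.1) (cinv c) _ (nbhs x)); first exact: cvg_fst.
    exact: cinv_cont.
  - apply: (@cvg_comp _ _ _ (fun z : E * E => z.2) (cinv c) _ (nbhs y)); first exact: cvg_snd.
    exact: cinv_cont.
have n1 : nbhs (x, y) [set z | ccod c z.1].
  by apply: (cvg_fst (F := nbhs x) (G := nbhs y)); apply: open_nbhs_nbhs; split => //; exact: ccod_open.
have n2 : nbhs (x, y) [set z | ccod c z.2].
  by apply: (cvg_snd (F := nbhs x) (G := nbhs y)); apply: open_nbhs_nbhs; split => //; exact: ccod_open.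
have n3 : nbhs (x, y) [set z | cdom c (cinv c z.1 * cinv c z.2)%g].
  by apply: cM; apply: open_nbhs_nbhs; split => //; exact: cdom_open.
near=> z; split.
- by near: z; exact: n1.
- by near: z; exact: n2.
- by near: z; exact: n3.
Unshelve. all: by end_near. Qed.

Let A_near z : A z -> \forall w \near z, A w.
Proof. by move=> Az; apply: open_nbhs_nbhs; split. Qed.

Let A_z0 : A z0.
Proof. by split => //=; rewrite cmapK // mulg1. Qed.

Let M_smooth : smooth A M.
Proof. exact: mulg_smooth. Qed.

Let D1 v z : A z -> has_deriv M z v ('D_v M z).
Proof.
by have [_ /(_ v)[h _]] := M_smooth 1 => /h; exact: derivable_has_deriv.
Qed.

Let D1_cont v z : A z -> {for z, continuous ('D_v M)}.
Proof.
have [_ /(_ v)[_ [h _]]] := M_smooth 1 => Az; move: h.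
by rewrite continuous_open_subspace //; apply; rewrite inE.
Qed.

Let D2 w v z : A z -> has_deriv ('D_v M) z w ('D_w ('D_v M) z).
Proof.
by have [_ /(_ v)[_ [_ /(_ w)[h _]]]] := M_smooth 2 => /h; exact: derivable_has_deriv.
Qed.

Let D2_cont w v z : A z -> {for z, continuous ('D_w ('D_v M))}.
Proof.
have [_ /(_ v)[_ [_ /(_ w)[_ [h _]]]]] := M_smooth 2 => Az; move: h.
by rewrite continuous_open_subspace //; apply; rewrite inE.
Qed.

Let H (i j : 'I_n) (z : E * E) : E := 'D_(e_ i, 0) ('D_(0, e_ j) M) z.

Let D1_sum (y : E) z : A z -> 'D_(0, y) M z = \sum_j y 0 j *: 'D_(0, e_ j) M z.
Proof.
move=> Az; apply: has_deriv_derive.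
rewrite (_ : (0, y) = \sum_j y 0 j *: ((0, e_ j) : E * E)); last first.
  rewrite [in LHS](row_sum_delta y) pair_sumr; apply: eq_bigr => i _.
  by rewrite -[RHS]/(y 0 i *: 0, y 0 i *: e_ i) scaler0.
apply: (has_deriv_sum (D := fun j z => y 0 j *: 'D_(0, e_ j) M z)) => j.
  by apply: filterS (A_near Az) => w Aw; apply: has_derivZ; exact: D1.
by apply: continuousZr; exact: D1_cont.
Qed.

Let D2_sum (x y : E) z : A z ->
  has_deriv ('D_(0, y) M) z (x, 0) (\sum_i \sum_j (x 0 i * y 0 j) *: H i j z).
Proof.
move=> Az.
have -> : \sum_i \sum_j (x 0 i * y 0 j) *: H i j z = \sum_i x 0 i *: 'D_(e_ i, 0) ('D_(0, y) M) z.
  apply: eq_bigr => i _; under eq_bigr do rewrite -scalerA.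
  rewrite -scaler_sumr; congr (_ *: _); apply/esym/has_deriv_derive.
  apply: has_deriv_near; last by apply: has_deriv_sumf => j; exact: D2.
  by apply: filterS (A_near Az) => w /D1_sum ->.
rewrite (_ : (x, 0) = \sum_i x 0 i *: ((e_ i, 0) : E * E)); last first.
  rewrite [in LHS](row_sum_delta x) pair_suml; apply: eq_bigr => i _.
  by rewrite -[RHS]/(x 0 i *: e_ i, x 0 i *: 0) scaler0.
apply: (has_deriv_sum (D := fun i z => x 0 i *: 'D_(e_ i, 0) ('D_(0, y) M) z)) => i.
  by apply: filterS (A_near Az) => w Aw; apply: has_derivZ; exact: D2.
by apply: continuousZr; exact: D2_cont.
Qed.

(** The mixed second derivative of the product at the identity. By [lie_bracket_chart] its
    antisymmetrisation is the bracket. *)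
Definition chart_bil (x y : E) : E := \sum_i \sum_j (x 0 i * y 0 j) *: H i j z0.
Local Notation B := chart_bil.

Lemma chart_bilDl x x' y : B (x + x') y = B x y + B x' y.
Proof.
rewrite -big_split; apply: eq_bigr => i _; rewrite -big_split; apply: eq_bigr => j _ /=.
by rewrite mxE mulrDl scalerDl.
Qed.

Lemma chart_bilZl a x y : B (a *: x) y = a *: B x y.
Proof.
rewrite scaler_sumr; apply: eq_bigr => i _; rewrite scaler_sumr; apply: eq_bigr => j _.
by rewrite mxE -mulrA scalerA.
Qed.

Lemma chart_bilDr x y y' : B x (y + y') = B x y + B x y'.
Proof.
rewrite -big_split; apply: eq_bigr => i _; rewrite -big_split; apply: eq_bigr => j _ /=.
by rewrite mxE mulrDr scalerDl.
Qed.

Lemma chart_bilZr a x y : B x (a *: y) = a *: B x y.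
Proof.
rewrite scaler_sumr; apply: eq_bigr => i _; rewrite scaler_sumr; apply: eq_bigr => j _.
by rewrite mxE mulrCA scalerA.
Qed.

Lemma chart_bil_bounded : exists2 K : R, 0 <= K & forall x y, `|B x y| <= K * `|x| * `|y|.
Proof.
exists (\sum_i \sum_j `|H i j z0|).
  by apply: sumr_ge0 => i _; apply: sumr_ge0.
move=> x y; rewrite -mulrA mulr_suml; apply: le_trans (ler_norm_sum _ _ _) _.
apply: ler_sum => i _; rewrite mulr_suml; apply: le_trans (ler_norm_sum _ _ _) _.
apply: ler_sum => j _; rewrite normrZ normrM mulrC ler_wpM2l // ler_pM ?mx_norm_coord //.
Qed.

(** The error carries the product [|x| |y|] because [q (p x * p y) - x - y] is a second difference
    of the multiplication: one mean value theorem in each factor expresses it by the mixed second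
    derivative at a nearby point, and continuity compares that with [chart_bil]. *)
Lemma chart_expansion eps : 0 < eps -> exists2 r : R, 0 < r & forall x y : E,
  `|x| < r -> `|y| < r -> p (q (p x * p y)%g) = (p x * p y)%g /\
  `|q (p x * p y)%g - x - y - B x y| <= eps * `|x| * `|y|.
Proof.
move=> eps0; pose N : R := n%:R * n%:R + 1.
have N0 : 0 < N by rewrite ltr_wpDl // mulr_ge0.
have e0 : 0 < eps / N by rewrite divr_gt0.
have /nbhs_ballP[r /= r0 hr] : \forall z \near z0, A z /\
    forall i j : 'I_n, `|H i j z - H i j z0| <= eps / N.
  apply: filterI; first exact: A_near.
  apply: (@filter_forall _ 'I_n (fun i z => forall j : 'I_n, `|H i j z - H i j z0| <= eps / N)
    (nbhs z0) _) => i.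
  apply: (@filter_forall _ 'I_n (fun j z => `|H i j z - H i j z0| <= eps / N) (nbhs z0) _) => j.
  have /cvgrPdist_le/(_ _ e0) := D2_cont (w := (e_ i, 0)) (v := (0, e_ j)) A_z0.
  move=> hz; apply: (filterS _ hz) => z.
  by rewrite [X in _ -> X <= _](distrC (H i j z) (H i j z0)).
have ball_r x y : `|x| < r -> `|y| < r -> ball z0 r (x0 + x, x0 + y).
  by move=> xr yr; split; rewrite -ball_normE /= opprD addrA subrr sub0r normrN.
exists r => // x y xr yr.
have Axy : A (x0 + x, x0 + y) by have [] := hr _ (ball_r _ _ xr yr).
split; first by rewrite /p /q [x0 + _]addrC subrK cmapK //; case: Axy.
pose f (z : E * E) := M (z + (x, 0)) - M z.
pose v : E * E := (0, y).
have inA (s t : R) : 0 <= s <= 1 -> 0 <= t <= 1 ->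
    ball z0 r (z0 + s *: v + t *: ((x, 0) : E * E)).
  move=> /andP[s0 s1] /andP[t0 t1].
  have -> : z0 + s *: v + t *: ((x, 0) : E * E) = (x0 + t *: x, x0 + s *: y).
    by rewrite -[LHS]/(x0 + s *: 0 + t *: x, x0 + s *: y + t *: 0) !scaler0 !addr0.
  apply: ball_r; rewrite normrZ ger0_norm //.
    by apply: le_lt_trans xr; rewrite ler_piMl.
  by apply: le_lt_trans yr; rewrite ler_piMl.
have s0A (s : R) : 0 <= s <= 1 -> A (z0 + s *: v).
  move=> s01; have := inA s 0 s01; rewrite lexx ler01 scale0r addr0.
  by move=> /(_ isT)/hr[].
have s1A (s : R) : 0 <= s <= 1 -> A (z0 + s *: v + (x, 0)).
  move=> s01; have := inA s 1 s01; rewrite lexx ler01 scale1r.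
  by move=> /(_ isT)/hr[].
apply: mx_norm_le; first by rewrite !mulr_ge0 // ltW.
move=> i0 l; rewrite ord1 {i0}.
have df (s : R) : 0 <= s <= 1 ->
    has_deriv f (z0 + s *: v) v ('D_v M (z0 + s *: v + (x, 0)) - 'D_v M (z0 + s *: v)).
  move=> s01; have -> : f = fun z => (-1) *: M z + M (z + (x, 0)).
    by apply/funext => z; rewrite scaleN1r addrC.
  have := has_deriv_lin (-1) (@D1 v _ (s0A s s01))
    (has_deriv_shift (@D1 v _ (s1A s s01))).
  by rewrite scaleN1r (addrC (- 'D_v M (z0 + s *: v))).
have [s s01 es] := mvt_line df l.
have [t t01 et] := @mvt_line R _ n ('D_v M) (z0 + s *: v) (x, 0) _
   (fun t t01 => D2_sum x y (proj1 (hr _ (inA s t s01 t01)))) l.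
have fv : f (z0 + v) - f z0 = q (p x * p y)%g - x - y.
  rewrite /f /M /q /p /=.
  rewrite !addr0 cmapK // !mul1g !mulg1 -/x0 !cinvK; try by case: Axy.
  by apply/rowP => j; rewrite !mxE; ring.
have rowB (u w : E) : (u - w) 0 l = u 0 l - w 0 l by rewrite !mxE.
rewrite -fv rowB rowB es rowB et.
apply: (bilinear_sum_close x y (K := fun i j => H i j (z0 + s *: v + t *: (x, 0)))) => //.
exact: ltW.
exact: (proj2 (hr _ (inA s t s01 t01))).
Qed.

(** The left-invariant field of [Z] is the derivative of the product in its second factor at the
    identity; its value there is [Z], and differentiating it in the first factor produces
    [chart_bil]. *)
Lemma lie_bracket_chart X Y : lie_bracket c X Y = B X Y - B Y X.
Proof.
have LI Z x : A (x, x0) -> left_invariant_vf c Z x = 'D_(0, Z) M (x, x0).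
  move=> Ax; apply: has_deriv_derive => eps eps0.
  have [r r0 hr] := @D1 (0, Z) _ Ax eps eps0; exists r => // h /hr.
  by rewrite -[X in M X - _]/(x + h *: 0, x0 + h *: Z) scaler0 addr0.
have LI0 Z : left_invariant_vf c Z x0 = Z.
  apply: has_deriv_derive; rewrite -/x0.
  apply: (@has_deriv_near _ _ _ id).
    have : nbhs x0 (ccod c) by apply: open_nbhs_nbhs; split => //; exact: ccod_open.
    by apply: filterS => y cy; rewrite /x0 cmapK // mul1g cinvK.
  move=> eps eps0; exists 1 => // h _.
  by rewrite -addrA -opprD subrr normr0 mulr_ge0 // ltW.
have dLI X' Y' : 'D_X' (left_invariant_vf c Y') x0 = B X' Y'.
  apply: has_deriv_derive.
  apply: (@has_deriv_near _ _ _ (fun x => 'D_(0, Y') M (x, x0))).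
    have /nbhs_ballP[r /= r0 hr] := A_near A_z0.
    apply/nbhs_ballP; exists r => // x xr; rewrite LI //; apply: hr; split=> //.
    exact: ballxx.
  move=> eps eps0; have [r r0 hr] := D2_sum X' Y' A_z0 eps0.
  exists r; [exact: r0 | move=> h hh; have := hr h hh].
  by rewrite -[z0 + _]/(x0 + h *: X', x0 + h *: 0) scaler0 addr0.
by rewrite /lie_bracket /vf_bracket -/x0 !LI0 !dLI.
Qed.

End ChartAtIdentity.

(** * The exponential map of a local group *)

Lemma near_cvg (T : Type) (F : set_system T) {FF : Filter F} (U : topologicalType)
    (f g : T -> U) (l : U) : (\forall x \near F, f x = g x) -> f @ F --> l -> g @ F --> l.
Proof.
move=> fg fl A nA; have h : \forall x \near F, A (f x) := fl A nA.
by apply: filterS2 fg h => x /= <-.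
Qed.

Section SequenceLimits.
Variables (R : realType) (V : normedModType R).
Implicit Types (f : nat -> V) (l : V).

Lemma cvg_norm_le f l (a : nat -> R) : (\forall k \near \oo, `|f k - l| <= a k) ->
  a k @[k --> \oo] --> (0 : R) -> f k @[k --> \oo] --> l.
Proof.
move=> fa a0; apply/cvgrPdist_le => e e0.
have /cvgrPdist_le/(_ e e0) := a0.
move=> h; apply: filterS2 fa h => k fk; rewrite sub0r normrN => ak.
by rewrite distrC (le_trans fk) // (le_trans (ler_norm _)).
Qed.

Lemma cvg_div_succ (C : R) : (C / k.+1%:R) @[k --> \oo] --> (0 : R).
Proof. by rewrite -(mulr0 C); apply: cvgMr; exact: cvg_harmonic. Qed.

Lemma cvg_inv_nat (N : nat -> nat) : N k @[k --> \oo] --> \oo ->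
  ((N k)%:R^-1 : R) @[k --> \oo] --> (0 : R).
Proof.
move=> /cvgnyPge hN; apply/cvgrPdist_le => e e0.
have := hN (Num.truncn e^-1).+1; apply: filterS => k hk.
have /andP[_ h2] : (Num.truncn e^-1)%:R <= e^-1 < (Num.truncn e^-1).+1%:R.
  by apply: truncn_itv; rewrite invr_ge0 ltW.
rewrite sub0r normrN ger0_norm ?invr_ge0 //.
have h3 : e^-1 <= (N k)%:R by apply: le_trans (ltW h2) _; rewrite ler_nat.
have e1 : 0 < e^-1 by rewrite invr_gt0.
by rewrite -[leRHS]invrK lef_pV2 ?posrE //; exact: lt_le_trans h3.
Qed.

Lemma cvg_scaled0 (N : nat -> nat) f l : N k @[k --> \oo] --> \oo ->
  ((N k)%:R *: f k) @[k --> \oo] --> l -> f k @[k --> \oo] --> (0 : V).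
Proof.
move=> hN hf; have h := cvgZ (cvg_inv_nat hN) hf; rewrite scale0r in h.
have /cvgnyPge/(_ 1) hN1 := hN.
apply: (near_cvg _ (h _)); apply: filterS hN1 => k N1.
by rewrite scalerA mulVf ?scale1r // pnatr_eq0 -lt0n.
Qed.

Lemma nat_rate (s : R) : 0 < s -> exists2 N : nat -> nat, N k @[k --> \oo] --> \oo &
  ((N k)%:R / k.+1%:R) @[k --> \oo] --> s.
Proof.
move=> s0; pose N k := Num.truncn (s * k.+1%:R).
have itv k : (N k)%:R <= s * k.+1%:R < (N k).+1%:R.
  by apply: truncn_itv; rewrite mulr_ge0 // ltW.
exists N.
  apply/cvgnyPge => A; exists (Num.truncn (A%:R / s)).+1 => // k /= hk.
  have /andP[_ h] := itv k; rewrite -ltnS -(ltr_nat R); apply: le_lt_trans h.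
  have /andP[_ h2] : (Num.truncn (A%:R / s))%:R <= A%:R / s < (Num.truncn (A%:R / s)).+1%:R.
    by apply: truncn_itv; rewrite divr_ge0 // ltW.
  rewrite mulrC -ler_pdivrMr //; apply: le_trans (ltW h2) _.
  by rewrite ler_nat (leq_trans hk).
apply/cvgrPdist_le => e e0; have /cvgrPdist_le/(_ e e0) := cvg_div_succ 1.
apply: filterS => k; rewrite sub0r normrN; apply: le_trans.
have k0 : 0 < k.+1%:R :> R by [].
have -> : s - (N k)%:R / k.+1%:R = (s * k.+1%:R - (N k)%:R) / k.+1%:R.
  by rewrite mulrBl mulfK // gt_eqF.
rewrite !normrM ler_wpM2r // normr1 ger0_norm; have /andP[h1 h2] := itv k.
  by rewrite lerBlDl natr1 ltW.
by rewrite subr_ge0.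
Qed.

End SequenceLimits.

Lemma rV_cauchy_cvg (R : realType) n (u : nat -> 'rV[R]_n) (a : nat -> R) :
  a k @[k --> \oo] --> (0 : R) -> (forall k l, `|u k - u l| <= a k + a l) ->
  exists l : 'rV[R]_n, u k @[k --> \oo] --> l.
Proof.
move=> a0 hu; apply/cvg_ex; apply/cauchy_cvgP/cauchyP => e e0.
have e2 : 0 < e / 3 by rewrite divr_gt0.
have /cvgrPdist_le/(_ _ e2)[N _ hN] := a0.
exists (u N); exists N => // k Nk; rewrite -ball_normE /=.
apply: le_lt_trans (hu _ _) _.
have := hN _ Nk; have := hN N (leqnn N); rewrite !sub0r !normrN => h1 h2.
have := ler_norm (a N); have := ler_norm (a k); lra.
Qed.
Section TopologicalGroupLimits.
Variables (G : topologicalGroupType) (T : Type) (F : set_system T).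
Context {FF : Filter F}.
Implicit Types (f g : T -> G).

Lemma cvgMg f g a b : f @ F --> a -> g @ F --> b -> (fun x => (f x * g x)%g) @ F --> (a * b)%g.
Proof.
move=> fa gb; apply: (@continuous2_cvg _ _ _ _ _ _ f g (fun a b => (a * b)%g)) => //.
exact: (@mulg_continuous G (a, b)).
Qed.

Lemma cvgVg f a : f @ F --> a -> (fun x => (f x)^-1%g) @ F --> (a^-1)%g.
Proof. by move=> fa; exact: (cvg_comp _ _ fa (@invg_continuous G a)). Qed.

Lemma cvgXg f a m : f @ F --> a -> (fun x => (f x ^+ m)%g) @ F --> (a ^+ m)%g.
Proof.
move=> fa; elim: m => [|m ih]; first by under eq_fun do rewrite expg0; rewrite expg0; exact: cvg_cst.
by under eq_fun do rewrite expgS; rewrite expgS; exact: cvgMg.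
Qed.

End TopologicalGroupLimits.

Section NormTriangles.
Variables (R : numDomainType) (V : normedZmodType R).
Implicit Types (a b c : V) (e : R).

Lemma norm_tri_ac a b c e : `|a - b - c| <= e -> `|a - c| <= e + `|b|.
Proof.
move=> h; have -> : a - c = (a - b - c) + b by rewrite [a - b - c]addrAC subrK.
by apply: le_trans (ler_normD _ _) _; rewrite lerD2r.
Qed.

Lemma norm_tri_ab a b c e : `|a - b - c| <= e -> `|a - b| <= e + `|c|.
Proof. by rewrite addrAC; exact: norm_tri_ac. Qed.

Lemma norm_tri_a a b c e : `|a - b - c| <= e -> `|a| <= e + `|b| + `|c|.
Proof.
move=> /norm_tri_ac h; have -> : a = (a - c) + c by rewrite subrK.
by apply: le_trans (ler_normD _ _) _; rewrite lerD2r.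
Qed.

Lemma norm_tri_b a b c e : `|a - b - c| <= e -> `|b| <= e + `|a - c|.
Proof.
move=> h; have -> : b = (a - c) - (a - b - c).
  by rewrite [a - b - c]addrAC [RHS]addrC opprB subrK.
by apply: le_trans (ler_normB _ _) _; rewrite addrC lerD2r.
Qed.

Lemma norm_tri_c a b c e : `|a - b - c| <= e -> `|c| <= e + `|a - b|.
Proof. by rewrite addrAC; exact: norm_tri_b. Qed.

End NormTriangles.

Section LocalGroup.
Variables (R : realType) (n : nat) (G : topologicalGroupType).
Local Notation E := 'rV[R]_n.
Variables (p : E -> G) (q : G -> E) (B : E -> E -> E).
Hypothesis hausG : hausdorff_space G.
Hypothesis p0 : p 0 = 1%g.
Hypothesis qp : exists2 r : R, 0 < r & forall x : E, `|x| < r ->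
  q (p x) = x /\ {for x, continuous p}.
Hypothesis pq : forall eps : R, 0 < eps ->
  \forall g \near (1%g : G), `|q g| < eps /\ p (q g) = g.
Hypothesis B_bounded : exists2 K : R, 0 <= K & forall x y, `|B x y| <= K * `|x| * `|y|.
Hypothesis expansion : forall eps : R, 0 < eps -> exists2 r : R, 0 < r & forall x y : E,
  `|x| < r -> `|y| < r -> p (q (p x * p y)%g) = (p x * p y)%g /\
  `|q (p x * p y)%g - x - y - B x y| <= eps * `|x| * `|y|.

(** The condition [K * r <= 4^-1] keeps the quadratic error of a product below a quarter of each
    argument, which is how the later estimates absorb it. *)
Definition local_radius (r K : R) :=
  [/\ 0 < r, 0 < K, K * r <= 4^-1,
   forall x : E, `|x| <= r -> q (p x) = x /\ {for x, continuous p} &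
   forall x y : E, `|x| <= r -> `|y| <= r -> p (q (p x * p y)%g) = (p x * p y)%g /\
     `|q (p x * p y)%g - x - y| <= K * `|x| * `|y|].

Lemma ex_local_radius : exists r K, local_radius r K.
Proof.
have [r1 r10 h1] := qp; have [K K0 hK] := B_bounded.
have [r2 r20 h2] := expansion ltr01.
have K1 : 0 < 1 + K by rewrite ltr_wpDr.
pose r := Num.min (Num.min (r1 / 2) (r2 / 2)) (4^-1 / (1 + K)).
have r0 : 0 < r by rewrite !lt_min !divr_gt0 // invr_gt0.
have lt1 x : `|x : E| <= r -> `|x| < r1.
  by rewrite !le_min => /andP[/andP[h _] _]; apply: le_lt_trans h _; lra.
have lt2 x : `|x : E| <= r -> `|x| < r2.
  by rewrite !le_min => /andP[/andP[_ h] _]; apply: le_lt_trans h _; lra.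
exists r, (1 + K); split=> //.
- by rewrite mulrC -ler_pdivlMr // ge_min lexx orbT.
- by move=> x /lt1/h1.
move=> x y xr yr; have [h' h] := h2 x y (lt2 _ xr) (lt2 _ yr); split=> //.
rewrite -(addrA (q _)) -opprD in h *.
apply: le_trans (norm_tri_ab h) _.
by rewrite !mulrDl lerD2l.
Qed.

Section Radius.
Variables (r K : R).
Hypothesis rK : local_radius r K.

Let r0 : 0 < r. Proof. by case: rK. Qed.
Let K0 : 0 < K. Proof. by case: rK. Qed.
Let Kr : K * r <= 4^-1. Proof. by case: rK. Qed.
Let pK x : `|x : E| <= r -> q (p x) = x. Proof. by case: rK => _ _ _ + _ => h /h[]. Qed.
Let p_cont x : `|x : E| <= r -> {for x, continuous p}.
Proof. by case: rK => _ _ _ + _ => h /h[]. Qed.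
Let mK x y : `|x : E| <= r -> `|y : E| <= r -> p (q (p x * p y)%g) = (p x * p y)%g.
Proof. by case: rK => _ _ _ _ + => h xr yr; have [] := h x y xr yr. Qed.
Let m_est x y : `|x : E| <= r -> `|y : E| <= r ->
  `|q (p x * p y)%g - x - y| <= K * `|x| * `|y|.
Proof. by case: rK => _ _ _ _ + => h xr yr; have [] := h x y xr yr. Qed.

Let q1 : q 1%g = 0.
Proof. by rewrite -p0 pK // normr0 ltW. Qed.

Let Kx_le x : `|x : E| <= r -> K * `|x| <= 4^-1.
Proof. by move=> xr; apply: le_trans Kr; rewrite ler_pM2l. Qed.

Let m_size x y : `|x : E| <= r -> `|y : E| <= r ->
  `|q (p x * p y)%g| <= `|x| + 5 / 4 * `|y|.
Proof.
move=> xr yr; have := norm_tri_a (m_est xr yr); have := Kx_le xr.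
have := normr_ge0 x; have := normr_ge0 y; nra.
Qed.

Lemma p_cont0 : p x @[x --> (0 : E)] --> 1%g.
Proof. by rewrite -p0; apply: p_cont; rewrite normr0 ltW. Qed.

Lemma ex_inverse_radius : exists2 d : R, 0 < d & forall x : E, `|x| <= d ->
  exists y : E, [/\ (p x)^-1%g = p y, `|y| <= r & `|y + x| <= K * `|x| * `|y|].
Proof.
have [|d /= d0 hd] := (@nbhs_ballP _ _ (0 : E)
    [set x | `|q (p x)^-1%g| < r /\ p (q (p x)^-1%g) = (p x)^-1%g]).1.
  have h : (p x)^-1%g @[x --> (0 : E)] --> (1^-1)%g := cvgVg p_cont0.
  rewrite invg1 in h; exact: h (pq r0).
exists (Num.min (d / 2) r); first by rewrite lt_min r0 divr_gt0.
move=> x; rewrite le_min => /andP[xd xr]; have /hd[hq1 hq2] : ball (0 : E) d x.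
  by rewrite -ball_normE /= sub0r normrN; apply: le_lt_trans xd _; lra.
exists (q (p x)^-1%g); split=> //; first exact: ltW.
have := m_est xr (ltW hq1); rewrite hq2 mulgV q1 sub0r.
by rewrite -opprD normrN addrC.
Qed.

(* [q] is Lipschitz for both translations, as [x] and [x'] are compared through
   the small element [u] with [p x = p u * p x'] (resp. [p x = p x' * p u]). *)
Lemma ex_lipschitz_radius : exists2 d : R, 0 < d & [/\ d <= r,
  forall x : E, `|x| <= d -> exists y : E, [/\ (p x)^-1%g = p y, `|y| <= 2 * `|x| & `|y| <= r],
  forall x x' y : E, `|x| <= d -> `|x'| <= d -> `|y| <= d ->
    `|q (p x * p y)%g - q (p x' * p y)%g| <= 2 * `|x - x'| &
  forall x y y' : E, `|x| <= d -> `|y| <= d -> `|y'| <= d ->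
    `|q (p x * p y)%g - q (p x * p y')%g| <= 2 * `|y - y'|].
Proof.
have r0' := r0; have K0' := K0; have Kr' := Kr; have [d d0 hd] := ex_inverse_radius.
pose e := Num.min d (r / 8); have e0 : 0 < e by rewrite lt_min d0 divr_gt0.
have inv x : `|x : E| <= e -> exists y : E,
    [/\ (p x)^-1%g = p y, `|y| <= 2 * `|x| & `|y| <= r].
  rewrite le_min => /andP[/hd[y [h1 h2 h3]] xr]; exists y; split=> //.
  have := norm_tri_a (a := y) (b := - x) (c := 0) (e := K * `|x| * `|y|).
  rewrite subr0 opprK normrN normr0 addr0 => /(_ h3).
  have := Kx_le h2; have := normr_ge0 x; have := normr_ge0 y; nra.
have er x : `|x : E| <= e -> `|x| <= r / 8 by rewrite le_min => /andP[].
have r8 x : `|x : E| <= r / 8 -> `|x| <= r by move=> h; apply: le_trans h _; lra.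
exists e => //; split=> //.
- by rewrite ge_min; apply/orP; right; lra.
- move=> x x' y /er xr x'e /er yr; have [z [ez z2 zr]] := inv _ x'e.
  have x'r := er _ x'e; pose u := q (p x * p z)%g.
  have pu : (p u * p x')%g = p x by rewrite /u (mK (r8 _ xr) zr) -ez -mulgA mulVg mulg1.
  have us : `|u| <= r by apply: le_trans (m_size (r8 _ xr) zr) _; lra.
  have u2 : `|u| <= 4 / 3 * `|x - x'|.
    have := m_est us (r8 _ x'r); rewrite pu pK ?r8 // => /norm_tri_b.
    by have := Kx_le (r8 _ x'r); have := normr_ge0 u; nra.
  pose w := q (p x' * p y)%g.
  have ws : `|w| <= r by apply: le_trans (m_size (r8 _ x'r) (r8 _ yr)) _; lra.
  have := m_est us ws; rewrite {1}/w (mK (r8 _ x'r) (r8 _ yr)) mulgA pu => /norm_tri_ac.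
  by have := Kx_le ws; have := normr_ge0 u; rewrite -/w; nra.
- move=> x y y' /er xr /er yr y'e; have [z [ez z2 zr]] := inv _ y'e.
  have y'r := er _ y'e; pose u := q (p z * p y)%g.
  have pu : (p y' * p u)%g = p y by rewrite /u (mK zr (r8 _ yr)) -ez mulgA mulgV mul1g.
  have us : `|u| <= r by apply: le_trans (m_size zr (r8 _ yr)) _; lra.
  have u2 : `|u| <= 4 / 3 * `|y - y'|.
    have := m_est (r8 _ y'r) us; rewrite pu pK ?r8 // => /norm_tri_c.
    by have := Kx_le (r8 _ y'r); have := normr_ge0 u; nra.
  pose w := q (p x * p y')%g.
  have ws : `|w| <= r by apply: le_trans (m_size (r8 _ xr) (r8 _ y'r)) _; lra.
  have := m_est ws us; rewrite {1}/w (mK (r8 _ xr) (r8 _ y'r)) -mulgA pu => /norm_tri_ab.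
  by have := Kx_le ws; have := normr_ge0 u; rewrite -/w; nra.
Qed.

(** One more factor adds an error of at most [K * 5/4 * j |x|^2], which fits into the increment
    [(2j + 1) K |x|^2] of the bound. *)
Lemma power_est (x : E) (j : nat) : j%:R * `|x| <= r / 2 ->
  p (q (p x ^+ j)%g) = (p x ^+ j)%g /\
  `|q (p x ^+ j)%g - j%:R *: x| <= K * (j%:R * `|x|) ^+ 2.
Proof.
have r0' := r0; have K0' := K0; have Kr' := Kr; elim: j => [|j ih] hj.
  by rewrite expg0 q1 p0 scale0r subr0 normr0 mul0r expr0n mulr0.
have x0 := normr_ge0 x.
have jx : j%:R * `|x| <= r / 2.
  by apply: le_trans hj; rewrite ler_wpM2r // ler_nat.
have [e1 e2] := ih jx; move: hj; rewrite -natr1 => hj.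
have j0 : 0 <= j%:R :> R by [].
set y := q _ in e1 e2; set J : R := j%:R in hj e2 j0 jx *.
have Jx0 : 0 <= J * `|x| by rewrite mulr_ge0.
have yJ : `|y| <= 5 / 4 * (J * `|x|).
  have := norm_tri_a (a := y) (b := J *: x) (c := 0) (e := K * (J * `|x|) ^+ 2).
  rewrite subr0 normr0 addr0 normrZ ger0_norm // => /(_ e2).
  rewrite expr2; have : K * (J * `|x|) <= 4^-1 by nra.
  nra.
have xr : `|x| <= r by lra.
have yr : `|y| <= r by lra.
rewrite expgSr -e1; split; first exact: mK.
have := m_est yr xr; rewrite scalerDl scale1r.
set z := q _; move=> hz.
have -> : z - (J *: x + x) = (z - y - x) + (y - J *: x).
  by apply/rowP => i; rewrite !mxE; ring.
apply: le_trans (ler_normD _ _) _; apply: le_trans (lerD hz e2) _.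
have : K * `|y| * `|x| <= K * (5 / 4 * (J * `|x|)) * `|x|.
  by rewrite ler_wpM2r // ler_pM2l.
rewrite !expr2; have : 0 <= K * (J * `|x|) * `|x| by rewrite !mulr_ge0 // ltW.
have : 0 <= K * `|x| * `|x| by rewrite !mulr_ge0 // ltW.
nra.
Qed.

(** [p x] is replaced by [p x'] one factor at a time; each replacement passes through two Lipschitz
    bounds of factor 2, and there are [N] of them. *)
Lemma ex_power_radius : exists2 s : R, 0 < s & s <= r / 2 /\ forall (x x' : E) (N : nat),
  N%:R * `|x| <= s -> N%:R * `|x'| <= s ->
  `|q (p x ^+ N)%g - q (p x' ^+ N)%g| <= 4 * N%:R * `|x - x'|.
Proof.
have r0' := r0; have K0' := K0; have Kr' := Kr; have [d d0 [dr _ lipl lipr]] := ex_lipschitz_radius.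
exists (d / 4); first exact: divr_gt0.
split=> [|x x' N hx hx']; first by lra.
have step (a b : nat) : (a + b.+1 <= N)%N ->
   `|q (p x ^+ a.+1 * p x' ^+ b)%g - q (p x ^+ a * p x' ^+ b.+1)%g| <= 4 * `|x - x'|.
  move=> ab.
  have sz (z : E) (j : nat) : (j <= N)%N -> N%:R * `|z| <= d / 4 ->
      j%:R * `|z| <= d / 4.
    by move=> jN; apply: le_trans; rewrite ler_wpM2r // ler_nat.
  have size z (j : nat) : (j <= N)%N -> N%:R * `|z : E| <= d / 4 ->
      p (q (p z ^+ j)%g) = (p z ^+ j)%g /\ `|q (p z ^+ j)%g| <= d / 2.
    move=> jN /(sz _ _ jN) hz; have hz2 : j%:R * `|z| <= r / 2 by lra.
    have [h1 h2] := power_est hz2; split=> //.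
    have := norm_tri_a (a := q (p z ^+ j)%g) (b := j%:R *: z) (c := 0) (e := K * (j%:R * `|z|) ^+ 2).
    rewrite subr0 normr0 addr0 normrZ ger0_norm // => /(_ h2).
    have j0 : 0 <= j%:R * `|z| by rewrite mulr_ge0.
    rewrite expr2; have : K * (j%:R * `|z|) <= 4^-1 by nra.
    nra.
  have N1 : 1 <= N%:R :> R by rewrite (ler_nat _ 1); apply: leq_trans ab; rewrite addnS.
  have xs : `|x| <= d / 4 by have := sz x 1 _ hx; rewrite mul1r; apply; rewrite -(ler_nat R).
  have x's : `|x'| <= d / 4 by have := sz x' 1 _ hx'; rewrite mul1r; apply; rewrite -(ler_nat R).
  have [aE as_] := size x a (leq_trans (leq_addr _ _) ab) hx.
  have [bE bs] := size x' b (leq_trans (leq_trans (leqnSn _) (leq_addl _ _)) ab) hx'.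
  have d2 z : `|z : E| <= d / 2 -> `|z| <= d by move=> h; lra.
  have d4 z : `|z : E| <= d / 4 -> `|z| <= d by move=> h; lra.
  have dd z : `|z : E| <= d -> `|z| <= r by move=> h; lra.
  rewrite expgSr expgS -!mulgA -aE -bE.
  rewrite -(mK (dd _ (d4 _ xs)) (dd _ (d2 _ bs))) -(mK (dd _ (d4 _ x's)) (dd _ (d2 _ bs))).
  have xb : `|q (p x * p (q (p x' ^+ b)%g))%g| <= d.
    by apply: le_trans (m_size (dd _ (d4 _ xs)) (dd _ (d2 _ bs))) _; lra.
  have x'b : `|q (p x' * p (q (p x' ^+ b)%g))%g| <= d.
    by apply: le_trans (m_size (dd _ (d4 _ x's)) (dd _ (d2 _ bs))) _; lra.
  apply: le_trans (lipr _ _ _ (d2 _ as_) xb x'b) _.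
  have := lipl _ _ _ (d4 _ xs) (d4 _ x's) (d2 _ bs); lra.
have tel i : (i <= N)%N ->
    `|q (p x ^+ N)%g - q (p x ^+ (N - i) * p x' ^+ i)%g| <= 4 * i%:R * `|x - x'|.
  elim: i => [|i ih] iN; first by rewrite subn0 expg0 mulg1 subrr normr0 mulr0 mul0r.
  have := ih (ltnW iN); have := step (N - i.+1)%N i.
  rewrite subnK // -subSn // subSS => /(_ (leqnn _)) h1 h2.
  apply: le_trans (ler_distD (q (p x ^+ (N - i) * p x' ^+ i)%g) _ _) _.
  by rewrite -[i.+1%:R]natr1 mulrDr mulrDl mulr1 lerD.
by have := tel N (leqnn _); rewrite subnn expg0 mul1g.
Qed.

End Radius.

Definition limit_power (X : E) (g : G) := forall (N : nat -> nat) (x : nat -> E),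
  N k @[k --> \oo] --> \oo -> ((N k)%:R *: x k) @[k --> \oo] --> X ->
  (p (x k) ^+ N k)%g @[k --> \oo] --> g.

(** The sequence [F] is Cauchy with an error of order [1/(k+1)]; any other admissible sequence is
    compared with it by [ex_power_radius], whose bound [4 N |x - X/N|] tends to zero. *)
Lemma ex_limit_power_small : exists r s K : R, [/\ local_radius r K, 0 < s &
  forall X : E, `|X| <= s -> exists Y : E,
    [/\ limit_power X (p Y), `|Y - X| <= K * `|X| ^+ 2 & `|Y| <= r]].
Proof.
have [r [K rK]] := ex_local_radius; have [s s0 [sr hs]] := ex_power_radius rK.
have [r0 K0 Kr pK _] := rK.
exists r, (s / 2), K; split=> //; first by rewrite divr_gt0.
move=> X Xs; pose F k := q (p (k.+1%:R^-1 *: X) ^+ k.+1)%g.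
have X0 := normr_ge0 X.
have scale k : k.+1%:R * `|k.+1%:R^-1 *: X| = `|X|.
  by rewrite normrZ ger0_norm // mulrA mulfV ?mul1r // pnatr_eq0.
have scaleX k : k.+1%:R *: (k.+1%:R^-1 *: X) = X.
  by rewrite scalerA mulfV ?scale1r // pnatr_eq0.
have FX k : p (F k) = (p (k.+1%:R^-1 *: X) ^+ k.+1)%g /\ `|F k - X| <= K * `|X| ^+ 2.
  have hk : k.+1%:R * `|k.+1%:R^-1 *: X| <= r / 2 by rewrite scale; lra.
  by have [h1] := power_est rK hk; rewrite scale scaleX.
(* Both [F k] and [F l] are close to the term of index [(k+1)(l+1)-1]. *)
have dist k l : `|F k - q (p ((k.+1 * l.+1)%:R^-1 *: X) ^+ (k.+1 * l.+1))%g| <=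
    4 * K * `|X| ^+ 2 / k.+1%:R.
  pose x := (k.+1 * l.+1)%:R^-1 *: X.
  have k0 : 0 < k.+1%:R :> R by [].
  have k1 : 1 <= k.+1%:R :> R by rewrite ler1n.
  have lx : l.+1%:R *: x = k.+1%:R^-1 *: X.
    by rewrite scalerA natrM invfM mulrCA mulfV ?mulr1 // pnatr_eq0.
  have nlx : l.+1%:R * `|x| = `|X| / k.+1%:R.
    rewrite -[l.+1%:R in LHS]ger0_norm // -normrZ lx normrZ ger0_norm ?invr_ge0 //.
    by rewrite mulrC.
  have Xk : `|X| / k.+1%:R <= `|X| by rewrite ler_pdivrMr // ler_peMr.
  have hl : l.+1%:R * `|x| <= r / 2 by rewrite nlx (le_trans Xk) //; lra.
  have [h1 h2] := power_est rK hl.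
  rewrite -/x mulnC expgnA -h1; set w := q (p x ^+ l.+1)%g in h1 h2 *.
  rewrite lx nlx in h2.
  have wk : `|w| <= 2 * (`|X| / k.+1%:R).
    have Xk0 : 0 <= `|X| / k.+1%:R by rewrite divr_ge0.
    have := norm_tri_a (a := w) (b := k.+1%:R^-1 *: X) (c := 0)
      (e := K * (`|X| / k.+1%:R) ^+ 2).
    rewrite subr0 normr0 addr0 normrZ ger0_norm ?invr_ge0 // [_^-1 * _]mulrC => /(_ h2).
    rewrite expr2; move: Xk Xk0; move: (`|X| / k.+1%:R) => t tX t0.
    have : K * t <= 1 by nra.
    nra.
  have := hs (k.+1%:R^-1 *: X) w k.+1; rewrite scale.
  have -> : k.+1%:R * `|w| <= s.
    apply: le_trans (ler_wpM2l (ltW k0) wk) _.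
    by rewrite mulrCA [k.+1%:R * _]mulrC divfK ?gt_eqF //; lra.
  have -> : `|X| <= s by lra.
  move=> /(_ isT isT) h3; apply: le_trans h3 _.
  rewrite distrC; apply: le_trans (ler_wpM2l _ h2) _; first by rewrite mulr_ge0.
  have -> : 4 * k.+1%:R * (K * (`|X| / k.+1%:R) ^+ 2) = 4 * K * `|X| ^+ 2 / k.+1%:R.
    by field; rewrite gt_eqF.
  by [].
have [Y FY] : exists Y : E, F k @[k --> \oo] --> Y.
  apply: (rV_cauchy_cvg (cvg_div_succ (4 * K * `|X| ^+ 2))) => k l.
  apply: le_trans (ler_distD (q (p ((k.+1 * l.+1)%:R^-1 *: X) ^+ (k.+1 * l.+1))%g) _ _) _.
  have h2 := dist l k; rewrite (mulnC l.+1 k.+1) distrC in h2.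
  exact: lerD (dist k l) h2.
have YX : `|Y - X| <= K * `|X| ^+ 2.
  apply/ler_addgt0Pr => e e0; move/cvgrPdist_le: (FY) => /(_ e e0)[N _ /(_ N (leqnn N)) h].
  by rewrite [leRHS]addrC; apply: le_trans (ler_distD (F N) _ _) (lerD h (proj2 (FX N))).
have Yr : `|Y| <= r.
  have := norm_tri_a (a := Y) (b := X) (c := 0) (e := K * `|X| ^+ 2).
  rewrite subr0 normr0 addr0 expr2 => /(_ YX).
  have : K * `|X| <= 4^-1 by nra.
  nra.
exists Y; split=> // N x hN hx.
have qY : q (p (x k) ^+ N k)%g @[k --> \oo] --> Y.
  have FN : F (N k).-1 @[k --> \oo] --> Y.
    apply: (cvg_comp (fun k => (N k).-1) F _ FY).
    apply/cvgnyPge => A; move/cvgnyPge: hN => /(_ A.+1); apply: filterS => k Ak.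
    by rewrite -ltnS (leq_trans Ak) // leqSpred.
  have NX : (N k)%:R *: x k - X @[k --> \oo] --> (0 : E).
    by rewrite -(subrr X); apply: cvgB => //; exact: cvg_cst.
  have NX4 : 4 * `|(N k)%:R *: x k - X| @[k --> \oo] --> (0 : R).
    have := cvgMr (a := 4) (cvg_norm NX); rewrite normr0 mulr0; apply.
  have near0 : \forall k \near \oo, `|q (p (x k) ^+ N k)%g - F (N k).-1| <=
      4 * `|(N k)%:R *: x k - X|.
    have hb : \forall k \near \oo, `|(N k)%:R *: x k - X| <= s / 2.
      have s2 : 0 < s / 2 by rewrite divr_gt0.
      by move/cvgrPdist_le: NX => /(_ _ s2); apply: filterS => k; rewrite sub0r normrN.
    move/cvgnyPge: hN => /(_ 1); apply: filterS2 hb => k hb Nk.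
    have Nk0 : 0 < (N k)%:R :> R by rewrite ltr0n.
    rewrite /F prednK //.
    have xk : (N k)%:R * `|x k| <= s.
      rewrite -[(N k)%:R in leLHS]ger0_norm // -normrZ.
      have := norm_tri_a (a := (N k)%:R *: x k) (b := X) (c := 0) (e := s / 2).
      by rewrite subr0 normr0 addr0 => /(_ hb); lra.
    have := hs (x k) ((N k)%:R^-1 *: X) (N k) xk.
    have -> : (N k)%:R * `|(N k)%:R^-1 *: X| = `|X| by rewrite -(prednK Nk) scale.
    have -> : `|X| <= s by lra.
    move=> /(_ isT) h; apply: le_trans h _.
    have -> : (N k)%:R *: x k - X = (N k)%:R *: (x k - (N k)%:R^-1 *: X).
      by rewrite scalerBr scalerA mulfV ?scale1r // gt_eqF.
    by rewrite normrZ ger0_norm // mulrA.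
  have d0 : q (p (x k) ^+ N k)%g - F (N k).-1 @[k --> \oo] --> (0 : E).
    by apply: (cvg_norm_le _ NX4); apply: filterS near0 => k; rewrite subr0.
  have h := cvgD d0 FN; rewrite add0r in h.
  by apply: (near_cvg _ (h _)); apply: nearW => k; exact: subrK.
have pqY := cvg_comp _ _ qY (proj2 (pK _ Yr)).
apply: (near_cvg _ pqY).
have r2 : 0 < r / 2 - `|X| by lra.
move/cvgrPdist_le: hx => /(_ _ r2); apply: filterS => k hk.
have : (N k)%:R * `|x k| <= r / 2.
  rewrite -[(N k)%:R in leLHS]ger0_norm // -normrZ -[_ *: _](subrK X).
  by apply: le_trans (ler_normD _ _) _; rewrite distrC -lerBrDr.
by move=> /(power_est rK)[].
Qed.

Lemma limit_power_unique X g g' : limit_power X g -> limit_power X g' -> g = g'.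
Proof.
have hN : k.+1 @[k --> \oo] --> \oo by apply/cvgnyPge => A; exists A => // k /= h; exact: leqW h.
have hx : k.+1%:R *: (k.+1%:R^-1 *: X) @[k --> \oo] --> X.
  apply: (near_cvg (f := cst X)); last exact: cvg_cst.
  by apply: nearW => k; rewrite scalerA mulfV ?scale1r // pnatr_eq0.
by move=> h h'; exact: (cvg_unique hausG (h _ _ hN hx) (h' _ _ hN hx)).
Qed.

(** For large [X] the limit is the [M]-th power of that of [X / M]. Dividing [N k] by [M] leaves
    fewer than [M] further factors, each tending to 1. *)
Lemma ex_limit_power X : exists g, limit_power X g.
Proof.
have [r [s [K [rK s0 hs]]]] := ex_limit_power_small.
pose M := (Num.truncn (`|X| / s)).+1.
have M0 : 0 < M%:R :> R by [].
have XM : `|M%:R^-1 *: X| <= s.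
  have /andP[_ h] : (Num.truncn (`|X| / s))%:R <= `|X| / s < M%:R.
    by apply: truncn_itv; rewrite divr_ge0 // ltW.
  rewrite normrZ ger0_norm ?invr_ge0 // mulrC ler_pdivrMr // mulrC -ler_pdivrMr //.
  exact: ltW.
have [Y [hY _ _]] := hs _ XM.
exists (p Y ^+ M)%g => N x hN hx.
have x0 := cvg_scaled0 hN hx.
have hQ : (N k %/ M)%N @[k --> \oo] --> \oo.
  apply/cvgnyPge => A; move/cvgnyPge: hN => /(_ (A * M)%N); apply: filterS => k.
  by rewrite leq_divRL.
have rx0 : (N k %% M)%:R *: x k @[k --> \oo] --> (0 : E).
  have hb : M%:R * `|x k| @[k --> \oo] --> (0 : R).
    by have := cvgMr (a := M%:R) (cvg_norm x0); rewrite normr0 mulr0; apply.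
  apply: (cvg_norm_le _ hb); apply: nearW => k; rewrite subr0 normrZ ger0_norm //.
  by rewrite ler_wpM2r // ler_nat ltnW // ltn_mod.
have hQx : (N k %/ M)%:R *: x k @[k --> \oo] --> M%:R^-1 *: X.
  have h := cvgZr (k := M%:R^-1) (cvgB hx rx0); rewrite subr0 in h.
  apply: (near_cvg _ (h _ _)); apply: nearW => k.
  transitivity (M%:R^-1 *: ((N k)%:R *: x k - (N k %% M)%:R *: x k)); first by [].
  have -> : (N k)%:R = (N k %/ M)%:R * M%:R + (N k %% M)%:R :> R.
    by rewrite -natrM -natrD -divn_eq.
  by rewrite scalerDl addrK scalerA mulrCA mulVf ?mulr1 // gt_eqF.
have c1 : ((p (x k) ^+ (N k %/ M)) ^+ M)%g @[k --> \oo] --> (p Y ^+ M)%g.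
  by apply: cvgXg; exact: hY.
have c2 : (p (x k) ^+ (N k %% M))%g @[k --> \oo] --> 1%g.
  have hj (j : 'I_M) : (p (x k) ^+ j)%g @[k --> \oo] --> 1%g.
    rewrite -(expg1n _ j); apply: cvgXg; apply: (cvg_comp x p x0); exact: (p_cont0 rK).
  move=> W nW; have hW : \forall k \near \oo, forall j : 'I_M, W (p (x k) ^+ j)%g.
    apply: (@filter_forall _ 'I_M (fun j k => W (p (x k) ^+ j)%g) _ _) => j.
    exact: (hj j W nW).
  apply: filterS hW => k /(_ (Ordinal (ltn_pmod (N k) (isT : 0 < M)%N))).
  by [].
have c12 := cvgMg c1 c2; rewrite mulg1 in c12; apply: (near_cvg _ (c12 _)); apply: nearW => k.
by rewrite -expgnA -expgnDr -divn_eq.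
Qed.

Definition lexp (X : E) : G := sval (cid (ex_limit_power X)).

Lemma lexpP X : limit_power X (lexp X).
Proof. exact: (svalP (cid (ex_limit_power X))). Qed.

Lemma lexp_small : exists r s K : R, [/\ local_radius r K, 0 < s &
  forall X : E, `|X| <= s -> exists Y : E,
    [/\ lexp X = p Y, `|Y - X| <= K * `|X| ^+ 2 & `|Y| <= r]].
Proof.
have [r [s [K [rK s0 hs]]]] := ex_limit_power_small.
exists r, s, K; split=> // X /hs[Y [h1 h2 h3]]; exists Y; split=> //.
exact: (limit_power_unique (@lexpP X) h1).
Qed.

Let succ_oo : k.+1 @[k --> \oo] --> \oo.
Proof. by apply/cvgnyPge => A; exists A => // k /= h; exact: leqW h. Qed.

Lemma lexp_cvg_succ (u : nat -> G) X (C : R) :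
  (\forall k \near \oo, exists y : E, [/\ u k = p y, q (u k) = y &
     `|y - k.+1%:R^-1 *: X| <= C / k.+1%:R ^+ 2]) ->
  (u k ^+ k.+1)%g @[k --> \oo] --> lexp X.
Proof.
move=> hu; apply: (near_cvg (f := fun k => (p (q (u k)) ^+ k.+1)%g)).
  by apply: filterS hu => k [y [-> -> _]].
apply: (lexpP (N := succn)) => //; apply: (cvg_norm_le (a := fun k => C / k.+1%:R) _ (cvg_div_succ C)).
apply: filterS hu => k [y [_ -> h]]; have k0 : 0 < k.+1%:R :> R by [].
have -> : k.+1%:R *: y - X = k.+1%:R *: (y - k.+1%:R^-1 *: X).
  by rewrite scalerBr scalerA mulfV ?scale1r // gt_eqF.
rewrite normrZ ger0_norm //; apply: le_trans (ler_wpM2l (ltW k0) h) _.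
by rewrite expr2 invfM mulrCA !mulrA mulfK // gt_eqF.
Qed.

Lemma near_succ_small (X : E) (d : R) : 0 < d -> \forall k \near \oo, `|k.+1%:R^-1 *: X| <= d.
Proof.
move=> d0; move/cvgrPdist_le: (cvg_div_succ `|X|) => /(_ d d0); apply: filterS => k.
rewrite sub0r normrN ger0_norm ?divr_ge0 // mulrC.
by rewrite normrZ ger0_norm ?invr_ge0.
Qed.

Lemma lexp0 : lexp 0 = 1%g.
Proof.
apply: (cvg_unique hausG (lexpP (N := succn) (x := fun=> 0) succ_oo _)).
  by under eq_fun do rewrite scaler0; exact: cvg_cst.
apply: (near_cvg (f := cst 1%g)); last exact: cvg_cst.
by apply: nearW => k; rewrite p0 expg1n.
Qed.

Lemma lexpN X : lexp (- X) = (lexp X)^-1%g.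
Proof.
have [r [K rK]] := ex_local_radius; have [r0 K0 Kr pK _] := rK.
have [d d0 hd] := ex_inverse_radius rK.
apply: (@cvg_unique _ hausG (((p (k.+1%:R^-1 *: X))^-1 ^+ k.+1)%g @[k --> \oo]) _).
  apply: (@lexp_cvg_succ _ _ (2 * K * `|X| ^+ 2)).
  apply: filterS2 (near_succ_small X d0) (near_succ_small X r0) => k xd xr.
  have [y [e y1 y2]] := hd _ xd; exists y; split=> //; first by rewrite e; case: (pK _ y1).
  rewrite scalerN opprK; apply: (le_trans y2).
  have yx : `|y| <= 2 * `|k.+1%:R^-1 *: X|.
    have := norm_tri_a (a := y) (b := - (k.+1%:R^-1 *: X)) (c := 0)
      (e := K * `|k.+1%:R^-1 *: X| * `|y|).
    rewrite subr0 opprK normrN normr0 addr0 => /(_ y2).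
    have : K * `|y| <= 4^-1 by apply: le_trans Kr; rewrite ler_pM2l.
    by have := normr_ge0 (k.+1%:R^-1 *: X); have := normr_ge0 y; nra.
  apply: le_trans (ler_wpM2l _ yx) _; first by rewrite mulr_ge0 // ltW.
  rewrite normrZ ger0_norm ?invr_ge0 //.
  have -> : K * (k.+1%:R^-1 * `|X|) * (2 * (k.+1%:R^-1 * `|X|)) = 2 * K * `|X| ^+ 2 / k.+1%:R ^+ 2.
    by field; rewrite gt_eqF.
  by [].
apply: (near_cvg (f := fun k => ((p (k.+1%:R^-1 *: X)) ^+ k.+1)^-1%g)).
  by apply: nearW => k; rewrite expVgn.
apply: cvgVg; apply: lexpP succ_oo _.
apply: (near_cvg (f := cst X)); last exact: cvg_cst.
by apply: nearW => k; rewrite scalerA mulfV ?scale1r // pnatr_eq0.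
Qed.

(** Both factors are limits of powers of the same elements [p (X / (k+1))], with exponents
    asymptotic to [s (k+1)] and [t (k+1)], and exponents add. *)
Let lexpD_ge0 X (s t : R) : 0 <= s -> 0 <= t -> lexp ((s + t) *: X) = (lexp (s *: X) * lexp (t *: X))%g.
Proof.
rewrite le_eqVlt => /orP[/eqP <- _|s0]; first by rewrite add0r scale0r lexp0 mul1g.
rewrite le_eqVlt => /orP[/eqP <-|t0]; first by rewrite addr0 scale0r lexp0 mulg1.
have [N N1 N2] := nat_rate s0; have [L L1 L2] := nat_rate t0.
pose x k := k.+1%:R^-1 *: X.
have c (M : nat -> nat) (a : R) : (M k)%:R / k.+1%:R @[k --> \oo] --> a ->
    (M k)%:R *: x k @[k --> \oo] --> a *: X.
  move=> Ma; have h := cvgZl (a := X) Ma.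
  by apply: (near_cvg _ (h _)); apply: nearW => k; rewrite /x scalerA.
apply: (@cvg_unique _ hausG ((p (x k) ^+ (N k + L k))%g @[k --> \oo]) _).
  apply: lexpP.
    apply/cvgnyPge => A; move/cvgnyPge: N1 => /(_ A); apply: filterS => k h.
    by rewrite (leq_trans h) // leq_addr.
  apply: c; have h := cvgD N2 L2.
  by apply: (near_cvg _ (h _)); apply: nearW => k; rewrite natrD mulrDl.
apply: (near_cvg (f := fun k => (p (x k) ^+ N k * p (x k) ^+ L k)%g)).
  by apply: nearW => k; rewrite expgnDr.
by apply: cvgMg; apply: lexpP => //; exact: c.
Qed.

Lemma lexpD X (s t : R) : lexp ((s + t) *: X) = (lexp (s *: X) * lexp (t *: X))%g.
Proof.
have V a : lexp (- a *: X) = (lexp (a *: X))^-1%g by rewrite scaleNr lexpN.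
have V2 a b : lexp ((b - a) *: X) = (lexp ((a - b) *: X))^-1%g by rewrite -V opprB.
have neg a b : 0 <= a -> lexp ((b - a) *: X) = (lexp (b *: X) * (lexp (a *: X))^-1)%g.
  move=> a0; have [b0|b0] := leP 0 b; last first.
    have nb : 0 <= - b by lra.
    by rewrite V2 lexpD_ge0 // V invgM invgK.
  have [ab|ab] := leP a b.
    have ba : 0 <= b - a by rewrite subr_ge0.
    by have := lexpD_ge0 X ba a0; rewrite subrK => ->; rewrite mulgK.
  have ba : 0 <= a - b by rewrite subr_ge0 ltW.
  have := lexpD_ge0 X ba b0; rewrite subrK => ->.
  by rewrite V2 invgM mulgA mulgV mul1g.
have [t0|t0] := leP 0 t; last first.
  have t1 : 0 <= - t by lra.
  by have := neg _ s t1; rewrite opprK V invgK.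
have [s0|s0] := leP 0 s; first exact: lexpD_ge0.
have s1 : 0 <= - s by lra.
have := neg _ t s1; rewrite opprK addrC => ->; rewrite V invgK.
have e : ((lexp (s *: X))^-1 * lexp (t *: X) = lexp (t *: X) * (lexp (s *: X))^-1)%g.
  by rewrite -V -!lexpD_ge0 // addrC.
by apply: (mulgI (lexp (s *: X))^-1%g); rewrite mulKg mulgA e mulgVK.
Qed.

Lemma cvg_small (T : Type) (F : set_system T) {FF : Filter F} (f g : T -> E) (K : R) :
  g x @[x --> F] --> (0 : E) -> (\forall x \near F, `|f x| <= K * `|g x|) ->
  f x @[x --> F] --> (0 : E).
Proof.
move=> g0 fg; apply/cvgrPdist_le => e e0; have K1 : 0 < `|K| + 1 by rewrite ltr_wpDl.
have eK : 0 < e / (`|K| + 1) by rewrite divr_gt0.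
move/cvgrPdist_le: g0 => /(_ _ eK); apply: filterS2 fg => x fgx.
rewrite !sub0r !normrN ler_pdivlMr // => h; apply: le_trans fgx _; apply: le_trans h.
by rewrite mulrC ler_wpM2l // (le_trans (ler_norm K)) // lerDl.
Qed.

Lemma near_size (K : R) (z Z : E) : 0 <= K -> `|Z| <= 1 -> `|z - Z| <= K * `|Z| ^+ 2 ->
  `|z| <= (K + 1) * `|Z|.
Proof.
move=> K0 Z1 h; have := norm_tri_a (a := z) (b := Z) (c := 0) (e := K * `|Z| ^+ 2).
rewrite subr0 normr0 addr0 => /(_ h) h2; apply: le_trans h2 _.
by rewrite mulrDl mul1r lerD2r ler_wpM2l // expr2 ler_piMl.
Qed.

Lemma lexp_cvg1 (T : Type) (F : set_system T) {FF : Filter F} (f : T -> E) :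
  f x @[x --> F] --> (0 : E) -> lexp (f x) @[x --> F] --> 1%g.
Proof.
move=> f0; have [r [s [K [rK s0 hs]]]] := lexp_small.
have [r0 K0 Kr pK _] := rK.
have /choice[Y hY] : forall x, exists y : E, `|f x| <= Num.min s 1 ->
    lexp (f x) = p y /\ `|y| <= (K + 1) * `|f x|.
  move=> x; have [fs|fs] := boolP (`|f x| <= Num.min s 1); last by exists 0.
  move: fs; rewrite le_min => /andP[/hs[y [h1 h2 h3]] f1]; exists y => _; split=> //.
  by apply: near_size h2 => //; exact: ltW.
have s1 : 0 < Num.min s 1 by rewrite lt_min s0 ltr01.
have fs : \forall x \near F, `|f x| <= Num.min s 1.
  by move/cvgrPdist_le: f0 => /(_ _ s1); apply: filterS => x; rewrite sub0r normrN.
have Y0 : Y x @[x --> F] --> (0 : E).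
  by apply: (cvg_small (K := K + 1) f0); apply: filterS fs => x /hY[].
apply: (near_cvg _ (cvg_comp Y p Y0 (p_cont0 rK))).
by apply: filterS fs => x /hY[].
Qed.

(** For small [t], [lexp (t *: X)] has coordinates [t X] up to [O(t^2)]; dividing by [t] bounds
    [|X - X'|] by a multiple of [t]. *)
Lemma lexp_inj X X' : (forall t : R, lexp (t *: X) = lexp (t *: X')) -> X = X'.
Proof.
move=> e; have [r [s [K [rK s0 hs]]]] := lexp_small.
have [r0 K0 Kr pK _] := rK.
pose N := `|X| + `|X'| + 1; have N0 : 0 < N by rewrite ltr_wpDl // addr_ge0.
have key (t : R) : 0 < t -> t * N <= s -> `|X - X'| <= t * (K * (`|X| ^+ 2 + `|X'| ^+ 2)).
  move=> t0 tN; have tX : `|t *: X| <= s.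
    rewrite normrZ gtr0_norm //; apply: le_trans tN; rewrite ler_pM2l //.
    by rewrite /N -addrA lerDl addr_ge0.
  have tX' : `|t *: X'| <= s.
    rewrite normrZ gtr0_norm //; apply: le_trans tN; rewrite ler_pM2l //.
    by rewrite /N [`|X| + _]addrC -addrA lerDl addr_ge0.
  have [Y [h1 h2 h3]] := hs _ tX; have [Y' [h1' h2' h3']] := hs _ tX'.
  have YY : Y = Y' by rewrite -(proj1 (pK _ h3)) -h1 e h1' (proj1 (pK _ h3')).
  rewrite -YY distrC in h2'; rewrite -(ler_pM2l t0) -[t in leLHS]gtr0_norm // -normrZ scalerBr.
  apply: le_trans (ler_distD Y _ _) _; rewrite [`|_ - Y|]distrC.
  rewrite [X in _ + X <= _]distrC in h2' *.
  apply: le_trans (lerD h2 h2') _; rewrite !normrZ gtr0_norm // !expr2.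
  by rewrite le_eqVlt; apply/orP; left; apply/eqP; ring.
apply/eqP; rewrite -subr_eq0 -normr_eq0 eq_le normr_ge0 andbT; apply/ler_addgt0Pr => d d0.
rewrite add0r; pose C := K * (`|X| ^+ 2 + `|X'| ^+ 2) + 1.
have C0 : 0 < C by rewrite ltr_wpDl // mulr_ge0 ?addr_ge0 ?exprn_ge0 // ltW.
pose t := Num.min (s / N) (d / C).
have t0 : 0 < t by rewrite lt_min !divr_gt0.
have tN : t * N <= s by rewrite -ler_pdivlMr // ge_min lexx.
apply: le_trans (key t t0 tN) _; have tC : t * C <= d by rewrite -ler_pdivlMr // ge_min lexx orbT.
by apply: le_trans tC; rewrite ler_pM2l // lerDl.
Qed.

Lemma lexp_trotter X Y :
  ((lexp (k.+1%:R^-1 *: X) * lexp (k.+1%:R^-1 *: Y)) ^+ k.+1)%g @[k --> \oo] --> lexp (X + Y).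
Proof.
have [r [s [K [rK s0 hs]]]] := lexp_small; have [r0 K0 Kr pK mK] := rK.
pose a k : R := k.+1%:R^-1.
pose d := Num.min s 1; have d0 : 0 < d by rewrite lt_min s0 ltr01.
apply: (@lexp_cvg_succ _ _ (K * `|X| ^+ 2 + K * `|Y| ^+ 2 + K * ((K + 1) * `|X|) * ((K + 1) * `|Y|))).
apply: filterS2 (near_succ_small X d0) (near_succ_small Y d0) => k.
rewrite !le_min => /andP[/hs[x [x1 x2 x3]] X1] /andP[/hs[y [y1 y2 y3]] Y1].
have xs := near_size (ltW K0) X1 x2; have ys := near_size (ltW K0) Y1 y2.
have [m1 m2] := mK x y x3 y3.
exists (q (p x * p y)%g); rewrite x1 y1; split=> //.
have -> : q (p x * p y)%g - k.+1%:R^-1 *: (X + Y) =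
    (q (p x * p y)%g - x - y) + (x - k.+1%:R^-1 *: X) + (y - k.+1%:R^-1 *: Y).
  by rewrite scalerDr; apply/rowP => i; rewrite !mxE; ring.
apply: le_trans (ler_normD _ _) _; apply: le_trans (lerD (ler_normD _ _) (lexx _)) _.
apply: le_trans (lerD (lerD m2 x2) y2) _.
have xy : K * `|x| * `|y| <= K * ((K + 1) * `|k.+1%:R^-1 *: X|) * ((K + 1) * `|k.+1%:R^-1 *: Y|).
  apply: ler_pM ys => //; first by rewrite mulr_ge0 // ltW.
  by rewrite ler_wpM2l // ltW.
apply: le_trans (lerD (lerD xy (lexx _)) (lexx _)) _.
rewrite !normrZ ger0_norm ?invr_ge0 // le_eqVlt; apply/orP; left; apply/eqP.
by field; rewrite gt_eqF.
Qed.

Lemma lexp_conj_trotter g X X' Y Y' :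
  (forall t : R, (g * lexp (t *: X) * g^-1)%g = lexp (t *: X')) ->
  (forall t : R, (g * lexp (t *: Y) * g^-1)%g = lexp (t *: Y')) ->
  (g * lexp (X + Y) * g^-1)%g = lexp (X' + Y').
Proof.
move=> hX hY; apply: (@cvg_unique _ hausG
   ((((g * lexp (k.+1%:R^-1 *: X) * g^-1) * (g * lexp (k.+1%:R^-1 *: Y) * g^-1)) ^+ k.+1)%g @[k --> \oo]) _).
  have e k : (((g * lexp (k.+1%:R^-1 *: X) * g^-1) * (g * lexp (k.+1%:R^-1 *: Y) * g^-1)) ^+ k.+1)%g =
      (g * (lexp (k.+1%:R^-1 *: X) * lexp (k.+1%:R^-1 *: Y)) ^+ k.+1 * g^-1)%g.
    move: (lexp _) (lexp _) => b a.
    rewrite [(g * a * g^-1 * _)%g](_ : _ = g * (a * b) * g^-1)%g; last by rewrite !mulgA mulgVK.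
    elim: k.+1 => [|j ih]; first by rewrite !expg0 mulg1 mulgV.
    by rewrite !expgS ih !mulgA mulgVK.
  apply: (near_cvg (f := fun k => (g * (lexp (k.+1%:R^-1 *: X) * lexp (k.+1%:R^-1 *: Y)) ^+ k.+1 * g^-1)%g)).
    by apply: nearW => k; rewrite e.
  apply: cvgMg; last exact: cvg_cst.
  by apply: cvgMg; [exact: cvg_cst | exact: lexp_trotter].
apply: (near_cvg _ (@lexp_trotter X' Y')).
by apply: nearW => k; rewrite hX hY.
Qed.

(* Newton iteration: [p x = exp x * p x1] with [x1] quadratically small, and so on. *)
Lemma lexp_generate (S : set G) : connected [set: G] -> closed S -> S 1%g ->
  (forall a b, S a -> S b -> S (a * b)%g) -> (forall X, S (lexp X)) -> S = setT.
Proof.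
move=> conG cS S1 SM Sexp; have [r [s [K [rK s0 hs]]]] := lexp_small.
have [r0 K0 Kr pK mK] := rK; have [d d0 [dr hinv _ hlip]] := ex_lipschitz_radius rK.
pose C := 2 * K + 1; have C0 : 0 < C by rewrite ltr_wpDl // mulr_ge0 // ltW.
pose e := Num.min (Num.min (Num.min s 1) (d / (4 * (K + 1)))) (2^-1 / C).
have K1 : 0 < K + 1 by rewrite ltr_wpDl // ltW.
have e0 : 0 < e by rewrite !lt_min s0 ltr01 !divr_gt0 ?mulr_gt0 // invr_gt0.
have step (x : E) : `|x| <= e -> exists u : E,
    (p x = lexp x * p u)%g /\ `|u| <= 2^-1 * `|x|.
  rewrite !le_min => /andP[/andP[/andP[xs x1] xd] xC].
  have [Y [h1 h2 h3]] := hs _ xs.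
  have Yx := near_size (ltW K0) x1 h2.
  have Yd : `|Y| <= d / 4.
    apply: le_trans Yx _; rewrite mulrC -ler_pdivlMr //.
    by apply: le_trans xd _; rewrite invfM mulrA.
  have xd' : `|x| <= d.
    apply: le_trans xd _; rewrite ler_pdivrMr ?mulr_gt0 // ler_peMr ?(ltW d0) //; nra.
  have Yd' : `|Y| <= d by lra.
  have [z [z1 z2 z3]] := hinv _ Yd'.
  have zd : `|z| <= d by lra.
  exists (q (p z * p x)%g); have [m1 _] := mK z x z3 (le_trans xd' dr).
  split; first by rewrite m1 -z1 h1 mulgA mulgV mul1g.
  have zY : q (p z * p Y)%g = 0.
    by rewrite -z1 mulVg -p0; case: (pK 0); rewrite ?normr0 // ltW.
  have := hlip z x Y zd xd' Yd'; rewrite zY subr0 distrC => h; apply: le_trans h _.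
  apply: le_trans (ler_wpM2l _ h2) _; first by [].
  rewrite ler_pdivlMr // in xC; rewrite expr2; have := normr_ge0 x.
  rewrite /C in xC; move: xC; move: (`|x|) => t; nra.
have Sp (x : E) : `|x| <= e -> S (p x).
  move=> xe; pose st (j : nat) := exists a (u : E), [/\ S a, p x = (a * p u)%g & `|u| <= 2^-1 ^+ j * `|x|].
  have hst j : st j.
    elim: j => [|j [a [u [Sa pa uj]]]].
      by exists 1%g, x; rewrite mul1g expr0 mul1r.
    have ue : `|u| <= e.
      apply: le_trans uj _; apply: le_trans xe; rewrite ler_piMl //.
      by rewrite exprn_ile1 // invr_le1 ?unitfE // ler1n.
    have [v [hv1 hv2]] := step u ue.
    exists (a * lexp u)%g, v; split; first by apply: SM.
      by rewrite pa hv1 mulgA.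
    by apply: le_trans hv2 _; rewrite exprS -mulrA ler_pM2l // invr_gt0.
  have /choice[a ha] := hst; have /choice[u hu] := ha.
  have u0 : u j @[j --> \oo] --> (0 : E).
    have h2 : 2^-1 ^+ j * `|x| @[j --> \oo] --> (0 : R).
      rewrite -(mul0r `|x|); apply: cvgMl; apply: cvg_expr.
      by rewrite ger0_norm ?invr_ge0 // invf_lt1 // ltr1n.
    by apply: (cvg_norm_le _ h2); apply: nearW => j; rewrite subr0; case: (hu j).
  have ca : a j @[j --> \oo] --> p x.
    have h : (p x * (p (u j))^-1)%g @[j --> \oo] --> (p x * 1^-1)%g.
      apply: cvgMg; first exact: cvg_cst.
      by apply: cvgVg; exact: (cvg_comp u p u0 (p_cont0 rK)).
    rewrite invg1 mulg1 in h; apply: (near_cvg _ h); apply: nearW => j /=.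
    by case: (hu j) => _ -> _; rewrite mulgK.
  by apply: (@closed_cvg _ _ _ _ a S cS _ _ ca); apply: nearW => j; case: (hu j).
have nS : nbhs (1%g : G) S.
  by apply: filterS (pq e0) => g [/ltW/Sp] + ge; rewrite ge.
have oS : open S.
  rewrite openE => a Sa; rewrite /interior.
  have ma : (a^-1 * b)%g @[b --> a] --> (1%g : G).
    rewrite -(mulVg a); apply: cvgMg; [exact: cvg_cst | exact: cvg_id].
  have h : \forall b \near a, S (a^-1 * b)%g := ma _ nS; apply: filterS h => b Sb.
  by rewrite -(mulVKg a b); apply: SM.
by apply: conG => //; [exists 1%g | exists S; rewrite ?setTI | exists S; rewrite ?setTI].
Qed.

(** The coordinates [x k] of [f (2^-k T)] satisfy [x k = 2 x k.+1] up to a quadratic error, so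
    [2^k x k] converges to some [Z]. Then [f (s T)] is a limit of [p (x k) ^+ L k] with
    [L k / 2^k -> s], which [lexpP] identifies. *)
Lemma lexp_hom (f : R -> G) : (forall s t, f (s + t) = (f s * f t)%g) ->
  f t @[t --> (0 : R)] --> 1%g -> exists Z, forall t : R, f t = lexp (t *: Z).
Proof.
move=> fD f1; have [r [K rK]] := ex_local_radius; have [r0 K0 Kr pK mK] := rK.
have f0 : f 0 = 1%g by apply: (mulgI (f 0)); rewrite -fD addr0 mulg1.
have fV t : f (- t) = (f t)^-1%g by apply: (mulgI (f t)); rewrite -fD subrr mulgV.
have fX t j : f (j%:R * t) = (f t ^+ j)%g.
  by elim: j => [|j ih]; [rewrite mul0r expg0 | rewrite -natr1 mulrDl mul1r fD ih expgSr].
have fc t : f s @[s --> t] --> f t.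
  have h : (f t * f (s - t))%g @[s --> t] --> (f t * 1)%g.
    apply: cvgMg; first exact: cvg_cst.
    apply: (cvg_comp (fun s => s - t) f _ f1).
    apply/cvgrPdist_le => e e0; apply/nbhs_ballP; exists e => // s.
    by rewrite /ball /= sub0r normrN distrC => /ltW.
  rewrite mulg1 in h; apply: (near_cvg _ h); apply: nearW => s.
  by rewrite -fD addrC subrK.
have [T T0 hT] : exists2 T : R, 0 < T & forall t : R, `|t| <= T -> `|q (f t)| < r /\ p (q (f t)) = f t.
  have /nbhs_ballP[T /= T0 hT] := f1 _ (pq r0).
  exists (T / 2) => [|t tT]; first exact: divr_gt0.
  by apply: hT; rewrite /ball /= sub0r normrN; apply: le_lt_trans tT _; lra.
pose x k := q (f (2^-1 ^+ k * T)).
have hx k : `|x k| < r /\ p (x k) = f (2^-1 ^+ k * T).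
  apply: hT; rewrite ger0_norm ?mulr_ge0 ?exprn_ge0 ?(ltW T0) //.
  by rewrite ler_piMl ?(ltW T0) // exprn_ile1 // invr_le1 ?unitfE // ler1n.
have dbl k : `|x k - x k.+1 - x k.+1| <= K * `|x k.+1| ^+ 2.
  have [h1 h2] := hx k.+1; have [_] := mK _ _ (ltW h1) (ltW h1).
  rewrite h2 -fD expr2 mulrA -mulrDl.
  by rewrite exprS -mulrDl [2^-1 + 2^-1](_ : _ = 1) ?mul1r //; lra.
(* The inequality [2 |x k.+1| <= |x k| + |x k.+1| / 4] gives the factor 4/7. *)
have half k : `|x k.+1| <= 4 / 7 * `|x k|.
  have := norm_tri_b (dbl k); have := norm_tri_c (dbl k).
  have [/ltW h1 _] := hx k.+1; have := normr_ge0 (x k.+1).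
  have Kx : K * `|x k.+1| <= 4^-1 by apply: le_trans Kr; rewrite ler_pM2l.
  have := norm_tri_a (a := x k.+1 + x k.+1) (b := x k) (c := 0) (e := K * `|x k.+1| ^+ 2).
  rewrite subr0 normr0 addr0 -[`|_ - x k|]normrN opprB opprD addrA => /(_ (dbl k)).
  rewrite -mulr2n normrMn expr2 => h _ _ _.
  have := normr_ge0 (x k.+1); have : K * (`|x k.+1| * `|x k.+1|) <= 4^-1 * `|x k.+1|.
    by rewrite mulrA ler_wpM2r.
  by move: h; rewrite -mulr_natl; lra.
have xk k : `|x k| <= (4 / 7) ^+ k * r.
  elim: k => [|k ih]; first by rewrite expr0 mul1r; have [/ltW] := hx 0.
  apply: le_trans (half k) _; rewrite exprS -(mulrA (4 / 7)) ler_pM2l //.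
(* The increment of [z] is at most [A (2 (4/7)^2)^k], and [2 (4/7)^2 = 32/49 <= 3/4]; the sequence
   [a] has exactly the differences [A (3/4)^k]. *)
pose z k := 2 ^+ k *: x k; pose A := K * r ^+ 2; pose a k := 4 * A * (3 / 4) ^+ k.
have A0 : 0 <= A by rewrite mulr_ge0 ?exprn_ge0 // ltW.
have zS k : `|z k - z k.+1| <= a k - a k.+1.
  have -> : z k - z k.+1 = 2 ^+ k *: (x k - x k.+1 - x k.+1).
    by rewrite /z exprS; apply/rowP => i; rewrite !mxE; ring.
  rewrite normrZ ger0_norm ?exprn_ge0 //.
  apply: le_trans (ler_wpM2l _ (dbl k)) _; first by rewrite exprn_ge0.
  have -> : a k - a k.+1 = A * (3 / 4) ^+ k by rewrite /a exprS; field.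
  have xx : `|x k.+1| ^+ 2 <= ((4 / 7) ^+ k * r) ^+ 2.
    rewrite ler_sqr ?nnegrE ?mulr_ge0 ?exprn_ge0 ?divr_ge0 ?(ltW r0) //.
    apply: le_trans (half k) _; apply: le_trans (xk k).
    by rewrite ler_piMl //; lra.
  apply: le_trans (ler_wpM2l _ (ler_wpM2l (ltW K0) xx)) _; first by rewrite exprn_ge0.
  have -> : 2 ^+ k * (K * ((4 / 7) ^+ k * r) ^+ 2) = A * (2 * (4 / 7) ^+ 2) ^+ k :> R.
    rewrite [in RHS]exprMn -exprM (mulnC 2%N k) exprM /A.
    by move: ((4 / 7) ^+ k) (2 ^+ k) => c b; ring.
  rewrite ler_wpM2l // lerXn2r ?nnegrE ?mulr_ge0 ?exprn_ge0 ?divr_ge0 //.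
  rewrite expr2; lra.
have za k l : `|z k - z (k + l)%N| <= a k - a (k + l)%N.
  elim: l => [|l ih]; first by rewrite addn0 !subrr normr0.
  apply: le_trans (ler_distD (z (k + l)%N) _ _) _; apply: le_trans (lerD ih _) _.
    by rewrite addnS; exact: zS.
  by rewrite addnS addrA subrK.
have a_ge0 k : 0 <= a k by apply: mulr_ge0; [exact: mulr_ge0 | apply: exprn_ge0; lra].
have a0 : a k @[k --> \oo] --> (0 : R).
  rewrite -(mulr0 (4 * A)); apply: cvgMr; apply: cvg_expr.
  by rewrite ger0_norm ?divr_ge0 //; lra.
have [Z hZ] : exists Z : E, z k @[k --> \oo] --> Z.
  apply: (rV_cauchy_cvg a0) => k l; have [kl|/ltnW lk] := leqP k l.
    have := za k (l - k)%N; rewrite subnKC // => h; apply: le_trans h _.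
    by rewrite lerD2l; have := a_ge0 l; lra.
  have := za l (k - l)%N; rewrite subnKC // distrC => h; apply: le_trans h _.
  by rewrite addrC lerD2r; have := a_ge0 k; lra.
have pos (s : R) : 0 < s -> f (s * T) = lexp (s *: Z).
  move=> s0; have [N N1 N2] := nat_rate s0.
  have oo2 : (2 ^ k).-1%N @[k --> \oo] --> \oo.
    apply/cvgnyPge => B0; exists B0 => // k /= Bk.
    by rewrite -ltnS prednK ?expn_gt0 // (leq_trans _ (ltn_expl k _)).
  have e2 k : ((2 ^ k).-1.+1)%:R = 2 ^+ k :> R by rewrite prednK ?expn_gt0 // natrX.
  have N3 := cvg_comp (fun k => (2 ^ k).-1) _ oo2 N2.
  pose L k := N (2 ^ k).-1.
  have N4 : (L k)%:R / 2 ^+ k @[k --> \oo] --> s.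
    by apply: (near_cvg _ N3); apply: nearW => k /=; rewrite e2.
  have k2 (k : nat) : 2 ^+ k != 0 :> R by rewrite expf_neq0.
  apply: (@cvg_unique _ hausG ((p (x k) ^+ L k)%g @[k --> \oo]) _).
    apply: (near_cvg (f := fun k => f ((L k)%:R / 2 ^+ k * T))).
      apply: nearW => k; have [_ ->] := hx k.
      by rewrite -fX mulrA exprVn.
    have h : (L k)%:R / 2 ^+ k * T @[k --> \oo] --> s * T by exact: cvgMl.
    exact: (cvg_comp _ f h (fc _)).
  apply: lexpP; first exact: (cvg_comp _ _ oo2 N1).
  have h := cvgZ N4 hZ; apply: (near_cvg _ (h _)); apply: nearW => k.
  by rewrite /z scalerA divfK.
exists (T^-1 *: Z) => t; rewrite scalerA.
have [t0|t0|->] := ltgtP t 0.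
- rewrite -[t]opprK fV mulNr scaleNr lexpN -pos ?divfK ?gt_eqF //.
  by rewrite divr_gt0 // oppr_gt0.
- by rewrite -pos ?divfK ?gt_eqF // divr_gt0.
- by rewrite mul0r scale0r lexp0.
Qed.

Lemma ex_lAd g X : exists Z, forall t : R, (g * lexp (t *: X) * g^-1)%g = lexp (t *: Z).
Proof.
apply: lexp_hom => [s t|]; first by rewrite lexpD !mulgA mulgVK.
have h : (g * lexp (t *: X) * g^-1)%g @[t --> (0 : R)] --> (g * 1 * g^-1)%g.
  apply: cvgMg; last exact: cvg_cst.
  apply: cvgMg; first exact: cvg_cst.
  apply: lexp_cvg1; rewrite -(scale0r X); apply: cvgZl; exact: (fun _ h => h).
by rewrite mulg1 mulgV in h.
Qed.

Definition lAd g X : E := sval (cid (ex_lAd g X)).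

Lemma lAdP g X t : (g * lexp (t *: X) * g^-1)%g = lexp (t *: lAd g X).
Proof. exact: (svalP (cid (ex_lAd g X))). Qed.

Lemma lAdE g X Z : (forall t : R, (g * lexp (t *: X) * g^-1)%g = lexp (t *: Z)) -> lAd g X = Z.
Proof. by move=> h; apply: lexp_inj => t; rewrite -lAdP. Qed.

Lemma lAd1 X : lAd 1%g X = X.
Proof. by apply: lAdE => t; rewrite invg1 mulg1 mul1g. Qed.

Lemma lAdM g h X : lAd (g * h)%g X = lAd g (lAd h X).
Proof. by apply: lAdE => t; rewrite -!lAdP invgM !mulgA. Qed.

Lemma lAdZ g a X : lAd g (a *: X) = a *: lAd g X.
Proof. by apply: lAdE => t; rewrite !scalerA lAdP. Qed.

Lemma lAdD g X Y : lAd g (X + Y) = lAd g X + lAd g Y.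
Proof.
apply: lAdE => t; rewrite !scalerDr; apply: lexp_conj_trotter => u; by rewrite !scalerA lAdP.
Qed.

Lemma lAd_lexp X : lAd (lexp X) X = X.
Proof.
apply: lAdE => t; rewrite -{1}[X]scale1r -lexpD addrC lexpD scale1r.
by rewrite mulgK.
Qed.

Hypotheses (BDl : forall x x' y, B (x + x') y = B x y + B x' y)
  (BZl : forall a x y, B (a *: x) y = a *: B x y)
  (BDr : forall x y y', B x (y + y') = B x y + B x y')
  (BZr : forall a x y, B x (a *: y) = a *: B x y).

(** Conjugation by [p a] reads [p a * lexp (t X) = lexp (t W) * p a]. Expanding both sides, dividing
    by [t] and letting [t] tend to 0 gives the estimate, still implicit since [W = lAd (p a) X] also
    occurs in the bound. *)
Lemma lAd_limit eps : 0 < eps -> exists2 d : R, 0 < d & forall a X : E, `|a| < d ->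
  `|X - lAd (p a) X + B a X - B (lAd (p a) X) a| <= eps * `|a| * (`|X| + `|lAd (p a) X|).
Proof.
move=> eps0; have [d d0 hd] := expansion eps0.
have [r [s [K [rK s0 hs]]]] := lexp_small; have [r0 K0 Kr pK mK] := rK.
have [C C0 hC] := B_bounded.
exists d => // a X ad; set W := lAd (p a) X.
have approx (e : R) : 0 < e -> exists x w : E, [/\ `|x - X| <= e, `|w - W| <= e &
    `|x - w + B a x - B w a| <= eps * `|a| * (`|x| + `|w|)].
  move=> e0; pose N := `|X| + `|W| + 1.
  have N0 : 0 < N by rewrite ltr_wpDl // addr_ge0.
  pose t := Num.min (Num.min (s / N) (N^-1)) (Num.min (d / (2 * (K + 1) * N)) (e / (K * N ^+ 2))).
  have K1 : 0 < K + 1 by rewrite ltr_wpDl // ltW.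
  have t0 : 0 < t.
    by rewrite !lt_min invr_gt0 N0 !divr_gt0 //; do ?[apply: mulr_gt0 | apply: exprn_gt0].
  have : t <= t by [].
  rewrite {2}/t !le_min => /andP[/andP[ts t1] /andP[td te]].
  rewrite ler_pdivlMr // in ts; rewrite -[_^-1]div1r ler_pdivlMr // in t1.
  rewrite ler_pdivlMr ?mulr_gt0 // in td; rewrite ler_pdivlMr ?mulr_gt0 ?exprn_gt0 // in te.
  have get (Z : E) : `|Z| <= N -> exists y : E, [/\ lexp (t *: Z) = p (t *: y),
      `|t *: y| < d, `|y - Z| <= e & True].
    move=> ZN; have tZ : `|t *: Z| <= t * N by rewrite normrZ gtr0_norm // ler_pM2l.
    have [y [h1 h2 h3]] := hs _ (le_trans tZ ts).
    exists (t^-1 *: y); rewrite scalerA mulfV ?gt_eqF // scale1r; split=> //.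
      apply: le_lt_trans (near_size (ltW K0) (le_trans tZ t1) h2) _.
      have := ler_wpM2l (ltW K1) tZ; move: td K1 d0; rewrite -/N.
      by move: (`|t *: Z|) => b; nra.
    have -> : t^-1 *: y - Z = t^-1 *: (y - t *: Z).
      by rewrite scalerBr scalerA mulVf ?scale1r // gt_eqF.
    rewrite normrZ gtr0_norm ?invr_gt0 // mulrC ler_pdivrMr //; apply: le_trans h2 _.
    have : `|t *: Z| ^+ 2 <= (t * N) ^+ 2 by rewrite ler_sqr ?nnegrE // mulr_ge0 // ltW.
    move=> /(ler_wpM2l (ltW K0)) h; apply: le_trans h _.
    have -> : K * (t * N) ^+ 2 = t * (K * N ^+ 2) * t by ring.
    by rewrite ler_pM2r.
  have [|x [x1 x2 x3 _]] := get X; first by rewrite /N -addrA lerDl addr_ge0.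
  have [|w [w1 w2 w3 _]] := get W; first by rewrite /N [`|X| + _]addrC -addrA lerDl addr_ge0.
  exists x, w; split=> //.
  have e1 : (p a * p (t *: x) = p (t *: w) * p a)%g.
    by rewrite -x1 -w1 -lAdP mulgVK.
  have [_ l1] := hd _ _ ad x2; have [_ l2] := hd _ _ w2 ad.
  rewrite e1 in l1; set m := q _ in l1 l2.
  rewrite -(ler_pM2l t0) -[t in leLHS]gtr0_norm // -normrZ.
  have -> : t *: (x - w + B a x - B w a) =
      (m - t *: w - a - B (t *: w) a) - (m - a - t *: x - B a (t *: x)).
    by rewrite BZl BZr; apply/rowP => i; rewrite !mxE; ring.
  apply: le_trans (ler_normB _ _) _; apply: le_trans (lerD l2 l1) _.
  rewrite !normrZ gtr0_norm // le_eqVlt; apply/orP; left; apply/eqP; ring.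
apply/ler_addgt0Pr => e e0.
pose D := 2 + 2 * C * `|a| + 2 * eps * `|a|; have D0 : 0 < D.
  by rewrite /D -addrA ltr_wpDr // addr_ge0 // !mulr_ge0 // ltW.
have eD : 0 < e / D by rewrite divr_gt0.
have [x [w [x1 w1 h]]] := approx _ eD; set f := e / D in eD x1 w1.
have BN u v : B (- u) v = - B u v by rewrite -scaleN1r BZl scaleN1r.
have BNr u v : B u (- v) = - B u v by rewrite -scaleN1r BZr scaleN1r.
have -> : X - W + B a X - B W a = (x - w + B a x - B w a) -
    ((x - X) - (w - W) + (B a (x - X) - B (w - W) a)).
  by rewrite BDr BDl BN BNr; apply/rowP => i; rewrite !mxE; ring.
apply: le_trans (ler_normB _ _) _.
have b1 := ler_normD (x - X - (w - W)) (B a (x - X) - B (w - W) a).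
have b2 := ler_normB (x - X) (w - W); have b3 := ler_normB (B a (x - X)) (B (w - W) a).
have b4 : `|B a (x - X)| <= C * `|a| * f.
  by apply: le_trans (hC _ _) _; rewrite ler_wpM2l // mulr_ge0.
have b5 : `|B (w - W) a| <= C * `|a| * f.
  by apply: le_trans (hC _ _) _; rewrite mulrAC ler_wpM2l // mulr_ge0.
have b6 : `|x| <= `|X| + f.
  by rewrite -[x](subrK X) addrC; apply: le_trans (ler_normD _ _) _; rewrite lerD2l.
have b7 : `|w| <= `|W| + f.
  by rewrite -[w](subrK W) addrC; apply: le_trans (ler_normD _ _) _; rewrite lerD2l.
have b8 : eps * `|a| * (`|x| + `|w|) <= eps * `|a| * (`|X| + `|W| + 2 * f).
  by rewrite ler_wpM2l ?mulr_ge0 ?(ltW eps0) //; lra.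
have b9 : e = D * f by rewrite /f mulrC divfK // gt_eqF.
have b10 : D * f = 2 * f + 2 * (C * `|a| * f) + eps * `|a| * (2 * f) by rewrite /D; ring.
rewrite b9 b10; rewrite mulrDr in b8; lra.
Qed.

(** With [eps = 1], [lAd_limit] first shows [|W - X| = O(|a| |X|)]; replacing [B W a] by [B X a]
    then costs only a term quadratic in [a]. *)
Lemma lAd_expansion eps : 0 < eps -> exists2 d : R, 0 < d & forall a X : E, `|a| < d ->
  `|lAd (p a) X - X - (B a X - B X a)| <= eps * `|a| * `|X|.
Proof.
move=> eps0; have [C C0 hC] := B_bounded.
have [d1 d10 h1] := lAd_limit ltr01.
have e4 : 0 < eps / 4 by rewrite divr_gt0.
have [d2 d20 h2] := lAd_limit e4.
pose M := 8 * (C + 1) * (C + 1); have C1 : 0 < C + 1 by rewrite ltr_wpDl.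
have M0 : 0 < M by rewrite !mulr_gt0.
exists (Num.min (Num.min d1 d2) (Num.min (8 * (C + 1))^-1 (eps / (4 * M)))).
  by rewrite !lt_min d10 d20 invr_gt0 divr_gt0 ?mulr_gt0.
move=> a X; rewrite !lt_min => /andP[/andP[a1 a2] /andP[a3 a4]].
have {}h1 := h1 a X a1; have {}h2 := h2 a X a2.
move: h1 h2; set W := lAd (p a) X => h1 h2.
have a0 := normr_ge0 a; have X0 := normr_ge0 X; have W0 := normr_ge0 W.
rewrite -[_^-1]div1r ltr_pdivlMr ?mulr_gt0 // in a3.
rewrite ltr_pdivlMr ?mulr_gt0 // in a4.
have g1 : `|B a X| <= C * `|a| * `|X| by [].
have g2 : `|B W a| <= C * `|W| * `|a| by [].
have g3 : `|W - X| <= `|B a X| + `|B W a| + 1 * `|a| * (`|X| + `|W|).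
  rewrite distrC; have -> : X - W = (X - W + B a X - B W a) - (B a X - B W a).
    by apply/rowP => i; rewrite !mxE; ring.
  apply: le_trans (ler_normB _ _) _; rewrite addrC lerD //; exact: ler_normB.
have aC : `|a| * (C + 1) <= 8^-1 by lra.
have g4 : `|W - X| <= (C + 1) * `|a| * (`|X| + `|W|).
  apply: le_trans g3 _; rewrite mul1r; nra.
have g5 : `|W| <= `|X| + `|W - X|.
  by rewrite -{1}[W](subrK X) addrC; exact: ler_normD.
have g6 : `|W| <= 2 * `|X|.
  have : (C + 1) * `|a| * (`|X| + `|W|) <= 8^-1 * (`|X| + `|W|).
    by rewrite ler_wpM2r ?addr_ge0 // mulrC.
  lra.
have g7 : `|W - X| <= 3 * (C + 1) * `|a| * `|X|.
  apply: le_trans g4 _; have := ler_wpM2l (_ : 0 <= (C + 1) * `|a|) g6.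
  by rewrite mulr_ge0 ?(ltW C1) // => /(_ isT); lra.
have g8 : `|B (W - X) a| <= C * (3 * (C + 1) * `|a| * `|X|) * `|a|.
  by apply: le_trans (hC _ _) _; rewrite ler_wpM2r // ler_wpM2l.
have BN u v : B (- u) v = - B u v by rewrite -scaleN1r BZl scaleN1r.
have -> : W - X - (B a X - B X a) = - (X - W + B a X - B W a) - B (W - X) a.
  by rewrite BDl BN; apply/rowP => i; rewrite !mxE; ring.
apply: le_trans (ler_normB _ _) _; rewrite normrN; apply: le_trans (lerD h2 g8) _.
have g9 : eps / 4 * `|a| * (`|X| + `|W|) <= eps / 4 * `|a| * (3 * `|X|).
  by rewrite ler_wpM2l ?mulr_ge0 ?(ltW e4) //; lra.
have g10 : C * (3 * (C + 1) * `|a| * `|X|) * `|a| <= (M * `|a|) * (`|a| * `|X|).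
  have -> : C * (3 * (C + 1) * `|a| * `|X|) * `|a| = (3 * C * (C + 1) * `|a|) * (`|a| * `|X|) by ring.
  rewrite ler_wpM2r ?mulr_ge0 // ler_wpM2r // /M ler_wpM2r ?(ltW C1) //; lra.
have g11 : (M * `|a|) * (`|a| * `|X|) <= eps / 4 * (`|a| * `|X|).
  by rewrite ler_wpM2r ?mulr_ge0 // mulrC; lra.
have -> : eps * `|a| * `|X| = eps / 4 * `|a| * (3 * `|X|) + eps / 4 * (`|a| * `|X|) by field.
lra.
Qed.
End LocalGroup.

(** * The exponential map of a Lie group *)

(* [e] is the exponential map, [Ad] the adjoint representation, and [p] a local
   parametrisation of the group around 1. *)
Record exponential (R : realType) (n : nat) (G : topologicalGroupType)
    (br : 'rV[R]_n -> 'rV[R]_n -> 'rV[R]_n) (e : 'rV[R]_n -> G)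
    (Ad : G -> 'rV[R]_n -> 'rV[R]_n) (p : 'rV[R]_n -> G) : Prop := Exponential {
  exp_hausdorff : hausdorff_space G;
  brDl : forall x x' y, br (x + x') y = br x y + br x' y;
  brZl : forall a x y, br (a *: x) y = a *: br x y;
  brC : forall x y, br x y = - br y x;
  exp0 : e 0 = 1%g;
  expN : forall X, e (- X) = (e X)^-1%g;
  expD : forall X (s t : R), e ((s + t) *: X) = (e (s *: X) * e (t *: X))%g;
  exp_cvg1 : forall X, e (t *: X) @[t --> (0 : R)] --> 1%g;
  exp_inj : forall X Y, (forall t : R, e (t *: X) = e (t *: Y)) -> X = Y;
  exp_trotter : forall X Y,
    ((e (k.+1%:R^-1 *: X) * e (k.+1%:R^-1 *: Y)) ^+ k.+1)%g @[k --> \oo] --> e (X + Y);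
  exp_generate : forall S : set G, closed S -> S 1%g ->
    (forall a b, S a -> S b -> S (a * b)%g) -> (forall X, S (e X)) -> S = setT;
  exp_Ad : forall g X t, (g * e (t *: X) * g^-1)%g = e (t *: Ad g X);
  Ad1 : forall X, Ad 1%g X = X;
  AdM : forall g h X, Ad (g * h)%g X = Ad g (Ad h X);
  AdD : forall g X Y, Ad g (X + Y) = Ad g X + Ad g Y;
  AdZ : forall g a X, Ad g (a *: X) = a *: Ad g X;
  Ad_exp : forall X, Ad (e X) X = X;
  Ad_deriv : forall X Y, has_deriv (fun t : R => Ad (e (t *: X)) Y) 0 1 (br X Y);
  Ad_expansion : forall eps : R, 0 < eps -> exists2 d : R, 0 < d &
    forall a X, `|a| < d -> `|Ad (p a) X - X - br a X| <= eps * `|a| * `|X|;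
  par0 : p 0 = 1%g;
  par_cont : exists2 d : R, 0 < d & forall x, `|x| < d -> {for x, continuous p};
  par_near : forall eps : R, 0 < eps ->
    \forall g \near (1%g : G), exists2 a, `|a| < eps & g = p a
}.

(** Near 0, [e (t *: X)] is [p a] with [a = t X + O(t^2)], so [lAd_expansion] applies; the
    thresholds on [t] give half of [eps] to its error and half to the quadratic difference between
    [a] and [t X]. *)
Lemma lAd_deriv (R : realType) (n : nat) (G : topologicalGroupType)
    (p : 'rV[R]_n -> G) (q : G -> 'rV[R]_n) (B : 'rV[R]_n -> 'rV[R]_n -> 'rV[R]_n)
    hausG p0 qp pq B_bounded expansion :
  (forall x x' y, B (x + x') y = B x y + B x' y) ->
  (forall a x y, B (a *: x) y = a *: B x y) ->
  (forall x y y', B x (y + y') = B x y + B x y') ->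
  (forall a x y, B x (a *: y) = a *: B x y) ->
  let e := @lexp R n G p q B p0 qp pq B_bounded expansion in
  let Ad := @lAd R n G p q B hausG p0 qp pq B_bounded expansion in
  forall X Y, has_deriv (fun t : R => Ad (e (t *: X)) Y) 0 1 (B X Y - B Y X).
Proof.
move=> BDl BZl BDr BZr e Ad X Y eps eps0.
have [r [s [K [rK s0 hs]]]] := lexp_small hausG p0 qp pq B_bounded expansion.
have [r0 K0 Kr pK mK] := rK; have [C C0 hC] := B_bounded.
pose N := (`|X| + 1) * (`|Y| + 1); have N0 : 0 < N by rewrite mulr_gt0 // ltr_wpDl.
have X1 : 0 < `|X| + 1 by rewrite ltr_wpDl.
have Y1 : 0 < `|Y| + 1 by rewrite ltr_wpDl.
have K1 : 0 < K + 1 by rewrite ltr_wpDl // ltW.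
have eps' : 0 < eps / (2 * (K + 1) * N) by rewrite divr_gt0 // !mulr_gt0.
have [d d0 hd] := lAd_expansion hausG p0 qp pq B_bounded expansion BDl BZl BDr BZr eps'.
pose M := 4 * (C + 1) * K * (`|X| + 1) ^+ 2 * (`|Y| + 1).
have M0 : 0 < M by rewrite !mulr_gt0 ?exprn_gt0 // ltr_wpDl.
exists (Num.min (Num.min (s / (`|X| + 1)) ((`|X| + 1)^-1))
    (Num.min (d / ((K + 1) * (`|X| + 1))) (eps / M))).
  by rewrite !lt_min invr_gt0 X1 !divr_gt0 //; exact: mulr_gt0.
move=> t; rewrite !lt_min => /andP[/andP[ts t1] /andP[td tM]].
rewrite ltr_pdivlMr // in ts; rewrite -[_^-1]div1r ltr_pdivlMr // in t1.
rewrite ltr_pdivlMr ?mulr_gt0 // in td; rewrite ltr_pdivlMr // in tM.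
rewrite add0r scale0r [t *: 1]mulr1.
have -> : Ad (e 0) Y = Y.
  have -> : e 0 = 1%g by exact: lexp0.
  exact: lAd1.
have t0 := normr_ge0 t.
have tX : `|t *: X| <= `|t| * (`|X| + 1) by rewrite normrZ ler_wpM2l // lerDl.
have [a [a1 a2 a3]] := hs _ (le_trans tX (ltW ts)).
have aX := near_size (ltW K0) (le_trans tX (ltW t1)) a2.
have aX' : `|a| <= (K + 1) * (`|t| * (`|X| + 1)).
  by apply: le_trans aX _; rewrite ler_pM2l.
have ad : `|a| < d by apply: le_lt_trans aX' _; rewrite mulrCA.
have h : `|Ad (e (t *: X)) Y - Y - (B a Y - B Y a)| <= eps / (2 * (K + 1) * N) * `|a| * `|Y|.
  by rewrite /e a1; exact: hd.
have BN u v : B (- u) v = - B u v by rewrite -scaleN1r BZl scaleN1r.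
have BNr u v : B u (- v) = - B u v by rewrite -scaleN1r BZr scaleN1r.
have -> : Ad (e (t *: X)) Y - Y - t *: (B X Y - B Y X) =
    (Ad (e (t *: X)) Y - Y - (B a Y - B Y a)) + (B (a - t *: X) Y - B Y (a - t *: X)).
  rewrite BDl BDr BN BNr BZl BZr; apply/rowP => i; rewrite !mxE; ring.
apply: le_trans (ler_normD _ _) _.
have h1 : eps / (2 * (K + 1) * N) * `|a| * `|Y| <= eps / 2 * `|t|.
  have -> : eps / 2 * `|t| = eps / (2 * (K + 1) * N) * ((K + 1) * (`|t| * (`|X| + 1))) * (`|Y| + 1).
    by rewrite /N; field; rewrite !gt_eqF.
  apply: ler_pM => //; first by rewrite mulr_ge0 // ltW.
  - by rewrite ler_pM2l.
  - by rewrite lerDl.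
have aN : `|a - t *: X| <= K * (`|t| * (`|X| + 1)) ^+ 2.
  apply: le_trans a2 _; by rewrite ler_pM2l // ler_sqr ?nnegrE ?mulr_ge0 ?(ltW X1).
have h2 : `|B (a - t *: X) Y - B Y (a - t *: X)| <= 2 * C * `|a - t *: X| * `|Y|.
  apply: le_trans (ler_normB _ _) _; have := hC (a - t *: X) Y; have := hC Y (a - t *: X).
  rewrite (mulrAC C `|Y|) => g1 g2; have := lerD g2 g1.
  by move: (C * _ * _) => u; rewrite -!mulrA; lra.
have h3 : 2 * C * `|a - t *: X| * `|Y| <= eps / 2 * `|t|.
  have h31 : 2 * C * `|a - t *: X| * `|Y| <=
      2 * (C + 1) * (K * (`|t| * (`|X| + 1)) ^+ 2) * (`|Y| + 1).
    apply: ler_pM => //; first by rewrite !mulr_ge0.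
    - by apply: ler_pM => //; rewrite ?mulr_ge0 //; lra.
    - by rewrite lerDl.
  apply: le_trans h31 _.
  have -> : 2 * (C + 1) * (K * (`|t| * (`|X| + 1)) ^+ 2) * (`|Y| + 1) = (`|t| * M / 2) * `|t|.
    by rewrite /M; field.
  by rewrite ler_wpM2r //; lra.
have -> : eps * `|t| = eps / 2 * `|t| + eps / 2 * `|t| by field.
exact: lerD (le_trans h h1) (le_trans h2 h3).
Qed.

Theorem lie_exponential (R : realType) (n : nat) (G : lieGroupType R n)
    (c : chart G 'rV[R]_n) : atlas c -> cdom c 1%g -> connected [set: G] ->
  exists e Ad p, @exponential R n G (lie_bracket c) e Ad p.
Proof.
move=> hc c1 conG.
have hausG : hausdorff_space G by exact: manifold_hausdorff.
pose p0 := chart_pt0 c1; pose qp := chart_ball c1; pose pq := chart_near1 c1.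
pose Bb := chart_bil_bounded c; pose ex := chart_expansion hc c1.
pose BDl := @chart_bilDl _ _ G c; pose BZl := @chart_bilZl _ _ G c.
pose BDr := @chart_bilDr _ _ G c; pose BZr := @chart_bilZr _ _ G c.
exists (lexp p0 qp pq Bb ex), (lAd hausG p0 qp pq Bb ex), (chart_pt c).
have brE X Y := lie_bracket_chart hc c1 X Y.
split.
- exact: hausG.
- by move=> x x' y; rewrite !brE BDl BDr opprD addrACA.
- by move=> a x y; rewrite !brE BZl BZr scalerBr.
- by move=> x y; rewrite !brE opprB.
- exact: lexp0.
- exact: lexpN.
- exact: lexpD.
- move=> X; apply: lexp_cvg1 => //; rewrite -(scale0r X).
  exact: (@scalel_continuous _ _ X 0).
- exact: lexp_inj.
- exact: lexp_trotter.
- by move=> S; exact: lexp_generate.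
- exact: lAdP.
- exact: lAd1.
- exact: lAdM.
- exact: lAdD.
- exact: lAdZ.
- exact: lAd_lexp.
- by move=> X Y; rewrite brE; exact: lAd_deriv.
- move=> eps eps0; have [d d0 hd] := lAd_expansion hausG p0 qp pq Bb ex BDl BZl BDr BZr eps0.
  by exists d => // a X ad; rewrite brE; exact: hd.
- exact: p0.
- by have [d d0 hd] := qp; exists d => // x /hd[].
- move=> eps eps0; apply: filterS (pq _ eps0) => g [g1 g2].
  by exists (chart_co c g).
Qed.

Section Exponential.
Variables (R : realType) (n : nat) (G : topologicalGroupType).
Local Notation E := 'rV[R]_n.
Variables (br : E -> E -> E) (e : E -> G) (Ad : G -> E -> E) (p : E -> G).
Hypothesis ex : exponential br e Ad p.

Let hausG := exp_hausdorff ex.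
Let AdD' := AdD ex.
Let AdZ' := AdZ ex.
Let brDl' := brDl ex.
Let brZl' := brZl ex.
Let brC' := brC ex.

Let brDr' (x y y' : E) : br x (y + y') = br x y + br x y'.
Proof. exact: (brDr brDl' brC'). Qed.
Let brZr' (a : R) (x y : E) : br x (a *: y) = a *: br x y.
Proof. exact: (brZr brZl' brC'). Qed.
Let brNl' := brNl brZl'.
Let brNr' := brNr brZl' brC'.

Lemma Ad_0 g : Ad g 0 = 0.
Proof. by have := AdZ' g 0 0; rewrite !scale0r. Qed.

Lemma AdN g X : Ad g (- X) = - Ad g X.
Proof. by rewrite -scaleN1r AdZ' scaleN1r. Qed.

Lemma AdB g X Y : Ad g (X - Y) = Ad g X - Ad g Y.
Proof. by rewrite AdD' AdN. Qed.

Lemma Ad_sum g m (X : 'I_m -> E) : Ad g (\sum_i X i) = \sum_i Ad g (X i).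
Proof. exact: (big_morph (Ad g) (AdD' g) (Ad_0 g)). Qed.

Definition Adm g : 'M[R]_n := \matrix_(i, j) Ad g (delta_mx 0 i) 0 j.

Lemma mul_Adm g X : X *m Adm g = Ad g X.
Proof.
rewrite [in RHS](row_sum_delta X) Ad_sum; apply/rowP => j.
rewrite mxE summxE; apply: eq_bigr => i _; rewrite !mxE AdZ' mxE //.
Qed.

Lemma AdmM g h : Adm (g * h)%g = Adm h *m Adm g.
Proof. by apply/row_matrixP => i; rewrite !rowE mulmxA !mul_Adm (AdM ex). Qed.

Lemma Adm1 : Adm 1%g = 1%:M.
Proof. by apply/row_matrixP => i; rewrite !rowE mul_Adm mulmx1 (Ad1 ex). Qed.

Lemma AdK g X : Ad g^-1%g (Ad g X) = X.
Proof. by rewrite -(AdM ex) mulVg (Ad1 ex). Qed.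

Lemma AdVK g X : Ad g (Ad g^-1%g X) = X.
Proof. by rewrite -(AdM ex) mulgV (Ad1 ex). Qed.

Lemma bilinear_bounded (f : E -> E -> E) :
  (forall x x' y, f (x + x') y = f x y + f x' y) -> (forall a x y, f (a *: x) y = a *: f x y) ->
  (forall x y y', f x (y + y') = f x y + f x y') -> (forall a x y, f x (a *: y) = a *: f x y) ->
  exists2 K : R, 0 <= K & forall x y, `|f x y| <= K * `|x| * `|y|.
Proof.
move=> fDl fZl fDr fZr.
have f0l y : f 0 y = 0 by have := fZl 0 0 y; rewrite !scale0r.
have f0r x : f x 0 = 0 by have := fZr 0 x 0; rewrite !scale0r.
pose d i : E := delta_mx 0 i.
exists (\sum_i \sum_j `|f (d i) (d j)|); first by apply: sumr_ge0 => i _; apply: sumr_ge0.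
move=> x y.
have -> : f x y = \sum_i \sum_j (x 0 i * y 0 j) *: f (d i) (d j).
  rewrite [in LHS](row_sum_delta x).
  rewrite (big_morph (f^~ y) (fun u v => fDl u v y) (f0l y)); apply: eq_bigr => i _.
  rewrite fZl [in LHS](row_sum_delta y) (big_morph (f _) (fDr _) (f0r _)) scaler_sumr.
  by apply: eq_bigr => j _; rewrite fZr scalerA.
rewrite -mulrA mulr_suml; apply: le_trans (ler_norm_sum _ _ _) _.
apply: ler_sum => i _; rewrite mulr_suml; apply: le_trans (ler_norm_sum _ _ _) _.
apply: ler_sum => j _; rewrite normrZ normrM mulrC ler_wpM2l // ler_pM ?mx_norm_coord //.
Qed.

Lemma br_bounded : exists2 K : R, 0 <= K & forall x y, `|br x y| <= K * `|x| * `|y|.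
Proof. exact: (bilinear_bounded brDl' brZl' brDr' brZr'). Qed.

Lemma Ad_bounded g : exists2 K : R, 0 <= K & forall x, `|Ad g x| <= K * `|x|.
Proof.
exists (\sum_i `|Ad g (delta_mx 0 i)|); first exact: sumr_ge0.
move=> x; rewrite [in leLHS](row_sum_delta x) Ad_sum mulr_suml.
apply: le_trans (ler_norm_sum _ _ _) _; apply: ler_sum => i _.
by rewrite AdZ' normrZ mulrC ler_wpM2l // mx_norm_coord.
Qed.

Lemma has_deriv_bounded (V : normedModType R) (f : V -> E) x v l (L : E -> E) (C : R) :
  (forall x y, L (x - y) = L x - L y) -> (forall a x, L (a *: x) = a *: L x) ->
  (forall x, `|L x| <= C * `|x|) ->
  has_deriv f x v l -> has_deriv (L \o f) x v (L l).
Proof.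
move=> LB LZ LC hf eps eps0; have C1 : 0 < `|C| + 1 by rewrite ltr_wpDl.
have eC : 0 < eps / (`|C| + 1) by rewrite divr_gt0.
have [r r0 hr] := hf _ eC; exists r => // h /hr hh.
rewrite /= -LZ -!LB; apply: le_trans (LC _) _.
apply: le_trans (_ : (`|C| + 1) * (eps / (`|C| + 1) * `|h|) <= _).
  apply: le_trans (ler_wpM2l _ hh); last exact: ltW.
  by rewrite ler_wpM2r // (le_trans (ler_norm C)) // lerDl.
by rewrite mulrA [(_ + 1) * _]mulrC divfK // gt_eqF.
Qed.

Lemma Ad_deriv_at X Y (t : R) :
  has_deriv (fun t : R => Ad (e (t *: X)) Y) t 1 (Ad (e (t *: X)) (br X Y)).
Proof.
have [C C0 hC] := Ad_bounded (e (t *: X)).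
have := has_deriv_bounded (AdB _) (AdZ' _) hC (Ad_deriv ex X Y).
move=> hd eps eps0; have [r r0 hr] := hd _ eps0; exists r => // h /hr.
rewrite /= !add0r -!(AdM ex) scale0r (exp0 ex) mulg1.
by rewrite -(expD ex).
Qed.

Lemma has_deriv_eq (V W : normedModType R) (f g : V -> W) x v l l' :
  f =1 g -> l = l' -> has_deriv f x v l -> has_deriv g x v l'.
Proof. by move=> /funext -> ->. Qed.

Lemma has_deriv_unique (V W : normedModType R) (f : V -> W) x v l l' :
  has_deriv f x v l -> has_deriv f x v l' -> l = l'.
Proof. by move=> /has_deriv_derive <- /has_deriv_derive. Qed.

Lemma has_deriv_cst0 (f : R -> E) : (forall t, has_deriv f t 1 0) -> forall t, f t = f 0.
Proof.
move=> df t; apply/rowP => j.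
have [|s _] := @mvt_line R R^o n f 0 t (fun=> 0) _ j.
  move=> s _; have := has_derivZ t (df (0 + s *: (t : R^o))).
  by rewrite scaler0 [t *: 1]mulr1.
by rewrite add0r mxE => /eqP; rewrite subr_eq0 => /eqP.
Qed.

Lemma has_derivB (f g : R -> E) t l l' : has_deriv f t 1 l -> has_deriv g t 1 l' ->
  has_deriv (fun s => f s - g s) t 1 (l - l').
Proof.
move=> df dg; apply: (has_deriv_eq _ _ (has_deriv_lin (-1) dg df)) => [u|]; rewrite scaleN1r.
  by rewrite (addrC (- g u)).
by rewrite (addrC (- l')).
Qed.

(** The derivative of [Ad (e (t *: A)) X] has exactly the form assumed for [u], so the difference of
    the two is constant and vanishes at 0. *)
Lemma Ad_flow A X (u : R -> E) : u 0 = X ->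
  (forall t, has_deriv u t 1 (Ad (e (t *: A)) (br A X))) -> forall t, Ad (e (t *: A)) X = u t.
Proof.
move=> u0 du t; apply/eqP; rewrite -subr_eq0; apply/eqP.
rewrite (has_deriv_cst0 (f := fun t => Ad (e (t *: A)) X - u t)).
  by rewrite scale0r (exp0 ex) (Ad1 ex) u0 subrr.
by move=> s; rewrite -(subrr (Ad (e (s *: A)) (br A X))); apply: has_derivB => //; exact: Ad_deriv_at.
Qed.

Lemma has_deriv_quadratic (X A C : E) (t : R) :
  has_deriv (fun t : R => X + t *: A + t ^+ 2 *: C) t 1 (A + (2 * t) *: C).
Proof.
move=> eps eps0; exists (eps / (`|C| + 1)); first by rewrite divr_gt0 // ltr_wpDl.
move=> h; rewrite ltr_pdivlMr ?ltr_wpDl // => hh; rewrite [h *: 1]mulr1.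
have -> : X + (t + h) *: A + (t + h) ^+ 2 *: C - (X + t *: A + t ^+ 2 *: C) - h *: (A + (2 * t) *: C) =
    h *: (h *: C) by apply/rowP => i; rewrite !mxE; ring.
rewrite !normrZ mulrC ler_wpM2r //; apply: le_trans (ltW hh).
by rewrite ler_wpM2l // lerDl.
Qed.

(** The exponential series of [ad A] at [X] stops after [Z]. [Ad_flow] is applied to [Z], [Y] and
    [X] in this order, since the derivative of each involves the next bracket. *)
Lemma Ad_quadratic A X Y Z : br A X = Y -> br A Y = Z -> br A Z = 0 ->
  forall t : R, Ad (e (t *: A)) X = X + t *: Y + t ^+ 2 *: (2^-1 *: Z).
Proof.
move=> h1 h2 h3.
have cZ t : Ad (e (t *: A)) Z = Z.
  apply: (Ad_flow (u := fun=> Z)) => // s; rewrite h3 Ad_0 => eps eps0.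
  by exists 1 => // h _; rewrite subrr scaler0 subr0 normr0 mulr_ge0 // ltW.
have cY t : Ad (e (t *: A)) Y = Y + t *: Z.
  apply: (Ad_flow (u := fun t => Y + t *: Z)) => [|s]; first by rewrite scale0r addr0.
  apply: (has_deriv_eq _ _ (has_deriv_quadratic Y Z 0 s)) => [u|].
    by rewrite scaler0 addr0.
  by rewrite h2 cZ scaler0 addr0.
apply: Ad_flow => [|s]; first by rewrite scale0r expr0n scale0r !addr0.
apply: (has_deriv_eq _ _ (has_deriv_quadratic X Y (2^-1 *: Z) s)) => //.
by rewrite h1 cY scalerA mulrAC mulfV ?mul1r.
Qed.

Lemma Ad_eigen A X (l : R) : br A X = l *: X ->
  forall t : R, Ad (e (t *: A)) X = expR (l * t) *: X.
Proof.
move=> hX t; apply/rowP => j.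
pose f (s : R) : R := Ad (e (s *: A)) X 0 j.
have df (s : R) : is_derive s 1 f (l * f s).
  have h := Ad_deriv_at A X s; rewrite hX AdZ' in h.
  have h' : has_deriv (fun s : R => Ad (e (s *: A)) X) (0 + s *: (1 : R^o)) 1 (l *: Ad (e (s *: A)) X).
    by rewrite add0r [s *: 1]mulr1.
  have := has_deriv_line (V := R^o) j h'; rewrite mxE => h2.
  have /has_derivP[d1 d2] : has_deriv f s 1 (l * f s).
    move=> eps eps0; have [r r0 hr] := h2 _ eps0; exists r => // u /hr.
    by rewrite /f !add0r ![_ *: (1 : R^o)]mulr1.
  by rewrite -d2; exact: DeriveDef.
have dg (s : R) : is_derive s 1 (fun s => expR (- l * s) * f s) 0.
  have d1 : is_derive s 1 (fun s => expR (- l * s)) (expR (- l * s) * - l).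
    have d0 : is_derive s 1 (fun s : R => - l * s) (- l).
      by have h := is_deriveZ (- l) (is_derive_id s (1 : R)); rewrite [- l *: 1]mulr1 in h.
    exact: (is_derive1_comp (is_derive_expR _) d0).
  have h := is_deriveM d1 (df s).
  have e0 : expR (- l * s) *: (l * f s) + f s *: (expR (- l * s) * - l) = 0 :> R.
    by rewrite /GRing.scale /=; ring.
  by rewrite e0 in h.
have := is_derive_0_is_cst t 0 dg.
rewrite mulr0 expR0 mul1r /f scale0r (exp0 ex) (Ad1 ex) mxE => <-.
by rewrite mulrA -expRD mulNr subrr expR0 mul1r.
Qed.

Lemma Ad_br g X Y : Ad g (br X Y) = br (Ad g X) (Ad g Y).
Proof.
have [C C0 hC] := Ad_bounded g.
have h1 := has_deriv_bounded (AdB _) (AdZ' _) hC (Ad_deriv ex X Y).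
apply: (has_deriv_unique h1).
apply: (has_deriv_eq _ _ (Ad_deriv ex (Ad g X) (Ad g Y))) => // t /=.
by rewrite -(exp_Ad ex) -!(AdM ex) mulgVK.
Qed.

(** This is the derivative at 0 of [Ad_br] along [e (t *: Z)]. For the product rule, the bracket of
    the moved vectors is split into two terms with one moved argument and the bracket of both
    increments, which is [O(t^2)]. *)
Lemma jacobi Z X Y : br Z (br X Y) = br (br Z X) Y + br X (br Z Y).
Proof.
have [K K0 hK] := br_bounded.
pose F (t : R) V := Ad (e (t *: Z)) V.
have F0 V : F 0 V = V by rewrite /F scale0r (exp0 ex) (Ad1 ex).
have dF V : has_deriv (fun t => F t V) 0 1 (br Z V) := Ad_deriv ex Z V.
have d1 : has_deriv (fun t => br (F t X) Y) 0 1 (br (br Z X) Y).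
  apply: (has_deriv_bounded (L := fun V => br V Y) (C := K * `|Y|)) (dF X) => //.
  - by move=> x y; rewrite brDl' brNl'.
  - by move=> x; rewrite mulrAC; exact: hK.
have d2 : has_deriv (fun t => br X (F t Y)) 0 1 (br X (br Z Y)).
  apply: (has_deriv_bounded (L := br X) (C := K * `|X|)) (dF Y) => //.
  by move=> x y; rewrite brDr' brNr'.
have d3 : has_deriv (fun t => br (F t X - X) (F t Y - Y)) 0 1 0.
  have bd V : exists2 r : R, 0 < r & forall h : R, `|h| < r -> `|F h V - V| <= (`|br Z V| + 1) * `|h|.
    have [r r0 hr] := dF V 1 ltr01; exists r => // h /hr.
    rewrite add0r [h *: 1]mulr1 F0 mul1r => h1.
    have := norm_tri_a (a := F h V - V) (b := h *: br Z V) (c := 0) (e := `|h|).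
    by rewrite subr0 normr0 addr0 normrZ => /(_ h1); lra.
  have [r1 r10 h1] := bd X; have [r2 r20 h2] := bd Y.
  pose M := (K + 1) * (`|br Z X| + 1) * (`|br Z Y| + 1).
  have M0 : 0 < M by rewrite !mulr_gt0 // ltr_wpDl.
  move=> eps eps0; exists (Num.min (Num.min r1 r2) (eps / M)).
    by rewrite !lt_min r10 r20 divr_gt0.
  move=> h; rewrite !lt_min => /andP[/andP[/h1 {}h1 /h2 {}h2]]; rewrite ltr_pdivlMr // => hM.
  rewrite scaler0 subr0 add0r [h *: 1]mulr1 !F0 !subrr.
  have -> : br 0 (0 : E) = 0 by have := brZl' 0 0 0; rewrite !scale0r.
  rewrite subr0; apply: le_trans (hK _ _) _.
  apply: le_trans (_ : (K + 1) * ((`|br Z X| + 1) * `|h|) * ((`|br Z Y| + 1) * `|h|) <= _).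
    apply: ler_pM => //; first by rewrite mulr_ge0.
    by apply: ler_pM => //; rewrite lerDl.
  have -> : (K + 1) * ((`|br Z X| + 1) * `|h|) * ((`|br Z Y| + 1) * `|h|) = (`|h| * M) * `|h|.
    by rewrite /M; ring.
  by rewrite ler_wpM2r // ltW.
apply: (has_deriv_unique (dF (br X Y))).
have d4 : has_deriv (fun t => F t (br X Y) + br X Y) 0 1 (br (br Z X) Y + br X (br Z Y)).
  apply: (has_deriv_eq _ _ (has_deriv_lin 1 d1 (has_deriv_lin 1 d2 d3))) => [t|].
    rewrite !scale1r /F Ad_br -/(F t X) -/(F t Y).
    by rewrite !brDl' !brDr' !brNl' !brNr'; apply/rowP => i; rewrite !mxE; ring.
  by rewrite !scale1r addr0.
move=> eps eps0; have [r r0 hr] := d4 _ eps0; exists r => // h /hr.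
by rewrite (opprD (F 0 _)) (addrACA (F (0 + _) _)) subrr addr0.
Qed.

End Exponential.

(** * Decay of matrix coefficients *)

Section RepresentationBasics.
Context {R : realType} {G : topologicalGroupType} {H : hilbertType R}.
Variable pi : unitary_representation G H.
Implicit Types (x y v : H) (g h : G).

Lemma rep_inner g x y : inner (pi g x) (pi g y) = inner x y.
Proof. exact: (rep_unitary pi g).1. Qed.

Lemma rep_rnorm g x : rnorm (pi g x) = rnorm x.
Proof.
apply/eqP; rewrite -(@eqrXn2 _ 2) ?rnorm_ge0 //; apply/eqP.
by have := rep_inner g x x; rewrite !innerxx => /eqP; rewrite eq_complex /= => /andP[/eqP].
Qed.

Lemma rep_mulVg g x : pi g^-1%g (pi g x) = x.
Proof. by rewrite -repM mulVg rep1. Qed.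

Lemma rep_mulgV g x : pi g (pi g^-1%g x) = x.
Proof. by rewrite -repM mulgV rep1. Qed.

Lemma rep_innerV g x y : inner (pi g x) y = inner x (pi g^-1%g y).
Proof. by rewrite -[in LHS](rep_mulgV g y) rep_inner. Qed.

Lemma repD g x y : pi g (x + y) = pi g x + pi g y.
Proof. exact: linearD. Qed.

Lemma repB g x y : pi g (x - y) = pi g x - pi g y.
Proof. exact: linearB. Qed.

Lemma repZ g (a : R[i]) x : pi g (a *: x) = a *: pi g x.
Proof. exact: linearZ. Qed.

Lemma rep_dist g x y : rnorm (pi g x - pi g y) = rnorm (x - y).
Proof. by rewrite -repB rep_rnorm. Qed.

Lemma rep_near g x (e : R) : 0 < e -> \forall h \near g, rnorm (pi g x - pi h x) < e.
Proof.
move=> e0; have c : pi h x @[h --> g] --> pi g x by exact: (@rep_strongly_continuous R G H pi x g).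
by have /cvg_rnormP/(_ e e0) := c.
Qed.

Lemma rep_near1 x (e : R) : 0 < e -> \forall g \near (1%g : G), rnorm (pi g x - x) < e.
Proof.
by move=> e0; have := rep_near 1%g x e0; apply: filterS => g; rewrite rep1 rdistC.
Qed.

Lemma rep_cvg (T : Type) (F : set_system T) {FF : Filter F} (u : T -> G) g x (e : R) :
  u t @[t --> F] --> g -> 0 < e -> \forall t \near F, rnorm (pi g x - pi (u t) x) < e.
Proof. by move=> ug e0; exact: (ug _ (rep_near g x e0)). Qed.

Lemma rep_fixed v g : inner (pi g v) v = inner v v -> pi g v = v.
Proof.
move=> h; apply/eqP; rewrite -subr_eq0 -rnorm_eq0 -sqrf_eq0; apply/eqP.
rewrite sqr_rnormB rep_rnorm h innerxx /=; ring.
Qed.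

Lemma rep_fixedV v g : pi g v = v -> pi g^-1%g v = v.
Proof. by move=> h; rewrite -{1}h rep_mulVg. Qed.

End RepresentationBasics.

Section Mixing.
Variables (R : realType) (n : nat) (G : topologicalGroupType) (H : hilbertType R).
Local Notation E := 'rV[R]_n.
Variables (br : E -> E -> E) (e : E -> G) (Ad : G -> E -> E) (p : E -> G).
Hypothesis ex : exponential br e Ad p.
Variable pi : unitary_representation G H.
Hypothesis irr : irreducible pi.
Variables (X0 H0 Z0 : E).
Hypotheses (HX : br H0 X0 = 2 *: X0) (HZ : br H0 Z0 = - (2 *: Z0)) (XZ : br X0 Z0 = H0).
Hypothesis Hdiag : forall x, eigen_sum br H0 x.
Hypothesis X0_act : exists t : R, exists v : H, pi (e (t *: X0)) v <> v.

Let a (r : R) := e (r *: H0).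
Let nn (t : R) := e (t *: X0).
Let zz (t : R) := e (t *: Z0).

Let conj_exp g X t : (g * e (t *: X) * g^-1)%g = e (t *: Ad g X).
Proof. exact: (exp_Ad ex). Qed.

Let eV X (t : R) : (e (t *: X))^-1%g = e (- t *: X).
Proof. by rewrite scaleNr (expN ex). Qed.

Let eM X (s t : R) : (e (s *: X) * e (t *: X))%g = e ((s + t) *: X).
Proof. by rewrite (expD ex). Qed.

Let e0 X : e (0 *: X) = 1%g.
Proof. by rewrite scale0r (exp0 ex). Qed.

Let conj_eigen X (l r t : R) : br H0 X = l *: X ->
  (a r * e (t *: X) * (a r)^-1)%g = e ((expR (l * r) * t) *: X).
Proof. by move=> hX; rewrite conj_exp (Ad_eigen ex hX) scalerA mulrC. Qed.

Let conj_n r t : (a r * nn t * (a r)^-1)%g = nn (expR (2 * r) * t).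
Proof. exact: conj_eigen. Qed.

Let conj_z r t : (a r * zz t * (a r)^-1)%g = zz (expR (- 2 * r) * t).
Proof. by apply: conj_eigen; rewrite HZ scaleNr. Qed.

(** A representative of the nontrivial Weyl element of the triple: [Ad w] sends [H0] to [- H0]. *)
Let w := (zz (- 1) * nn 1 * zz (- 1))%g.

Let ZX : br Z0 X0 = - H0. Proof. by rewrite (brC ex) XZ. Qed.
Let XH : br X0 H0 = - (2 *: X0). Proof. by rewrite (brC ex) HX. Qed.
Let ZH : br Z0 H0 = 2 *: Z0. Proof. by rewrite (brC ex) HZ opprK. Qed.

Let Ad_wH : Ad w H0 = - H0.
Proof.
have brxx x : br x x = 0 := brxx (brC ex) x.
have bZr := brZr (brZl ex) (brC ex); have bNr := brNr (brZl ex) (brC ex).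
have zH (t : R) : Ad (zz t) H0 = H0 + t *: (2 *: Z0).
  have h2 : br Z0 (2 *: Z0) = 0 by rewrite bZr brxx scaler0.
  have h3 : br Z0 (0 : E) = 0 := br0r (brZl ex) (brC ex) Z0.
  by have := Ad_quadratic ex ZH h2 h3 t; rewrite !scaler0 addr0.
have zZ (t : R) : Ad (zz t) Z0 = Z0.
  have h3 : br Z0 (0 : E) = 0 := br0r (brZl ex) (brC ex) Z0.
  by have := Ad_quadratic ex (brxx Z0) h3 h3 t; rewrite !scaler0 !addr0.
have nH : Ad (nn 1) H0 = H0 - 2 *: X0.
  have h2 : br X0 (- (2 *: X0)) = 0 by rewrite bNr bZr brxx scaler0 oppr0.
  have h3 : br X0 (0 : E) = 0 := br0r (brZl ex) (brC ex) X0.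
  by have := Ad_quadratic ex XH h2 h3 1; rewrite /nn !scaler0 addr0 !scale1r.
have nZ : Ad (nn 1) Z0 = Z0 + H0 - X0.
  have h3 : br X0 (- (2 *: X0)) = 0 by rewrite bNr bZr brxx scaler0 oppr0.
  have := Ad_quadratic ex XZ XH h3 1.
  by rewrite /nn expr1n !scale1r scalerN scalerA mulVf // scale1r.
rewrite /w !(AdM ex) zH scaleN1r (AdB ex) (AdZ ex (nn 1)) nH nZ.
have -> : H0 - 2 *: X0 - 2 *: (Z0 + H0 - X0) = - H0 - 2 *: Z0.
  by apply/rowP => i; rewrite !mxE; ring.
rewrite (AdB ex) (AdN ex) (AdZ ex) zH zZ scaleN1r.
by apply/rowP => i; rewrite !mxE; ring.
Qed.

Let conj_w r : (w * a r * w^-1)%g = a (- r).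
Proof. by rewrite conj_exp Ad_wH scalerN /a scaleNr. Qed.

(* [a r w a (-r)] is computed in two ways: conjugating the factors of [w] and
   moving [a (-r)] across [w]. *)
Let a_unipotent r : (zz (- expR (- 2 * r)) * nn (expR (2 * r)) * zz (- expR (- 2 * r)) * w^-1)%g = a (2 * r).
Proof.
have := conj_z r (- 1); have := conj_n r 1; rewrite mulrN !mulr1 => <- <-.
have -> : (a r * zz (- 1) * (a r)^-1 * (a r * nn 1 * (a r)^-1) * (a r * zz (- 1) * (a r)^-1) =
    a r * w * (a r)^-1)%g by rewrite /w !mulgA !mulgVK.
have -> : (a r * w * (a r)^-1 * w^-1 = a r * (w * (a r)^-1 * w^-1))%g by rewrite !mulgA.
by rewrite {2}/a eV -/(a _) conj_w opprK eM mulr_natl mulr2n.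
Qed.

Definition tends0 (f : R -> R) := forall eps : R, 0 < eps -> exists T : R, forall r, T <= r -> f r <= eps.

Lemma tends0_le (f g : R -> R) : (forall r, f r <= g r) -> tends0 g -> tends0 f.
Proof.
by move=> fg g0 eps eps0; have [T hT] := g0 _ eps0; exists T => r /hT; apply: le_trans.
Qed.

Lemma tends0D (f g : R -> R) : tends0 f -> tends0 g -> tends0 (fun r => f r + g r).
Proof.
move=> f0 g0 eps eps0; have e2 : 0 < eps / 2 by rewrite divr_gt0.
have [T hT] := f0 _ e2; have [U hU] := g0 _ e2; exists (Num.max T U) => r.
by rewrite ge_max => /andP[/hT h1 /hU h2]; rewrite (splitr eps) lerD.
Qed.

Lemma tends0M (f : R -> R) (C : R) : 0 <= C -> tends0 f -> tends0 (fun r => C * f r).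
Proof.
move=> C0 f0 eps eps0; have C1 : 0 < C + 1 by rewrite ltr_wpDl.
have [|T hT] := f0 (eps / (C + 1)); first by rewrite divr_gt0.
exists T => r /hT h; have := h; rewrite ler_pdivlMr // => h1.
have [fr|fr] := leP 0 (f r); first by apply: le_trans h1; rewrite mulrC ler_wpM2l // lerDl.
by apply: le_trans (ltW eps0); rewrite mulr_ge0_le0 // ltW.
Qed.

Lemma rep_exp_tends0 (X : E) x (u : R -> R) : (forall d : R, 0 < d -> exists T, forall r, T <= r -> `|u r| < d) ->
  tends0 (fun r => rnorm (pi (e (u r *: X)) x - x)).
Proof.
move=> hu eps eps0; have hc : e (t *: X) @[t --> (0 : R)] --> 1%g := @exp_cvg1 _ _ _ _ _ _ _ ex X.
have /nbhs_ballP[d /= d0 hd] := hc _ (rep_near1 pi x eps0).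
have [T hT] := hu d d0; exists T => r /hT ur; apply: ltW; apply: hd.
by rewrite /ball /= sub0r normrN.
Qed.

Let small_expN (c k d : R) : 0 < k -> 0 < d -> exists T, forall r, T <= r -> `|expR (- k * r) * c| < d.
Proof.
move=> k0 d0; pose N := (`|c| + 1) / d; have N0 : 0 < N by rewrite divr_gt0 // ltr_wpDl.
exists (N / k) => r; rewrite ler_pdivrMr // mulrC => Nr.
rewrite normrM gtr0_norm ?expR_gt0 // mulNr expRN mulrC ltr_pdivrMr ?expR_gt0 //.
have h : N < expR (k * r) by apply: lt_le_trans (expR_ge1Dx _); lra.
have : `|c| < d * N by rewrite mulrC divfK ?gt_eqF //; lra.
by move=> h2; apply: lt_trans h2 _; rewrite ltr_pM2l.
Qed.

Let coef x y r := rnorm (inner (pi (a r) x) y).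

(** [Sright] and [Snull] collect the vectors whose coefficients along [a r] tend to 0 when they
    stand on the right or on the left. Both are closed subspaces, so mixing reduces to showing that
    only 0 is orthogonal to [Snull]. *)
Let Sright := [set y : H | forall x, tends0 (coef x y)].
Let Snull := [set x : H | forall y, tends0 (coef x y)].

Let closed_subspaceR : closed Sright /\ subspace Sright.
Proof.
split.
  apply: rnorm_closed => y hy x eps eps0.
  have e1 : 0 < eps / (2 * (rnorm x + 1)) by rewrite divr_gt0 // mulr_gt0 // ltr_wpDl // rnorm_ge0.
  have [y' Sy' yy'] := hy _ e1; have e2 : 0 < eps / 2 by rewrite divr_gt0.
  have [T hT] := Sy' x _ e2; exists T => r /hT h.
  rewrite /coef -(subrK y' y) innerDr; apply: le_trans (cnormD _ _) _.
  rewrite (splitr eps) lerD //; apply: le_trans (cauchy_schwarz _ _) _; rewrite rep_rnorm.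
  rewrite ltr_pdivlMr ?mulr_gt0 // in yy'; last by rewrite ltr_wpDl // rnorm_ge0.
  by have := rnorm_ge0 x; have := rnorm_ge0 (y - y'); nra.
split=> [x eps eps0|c y y' hy hy' x]; first by exists 0 => r _; rewrite /coef inner0r cnorm0 ltW.
apply: (tends0_le (g := fun r => rnorm c * coef x y r + coef x y' r)).
  move=> r; rewrite /coef innerDr innerZr; apply: le_trans (cnormD _ _) _.
  by rewrite rnormM rnorm_conj.
by apply: tends0D => //; apply: tends0M => //; exact: rnorm_ge0.
Qed.

Let closed_subspaceL : closed Snull /\ subspace Snull.
Proof.
split.
  apply: rnorm_closed => x hx y eps eps0.
  have e1 : 0 < eps / (2 * (rnorm y + 1)) by rewrite divr_gt0 // mulr_gt0 // ltr_wpDl // rnorm_ge0.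
  have [x' Sx' xx'] := hx _ e1; have e2 : 0 < eps / 2 by rewrite divr_gt0.
  have [T hT] := Sx' y _ e2; exists T => r /hT h.
  rewrite /coef -(subrK x' x) repD innerDl; apply: le_trans (cnormD _ _) _.
  rewrite (splitr eps) lerD //; apply: le_trans (cauchy_schwarz _ _) _; rewrite rep_rnorm.
  rewrite ltr_pdivlMr ?mulr_gt0 // in xx'; last by rewrite ltr_wpDl // rnorm_ge0.
  by have := rnorm_ge0 y; have := rnorm_ge0 (x - x'); nra.
split=> [y eps eps0|c x x' hx hx' y].
  by exists 0 => r _; rewrite /coef linear0 inner0l cnorm0 ltW.
apply: (tends0_le (g := fun r => rnorm c * coef x y r + coef x' y r)).
  move=> r; rewrite /coef repD repZ innerDl innerZl; apply: le_trans (cnormD _ _) _.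
  by rewrite rnormM.
by apply: tends0D => //; apply: tends0M => //; exact: rnorm_ge0.
Qed.

(** Mautner's argument: [a r] contracts [zz s] as [r] grows, so [zz s] can be moved to the other
    side of the inner product, where it tends to the identity. *)
Let null_z s u : Snull (pi (zz s) u - u).
Proof.
move=> y; pose f r := rnorm u * rnorm (pi (zz (expR (- 2 * r) * - s)) y - y).
apply: (tends0_le (g := f)); last first.
  apply: tends0M; first exact: rnorm_ge0.
  by apply: rep_exp_tends0 => d d0; exact: small_expN.
move=> r; rewrite /coef repB -repM -[(a r * zz s)%g](mulgVK (a r)) conj_z repM.
rewrite innerBl rep_innerV eV -innerBr /f mulrN; apply: le_trans (cauchy_schwarz _ _) _.
by rewrite rep_rnorm.
Qed.

(** The elements [nn t] are expanded by [a r] but contracted by its inverse, so the same argument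
    works with [pi (nn t) u - u] as the right vector. *)
Let right_n t u : Sright (pi (nn t) u - u).
Proof.
move=> x; pose f r := rnorm u * rnorm (pi (nn (expR (- 2 * r) * - t)) x - x).
apply: (tends0_le (g := f)); last first.
  apply: tends0M; first exact: rnorm_ge0.
  by apply: rep_exp_tends0 => d d0; exact: small_expN.
move=> r; rewrite /coef innerBr -[inner _ (pi (nn t) u)]invrK invrK.
have -> : inner (pi (a r) x) (pi (nn t) u) = inner (pi (a r) (pi (nn (expR (- 2 * r) * - t)) x)) u.
  rewrite -[nn t]invgK -rep_innerV -!repM; congr (inner (pi _ _) _).
  have := conj_n (- r) (- t); rewrite (_ : 2 * - r = - 2 * r) => [<-|]; last by ring.
  rewrite /a !eV opprK.
  by rewrite !mulgA eM subrr e0 mul1g.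
rewrite -innerBl -repB; apply: le_trans (cauchy_schwarz _ _) _.
by rewrite rep_rnorm mulrC.
Qed.

Let fixed_n v := forall t, pi (nn t) v = v.

(** Split [y] along [Sright]. The part in [Sright] contributes a null coefficient by definition; the
    part orthogonal to it is fixed by every [nn s] because of [right_n], and its coefficient against
    [pi (nn t) u - u] is exactly 0. *)
Let null_n t u : Snull (pi (nn t) u - u).
Proof.
move=> y; have [y1 hy1 hy2] := projection y closed_subspaceR.1 closed_subspaceR.2.
have fy2 : fixed_n (y - y1).
  move=> s; apply: rep_fixed; have := hy2 _ (right_n (- s) (y - y1)).
  rewrite innerBr => /eqP; rewrite subr_eq0 => /eqP h.
  by rewrite rep_innerV eV h.
apply: (tends0_le _ (hy1 (pi (nn t) u - u))) => r.
rewrite /coef -[in X in X <= _](subrK y1 y) innerDr.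
suff -> : inner (pi (a r) (pi (nn t) u - u)) (y - y1) = 0 by rewrite add0r.
have fa : pi (nn (- t)) (pi (a r)^-1%g (y - y1)) = pi (a r)^-1%g (y - y1).
  rewrite -repM; have := conj_n r (- t) => h.
  have -> : (nn (- t) * (a r)^-1 = (a r)^-1 * nn (expR (2 * r) * - t))%g.
    by rewrite -h !mulgA mulVg mul1g.
  by rewrite repM fy2.
by rewrite rep_innerV innerBl [inner (pi (nn t) u) _]rep_innerV eV fa subrr.
Qed.

Let perp_fixed v (X : E) : (forall s u, inner v (pi (e (s *: X)) u - u) = 0) ->
  forall s, pi (e (s *: X)) v = v.
Proof.
move=> h s; apply: rep_fixed; have := h (- s) v; rewrite innerBr => /eqP.
by rewrite subr_eq0 => /eqP h2; rewrite rep_innerV eV h2.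
Qed.

Let fixed_a : set H := [set v | forall r, pi (a r) v = v].

(** Such a vector is fixed by all [nn s] and [zz s], hence by [w], and [a_unipotent] writes [a r] as
    a product of these. *)
Let perp_null_fixed v : (forall s, Snull s -> inner v s = 0) -> fixed_a v.
Proof.
move=> hv; have vn : forall s, pi (nn s) v = v by apply: perp_fixed => s u; apply: hv; exact: null_n.
have vz : forall s, pi (zz s) v = v by apply: perp_fixed => s u; apply: hv; exact: null_z.
have vw : pi w v = v by rewrite /w !repM vz vn vz.
move=> r; have := a_unipotent (r / 2); rewrite (_ : 2 * (r / 2) = r) => [<-|]; last by field.
by rewrite !repM (rep_fixedV vw) vz vn vz.
Qed.

Let closed_fixed g : closed [set v : H | pi g v = v].
Proof.
apply: rnorm_closed => v hv; apply/eqP; rewrite -subr_eq0 -rnorm_eq0 eq_le rnorm_ge0 andbT.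
apply/ler_addgt0Pr => eps eps0; have e2 : 0 < eps / 2 by rewrite divr_gt0.
have [u /= gu vu] := hv _ e2; rewrite add0r.
apply: le_trans (rdistD (pi g u) _ _) _; rewrite rep_dist gu [rnorm (u - v)]rdistC; lra.
Qed.

(** For [l = 0] the two subgroups commute. Otherwise [a r], with the sign of [r] opposite to that of
    [l], contracts [e (t *: X)] to 1 without changing its coefficient at [v], so [v] is fixed. *)
Let fixed_a_eigen v X (l : R) : fixed_a v -> br H0 X = l *: X -> forall t, fixed_a (pi (e (t *: X)) v).
Proof.
move=> va hX t; have [l0|l0] := eqVneq l 0.
  move=> r; rewrite -repM; have := conj_eigen r t hX; rewrite l0 mul0r expR0 mul1r => h.
  have -> : (a r * e (t *: X) = e (t *: X) * a r)%g by rewrite -{2}h mulgVK.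
  by rewrite repM va.
suff -> : pi (e (t *: X)) v = v by [].
apply: rep_fixed; have inv r : inner (pi (e ((expR (l * r) * t) *: X)) v) v = inner (pi (e (t *: X)) v) v.
  rewrite -(conj_eigen r t hX) !repM rep_fixedV // [LHS]rep_innerV rep_fixedV //.
apply/eqP; rewrite -subr_eq0 -cnorm_eq0 eq_le rnorm_ge0 andbT; apply/ler_addgt0Pr => eps eps0.
have v1 : 0 < rnorm v + 1 by rewrite ltr_wpDl // rnorm_ge0.
have k0 : 0 < `|l| by rewrite normr_gt0.
have [|T hT] := @rep_exp_tends0 X v (fun r => expR (- `|l| * r) * t) _ (eps / (rnorm v + 1)) (divr_gt0 eps0 v1).
  by move=> d d0; exact: small_expN.
have := hT T (lexx _); rewrite ler_pdivlMr // => h.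
have lT : - `|l| * T = l * (- Num.sg l * T).
  by rewrite normrEsg; ring.
rewrite -(inv (- Num.sg l * T)) -lT -innerBl add0r.
apply: le_trans (cauchy_schwarz _ _) _; apply: le_trans h.
by rewrite ler_wpM2l ?rnorm_ge0 // lerDl.
Qed.

(** The elements preserving [fixed_a] form a closed set stable under products. It contains the
    exponentials of eigenvectors of [ad H0], by Trotter's formula those of their sums, by [Hdiag]
    all exponentials, and these generate [G]. *)
Let fixed_a_full v g : fixed_a v -> fixed_a (pi g v).
Proof.
pose S : set G := [set g | forall v, fixed_a v -> fixed_a (pi g v)].
have S1 : S 1%g by move=> u; rewrite rep1.
have SM g1 g2 : S g1 -> S g2 -> S (g1 * g2)%g by move=> h1 h2 u fu; rewrite repM; apply/h1/h2.
have cS : closed S.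
  move=> g0 cg u fu r; apply: (closed_rnorm (S := [set v : H | pi (a r) v = v])).
    exact: closed_fixed.
  move=> eps eps0; have [g1 [Sg1 h]] := cg _ (rep_near pi g0 u eps0).
  by exists (pi g1 u) => //; exact: Sg1.
have SX m g1 : S g1 -> S (g1 ^+ m)%g.
  by move=> h; elim: m => [|m ih]; rewrite ?expg0 // expgS; exact: SM.
pose L : set E := [set X | forall t : R, S (e (t *: X))].
have LD X Y : L X -> L Y -> L (X + Y).
  move=> hX hY t; rewrite scalerDr.
  apply: (@closed_cvg _ _ _ _ _ S cS _ _ (@exp_trotter _ _ _ _ _ _ _ ex (t *: X) (t *: Y))).
  by apply: nearW => k; apply: SX; apply: SM; rewrite scalerA.
have L0 : L 0 by move=> t; rewrite scaler0 (exp0 ex).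
have LX X : L X.
  have [s -> hs] := Hdiag X; rewrite big_seq; apply: big_ind => // q0 /hs hq t u fu.
  exact: fixed_a_eigen fu hq t.
have SG : S = setT.
  by apply: (exp_generate ex) => // X; have := LX X 1; rewrite scale1r.
have : S g by rewrite SG.
by apply.
Qed.

(** By irreducibility [fixed_a] is 0 or everything. In the second case [X0], an eigenvector of
    [ad H0], would act trivially by the contraction argument, against [X0_act]. *)
Let fixed_a_eq0 v : fixed_a v -> v = 0.
Proof.
move=> fv; have [_ /(_ fixed_a)[]] := irr.
- apply: rnorm_closed => u hu r; apply: (closed_rnorm (S := [set v : H | pi (a r) v = v])).
    exact: closed_fixed.
  by move=> eps /hu[u' fu' uu']; exists u' => //; exact: fu'.
- by move=> r; exact: linear0.
- by move=> c x y fx fy r; rewrite repD repZ fx fy.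
- by move=> g x; exact: fixed_a_full.
- by move=> h; have : fixed_a v by []; rewrite h.
move=> fT; have [t [u hu]] := X0_act; exfalso; apply: hu.
have fu : fixed_a u by rewrite fT.
apply: rep_fixed; apply/eqP; rewrite -subr_eq0 -cnorm_eq0 eq_le rnorm_ge0 andbT.
apply/ler_addgt0Pr => eps eps0; have v1 : 0 < rnorm u + 1 by rewrite ltr_wpDl // rnorm_ge0.
have [|T hT] := @rep_exp_tends0 X0 u (fun r => expR (- 2 * r) * t) _ (eps / (rnorm u + 1)) (divr_gt0 eps0 v1).
  by move=> d d0; exact: small_expN.
have := hT T (lexx _); rewrite ler_pdivlMr // => h.
have -> : inner (pi (e (t *: X0)) u) u = inner (pi (nn (expR (- 2 * T) * t)) u) u.
  have := conj_n (- T) t; rewrite (_ : 2 * - T = - 2 * T) => [<-|]; last by ring.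
  rewrite !repM.
  by rewrite rep_fixedV // [RHS]rep_innerV rep_fixedV.
rewrite -innerBl add0r; apply: le_trans (cauchy_schwarz _ _) _; apply: le_trans h.
by rewrite ler_wpM2l ?rnorm_ge0 // lerDl.
Qed.

Let a_mixing x y : tends0 (coef x y).
Proof.
apply: (subspace_full closed_subspaceL.1 closed_subspaceL.2) => v hv.
by apply: fixed_a_eq0; exact: perp_null_fixed.
Qed.

(** Solving [a_unipotent] for the unipotent factor gives [nn t = zz (1/t) a(ln t) w zz (1/t)]; both
    outer factors tend to 1, so mixing along [a] carries over. *)
Let n_mixing x y : tends0 (fun t => rnorm (inner (pi (nn t) x) y)).
Proof.
have key t : 0 < t -> rnorm (inner (pi (nn t) x) y) <= coef (pi w x) y (ln t) +
   (rnorm x * rnorm (pi (zz (- t^-1)) y - y) + rnorm y * rnorm (pi (zz t^-1) x - x)).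
  move=> t0; pose r := ln t / 2.
  have r2 : 2 * r = ln t by rewrite mulrC divfK.
  have et : expR (2 * r) = t by rewrite r2 lnK // posrE.
  have et' : expR (- 2 * r) = t^-1 by rewrite mulNr expRN et.
  have -> : nn t = (zz t^-1 * a (ln t) * w * zz t^-1)%g.
    have := a_unipotent r; rewrite et et' r2 => <-.
    have gen (z1 z2 n0 w0 : G) : (z1 * z2 = 1 -> z2 * z1 = 1 ->
        n0 = z1 * (z2 * n0 * z2 * w0^-1) * w0 * z1)%g.
      by move=> h1 h2; rewrite !mulgA mulgVK h1 mul1g -mulgA h2 mulg1.
    by apply: gen; rewrite /zz eM ?subrr ?addNr e0.
  rewrite 3!repM rep_innerV eV -/(zz _).
  set x' := pi (zz t^-1) x; set y' := pi (zz (- t^-1)) y.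
  have -> : inner (pi (a (ln t)) (pi w x')) y' = inner (pi (a (ln t)) (pi w x)) y +
     (inner (pi (a (ln t)) (pi w x')) (y' - y) + inner (pi (a (ln t)) (pi w (x' - x))) y).
    by rewrite !repB innerBr innerBl; ring.
  apply: le_trans (cnormD _ _) _; rewrite lerD //; apply: le_trans (cnormD _ _) _.
  rewrite lerD //; apply: le_trans (cauchy_schwarz _ _) _; rewrite !rep_rnorm //.
  by rewrite mulrC.
have c1 : tends0 (fun t => coef (pi w x) y (ln t)).
  move=> eps eps0; have [T hT] := a_mixing (pi w x) y eps0; exists (expR T) => t tT; apply: hT.
  by rewrite -(expRK T) ler_ln ?posrE ?expR_gt0 // (lt_le_trans _ tT) ?expR_gt0.
have invd (d : R) : 0 < d -> exists T : R, forall r, T <= r -> `|r^-1| < d.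
  move=> d0; exists (d^-1 + 1) => r hr; have d1 : 0 < d^-1 by rewrite invr_gt0.
  have r0 : 0 < r by lra.
  rewrite gtr0_norm ?invr_gt0 // -[ltRHS]invrK ltf_pV2 ?posrE //; lra.
have c2 : tends0 (fun t => rnorm x * rnorm (pi (zz (- t^-1)) y - y)).
  apply: tends0M; first exact: rnorm_ge0.
  by apply: rep_exp_tends0 => d /invd[T hT]; exists T => r; rewrite normrN; exact: hT.
have c3 : tends0 (fun t => rnorm y * rnorm (pi (zz t^-1) x - x)).
  apply: tends0M; first exact: rnorm_ge0.
  by apply: rep_exp_tends0 => d /invd.
move=> eps eps0; have [T hT] := tends0D c1 (tends0D c2 c3) eps0.
exists (Num.max T 1) => t; rewrite ge_max => /andP[/hT h t1].
by apply: le_trans (key t _) h; lra.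
Qed.

Lemma sl2_mixing : exists (u : R -> G) (h : nat -> G),
  [/\ forall s t, u (s + t) = (u s * u t)%g,
      forall x y (eps : R), 0 < eps -> exists T, forall t, T <= t -> rnorm (inner (pi (u t) x) y) <= eps,
      forall x y (eps : R), 0 < eps -> exists N, forall k, (N <= k)%N -> rnorm (inner (pi (h k) x) y) <= eps &
      forall t, (h k * u t * (h k)^-1)%g @[k --> \oo] --> 1%g].
Proof.
exists nn, (fun k => a (- k%:R)); split.
- by move=> s t; rewrite /nn eM.
- exact: n_mixing.
- move=> x y eps eps0; have [T hT] := a_mixing y x eps0.
  exists (Num.truncn `|T|).+1 => k hk; rewrite rep_innerV /a eV opprK rnorm_innerC; apply: hT.
  have /andP[_ h] : (Num.truncn `|T|)%:R <= `|T| < (Num.truncn `|T|).+1%:R by exact: truncn_itv.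
  apply: le_trans (ler_norm T) _; apply: le_trans (ltW h) _; by rewrite ler_nat.
move=> t; have hc : e (s *: X0) @[s --> (0 : R)] --> 1%g := @exp_cvg1 _ _ _ _ _ _ _ ex X0.
have h0 : (expR (- 2 * k%:R) * t) @[k --> \oo] --> (0 : R).
  apply/cvgrPdist_le => eps eps0; have [|T hT] := @small_expN t 2 eps _ eps0; first by [].
  exists (Num.truncn `|T|).+1 => // k /= hk; rewrite sub0r normrN ltW //; apply: hT.
  have /andP[_ h] : (Num.truncn `|T|)%:R <= `|T| < (Num.truncn `|T|).+1%:R by exact: truncn_itv.
  apply: le_trans (ler_norm T) _; apply: le_trans (ltW h) _; by rewrite ler_nat.
apply: (near_cvg _ (cvg_comp _ _ h0 hc)); apply: nearW => k /=.
by have h := conj_n (- k%:R) t; rewrite (_ : 2 * - k%:R = - 2 * k%:R) in h; last by ring.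
Qed.

End Mixing.

(** * Representations with totally bounded orbits *)

Section RankOneSums.
Context {R : realType} {H : hilbertType R}.
Local Notation C := R[i].
Implicit Types (s t : seq (R * H)) (x y v : H).

(** A list of weighted vectors represents the self-adjoint finite-rank operator [sum c <., v> v];
    [hs] is the Hilbert-Schmidt product of two such operators, read off from the lists. *)
Definition op_of s x : H := \sum_(p <- s) p.1%:C *: (inner x p.2 *: p.2).
Definition hs s t : R := \sum_(p <- s) \sum_(r <- t) p.1 * r.1 * rnorm (inner p.2 r.2) ^+ 2.
Definition scale_list (a : R) s := [seq (a * p.1, p.2) | p <- s].

Lemma op_of_cat s t x : op_of (s ++ t) x = op_of s x + op_of t x.
Proof. by rewrite /op_of big_cat. Qed.

Lemma op_of_scale a s x : op_of (scale_list a s) x = a%:C *: op_of s x.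
Proof.
rewrite /op_of big_map scaler_sumr; apply: eq_bigr => p _ /=.
by rewrite rmorphM /= -scalerA.
Qed.

Lemma op_ofD s x y : op_of s (x + y) = op_of s x + op_of s y.
Proof.
rewrite /op_of -big_split; apply: eq_bigr => p _ /=.
by rewrite innerDl scalerDl scalerDr.
Qed.

Lemma op_ofZ s (a : C) x : op_of s (a *: x) = a *: op_of s x.
Proof.
rewrite /op_of scaler_sumr; apply: eq_bigr => p _.
by rewrite innerZl !scalerA mulrCA mulrA.
Qed.

Lemma op_of_sym s x y : inner (op_of s x) y = inner x (op_of s y).
Proof.
rewrite /op_of inner_suml inner_sumr; apply: eq_bigr => p _.
rewrite !innerZl !innerZr conjc_real; congr (_ * _).
by rewrite -innerC mulrC.
Qed.

Lemma hsC s t : hs s t = hs t s.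
Proof.
rewrite /hs exchange_big /=; apply: eq_bigr => p _; apply: eq_bigr => r _.
by rewrite rnorm_innerC (mulrC r.1).
Qed.

Lemma hs_catl s t u : hs (s ++ t) u = hs s u + hs t u.
Proof. by rewrite /hs big_cat. Qed.

Lemma hs_catr s t u : hs u (s ++ t) = hs u s + hs u t.
Proof. by rewrite hsC hs_catl !(hsC _ u). Qed.

Lemma hs_scalel a s t : hs (scale_list a s) t = a * hs s t.
Proof.
rewrite /hs big_map mulr_sumr; apply: eq_bigr => p _.
by rewrite mulr_sumr; apply: eq_bigr => r _ /=; rewrite !mulrA.
Qed.

Lemma hs_scaler a s t : hs s (scale_list a t) = a * hs s t.
Proof. by rewrite hsC hs_scalel hsC. Qed.

Lemma hsE s t : (hs s t)%:C = \sum_(r <- t) r.1%:C * inner (op_of s r.2) r.2.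
Proof.
rewrite hsC /hs raddf_sum /=; apply: eq_bigr => r _; rewrite raddf_sum /=.
rewrite /op_of inner_suml mulr_sumr; apply: eq_bigr => p _.
rewrite !innerZl (rmorphM _ (r.1 * p.1)) (rmorphM _ r.1) /= sqr_rnormC -mulrA.
by rewrite -innerC.
Qed.

Definition list_basis s : nat -> H := gram_schmidt (fun k => (nth (0, 0) s k).2).

Lemma list_basisP s p : p \in s -> proj_sum (list_basis s) (size s) p.2 = p.2.
Proof.
move=> ps; pose v k := (nth (0, 0) s k).2; pose i := index p s.
have iN : (i < size s)%N by rewrite index_mem.
have vi : v i = p.2 by rewrite /v nth_index.
rewrite -vi; apply: (proj_sum_stable (gram_schmidt_orthosys v) iN).
by rewrite /proj_sum -gram_schmidtE.
Qed.

(* For an orthonormal system [e] spanning the vectors of [s], the squares of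
   the norms of [op_of s (e k)] add up to [hs s s]. *)
Lemma op_of_bound s x : rnorm (op_of s x) ^+ 2 <= hs s s * rnorm x ^+ 2.
Proof.
pose e := list_basis s; pose N := size s.
have oe : orthosys e := gram_schmidt_orthosys _.
have span p : p \in s -> proj_sum e N p.2 = p.2 by exact: list_basisP.
have opN y : proj_sum e N (op_of s y) = op_of s y.
  rewrite {1}/op_of big_seq /proj_sum.
  transitivity (\sum_(p <- s | p \in s) p.1%:C *: (inner y p.2 *: proj_sum e N p.2)).
    transitivity (\sum_(k < N) \sum_(p <- s | p \in s)
      inner (p.1%:C *: (inner y p.2 *: p.2)) (e k) *: e k).
      by apply: eq_bigr => k _; rewrite inner_suml scaler_suml.
    rewrite exchange_big /=; apply: eq_bigr => p _.
    rewrite !scaler_sumr; apply: eq_bigr => k _.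
    by rewrite !innerZl !scalerA !mulrA.
  by rewrite /op_of [RHS]big_seq; apply: eq_bigr => p /span ->.
rewrite -opN (sqr_proj_sum oe).
apply: le_trans (_ : \sum_(k < N) rnorm x ^+ 2 * rnorm (op_of s (e k)) ^+ 2 <= _).
  apply: ler_sum => k _; rewrite op_of_sym -exprMn ler_sqr ?nnegrE ?mulr_ge0 ?rnorm_ge0 //.
  exact: cauchy_schwarz.
rewrite -mulr_sumr mulrC ler_wpM2r ?sqr_ge0 // le_eqVlt; apply/orP; left; apply/eqP.
apply: (@complexI R).
rewrite raddf_sum hsE /=; under eq_bigr do rewrite sqr_rnorm.
under eq_bigr => k _ do rewrite {2}/op_of inner_sumr.
rewrite exchange_big big_seq [RHS]big_seq /=; apply: eq_bigr => p ps.
transitivity (\sum_(k < N) p.1%:C * (inner p.2 (e k) * inner (op_of s (e k)) p.2)).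
  by apply: eq_bigr => k _; rewrite !innerZr conjc_real -innerC.
rewrite -mulr_sumr op_of_sym; congr (_ * _).
rewrite -[X in inner X (op_of _ _)](span p ps) /proj_sum inner_suml.
by apply: eq_bigr => k _; rewrite innerZl -op_of_sym.
Qed.

End RankOneSums.
Lemma eq0_of_inv_bound (R : realType) (a C : R) : 0 <= a ->
  (forall j : nat, a <= j.+1%:R^-1 * C) -> a = 0.
Proof.
move=> a0 h; apply/eqP; rewrite eq_le a0 andbT; apply/ler_addgt0Pr => e e0.
have C1 : 0 < `|C| + 1 by rewrite ltr_wpDl.
have [N hN] := invn_lt (divr_gt0 e0 C1); have := hN N (leqnn N); rewrite ltr_pdivlMr // => h2.
rewrite add0r; apply: le_trans (h N) _; apply: le_trans (ltW h2).
by rewrite ler_wpM2l // (le_trans (ler_norm C)) // lerDl.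
Qed.

(** * Convergent subsequences along an ultrafilter *)

Section UltraOscillation.
Variables (R : realType) (H : hilbertType R) (U : set_system nat).
Context {UF : UltraFilter U}.

(** Compactness gives a cluster point along [U], and an ultrafilter must contain the preimage of
    each ball around it. A single ultrafilter treats all coefficients at once, where subsequences
    would have to be extracted repeatedly. *)
Lemma ultra_osc_real (f : nat -> R) (B e : R) : (forall j, `|f j| <= B) -> 0 < e ->
  exists2 A, U A & forall i j, A i -> A j -> `|f i - f j| <= e.
Proof.
move=> fB e0; have cpt : compact `[(- B), B] by exact: segment_compact.
have fU : U (f @^-1` (`[(- B), B]%classic)).
  by apply: filterS filterT => j _; rewrite /= in_itv /= -ler_norml; exact: fB.
have [p [_ hp]] : `[(- B), B]%classic `&` cluster (f @ U) !=set0 by apply: cpt.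
have e2 : 0 < e / 2 by rewrite divr_gt0.
have nb : nbhs p (ball p (e / 2)) by exact: nbhsx_ballx.
have [h|h] := in_ultra_setVsetC (f @^-1` ball p (e / 2)) UF.
  exists (f @^-1` ball p (e / 2)) => // i j; rewrite /ball /= => hi hj.
  by apply: le_trans (ler_distD p _ _) _; rewrite distrC (splitr e) lerD // ltW.
have [x [h1 h2]] := hp (~` ball p (e / 2)) _ h nb.
by case: h1.
Qed.

Lemma ultra_osc_complex (f : nat -> R[i]) (B e : R) : (forall j, rnorm (f j) <= B) -> 0 < e ->
  exists2 A, U A & forall i j, A i -> A j -> rnorm (f i - f j) <= e.
Proof.
move=> fB e0; have e2 : 0 < e / 2 by rewrite divr_gt0.
have ReB j : `|complex.Re (f j)| <= B by apply: le_trans (Re_le_rnorm _) (fB j).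
have ImE (z : R[i]) : complex.Im z = complex.Re ('i * - z).
  by case: z => a b /=; simpc; ring.
have ni : rnorm ('i : R[i]) = 1.
  by rewrite /rnorm normCi.
have ImB j : `|complex.Im (f j)| <= B.
  by rewrite ImE; apply: le_trans (Re_le_rnorm _) _; rewrite rnormM ni mul1r cnormN.
have [A1 U1 h1] := ultra_osc_real ReB e2; have [A2 U2 h2] := ultra_osc_real ImB e2.
exists (A1 `&` A2); first exact: filterI.
move=> i j [i1 i2] [j1 j2].
have -> : f i - f j = (complex.Re (f i) - complex.Re (f j))%:C +
    'i * (complex.Im (f i) - complex.Im (f j))%:C.
  by case: (f i) => a b; case: (f j) => c d; simpc.
apply: le_trans (cnormD _ _) _; rewrite rnormM ni mul1r !rnormC (splitr e).
by rewrite lerD ?h1 ?h2.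
Qed.

Lemma ultra_osc_op (x : nat -> H) (s : seq (R * H)) (e : R) : (forall j, rnorm (x j) <= 1) -> 0 < e ->
  exists2 A, U A & forall i j, A i -> A j -> rnorm (op_of s (x i) - op_of s (x j)) <= e.
Proof.
move=> x1; elim: s e => [|p s ih] e e0.
  exists setT; first exact: filterT.
  by move=> i j _ _; rewrite /op_of !big_nil subrr rnorm0 ltW.
have e2 : 0 < e / 2 by rewrite divr_gt0.
pose C := `|p.1| * rnorm p.2 + 1; have C0 : 0 < C by rewrite ltr_wpDl // mulr_ge0 ?rnorm_ge0.
have [A UA hA] := ih _ e2.
have [|A' UA' hA'] := @ultra_osc_complex (fun j => inner (x j) p.2) (rnorm p.2) (e / 2 / C) _ (divr_gt0 e2 C0).
  move=> j; apply: le_trans (cauchy_schwarz _ _) _.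
  by rewrite -[leRHS]mul1r ler_wpM2r ?rnorm_ge0.
exists (A `&` A'); first exact: filterI.
move=> i j [i1 i2] [j1 j2].
rewrite /op_of !big_cons -!/(op_of s _) opprD addrACA -scalerBr -scalerBl.
apply: le_trans (rnormD _ _) _; rewrite (splitr e) lerD ?hA // !rnormZ rnormC.
have := hA' i j i2 j2; rewrite ler_pdivlMr // => h; apply: le_trans h.
rewrite mulrCA ler_wpM2l ?rnorm_ge0 // lerDl //.
Qed.

(** [jj k] is picked in the intersection of the first [k + 1] sets of small oscillation, which
    belongs to [U]; since [U] refines [\oo], it can be taken at least [k]. *)
Lemma ultra_subsequence (y : nat -> H) : \oo `<=` U ->
  (forall e : R, 0 < e -> exists2 A, U A & forall i j, A i -> A j -> rnorm (y i - y j) <= e) ->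
  exists jj : nat -> nat, (forall k, (k <= jj k)%N) /\
    exists l : H, forall e : R, 0 < e -> exists N, forall k, (N <= k)%N -> rnorm (l - y (jj k)) < e.
Proof.
move=> ooU hy.
have /choice[A hA] : forall k : nat, exists A : set nat, U A /\
    forall i j, A i -> A j -> rnorm (y i - y j) <= k.+1%:R^-1.
  by move=> k; have [|A UA h] := hy k.+1%:R^-1; [rewrite invr_gt0 | exists A].
have UB k : U (\bigcap_(i < k.+1) A i).
  elim: k => [|k ih].
    by apply: filterS (hA 0).1 => j Aj i /=; rewrite ltnS leqn0 => /eqP ->.
  apply: filterS (filterI ih (hA k.+1).1) => j [h1 h2] i /=.
  by rewrite ltnS leq_eqVlt => /orP[/eqP -> //|]; exact: h1.
have /choice[jj hjj] : forall k, exists j, (k <= j)%N /\ (\bigcap_(i < k.+1) A i) j.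
  move=> k; have Uk : U [set j | (k <= j)%N] by apply: ooU; exists k.
  by have [j [h1 h2]] := filter_ex (filterI Uk (UB k)); exists j.
exists jj; split; first by move=> k; case: (hjj k).
apply: rnorm_complete => e e0; have [N hN] := invn_lt e0; exists N => k l Nk Nl.
apply: le_lt_trans (hN N (leqnn N)); apply: (hA N).2.
  by apply: (hjj k).2; rewrite /= ltnS.
by apply: (hjj l).2; rewrite /= ltnS.
Qed.

End UltraOscillation.

(** * The averaged rank one projection and its spectrum *)

Section FiniteOrbitNet.
Context {R : realType} {G : topologicalGroupType} {H : hilbertType R}.
Variable pi : unitary_representation G H.
Hypothesis irr : irreducible pi.
Variable psi : H.
Hypothesis psi1 : rnorm psi = 1.
Variables (m : nat) (f : 'I_m -> H).
Hypothesis net : forall g, exists i, rnorm (pi g psi - f i) <= 4^-1.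
Implicit Types (s t : seq (R * H)) (x y : H).

Definition convex_orbit s :=
  (forall p, p \in s -> 0 <= p.1 /\ exists g, p.2 = pi g psi) /\ \sum_(p <- s) p.1 = 1.

Let m0 : (0 < m)%N.
Proof. by have [i _] := net 1%g; apply: leq_ltn_trans (ltn_ord i). Qed.

Let orbit1 s p : convex_orbit s -> p \in s -> rnorm p.2 = 1.
Proof. by move=> [hs1 _] /hs1[_ [g ->]]; rewrite rep_rnorm. Qed.

(** Distribute the weights over the [m] cells of the net. The squares of the cell masses add up to
    at least [1/m], and two unit vectors of a common cell are at distance at most 1/2, so their
    squared overlap is at least 1/2. *)
Let convex_lower s : convex_orbit s -> (2 * m%:R)^-1 <= hs s s.
Proof.
move=> cs; have [i0 _] := net 1%g.
pose idx v : 'I_m := odflt i0 [pick i | rnorm (v - f i) <= 4^-1].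
have idxP p : p \in s -> rnorm (p.2 - f (idx p.2)) <= 4^-1.
  move=> /cs.1[_ [g ->]]; rewrite /idx; case: pickP => [i //|h].
  by have [i hi] := net g; rewrite h in hi.
have close p r : p \in s -> r \in s -> idx p.2 = idx r.2 -> 2^-1 <= rnorm (inner p.2 r.2) ^+ 2.
  move=> ps rs e; have h1 := idxP _ ps; have h2 := idxP _ rs; rewrite -e rdistC in h2.
  have h3 := rdistD (f (idx p.2)) p.2 r.2.
  have h4 : rnorm (p.2 - r.2) <= 2^-1 by lra.
  have h5 := sqr_rnormB p.2 r.2; rewrite !(orbit1 cs) // expr1n in h5.
  have h6 : rnorm (p.2 - r.2) ^+ 2 <= 2^-1 ^+ 2 by rewrite ler_sqr ?nnegrE ?rnorm_ge0.
  have h7 : 7 / 8 <= rnorm (inner p.2 r.2).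
    have := Re_le_rnorm (inner p.2 r.2); have := ler_norm (complex.Re (inner p.2 r.2)).
    by rewrite expr2 in h6; lra.
  by rewrite expr2; nra.
pose W (k : 'I_m) := \sum_(p <- s) p.1 * (idx p.2 == k)%:R.
have W1 : \sum_k W k = 1.
  rewrite exchange_big /= -[RHS]cs.2; apply: eq_bigr => p _.
  rewrite (bigD1 (idx p.2)) //= eqxx mulr1 big1 ?addr0 // => k; rewrite eq_sym => /negbTE ->.
  by rewrite mulr0.
have mp : 0 < m%:R :> R by rewrite ltr0n.
have W2 : m%:R^-1 <= \sum_k W k ^+ 2.
  have : 0 <= \sum_k (W k - m%:R^-1) ^+ 2 by apply: sumr_ge0 => k _; exact: sqr_ge0.
  have -> : \sum_k (W k - m%:R^-1) ^+ 2 = \sum_k W k ^+ 2 - m%:R^-1.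
    transitivity (\sum_k (W k ^+ 2 - 2 * m%:R^-1 * W k + m%:R^-1 ^+ 2)).
      by apply: eq_bigr => k _; ring.
    rewrite big_split /= sumrB -mulr_sumr W1 sumr_const card_ord -mulr_natl.
    by field; rewrite gt_eqF.
  lra.
have E : \sum_k W k ^+ 2 = \sum_(p <- s) \sum_(r <- s) p.1 * r.1 * (idx p.2 == idx r.2)%:R.
  transitivity (\sum_k \sum_(p <- s) \sum_(r <- s) p.1 * r.1 * ((idx p.2 == k)%:R * (idx r.2 == k)%:R)).
    apply: eq_bigr => k _; rewrite expr2 /W mulr_suml; apply: eq_bigr => p _.
    by rewrite mulr_sumr; apply: eq_bigr => r _; ring.
  rewrite exchange_big /=; apply: eq_bigr => p _.
  rewrite exchange_big /=; apply: eq_bigr => r _.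
  rewrite -mulr_sumr; congr (_ * _).
  rewrite (bigD1 (idx p.2)) //= eqxx /= mul1r big1 ?addr0; first by rewrite eq_sym.
  by move=> k; rewrite eq_sym => /negbTE ->; rewrite mul0r.
rewrite invfM; apply: le_trans (ler_wpM2l _ W2) _; first by rewrite invr_ge0.
rewrite E /hs mulr_sumr !big_seq; apply: ler_sum => p ps; rewrite mulr_sumr !big_seq.
apply: ler_sum => r rs; have [[p0 _] [r0 _]] := (cs.1 p ps, cs.1 r rs).
have [e|_] := eqVneq (idx p.2) (idx r.2); last first.
  by rewrite !mulr0 mulr_ge0 ?sqr_ge0 // mulr_ge0.
by rewrite mulr1 mulrC ler_wpM2l ?mulr_ge0 ?close.
Qed.

Let A := [set hs s s | s in convex_orbit].
Let d := inf A.

Let A0 : A !=set0.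
Proof.
exists (hs [:: (1, psi)] [:: (1, psi)]); exists [:: (1, psi)] => //; split.
  by move=> p; rewrite inE => /eqP -> /=; split=> //; exists 1%g; rewrite rep1.
by rewrite big_seq1.
Qed.

Let Alb : lbound A 0.
Proof.
move=> _ [s cs <-]; apply: le_trans (convex_lower cs).
by rewrite invr_ge0 mulr_ge0.
Qed.

Let d_le s : convex_orbit s -> d <= hs s s.
Proof. by move=> cs; apply: ge_inf; [exists 0; exact: Alb | exists s]. Qed.

Let mid s t := scale_list 2^-1 s ++ scale_list 2^-1 t.
Let diff s t := s ++ scale_list (- 1) t.

Let convex_mid s t : convex_orbit s -> convex_orbit t -> convex_orbit (mid s t).
Proof.
move=> cs ct; split.
  move=> p; rewrite mem_cat => /orP[] /mapP[r rs ->] /=.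
    by have [r0 ?] := cs.1 r rs; split=> //; rewrite mulr_ge0.
  by have [r0 ?] := ct.1 r rs; split=> //; rewrite mulr_ge0.
rewrite big_cat !big_map /= -!mulr_sumr cs.2 ct.2; lra.
Qed.

(** The parallelogram law for the Hilbert-Schmidt norm; the midpoint is again a convex combination,
    of squared norm at least [d]. *)
Let diff_small s t : convex_orbit s -> convex_orbit t ->
  hs (diff s t) (diff s t) <= 2 * (hs s s - d) + 2 * (hs t t - d).
Proof.
move=> cs ct; have := d_le (convex_mid cs ct).
rewrite /mid /diff !hs_catl !hs_catr !hs_scalel !hs_scaler (hsC t s); lra.
Qed.

Let op_diff s t x : op_of (diff s t) x = op_of s x - op_of t x.
Proof. by rewrite op_of_cat op_of_scale rmorphN /= scaleN1r. Qed.

Let close s t (a : R) x : convex_orbit s -> convex_orbit t -> 0 <= a ->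
  hs s s <= d + a ^+ 2 / 4 -> hs t t <= d + a ^+ 2 / 4 ->
  rnorm (op_of s x - op_of t x) <= a * rnorm x.
Proof.
move=> cs ct a0 hs1 ht1; rewrite -ler_sqr ?nnegrE ?mulr_ge0 ?rnorm_ge0 // -op_diff.
apply: le_trans (op_of_bound _ _) _; rewrite exprMn ler_wpM2r ?sqr_ge0 //.
apply: le_trans (diff_small cs ct) _; lra.
Qed.

Let ex_min : exists S : nat -> seq (R * H), forall j, convex_orbit (S j) /\
  hs (S j) (S j) <= d + j.+1%:R^-1 ^+ 2 / 4.
Proof.
suff /choice[S hS] : forall j : nat, exists s, convex_orbit s /\
    hs s s <= d + j.+1%:R^-1 ^+ 2 / 4 by exists S.
move=> j; have e0 : 0 < j.+1%:R^-1 ^+ 2 / 4 :> R by rewrite divr_gt0 // exprn_gt0 // invr_gt0.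
have lA : has_lbound A by exists 0; exact: Alb.
have [_ [s cs <-] h] := inf_adherent e0 (conj A0 lA).
by exists s; split=> //; exact: ltW.
Qed.

(** Nearly minimal combinations are close to each other in Hilbert-Schmidt norm, hence in operator
    norm, so a minimising sequence converges. Its translate by [g] is again minimising and has the
    same limit, which is why [K] commutes with [pi]. *)
Lemma ex_averaging : exists (S : nat -> seq (R * H)) (K : H -> H),
  [/\ forall j, convex_orbit (S j),
      forall j x, rnorm (K x - op_of (S j) x) <= j.+1%:R^-1 * rnorm x &
      forall g x, K (pi g x) = pi g (K x)].
Proof.
have [S hS] := ex_min; exists S.
have cS j : convex_orbit (S j) by case: (hS j).
have inv_le (j k : nat) : (j <= k)%N -> k.+1%:R^-1 <= j.+1%:R^-1 :> R.
  by move=> jk; rewrite lef_pV2 ?posrE // ler_nat.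
have cl j k x : (j <= k)%N -> rnorm (op_of (S j) x - op_of (S k) x) <= j.+1%:R^-1 * rnorm x.
  move=> jk; apply: close => //; first by case: (hS j).
  apply: le_trans (hS k).2 _; rewrite lerD2l ler_pM2r ?invr_gt0 //.
  by rewrite ler_sqr ?nnegrE ?invr_ge0 // inv_le.
have /choice[K hK] : forall x, exists y : H, forall j,
    rnorm (y - op_of (S j) x) <= j.+1%:R^-1 * rnorm x.
  move=> x; have x1 : 0 < rnorm x + 1 by rewrite ltr_wpDl // rnorm_ge0.
  have [|y hy] := @rnorm_complete R H (fun j => op_of (S j) x).
    move=> e e0; have [N hN] := invn_lt (divr_gt0 e0 x1); exists N.
    have main k l : (N <= k)%N -> (k <= l)%N -> rnorm (op_of (S k) x - op_of (S l) x) < e.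
      move=> Nk kl; apply: le_lt_trans (cl _ _ _ kl) _.
      have := hN k Nk; rewrite ltr_pdivlMr // => h; apply: le_lt_trans h.
      by rewrite ler_wpM2l // lerDl.
    move=> k l Nk Nl; have [kl|/ltnW lk] := leqP k l; first exact: main.
    by rewrite rdistC; exact: main.
  exists y => j; apply/ler_addgt0Pr => e e0; have [N hN] := hy e e0.
  apply: le_trans (rdistD (op_of (S (maxn N j)) x) _ _) _; rewrite addrC lerD //.
    by rewrite rdistC; apply: cl; exact: leq_maxr.
  by apply: ltW; apply: hN; exact: leq_maxl.
exists K; split=> // g x.
apply/eqP; rewrite -subr_eq0 -rnorm_eq0; apply/eqP.
apply: (@eq0_of_inv_bound _ _ (3 * rnorm x)); first exact: rnorm_ge0.
move=> j; pose T := [seq (p.1, pi g p.2) | p <- S j].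
have cT : convex_orbit T.
  split; last by rewrite big_map /=; case: (cS j).
  by move=> _ /mapP[p ps ->] /=; have [p0 [h ->]] := (cS j).1 p ps; split=> //; exists (g * h)%g; rewrite repM.
have hT : hs T T = hs (S j) (S j).
  rewrite /hs big_map; apply: eq_bigr => p _; rewrite big_map; apply: eq_bigr => r _ /=.
  by rewrite rep_inner.
have opT : op_of T (pi g x) = pi g (op_of (S j) x).
  rewrite /op_of big_map linear_sum /=; apply: eq_bigr => p _.
  by rewrite !repZ rep_inner.
have h1 := hK (pi g x) j; rewrite rep_rnorm in h1.
have h2 : rnorm (op_of (S j) (pi g x) - op_of T (pi g x)) <= j.+1%:R^-1 * rnorm x.
  rewrite -[in leRHS](rep_rnorm pi g x); apply: close => //; first by case: (hS j).
  by rewrite hT; case: (hS j).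
have h3 := hK x j; rewrite -(rep_dist pi g) -opT in h3.
have h4 := rdistD (op_of (S j) (pi g x)) (K (pi g x)) (pi g (K x)).
have h5 := rdistD (op_of T (pi g x)) (op_of (S j) (pi g x)) (pi g (K x)).
rewrite rdistC in h3; apply: le_trans h4 _.
apply: le_trans (lerD h1 (le_trans h5 (lerD h2 h3))) _.
by rewrite le_eqVlt; apply/orP; left; apply/eqP; ring.
Qed.

(** [hs] of [S N] with itself is a weighted mean of [<op_of (S N) r, r>] over unit vectors, so an
    operator bound [1/(N+1)] would push it below the bound of [convex_lower]. *)
Let K_zero_contra (S : nat -> seq (R * H)) : (forall j, convex_orbit (S j)) ->
  ~ forall j x, rnorm (op_of (S j) x) <= j.+1%:R^-1 * rnorm x.
Proof.
move=> cS h; have k0 : 0 < (2 * m%:R)^-1 :> R by rewrite invr_gt0 mulr_gt0 // ltr0n.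
have [N hN] := invn_lt k0; have h1 := convex_lower (cS N).
suff : hs (S N) (S N) <= N.+1%:R^-1.
  by move=> h2; have := le_lt_trans (le_trans h1 h2) (hN N (leqnn N)); rewrite ltxx.
have -> : hs (S N) (S N) = complex.Re (\sum_(r <- S N) r.1%:C * inner (op_of (S N) r.2) r.2) by rewrite -hsE.
have -> : N.+1%:R^-1 = \sum_(p <- S N) N.+1%:R^-1 * p.1 by rewrite -mulr_sumr (cS N).2 mulr1.
rewrite raddf_sum /= !big_seq.
apply: ler_sum => r rs; have [r0 _] := (cS N).1 r rs.
apply: le_trans (ler_norm _) _; apply: le_trans (Re_le_rnorm _) _.
rewrite rnormM rnormCr // mulrC ler_wpM2r //; apply: le_trans (cauchy_schwarz _ _) _.
rewrite (orbit1 (cS N) rs) mulr1; apply: le_trans (h _ _) _.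
by rewrite (orbit1 (cS N) rs) mulr1.
Qed.

(** [K] is nonzero, compact and self-adjoint. Its square has the eigenvalue [N^2], with [N] the norm
    of [K]; the eigenspace is invariant, so it is all of [H] and [K] multiplies norms by [N]. But
    [K] is within less than [N] of a finite-rank operator, which kills a nonzero vector when the
    dimension is infinite. *)
Theorem finite_net_finite_dim : ~ infinite_dimensional H.
Proof.
move=> inf; have [S [K [cS hK KG]]] := ex_averaging.
have approx (x : H) (C : R) : (forall j : nat, rnorm x <= j.+1%:R^-1 * C) -> x = 0.
  by move=> h; apply/eqP; rewrite -rnorm_eq0 (eq0_of_inv_bound (rnorm_ge0 x) h).
have KD x y : K (x + y) = K x + K y.
  apply/eqP; rewrite -subr_eq0; apply/eqP.
  apply: (@approx _ (rnorm (x + y) + (rnorm x + rnorm y))) => j.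
  have -> : K (x + y) - (K x + K y) = (K (x + y) - op_of (S j) (x + y)) -
     ((K x - op_of (S j) x) + (K y - op_of (S j) y)).
    by rewrite op_ofD addrACA -opprD opprB addrA subrK.
  apply: le_trans (rnormB _ _) _; rewrite mulrDr lerD //.
  by apply: le_trans (rnormD _ _) _; rewrite mulrDr lerD.
have KZ (a : R[i]) x : K (a *: x) = a *: K x.
  apply/eqP; rewrite -subr_eq0; apply/eqP.
  apply: (@approx _ (rnorm (a *: x) + rnorm a * rnorm x)) => j.
  have -> : K (a *: x) - a *: K x = (K (a *: x) - op_of (S j) (a *: x)) - a *: (K x - op_of (S j) x).
    by rewrite op_ofZ scalerBr opprB addrA subrK.
  apply: le_trans (rnormB _ _) _; rewrite mulrDr lerD // rnormZ mulrCA.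
  by rewrite ler_wpM2l ?rnorm_ge0.
have K0 : K 0 = 0 by have := KZ 0 0; rewrite !scale0r.
have KB x y : K (x - y) = K x - K y by rewrite KD -scaleN1r KZ scaleN1r.
have Ksym x y : inner (K x) y = inner x (K y).
  apply/eqP; rewrite -subr_eq0 -cnorm_eq0; apply/eqP.
  apply: (@eq0_of_inv_bound _ _ (2 * rnorm x * rnorm y)); first exact: rnorm_ge0.
  move=> j; have -> : inner (K x) y - inner x (K y) =
     inner (K x - op_of (S j) x) y - inner x (K y - op_of (S j) y).
    by rewrite innerBl innerBr op_of_sym; ring.
  apply: le_trans (cnormB _ _) _.
  apply: le_trans (lerD (cauchy_schwarz _ _) (cauchy_schwarz _ _)) _.
  have h1 := ler_wpM2r (rnorm_ge0 y) (hK j x); have h2 := ler_wpM2l (rnorm_ge0 x) (hK j y).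
  apply: le_trans (lerD h1 h2) _; rewrite le_eqVlt; apply/orP; left; apply/eqP; ring.
pose B := Num.sqrt (hs (S 0) (S 0)) + 1.
have KB1 x : rnorm (K x) <= B * rnorm x.
  have h := hK 0 x; rewrite invr1 mul1r in h.
  have hs0 : 0 <= hs (S 0) (S 0).
    by apply: le_trans (convex_lower (cS 0)); rewrite invr_ge0 mulr_ge0.
  have h2 : rnorm (op_of (S 0) x) <= Num.sqrt (hs (S 0) (S 0)) * rnorm x.
    rewrite -ler_sqr ?nnegrE ?rnorm_ge0 ?mulr_ge0 ?rnorm_ge0 ?sqrtr_ge0 //.
    by rewrite exprMn sqr_sqrtr //; exact: op_of_bound.
  have := rnormD (K x - op_of (S 0) x) (op_of (S 0) x); rewrite subrK => h3.
  apply: le_trans h3 _; rewrite mulrDl mul1r addrC; exact: lerD.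
pose E := [set rnorm (K x) | x in [set x : H | rnorm x <= 1]].
have E0 : E !=set0 by exists (rnorm (K 0)); exists 0 => //=; rewrite rnorm0.
have B0 : 0 <= B by rewrite addr_ge0 ?sqrtr_ge0.
have Eub : has_ubound E.
  exists B => _ [x /= x1 <-]; apply: le_trans (KB1 x) _.
  by rewrite -[leRHS]mulr1 ler_wpM2l.
pose N := sup E.
have KN1 x : rnorm x <= 1 -> rnorm (K x) <= N by move=> x1; apply: ub_le_sup => //; exists x.
have N_ge0 : 0 <= N by apply: le_trans (rnorm_ge0 (K 0)) (KN1 0 _); rewrite rnorm0.
have KN x : rnorm (K x) <= N * rnorm x.
  have [->|x0] := eqVneq x 0; first by rewrite K0 rnorm0 mulr0.
  have xp : 0 < rnorm x by rewrite rnorm_gt0.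
  have := KN1 (((rnorm x)^-1)%:C *: x); rewrite KZ !rnormZ rnormCr ?invr_ge0 ?rnorm_ge0 //.
  by rewrite mulVf ?gt_eqF // => /(_ (lexx _)); rewrite mulrC ler_pdivrMr.
have N0 : 0 < N.
  rewrite lt_neqAle N_ge0 andbT eq_sym; apply/eqP => Nz.
  apply: (K_zero_contra cS) => j x; have := hK j x.
  have -> : K x = 0.
    by apply/eqP; rewrite -rnorm_eq0 eq_le rnorm_ge0 andbT; have := KN x; rewrite Nz mul0r.
  by rewrite sub0r rnormN.
have /choice[x hx] : forall j : nat, exists x : H, rnorm x <= 1 /\ N - j.+1%:R^-1 < rnorm (K x).
  move=> j; have i0 : 0 < j.+1%:R^-1 :> R by rewrite invr_gt0.
  by have [_ [x /= x1 <-] h] := sup_adherent i0 (conj E0 Eub); exists x.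
have x1 j : rnorm (x j) <= 1 by case: (hx j).
have [U [UF ooU]] := ultraFilterLemma (eventually_filter : ProperFilter \oo).
have osc (e : R) : 0 < e -> exists2 A, U A & forall i j, A i -> A j -> rnorm (K (x i) - K (x j)) <= e.
  move=> e0; have e4 : 0 < e / 4 by rewrite divr_gt0.
  have [l hl] := invn_lt e4; have := hl l (leqnn l) => hll.
  have e2 : 0 < e / 2 by rewrite divr_gt0.
  have [A1 UA hA] := ultra_osc_op (S l) x1 e2; exists A1 => // i j Ai Aj.
  have h k : rnorm (K (x k) - op_of (S l) (x k)) <= e / 4.
    apply: le_trans (hK l _) _; apply: le_trans (ltW hll).
    by rewrite -[leRHS]mulr1 ler_wpM2l ?invr_ge0.
  apply: le_trans (rdistD (op_of (S l) (x i)) _ _) _.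
  apply: le_trans (lerD (h i) (rdistD (op_of (S l) (x j)) _ _)) _.
  apply: le_trans (lerD (lexx _) (lerD (hA i j Ai Aj) (lexx _))) _.
  by have := h j; rewrite rdistC; lra.
have [jj [jjk [y hy]]] := ultra_subsequence ooU osc.
(* For a maximising sequence [|K^2 x - N^2 x|^2 <= N^2 (N^2 - |K x|^2)], which tends to 0. *)
have sq j : rnorm (K (K (x j)) - (N ^+ 2)%:C *: x j) ^+ 2 <= N ^+ 2 * (2 * N * j.+1%:R^-1).
  rewrite sqr_rnormB rnormZ rnormCr ?sqr_ge0 // innerZr conjc_real [inner (K _) _]Ksym innerxx.
  have -> : complex.Re ((N ^+ 2)%:C * (rnorm (K (x j)) ^+ 2)%:C) = N ^+ 2 * rnorm (K (x j)) ^+ 2.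
    by rewrite -rmorphM.
  have h1 : rnorm (K (K (x j))) ^+ 2 <= N ^+ 2 * rnorm (K (x j)) ^+ 2.
    by rewrite -exprMn ler_sqr ?nnegrE ?mulr_ge0 ?rnorm_ge0.
  have h2 : (N ^+ 2 * rnorm (x j)) ^+ 2 <= N ^+ 2 * N ^+ 2.
    rewrite -[leRHS]expr2 ler_sqr ?nnegrE ?mulr_ge0 ?sqr_ge0 ?rnorm_ge0 //.
    by rewrite -[leRHS]mulr1 ler_wpM2l ?sqr_ge0.
  have h3 : N ^+ 2 - rnorm (K (x j)) ^+ 2 <= 2 * N * j.+1%:R^-1.
    have [_ h] := hx j; have h4 := KN1 _ (x1 j); have i0 : 0 <= j.+1%:R^-1 :> R by rewrite invr_ge0.
    have h5 := rnorm_ge0 (K (x j)).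
    have -> : N ^+ 2 - rnorm (K (x j)) ^+ 2 = (N - rnorm (K (x j))) * (N + rnorm (K (x j))) by ring.
    apply: le_trans (_ : j.+1%:R^-1 * (N + N) <= _).
      apply: ler_pM; rewrite ?subr_ge0 ?addr_ge0 ?lerD2l //.
      by rewrite lerBlDl -lerBlDr ltW.
    by rewrite le_eqVlt; apply/orP; left; apply/eqP; ring.
  have := ler_wpM2l (sqr_ge0 N) h3; rewrite mulrBr => h4.
  apply: le_trans h4; lra.
have Ky_lim (e : R) : 0 < e -> exists k0, forall k, (k0 <= k)%N ->
    rnorm (K y - (N ^+ 2)%:C *: x (jj k)) < e.
  move=> e0; have e2 : 0 < e / 2 by rewrite divr_gt0.
  have [k1 hk1] := hy _ (divr_gt0 e2 N0).
  have c0 : 0 < 2 * N ^+ 3 by rewrite mulr_gt0 ?exprn_gt0.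
  have [k2 hk2] := invn_lt (divr_gt0 (exprn_gt0 2 e2) c0).
  exists (maxn k1 k2) => k; rewrite geq_max => /andP[/hk1 h1 kk2].
  have h2 := hk2 _ (leq_trans kk2 (jjk k)); rewrite ltr_pdivlMr // in h2.
  have h3 : rnorm (K (K (x (jj k))) - (N ^+ 2)%:C *: x (jj k)) < e / 2.
    rewrite -ltr_sqr ?nnegrE ?rnorm_ge0 ?(ltW e2) //; apply: le_lt_trans (sq _) _.
    apply: le_lt_trans h2; rewrite le_eqVlt; apply/orP; left; apply/eqP; ring.
  have h4 : rnorm (K y - K (K (x (jj k)))) <= e / 2.
    rewrite -KB; apply: le_trans (KN _) _; move: h1; rewrite ltr_pdivlMr // mulrC.
    exact: ltW.
  apply: le_lt_trans (rdistD (K (K (x (jj k)))) _ _) _.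
  by rewrite [ltRHS](splitr e); exact: ler_ltD.
(* Along the subsequence [K x] tends to [y] and [K^2 x - N^2 x] to 0, so [x] itself converges to
   [z], the eigenvector sought. *)
pose z : H := ((N ^+ 2)^-1)%:C *: K y.
have N2 : N ^+ 2 != 0 by rewrite expf_neq0 // gt_eqF.
have NNz : (N ^+ 2)%:C *: z = K y by rewrite /z scalerA -rmorphM /= mulfV // scale1r.
have Kz : K z = y.
  apply/eqP; rewrite -subr_eq0 -rnorm_eq0 eq_le rnorm_ge0 andbT; apply/ler_addgt0Pr => e e0.
  have e2 : 0 < e / 2 by rewrite divr_gt0.
  have [k1 hk1] := hy _ e2; have [|k2 hk2] := Ky_lim (e / 2 * N).
    by rewrite mulr_gt0.
  pose k := maxn k1 k2; have h1 := hk1 k (leq_maxl _ _); have h2 := hk2 k (leq_maxr _ _).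
  rewrite -NNz -scalerBr rnormZ rnormCr ?sqr_ge0 // in h2.
  have {}h2 : N * rnorm (z - x (jj k)) < e / 2.
    by rewrite -(ltr_pM2l N0) mulrA -expr2 [X in _ < X]mulrC.
  rewrite add0r; apply: le_trans (rdistD (K (x (jj k))) _ _) _; rewrite (splitr e) lerD //.
    by rewrite -KB; apply: le_trans (KN _) (ltW h2).
  by rewrite rdistC ltW.
have y0 : y != 0.
  apply/eqP => yz; have N2p : 0 < N / 2 by rewrite divr_gt0.
  have [k1 hk1] := hy _ N2p; have [k2 hk2] := invn_lt N2p.
  pose k := maxn k1 k2; have h1 := hk1 k (leq_maxl _ _).
  have h2 := hk2 _ (leq_trans (leq_maxr _ _ : (k2 <= k)%N) (jjk k)).
  have [_ h3] := hx (jj k); rewrite yz sub0r rnormN in h1.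
  have h4 : N - N / 2 < rnorm (K (x (jj k))) by apply: le_lt_trans h3; rewrite lerD2l lerN2 ltW.
  by have := lt_trans h4 h1; lra.
pose V := [set u : H | K (K u) = (N ^+ 2)%:C *: u].
have VT : V = setT.
  have [_ /(_ V)[]] := irr.
  - apply: rnorm_closed => u hu; apply/eqP; rewrite -subr_eq0 -rnorm_eq0 eq_le rnorm_ge0 andbT.
    apply/ler_addgt0Pr => e e0; have c0 : 0 < 2 * N ^+ 2 by rewrite mulr_gt0 // exprn_gt0.
    have [w Vw uw] := hu _ (divr_gt0 e0 c0); rewrite add0r.
    have -> : K (K u) - (N ^+ 2)%:C *: u = K (K (u - w)) - (N ^+ 2)%:C *: (u - w).
      by rewrite !KB Vw scalerBr opprB addrA subrK.
    apply: le_trans (rnormB _ _) _; rewrite rnormZ rnormCr ?sqr_ge0 //.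
    have h1 := KN (K (u - w)); have h2 := ler_wpM2l N_ge0 (KN (u - w)).
    have h3 := le_trans h1 h2; rewrite ltr_pdivlMr // in uw.
    apply: le_trans (lerD h3 (lexx _)) _; apply: le_trans (ltW uw).
    rewrite le_eqVlt; apply/orP; left; apply/eqP; ring.
  - by rewrite /V /= K0 scaler0.
  - by move=> a u w hu hw; rewrite /V /= !KD !KZ hu hw scalerDr !scalerA mulrC.
  - by move=> g u hu; rewrite /V /= !KG hu repZ.
  - move=> V0; have : V z by rewrite /V /= Kz NNz.
    by rewrite V0 /= => zz; move: y0; rewrite -Kz zz K0 eqxx.
  - by [].
have [l hl] := invn_lt N0; have := hl l (leqnn l) => hll.
pose e := list_basis (S l); pose sz := size (S l).
have [w hw] := inf sz (fun i => e i).
pose u := w - proj_sum e sz w.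
have u0 : u != 0.
  by apply/eqP => /eqP; rewrite subr_eq0 => /eqP uw; apply: (hw (fun i => inner w (e i))).
have opu : op_of (S l) u = 0.
  rewrite /op_of big_seq big1 // => p0 ps.
  by rewrite -(list_basisP ps) inner_proj_sum_perp ?scale0r ?scaler0 //; exact: gram_schmidt_orthosys.
have Ku : rnorm (K u) = N * rnorm u.
  have : V u by rewrite VT.
  move=> hu; apply/eqP; rewrite -(@eqrXn2 _ 2) ?mulr_ge0 ?rnorm_ge0 //; apply/eqP.
  have h := Ksym (K u) u; rewrite hu innerZl !innerxx -rmorphM /= in h.
  by move/eqP: h; rewrite eq_complex /= => /andP[/eqP <- _]; rewrite exprMn.
have := hK l u; rewrite opu subr0 Ku ler_pM2r ?rnorm_gt0 //.
by move=> /le_lt_trans/(_ hll); rewrite ltxx.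
Qed.

End FiniteOrbitNet.

(** * Rigidity of the adjoint representation *)

Lemma mulmx_norm (R : realType) m n q (A : 'M[R]_(m, n)) (B : 'M[R]_(n, q)) :
  `|A *m B| <= n%:R * (`|A| * `|B|).
Proof.
apply: mx_norm_le => [|i j]; first by rewrite !mulr_ge0.
rewrite mxE; apply: le_trans (ler_norm_sum _ _ _) _.
apply: le_trans (_ : \sum_(k < n) `|A| * `|B| <= _); last first.
  by rewrite sumr_const card_ord mulr_natl.
by apply: ler_sum => k _; rewrite normrM ler_pM ?mx_norm_coord.
Qed.

Lemma mxtrace_norm (R : realType) n (A : 'M[R]_n) : `|\tr A| <= n%:R * `|A|.
Proof.
apply: le_trans (ler_norm_sum _ _ _) _.
apply: le_trans (_ : \sum_(k < n) `|A| <= _); last by rewrite sumr_const card_ord mulr_natl.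
by apply: ler_sum => k _; exact: mx_norm_coord.
Qed.

Lemma delta_norm (R : realType) n (i : 'I_n) : `|delta_mx 0 i : 'rV[R]_n| <= 1.
Proof.
by apply: mx_norm_le => // a b; rewrite mxE; case: (_ && _); rewrite ?normr1 ?normr0.
Qed.

Lemma scalar1_norm (R : realType) n : `|1%:M : 'M[R]_n| <= 1.
Proof. by apply: mx_norm_le => // i j; rewrite mxE; case: (i == j); rewrite ?normr1 ?normr0. Qed.

Lemma trace_pow_nilpotent (R : realType) n (D : 'M[R]_n) :
  (forall j, \tr (D ^+ j.+1) = 0) -> exists k, D ^+ k = 0.
Proof. by move=> h; have [S [_ tr0 nil _]] := replica D; apply: nil; exact: tr0. Qed.

Section Rigidity.
Variables (R : realType) (n : nat) (G : topologicalGroupType).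
Local Notation E := 'rV[R]_n.
Variables (br : E -> E -> E) (e : E -> G) (Ad : G -> E -> E) (p : E -> G).
Hypothesis ex : exponential br e Ad p.
Hypothesis killing_nd : forall x, (forall y, killing br x y = 0) -> x = 0.

Let brDl' := brDl ex.
Let brZl' := brZl ex.
Let brC' := brC ex.
Let jac := jacobi ex.
Local Notation ad := (ad br).
Local Notation Adm := (Adm Ad).
Local Notation kil := (killing br).

Lemma killing_repr : exists2 C : R, 0 <= C & forall l : E, exists X : E,
  `|X| <= C * `|l| /\ forall V, kil X V = (l *m V^T) 0 0.
Proof.
have uK := killing_mx_unit brDl' brZl' brC' killing_nd.
exists (n%:R * `|invmx (killing_mx br)|); first by rewrite mulr_ge0.
move=> l; exists (l *m invmx (killing_mx br)); split.
  by rewrite -mulrA (mulrC `|invmx _|); exact: mulmx_norm.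
by move=> V; rewrite (killingE brDl' brZl' brC') -(mulmxA l) mulVmx // mulmx1.
Qed.

Lemma killing_bound : exists2 C : R, 0 <= C & forall (x : E) (M : R), 0 <= M ->
  (forall V, `|kil x V| <= M * `|V|) -> `|x| <= C * M.
Proof.
have [C C0 hC] := killing_repr; exists C => // x M M0 hM.
pose l : E := x *m killing_mx br.
have [X [Xl hX]] := hC l.
have -> : x = X.
  apply/eqP; rewrite -subr_eq0; apply/eqP; apply: killing_nd => V.
  rewrite (killingDl brDl' brZl' brC') -scaleN1r (killingZl brDl' brZl' brC') hX.
  by rewrite (killingE brDl' brZl' brC') mulN1r subrr.
apply: le_trans Xl _; rewrite ler_wpM2l //; apply: mx_norm_le => // i j.
have -> : l i j = kil x (delta_mx 0 j).
  rewrite (killingE brDl' brZl' brC') ord1 [RHS]mxE (bigD1 j) //= big1 ?addr0 => [|k kj].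
    by rewrite !mxE !eqxx mulr1.
  by rewrite [X in _ * X]mxE [X in _ * X]mxE (negPf kj) andbF mulr0.
apply: le_trans (hM _) _; rewrite -[leRHS]mulr1 ler_wpM2l //; exact: delta_norm.
Qed.

Lemma ad_norm : exists2 K : R, 0 <= K & forall x, `|ad x| <= K * `|x|.
Proof.
have [K K0 hK] := br_bounded ex; exists K => // x; apply: mx_norm_le => [|i j].
  by rewrite mulr_ge0.
rewrite mxE; apply: le_trans (mx_norm_coord _ _ _) _; apply: le_trans (hK _ _) _.
by rewrite -[leRHS]mulr1 ler_wpM2l ?mulr_ge0 // delta_norm.
Qed.

Lemma norm_le_ad : exists2 C : R, 0 <= C & forall x, `|x| <= C * `|ad x|.
Proof.
have [C C0 hC] := killing_bound; have [K K0 hK] := ad_norm.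
exists (C * (n%:R * (n%:R * K))); first by rewrite !mulr_ge0.
move=> x; rewrite -mulrA; apply: hC => [|V]; first by rewrite !mulr_ge0.
apply: le_trans (mxtrace_norm _) _; rewrite -!mulrA ler_wpM2l //.
apply: le_trans (mulmx_norm _ _) _; rewrite ler_wpM2l // mulrCA ler_wpM2l //; exact: hK.
Qed.

Lemma Adm_ad g W : ad W *m Adm g = Adm g *m ad (W *m Adm g).
Proof.
apply/row_matrixP => i; rewrite !rowE !mulmxA.
by rewrite (mul_ad brDl' brZl' brC') !(mul_Adm ex) (mul_ad brDl' brZl' brC') (Ad_br ex).
Qed.

(* The Lie algebra has only inner derivations, so an automorphism close to 1
   is close to [1 + ad X] to second order. *)
Lemma inner_approx : exists2 C : R, 0 <= C & forall g, let D := Adm g - 1%:M in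
  exists X : E, `|X| <= C * `|D| /\ `|D - ad X| <= C * `|D| ^+ 2.
Proof.
have [C C0 hC] := killing_repr; have [K K0 hK] := ad_norm.
have [C' C'0 hC'] := killing_bound.
pose C1 := C * (n%:R * (n%:R * K)); pose C2 := C' * (n%:R * (n%:R * (n%:R * (n%:R * K * K)))).
have C10 : 0 <= C1 by rewrite !mulr_ge0.
have C20 : 0 <= C2 by rewrite !mulr_ge0.
exists (C1 + C2) => [|g D]; first exact: addr_ge0.
have AD : Adm g = 1%:M + D by rewrite addrC subrK.
(* Up to the quadratic last term, the automorphism property of [1 + D] makes [D] a derivation. *)
have adWD W : ad (W *m D) = ad W *m D - D *m ad W - D *m ad (W *m D).
  have := Adm_ad g W; rewrite AD mulmxDr mulmx1 mulmxDl mul1mx mulmxDr mulmx1.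
  rewrite (adD brDl' brZl' brC') mulmxDr -addrA => /addrI ->.
  move: (D *m ad W) (ad (W *m D)) (mulmxDr D (ad W) (ad (W *m D))) => u a ->.
  by move: (D *m a) => v; apply/matrixP => i j; rewrite !mxE; ring.
clearbody D.
(* Representing [V |-> tr (D ad V)] by the Killing form selects the [X] for which [D - ad X] is
   trace-orthogonal to every [ad V]. *)
pose l : E := \row_j \tr (D *m ad (delta_mx 0 j)).
have [X [Xl hX]] := hC l; exists X.
have lE V : (l *m V^T) 0 0 = \tr (D *m ad V).
  rewrite [in RHS](row_sum_delta V) (ad_sum brDl' brZl' brC') mulmx_sumr raddf_sum mxE /=.
  apply: eq_bigr => j _; rewrite (adZ brDl' brZl' brC') -scalemxAr mxtraceZ !mxE.
  by rewrite mulrC.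
have trb V (A : 'M[R]_n) : `|\tr (A *m ad V)| <= n%:R * (n%:R * K) * `|A| * `|V|.
  apply: le_trans (mxtrace_norm _) _; rewrite -!mulrA ler_wpM2l //.
  apply: le_trans (mulmx_norm _ _) _; rewrite ler_wpM2l // mulrCA ler_wpM2l //; exact: hK.
split.
  apply: le_trans Xl _; apply: le_trans (_ : C1 * `|D| <= _); last first.
    by rewrite ler_wpM2r // lerDl.
  rewrite /C1 -mulrA ler_wpM2l //; apply: mx_norm_le => [|i j]; first by rewrite !mulr_ge0.
  rewrite mxE; apply: le_trans (trb _ _) _; rewrite -[leRHS]mulr1 ler_wpM2l ?delta_norm //.
  by rewrite !mulr_ge0.
pose D' := D - ad X.
have trD' V : \tr (D' *m ad V) = 0.
  by rewrite mulmxBl raddfB /= -lE -hX subrr.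
have adD' W : ad (W *m D') = ad W *m D' - D' *m ad W - D *m ad (W *m D).
  rewrite mulmxBr (adD brDl' brZl' brC') (adN brDl' brZl' brC').
  move: (D *m ad (W *m D)) (adWD W) => a0 ->.
  rewrite (mul_ad brDl' brZl' brC') (ad_br brDl' brZl' brC' jac) mulmxBr mulmxBl !opprB.
  move: (_ *m _) (D *m ad W) (_ *m _) (_ *m _) (_ *m _) => a1 a2 a3 a4 a5.
  by apply/matrixP => i j; rewrite !mxE; ring.
rewrite -/D'; clearbody D'.
(* With that orthogonality only the quadratic term survives in the Killing form of [W D'];
   nondegeneracy turns this into a bound on [D'] itself. *)
have kW (W V : E) : kil (W *m D') V = - \tr (D *m ad (W *m D) *m ad V).
  rewrite /killing adD' !mulmxBl !raddfB /= -[RHS]add0r; congr (_ - _).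
  have -> : \tr (ad W *m D' *m ad V) = \tr (D' *m (ad V *m ad W)).
    by rewrite -mulmxA mxtrace_mulC mulmxA.
  rewrite -(mulmxA D')  -raddfB /= -mulmxBr -(ad_br brDl' brZl' brC' jac).
  exact: trD'.
have hW (W : E) : `|W *m D'| <= C2 * `|D| ^+ 2 * `|W|.
  rewrite /C2 -!mulrA; apply: hC' => [|V]; first by rewrite !mulr_ge0 // exprn_ge0.
  rewrite kW normrN; apply: le_trans (trb _ _) _.
  rewrite -!mulrA !ler_wpM2l //.
  apply: le_trans (_ : K * (n%:R * (`|D| * (K * (n%:R * (`|W| * `|D|))))) * `|V| <= _).
    rewrite mulrA ler_wpM2r // ler_wpM2l //.
    apply: le_trans (mulmx_norm _ _) _; rewrite ler_wpM2l // ler_wpM2l //.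
    apply: le_trans (hK _) _; rewrite ler_wpM2l //; exact: mulmx_norm.
  by rewrite le_eqVlt; apply/orP; left; apply/eqP; ring.
apply: le_trans (_ : C2 * `|D| ^+ 2 <= _); last by rewrite ler_wpM2r ?exprn_ge0 // lerDr.
apply: mx_norm_le => [|i j]; first by rewrite mulr_ge0 // exprn_ge0.
have -> : D' i j = ((delta_mx 0 i : E) *m (D' : 'M[R]_n)) 0 j by rewrite -rowE mxE.
apply: le_trans (mx_norm_coord _ _ _) _; apply: le_trans (hW _) _.
by rewrite -[leRHS]mulr1 ler_wpM2l ?delta_norm // mulr_ge0 // exprn_ge0.
Qed.

Lemma Adm_expansion eps : 0 < eps -> exists2 d : R, 0 < d &
  forall a, `|a| < d -> `|Adm (p a) - 1%:M - ad a| <= eps * `|a|.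
Proof.
move=> eps0; have [d d0 hd] := Ad_expansion ex eps0; exists d => // a /hd {}hd.
apply: mx_norm_le => [|i j]; first by rewrite mulr_ge0 // ltW.
pose di : E := delta_mx 0 i.
have -> : (Adm (p a) - 1%:M - ad a) i j = (Ad (p a) di - di - br a di) 0 j.
  by rewrite !mxE eqxx andTb (eq_sym j).
apply: le_trans (mx_norm_coord _ _ _) _; apply: le_trans (hd _) _.
by rewrite -[leRHS]mulr1 ler_wpM2l ?delta_norm // mulr_ge0 // ltW.
Qed.

Lemma Adm_near1 eps : 0 < eps -> \forall g \near (1%g : G), `|Adm g - 1%:M| <= eps.
Proof.
move=> eps0; have [d d0 hd] := Adm_expansion ltr01; have [K K0 hK] := ad_norm.
have r0 : 0 < Num.min d (eps / (K + 1)) by rewrite lt_min d0 divr_gt0 // ltr_wpDl.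
have := par_near ex r0; apply: filterS => g [a]; rewrite lt_min => /andP[/hd ad1].
rewrite ltr_pdivlMr ?ltr_wpDl // => /ltW ad2 ->; apply: le_trans ad2.
apply: le_trans (norm_tri_ab ad1) _; rewrite mul1r mulrDr mulr1 addrC lerD2r mulrC; exact: hK.
Qed.

Lemma Adm_near g eps : 0 < eps -> \forall h \near g, `|Adm h - Adm g| <= eps.
Proof.
move=> eps0; have c0 : 0 < n%:R * `|Adm g| + 1 by rewrite ltr_wpDl // mulr_ge0.
have h1 := Adm_near1 (divr_gt0 eps0 c0).
have cg : (g^-1 * h)%g @[h --> g] --> 1%g.
  rewrite -(mulVg g); apply: cvgMg; first exact: cvg_cst.
  exact: (fun _ h => h).
have h2 : \forall h \near g, `|Adm (g^-1 * h)%g - 1%:M| <= eps / (n%:R * `|Adm g| + 1) := cg _ h1.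
apply: filterS h2 => h hh.
have -> : Adm h - Adm g = (Adm (g^-1 * h)%g - 1%:M) *m Adm g.
  by rewrite mulmxBl -(AdmM ex) mulVKg mul1mx.
apply: le_trans (mulmx_norm _ _) _; rewrite mulrCA.
rewrite ler_pdivlMr // in hh; apply: le_trans hh; rewrite ler_wpM2l // lerDl //.
Qed.

(* If [Ad ((p x)^-1 * u)] is as close to 1 as possible among small [x], then it
   is 1, since [inner_approx] would provide a better [x]. *)
Lemma adm_rigidity rho : 0 < rho -> exists2 eps0 : R, 0 < eps0 & forall u,
  `|Adm u - 1%:M| < eps0 -> exists2 x, `|x| <= rho & Adm u = Adm (p x).
Proof.
move=> rho0.
have [C C0 hC] := inner_approx; have [K K0 hK] := ad_norm; have [c c0 hc] := norm_le_ad.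
pose N : R := n%:R + 1; have N1 : 1 <= N by rewrite lerDr.
have N0 : 0 < N by exact: lt_le_trans N1.
have nN : n%:R <= N by rewrite lerDl.
pose C1 := C + 1; have C1ge : 1 <= C1 by rewrite lerDr.
have C10 : 0 < C1 by exact: lt_le_trans C1ge.
have CC1 : C <= C1 by rewrite lerDl.
pose c1 := c + 1; have c10 : 0 < c1 by rewrite ltr_wpDl.
have cc1 : c <= c1 by rewrite lerDl.
(* The bound [eta c1 <= 1/2] controls [|x|] by the distance of [Adm (p x)] from 1; [eta N C1 <= 1/8]
   and the third bound in [eps0] contribute 1/4 each to the factor 1/2 of [key]. *)
pose eta := Num.min ((2 * c1)^-1) ((8 * N * C1)^-1).
have eta0 : 0 < eta by rewrite lt_min !invr_gt0 !mulr_gt0.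
have eta1 : eta * c1 <= 2^-1.
  have : eta <= (2 * c1)^-1 by rewrite ge_min lexx.
  rewrite invfM -[X in _ -> _ <= X]mulr1 => h; apply: le_trans (ler_wpM2r (ltW c10) h) _.
  by rewrite mulfVK ?mulr1 // gt_eqF.
have eta2 : eta * (N * C1) <= 8^-1.
  have : eta <= (8 * (N * C1))^-1 by rewrite mulrA ge_min lexx orbT.
  rewrite invfM => h; have NC : 0 < N * C1 by rewrite mulr_gt0.
  apply: le_trans (ler_wpM2r (ltW NC) h) _.
  by rewrite mulfVK // gt_eqF.
have [d0 d00 hd0] := Adm_expansion eta0.
have [d1 d10 hd1] := par_cont ex.
have near2 : \forall g \near (1%g : G), `|Adm g| <= 2 /\ `|Adm g^-1%g| <= 2.
  have b2 g : `|Adm g - 1%:M| <= 1 -> `|Adm g| <= 2.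
    move=> h; have := ler_normD (Adm g - 1%:M) 1%:M; rewrite subrK => h2.
    by apply: le_trans h2 _; have := scalar1_norm R n; lra.
  have V1 : (g^-1)%g @[g --> (1%g : G)] --> 1%g.
    by have := @invg_continuous G 1%g; rewrite /continuous_at invg1.
  have h1 := Adm_near1 ltr01; have h2 := V1 _ h1.
  by apply: filterS2 h1 h2 => g /b2 g1 /b2 g2.
have pc0 : p x @[x --> (0 : E)] --> 1%g.
  have [r r0 hr] := par_cont ex.
  by have := hr 0; rewrite normr0 => /(_ r0); rewrite /prop_for /continuous_at (par0 ex).
have [d2 d20 hd2] : exists2 d : R, 0 < d & forall x : E, `|x| < d ->
    `|Adm (p x)| <= 2 /\ `|Adm (p x)^-1%g| <= 2.
  have := pc0 _ near2; move=> /nbhs_norm0P[d /= d0' hd]; exists d => // x xd; exact: (hd x xd).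
pose rho' := Num.min (Num.min rho (d1 / 2)) (Num.min (d0 / 2) (d2 / 2)).
have rho'0 : 0 < rho' by rewrite !lt_min rho0 !divr_gt0.
have [rho'rho rho'd1 rho'd0 rho'd2] : [/\ rho' <= rho, rho' < d1, rho' < d0 & rho' < d2].
  have : rho' <= rho' by [].
  rewrite {2}/rho' !le_min => /andP[/andP[h1 h2] /andP[h3 h4]].
  by split=> //; lra.
clearbody rho'.
have [r1 r10 hr1] : exists2 r : R, 0 < r & forall x y : E, `|x| < r -> `|y| < r ->
    exists2 a, `|a| < rho' & (p x * p y)%g = p a.
  have h := par_near ex rho'0.
  have hm : (z.1 * z.2)%g @[z --> ((1%g, 1%g) : G * G)] --> 1%g.
    by have := @mulg_continuous G (1%g, 1%g); rewrite /continuous_at /= mulg1.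
  have [[A B] /= [nA nB] AB] := hm _ h.
  have /nbhs_norm0P[rA /= rA0 hA] := pc0 _ nA; have /nbhs_norm0P[rB /= rB0 hB] := pc0 _ nB.
  exists (Num.min rA rB); first by rewrite lt_min rA0.
  move=> x y; rewrite !lt_min => /andP[xA _] /andP[_ yB].
  exact: (AB (p x, p y) (conj (hA x xA) (hB y yB))).
pose r2 := Num.min (Num.min r1 rho') d0.
have r20 : 0 < r2 by rewrite !lt_min r10 rho'0 d00.
pose eps0 := Num.min (r2 / (4 * c1 * N * 3)) (Num.min (r2 / (2 * C1)) ((8 * N * C1)^-1)).
have eps00 : 0 < eps0 by rewrite !lt_min invr_gt0 !divr_gt0 ?mulr_gt0.
have epsA : eps0 * (4 * c1 * N * 3) <= r2.
  by rewrite -ler_pdivlMr ?mulr_gt0 // ge_min lexx.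
have epsB : eps0 * (2 * C1) <= r2.
  by rewrite -ler_pdivlMr ?mulr_gt0 // !ge_min lexx orbT.
have epsC : eps0 * (8 * N * C1) <= 1.
  by rewrite -ler_pdivlMr ?mulr_gt0 // mul1r !ge_min lexx !orbT.
exists eps0 => // u hu.
pose w (x : E) := ((p x)^-1 * u)%g.
pose phi (x : E) : R := `|Adm (w x) - 1%:M|.
pose B := closed_ball (0 : E) rho'.
have BP x : B x <-> `|x| <= rho'.
  by rewrite /B closed_ballE // /closed_ball_ /= sub0r normrN.
have B0 : B 0 by apply/BP; rewrite normr0 ltW.
have cB : compact B.
  apply: bounded_closed_compact; last exact: closed_ball_closed.
  by exists rho'; split; [exact: num_real|move=> y hy x /BP /le_trans; apply; exact: ltW].
have phiC : {within B, continuous phi}.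
  apply: continuous_in_subspaceT => x /set_mem /BP xB.
  have cw : w y @[y --> x] --> w x.
    have px : {for x, continuous p} by apply: hd1; exact: le_lt_trans rho'd1.
    exact: (cvgMg (cvgVg px) (cvg_cst u)).
  suff h (eps' : R) : 0 < eps' -> \forall y \near nbhs x, `|phi x - phi y| <= eps'.
    have h' : phi y @[y --> nbhs x] --> (phi x : R^o) by apply/cvgrPdist_le.
    exact: h'.
  move=> eps'0.
  have : \forall y \near nbhs x, `|Adm (w y) - Adm (w x)| <= eps' := cw _ (Adm_near (w x) eps'0).
  apply: filterS => y hy.
  apply: le_trans hy; rewrite /phi [leRHS]distrC.
  apply: le_trans (ler_dist_dist _ _) _.
  by rewrite opprB addrA subrK.
(* The minimum exists by compactness of the ball. By [xsmall] the minimiser is so small that the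
   improved point [x'] is still in the ball; comparing the two gives [|D| <= |D| / 2]. *)
have [x /set_mem /BP xB xmin] := EVT_min_rV (ex_intro _ 0 B0) cB phiC.
have {}xmin y : `|y| <= rho' -> phi x <= phi y by move=> /BP yB; apply: xmin; exact: mem_set.
have phi0 : phi 0 < eps0 by rewrite /phi /w (par0 ex) invg1 mul1g.
have phix : phi x < eps0 by apply: le_lt_trans phi0; apply: xmin; rewrite normr0 ltW.
pose D := Adm (w x) - 1%:M; have phixE : phi x = `|D| by [].
have D0 : 0 <= `|D| by [].
have DE : Adm (w x) = 1%:M + D by rewrite addrC subrK.
have uE : Adm u = Adm (w x) *m Adm (p x) by rewrite -(AdmM ex) mulVKg.
have xd2 : `|x| < d2 by exact: le_lt_trans rho'd2.
have px2 := (hd2 _ xd2).1.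
have pxn : `|Adm (p x) - 1%:M| <= eps0 * (N * 3).
  have -> : Adm (p x) - 1%:M = (Adm u - 1%:M) - D *m Adm (p x).
    by rewrite uE DE mulmxDl mul1mx addrAC addrK.
  apply: le_trans (ler_normB _ _) _.
  have h : `|D *m Adm (p x)| <= N * (eps0 * 2).
    apply: le_trans (mulmx_norm _ _) _; apply: ler_pM; rewrite ?mulr_ge0 ?ler0n //.
    by apply: ler_pM => //; rewrite ltW // -phixE.
  apply: le_trans (lerD (ltW hu) h) _.
  apply: le_trans (_ : eps0 * N + N * (eps0 * 2) <= _).
    by rewrite lerD2r -[leLHS]mulr1 ler_wpM2l // ltW.
  by rewrite le_eqVlt; apply/orP; left; apply/eqP; ring.
have xsmall : `|x| <= 2 * c1 * (eps0 * (N * 3)).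
  have h1 := hd0 _ (le_lt_trans xB rho'd0).
  have h2 := norm_tri_c h1.
  have h3 : `|x| <= c1 * `|ad x| by apply: le_trans (hc x) _; rewrite ler_wpM2r.
  have h4 := ler_wpM2l (ltW c10) h2.
  have h5 := ler_wpM2r (normr_ge0 x) eta1.
  have h6 := ler_wpM2l (ltW c10) pxn.
  have x0 := normr_ge0 x.
  have h7 : c1 * (eta * `|x| + `|Adm (p x) - 1%:M|) = eta * c1 * `|x| + c1 * `|Adm (p x) - 1%:M| by ring.
  rewrite h7 in h4; have h8 := le_trans h3 h4.
  have h9 : `|x| <= 2^-1 * `|x| + c1 * (eps0 * (N * 3)) by apply: le_trans h8 _; exact: lerD.
  lra.
have xr2 : `|x| < r2.
  apply: le_lt_trans xsmall _; apply: lt_le_trans epsA.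
  have -> : eps0 * (4 * c1 * N * 3) = 2 * (2 * c1 * (eps0 * (N * 3))) by ring.
  have : 0 < 2 * c1 * (eps0 * (N * 3)) by rewrite !mulr_gt0.
  lra.
have [X [X1 X2]] := hC (w x); rewrite -/D in X1 X2.
have XD : `|X| <= C1 * `|D| by apply: le_trans X1 _; rewrite ler_wpM2r.
have Xr2 : `|X| < r2.
  apply: le_lt_trans XD _; apply: lt_le_trans epsB.
  rewrite mulrC -phixE mulrCA (mulrC 2); apply: lt_le_trans (_ : eps0 * C1 <= _); first by rewrite ltr_pM2r.
  have : 0 < eps0 * C1 by rewrite mulr_gt0.
  lra.
have [x' x'rho x'E] : exists2 a, `|a| < rho' & (p x * p X)%g = p a.
  by apply: hr1; [move: xr2|move: Xr2]; rewrite !lt_min => /andP[/andP[]].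
have X0 : `|X| < d0 by move: Xr2; rewrite !lt_min => /andP[].
have Xd2 : `|X| < d2.
  by apply: lt_trans rho'd2; move: Xr2; rewrite !lt_min => /andP[/andP[]].
have wx' : w x' = ((p X)^-1 * w x)%g by rewrite /w -x'E invgM mulgA.
have key : `|Adm (w x') - 1%:M| <= 2^-1 * `|D|.
  have -> : Adm (w x') - 1%:M =
      ((D - ad X) - (Adm (p X) - 1%:M - ad X)) *m Adm (p X)^-1%g.
    have -> : (D - ad X) - (Adm (p X) - 1%:M - ad X) = Adm (w x) - Adm (p X).
      by apply/matrixP => i j; rewrite !mxE; ring.
    by rewrite wx' (AdmM ex) mulmxBl -(AdmM ex (p X)^-1%g (p X)) mulVg (Adm1 ex).
  apply: le_trans (mulmx_norm _ _) _.
  have hX := hd0 _ X0.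
  have s1 : `|D - ad X| <= C1 * (eps0 * `|D|).
    apply: le_trans X2 _; apply: ler_pM; rewrite ?exprn_ge0 //.
    by rewrite expr2 ler_wpM2r // -phixE ltW.
  have s2 : `|Adm (p X) - 1%:M - ad X| <= eta * (C1 * `|D|).
    by apply: le_trans hX _; rewrite ler_wpM2l // ltW.
  have s3 := le_trans (ler_normB _ _) (lerD s1 s2).
  apply: le_trans (_ : N * ((C1 * (eps0 * `|D|) + eta * (C1 * `|D|)) * 2) <= _).
    apply: ler_pM; rewrite ?mulr_ge0 ?ler0n //.
    by apply: ler_pM => //; exact: (hd2 _ Xd2).2.
  have -> : N * ((C1 * (eps0 * `|D|) + eta * (C1 * `|D|)) * 2) =
      (4^-1 * (eps0 * (8 * N * C1)) + 2 * (eta * (N * C1))) * `|D| by field.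
  rewrite ler_wpM2r //; lra.
have D00 : `|D| <= 0.
  have := le_trans (xmin _ (ltW x'rho)) key; rewrite phixE; lra.
have D00' : D = 0 by apply/eqP; rewrite -normr_le0.
exists x; first exact: le_trans rho'rho.
by rewrite uE DE D00' addr0 mul1mx.
Qed.

End Rigidity.

(** A subspace of maximal dimension among those contained in [P] exhausts [P]: a further vector
    would increase the dimension. *)
Lemma vspace_of_pred (R : fieldType) n (P : 'rV[R]_n -> Prop) : P 0 ->
  (forall a x y, P x -> P y -> P (a *: x + y)) ->
  exists U : {vspace 'rV[R]_n}, forall x, x \in U <-> P x.
Proof.
move=> P0 PL; pose Q (U : {vspace 'rV[R]_n}) := forall x, x \in U -> P x.
pose B k := `[< exists2 U, Q U & \dim U = k >].
have B0 : exists k, B k.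
  by exists 0%N; apply/asboolP; exists 0%VS; [move=> x; rewrite memv0 => /eqP ->|rewrite dimv0].
have Bn k : B k -> (k <= n)%N.
  move=> /asboolP[U _ <-]; apply: leq_trans (dimvS (subvf U)) _.
  by rewrite dimvf /dim /= mul1n.
have /asboolP[U QU dU] : B (ex_maxn B0 Bn) by case: ex_maxnP.
exists U => x; split=> [/QU//|Px].
have QUx : Q (U + <[x]>)%VS.
  by move=> y /memv_addP[u /QU Pu [_ /vlineP[a ->] ->]]; rewrite addrC; exact: PL.
have : B (\dim (U + <[x]>)%VS) by apply/asboolP; exists (U + <[x]>)%VS.
move: dU; case: ex_maxnP => k _ hk dU /hk; rewrite -dU => dUx.
have /eqP -> : U == (U + <[x]>)%VS by rewrite eqEdim addvSl.
exact: (subvP (addvSr U <[x]>) _ (memv_line x)).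
Qed.

(** Coordinates are rounded down on a grid of mesh [d], leaving finitely many codes. One element
    satisfying [P] is kept for each code that occurs, and [t0] stands in for the others. *)
Lemma bounded_net (R : realType) n (T : choiceType) (t0 : T) (P : T -> Prop)
    (f : T -> 'M[R]_n) (Q d : R) : P t0 -> 0 < d -> (forall t, P t -> `|f t| <= Q) ->
  exists s : seq T, (forall t, t \in s -> P t) /\
    forall t, P t -> exists2 u, u \in s & `|f t - f u| <= d.
Proof.
move=> Pt0 d0 fQ; have Q0 : 0 <= Q by apply: le_trans (fQ _ Pt0).
pose K := (Num.truncn ((Q + Q) / d)).+1.
pose code (t : T) : {ffun 'I_n * 'I_n -> 'I_K} :=
  [ffun ij => inord (Num.truncn ((f t ij.1 ij.2 + Q) / d))].
pose c (k : {ffun 'I_n * 'I_n -> 'I_K}) : T := xget t0 [set t | P t /\ code t = k].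
exists [seq c k | k <- enum {: {ffun 'I_n * 'I_n -> 'I_K}}]; split.
  move=> _ /mapP[k _ ->]; rewrite /c; case: xgetP => [y _ [Py _] //|_ //].
move=> t Pt; exists (c (code t)); first by apply: map_f; rewrite mem_enum.
have [Pc cc] : P (c (code t)) /\ code (c (code t)) = code t.
  rewrite /c; case: xgetP => [y _ [Py cy]|h]; first by split.
  by case: (h t).
set u := c _ in Pc cc *.
apply: mx_norm_le => [|i j]; first exact: ltW.
have bd v : P v -> 0 <= (f v i j + Q) / d /\ (Num.truncn ((f v i j + Q) / d) < K)%N.
  move=> Pv; have := le_trans (mx_norm_coord (f v) i j) (fQ _ Pv).
  rewrite ler_norml => /andP[h1 h2]; split; first by rewrite divr_ge0 ?(ltW d0) //; lra.
  by rewrite ltnS; apply: le_truncn; rewrite ler_pM2r ?invr_gt0 //; lra.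
have /ffunP/(_ (i, j)) := cc; rewrite !ffunE => /(congr1 val) /=.
have [tb1 tb2] := bd t Pt; have [ub1 ub2] := bd u Pc.
rewrite !inordK // => tr.
have /andP[h1 h2] := truncn_itv tb1; have /andP[h3 h4] := truncn_itv ub1.
rewrite tr in h3 h4; rewrite !mxE.
have -> : f t i j - f u i j = ((f t i j + Q) / d - (f u i j + Q) / d) * d.
  by field; rewrite gt_eqF.
rewrite normrM (gtr0_norm d0) -[leRHS]mul1r ler_wpM2r ?(ltW d0) //.
rewrite ler_norml; rewrite -natr1 in h2 h4.
by apply/andP; split; lra.
Qed.

(** Compactness of the unit ball. The cluster point is described through the continuous functions
    that tend to 0 along [Y], the form in which unit norm, orthogonality to an ideal and vanishing
    traces are passed to the limit. *)
Lemma unit_cluster (R : realType) n (Y : nat -> 'rV[R]_n) : (forall k, `|Y k| = 1) ->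
  exists Z : 'rV[R]_n, forall f : 'rV[R]_n -> R, continuous f ->
    (forall d : R, 0 < d -> exists N, forall k, (N <= k)%N -> `|f (Y k)| <= d) -> f Z = 0.
Proof.
move=> Y1; pose B := closed_ball (0 : 'rV[R]_n) 1.
have BP x : B x <-> `|x| <= 1 by rewrite /B closed_ballE // /closed_ball_ /= sub0r normrN.
have cB : compact B.
  apply: bounded_closed_compact; last exact: closed_ball_closed.
  by exists 1; split; [exact: num_real|move=> y hy x /BP /le_trans; apply; exact: ltW].
have [|Z [_ clZ]] := cB (Y k @[k --> \oo]) _.
  have h : \forall k \near \oo, B (Y k) by apply: nearW => k; apply/BP; rewrite Y1.
  exact: h.
exists Z => f cf f0; apply/eqP; apply: contraT; rewrite -normr_gt0 => fZ.
have f2 : 0 < `|f Z| / 2 by rewrite divr_gt0.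
have [N hN] := f0 _ f2.
have nU : nbhs Z [set z | `|f Z - f z| < `|f Z| / 2].
  have h : f z @[z --> Z] --> (f Z : R^o) := cf Z.
  by have /cvgrPdist_lt/(_ _ f2) := h.
have nA : (Y k @[k --> \oo]) [set z | `|f z| <= `|f Z| / 2] by exists N.
have [z [/= h1 h2]] := clZ _ _ nA nU.
have := ler_normD (f Z - f z) (f z); rewrite subrK => h3.
by have h4 := le_lt_trans h3 (ltr_leD h2 h1); lra.
Qed.

Section TracePowers.
Variables (R : realType) (n : nat) (br : 'rV[R]_n -> 'rV[R]_n -> 'rV[R]_n).
Hypothesis brDl : forall x y z, br (x + y) z = br x z + br y z.
Hypothesis brZl : forall a x z, br (a *: x) z = a *: br x z.
Hypothesis brC : forall x y, br x y = - br y x.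

Lemma linear_form_continuous (f : 'rV[R]_n -> R) :
  (forall x y, f (x + y) = f x + f y) -> (forall a x, f (a *: x) = a * f x) -> continuous f.
Proof.
move=> fD fZ; pose C := \sum_i `|f (delta_mx 0 i)|; have C0 : 0 <= C by exact: sumr_ge0.
have fb x : `|f x| <= C * `|x|.
  have f0 : f 0 = 0 by have := fZ 0 0; rewrite scale0r mul0r.
  rewrite [in leLHS](row_sum_delta x) (big_morph f fD f0) mulr_suml.
  apply: le_trans (ler_norm_sum _ _ _) _; apply: ler_sum => i _.
  by rewrite fZ normrM mulrC ler_wpM2l // mx_norm_coord.
have fB x y : f (x - y) = f x - f y by rewrite fD -scaleN1r fZ mulN1r.
move=> x; suff h : forall eps : R, 0 < eps -> \forall y \near nbhs x, `|f x - f y| <= eps.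
  have h' : f y @[y --> nbhs x] --> (f x : R^o) by apply/cvgrPdist_le.
  exact: h'.
move=> eps eps0; have r0 : 0 < eps / (C + 1) by rewrite divr_gt0 // ltr_wpDl.
have c : y @[y --> nbhs x] --> x by exact: (fun _ h => h).
have /cvgrPdist_lt/(_ _ r0) := c; apply: filterS.
move=> y /=; rewrite ltr_pdivlMr ?ltr_wpDl // => /ltW xy.
rewrite -fB; apply: le_trans (fb _) _; apply: le_trans xy.
by rewrite mulrDr mulr1 mulrC lerDl.
Qed.

Lemma ad_pow_continuous j a b : continuous (fun Z => (ad br Z ^+ j) a b).
Proof.
elim: j a b => [|j ih] a b.
  have -> : (fun Z => (ad br Z ^+ 0) a b) = fun=> (1%:M : 'M[R]_n) a b.
    by apply/funext => Z; rewrite expr0.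
  exact: cst_continuous.
have -> : (fun Z => (ad br Z ^+ j.+1) a b) =
    \sum_c (fun Z => ad br Z a c * (ad br Z ^+ j) c b).
  by apply/funext => Z; rewrite fct_sumE exprS -mulmxE mxE.
elim/big_ind: _ => [|f g cf cg x|c _ x]; first exact: (@cst_continuous _ _ (0 : R)).
  exact: (cvgD (cf x) (cg x)).
have lc : continuous (fun Z => ad br Z a c).
  apply: linear_form_continuous => [y z|s y].
    by rewrite (adD brDl brZl brC) mxE.
  by rewrite (adZ brDl brZl brC) mxE.
exact: (cvgM (lc x) (ih c b x)).
Qed.

Lemma trace_ad_pow_continuous j : continuous (fun Z => \tr (ad br Z ^+ j)).
Proof.
have -> : (fun Z => \tr (ad br Z ^+ j)) = \sum_a (fun Z => (ad br Z ^+ j) a a).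
  by apply/funext => Z; rewrite fct_sumE.
elim/big_ind: _ => [|f g cf cg x|c _ x]; first exact: (@cst_continuous _ _ (0 : R)).
  exact: (cvgD (cf x) (cg x)).
exact: ad_pow_continuous.
Qed.

Lemma mxpow_norm (A : 'M[R]_n) j : `|A ^+ j| <= (n%:R * `|A|) ^+ j.
Proof.
elim: j => [|j ih]; first by rewrite !expr0 scalar1_norm.
rewrite !exprS -mulmxE; apply: le_trans (mulmx_norm _ _) _; rewrite -mulrA.
by rewrite ler_wpM2l // ler_wpM2l.
Qed.

End TracePowers.

(** * Bounded and unbounded adjoint action *)

Section MixingData.
Variables (R : realType) (n : nat) (G : topologicalGroupType) (H : hilbertType R).
Local Notation E := 'rV[R]_n.
Variables (br : E -> E -> E) (e : E -> G) (Ad : G -> E -> E) (p : E -> G).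
Hypothesis ex : exponential br e Ad p.
Hypothesis semisimple_br : forall I, ideal br I ->
  (exists k, iter k (derived br) I = 0%VS) -> I = 0%VS.
Hypothesis finZ : finite_set (group_center G).
Variable pi : unitary_representation G H.
Hypothesis irr : irreducible pi.
Hypothesis infH : infinite_dimensional H.

Let brDl' := brDl ex.
Let brZl' := brZl ex.
Let brC' := brC ex.
Let jac := jacobi ex.
Local Notation ad := (ad br).
Local Notation Adm := (Adm Ad).
Local Notation kil := (killing br).

Let killing_nd x : (forall y, kil x y = 0) -> x = 0.
Proof. exact: (killing_nondeg brDl' brZl' brC' jac semisimple_br). Qed.

Lemma fixed_closed v : closed [set g | pi g v = v].
Proof.
move=> g /= cg; apply/eqP; rewrite -subr_eq0 -rnorm_eq0; apply/eqP/le_anti.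
rewrite rnorm_ge0 andbT; apply: le_of_forall_lt => d d0; rewrite add0r.
have [h [/= hv gh]] := cg _ (rep_near pi g v d0).
by rewrite -{2}hv ltW.
Qed.

(** The kernel of the derived representation, expressed through one-parameter subgroups;
    [exp_add_closed], a consequence of Trotter's formula, makes it a subspace. *)
Let trivial_at X := forall (t : R) v, pi (e (t *: X)) v = v.

Lemma closed_pow (S : set G) : S 1%g -> (forall a b, S a -> S b -> S (a * b)%g) ->
  forall a k, S a -> S (a ^+ k)%g.
Proof. by move=> S1 SM a k Sa; elim: k => [|k ih]; rewrite ?expg0 ?expgS //; exact: SM. Qed.

Lemma exp_add_closed (S : set G) : closed S -> S 1%g -> (forall a b, S a -> S b -> S (a * b)%g) ->
  forall X Y, (forall t : R, S (e (t *: X))) -> (forall t : R, S (e (t *: Y))) ->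
  S (e (X + Y)).
Proof.
move=> cS S1 SM X Y SX SY.
have h := @exp_trotter _ _ _ _ _ _ _ ex X Y.
apply: (@closed_cvg _ _ _ _ _ S cS _ _ h); apply: nearW => k.
by apply: closed_pow => //; apply: SM.
Qed.

Lemma trivial_atL a X Y : trivial_at X -> trivial_at Y -> trivial_at (a *: X + Y).
Proof.
move=> tX tY t v; rewrite scalerDr.
apply: (exp_add_closed (@fixed_closed v)) => [|g h /= gv hv|s|s] /=.
- exact: rep1.
- by rewrite repM hv.
- by rewrite !scalerA; exact: tX.
- by rewrite scalerA; exact: tY.
Qed.

Let exK : exists U : {vspace E}, forall x, x \in U <-> trivial_at x.
Proof.
apply: vspace_of_pred; last exact: trivial_atL.
by move=> t v; rewrite scaler0 (exp0 ex) rep1.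
Qed.

Lemma trivial_at_Ad g X : trivial_at X -> trivial_at (Ad g X).
Proof. by move=> tX t v; rewrite -(exp_Ad ex) !repM tX rep_mulgV. Qed.

(** The map [L], with kernel [U], kills the whole curve [Ad (e (t *: X)) Y], hence also its
    derivative [[X, Y]] at 0. *)
Lemma vspace_ideal (U : {vspace E}) : (forall g X, X \in U -> Ad g X \in U) -> ideal br U.
Proof.
move=> AdU X Y YU; pose L (x : E) := x - projv U x.
have LB x y : L (x - y) = L x - L y by rewrite /L linearB /= !opprD addrACA.
have LZ a x : L (a *: x) = a *: L x by rewrite /L linearZ scalerBr.
have LU x : x \in U -> L x = 0 by move=> xU; rewrite /L projv_id // subrr.
have L0 : L 0 = 0 by rewrite LU ?mem0v.
have LN x : L (- x) = - L x by rewrite -sub0r LB L0 sub0r.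
have LD x y : L (x + y) = L x + L y by rewrite -{1}[y]opprK LB LN opprK.
have Lb x : `|L x| <= (\sum_i `|L (delta_mx 0 i)|) * `|x|.
  rewrite [in leLHS](row_sum_delta x) (big_morph L LD L0) mulr_suml.
  apply: le_trans (ler_norm_sum _ _ _) _; apply: ler_sum => i _.
  by rewrite LZ normrZ mulrC ler_wpM2l // mx_norm_coord.
have d1 := has_deriv_bounded LB LZ Lb (Ad_deriv ex X Y).
have d2 : has_deriv (L \o (fun t : R => Ad (e (t *: X)) Y)) 0 1 0.
  move=> eps eps0; exists 1 => // h _ /=.
  by rewrite !LU ?AdU // scaler0 !subr0 normr0 mulr_ge0 // ltW.
have /eqP := has_deriv_unique d1 d2; rewrite subr_eq0 => /eqP ->.
exact: memv_proj.
Qed.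

Lemma killing_Ad g X Y : kil (Ad g X) (Ad g Y) = kil X Y.
Proof.
have adg Z : ad (Ad g Z) = Adm g^-1%g *m ad Z *m Adm g.
  by rewrite -mulmxA (Adm_ad ex) (mul_Adm ex) mulmxA -(AdmM ex) mulgV (Adm1 ex) mul1mx.
rewrite /killing !adg -!mulmxA mxtrace_mulC -!mulmxA -(AdmM ex) mulVg (Adm1 ex) mulmx1.
by rewrite [Adm g *m _]mulmxA -(AdmM ex) mulVg (Adm1 ex) mul1mx.
Qed.

Lemma unbounded_mixing (U : {vspace E}) : (forall x, x \in U <-> trivial_at x) ->
  (forall M : R, exists g X, X \in orth br U /\ M * `|X| < `|Ad g X|) ->
  exists (u : R -> G) (h : nat -> G),
  [/\ forall s t, u (s + t) = (u s * u t)%g,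
      forall x y (eps : R), 0 < eps -> exists T, forall t, T <= t -> rnorm (inner (pi (u t) x) y) <= eps,
      forall x y (eps : R), 0 < eps -> exists N, forall k, (N <= k)%N -> rnorm (inner (pi (h k) x) y) <= eps &
      forall t, (h k * u t * (h k)^-1)%g @[k --> \oo] --> 1%g].
Proof.
move=> UP unb; have iU : ideal br U.
  by apply: vspace_ideal => g X /UP tX; apply/UP; exact: trivial_at_Ad.
pose gX (k : nat) (z : G * E) := z.2 \in orth br U /\ k.+1%:R * `|z.2| < `|Ad z.1 z.2|.
have [z hz] : exists z : nat -> G * E, forall k, gX k (z k).
  have h k : exists z, gX k z by have [g [X hX]] := unb k.+1%:R; exists (g, X).
  by exists (fun k => projT1 (cid (h k))) => k; exact: (projT2 (cid (h k))).
pose N k := `|Ad (z k).1 (z k).2|.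
have N0 k : 0 < N k by apply: le_lt_trans (hz k).2; rewrite mulr_ge0.
pose Y k := (N k)^-1 *: Ad (z k).1 (z k).2.
have Y1 k : `|Y k| = 1 by rewrite normrZ gtr0_norm ?invr_gt0 // mulVf // gt_eqF.
have [Z hZ] := unit_cluster Y1.
have Z1 : `|Z| = 1.
  apply/eqP; rewrite -subr_eq0; apply/eqP; apply: (hZ (fun z => `|z| - 1)).
    move=> x; suff h : forall d : R, 0 < d -> \forall y \near nbhs x, `|(`|x| - 1) - (`|y| - 1)| <= d.
      have h' : (`|y| - 1) @[y --> nbhs x] --> (`|x| - 1 : R^o) by apply/cvgrPdist_le.
      exact: h'.
    move=> d d0; have c : y @[y --> nbhs x] --> x by exact: (fun _ h => h).
    have /cvgrPdist_le/(_ _ d0) := c; apply: filterS => y; apply: le_trans.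
    by rewrite opprB addrA subrK; exact: ler_dist_dist.
  by move=> d d0; exists 0%N => k _; rewrite Y1 subrr normr0 ltW.
have kD := killingDl brDl' brZl' brC'; have kZ := killingZl brDl' brZl' brC'.
have ZU : Z \in orth br U.
  apply/(mem_orth brDl' brZl' brC') => V VU; apply: (hZ (kil^~ V)).
    by apply: linear_form_continuous.
  move=> d d0; exists 0%N => k _; rewrite kZ -(AdVK ex (z k).1 V) killing_Ad.
  have /(mem_orth brDl' brZl' brC') -> := (hz k).1; first by rewrite mulr0 normr0 ltW.
  by apply/UP; apply: trivial_at_Ad; exact/UP.
have [K K0 hK] := ad_norm ex.
(* [ad (Ad g X)] is conjugate to [ad X], so after normalisation the trace of its [j.+1]-st power is
   [O((|X| / |Ad g X|)^j.+1)], which tends to 0; a limit with vanishing power traces is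
   nilpotent. *)
have [m nil] : exists m, ad Z ^+ m = 0.
  apply: trace_pow_nilpotent => j.
  apply: (hZ (fun z => \tr (ad z ^+ j.+1))); first exact: trace_ad_pow_continuous.
  move=> d d0; pose C := n%:R * (n%:R * K) ^+ j.+1.
  have C0 : 0 <= C by rewrite mulr_ge0 // exprn_ge0 // mulr_ge0.
  exists (Num.truncn (C / d)).+1 => k hk.
  have adg g X : ad (Ad g X) = Adm g^-1%g *m ad X *m Adm g.
    by rewrite -mulmxA (Adm_ad ex) (mul_Adm ex) mulmxA -(AdmM ex) mulgV (Adm1 ex) mul1mx.
  have powg g X i : ad (Ad g X) ^+ i = Adm g^-1%g *m ad X ^+ i *m Adm g.
    elim: i => [|i ih]; first by rewrite !expr0 -[1]/(1%:M) mulmx1 -(AdmM ex) mulgV (Adm1 ex).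
    rewrite !exprS ih -!mulmxE adg -!mulmxA; congr (_ *m (_ *m _)).
    by rewrite mulmxA -(AdmM ex) mulVg (Adm1 ex) mul1mx.
  have ZX (a : R) (A : 'M[R]_n) i : (a *: A) ^+ i = a ^+ i *: A ^+ i.
    elim: i => [|i ih]; first by rewrite !expr0 scale1r.
    by rewrite !exprS ih -!mulmxE -scalemxAl -scalemxAr scalerA.
  rewrite /Y (adZ brDl' brZl' brC') ZX mxtraceZ powg mxtrace_mulC mulmxA.
  rewrite -(AdmM ex) mulVg (Adm1 ex) mul1mx normrM normrX gtr0_norm ?invr_gt0 //.
  have h1 : `|\tr (ad (z k).2 ^+ j.+1)| <= C * `|(z k).2| ^+ j.+1.
    apply: le_trans (mxtrace_norm _) _; rewrite /C -mulrA ler_wpM2l //.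
    apply: le_trans (mxpow_norm _ _) _; rewrite -exprMn lerXn2r ?nnegrE ?mulr_ge0 //.
    by rewrite -mulrA ler_wpM2l.
  apply: le_trans (_ : (N k)^-1 ^+ j.+1 * (C * `|(z k).2| ^+ j.+1) <= _).
    by rewrite ler_wpM2l // exprn_ge0 // invr_ge0 ltW.
  rewrite mulrCA -exprMn.
  have h2 : (N k)^-1 * `|(z k).2| <= k.+1%:R^-1.
    rewrite mulrC ler_pdivrMr // mulrC ler_pdivlMr // mulrC ltW //; exact: (hz k).2.
  have h20 : 0 <= (N k)^-1 * `|(z k).2| by rewrite mulr_ge0 // invr_ge0 ltW.
  have h3 : ((N k)^-1 * `|(z k).2|) ^+ j.+1 <= k.+1%:R^-1.
    rewrite exprS; apply: (le_trans _ h2); rewrite -[leRHS]mulr1 ler_wpM2l // exprn_ile1 //.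
    by apply: le_trans h2 _; rewrite invf_le1 // ler1n.
  apply: le_trans (ler_wpM2l C0 h3) _.
  rewrite ler_pdivrMr // mulrC -ler_pdivrMr // ltW //.
  have /andP[_ h] : (Num.truncn (C / d))%:R <= C / d < (Num.truncn (C / d)).+1%:R.
    by apply: truncn_itv; rewrite divr_ge0 // ltW.
  by apply: lt_le_trans h _; rewrite ler_nat ltnW.
have [h [w [hz1 hw1 zw es]]] := jacobson_morozov brDl' brZl' brC' jac killing_nd nil.
apply: (sl2_mixing ex irr hz1 hw1 zw es).
(* If [Z] acted trivially it would lie in [U] and in its orthogonal, hence be 0, whereas
   [|Z| = 1]. *)
apply: contrapT => nact; have ZK : Z \in U.
  apply/UP => t v; apply: contrapT => h0; apply: nact; by exists t, v.
have : Z \in (U :&: orth br U)%VS by rewrite memv_cap ZK.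
rewrite (ideal_orth_cap brDl' brZl' brC' jac semisimple_br iU) memv0 => /eqP Z0.
by move: Z1; rewrite Z0 normr0 => /esym/eqP; rewrite oner_eq0.
Qed.

(* The elements whose adjoint action is trivial on [U] form a subgroup [C], whose
   image is dense in that of [G], and [Ad] is bounded on [C]. *)
Lemma bounded_contra (U : {vspace E}) : (forall x, x \in U <-> trivial_at x) ->
  ~ (exists M : R, forall g X, X \in orth br U -> `|Ad g X| <= M * `|X|).
Proof.
move=> UP [M hM]; have iU : ideal br U.
  by apply: vspace_ideal => g X /UP tX; apply/UP; exact: trivial_at_Ad.
have dec X : exists Y Z, [/\ Y \in U, Z \in orth br U & X = Y + Z].
  have : X \in (U + orth br U)%VS by rewrite (ideal_orth_add brDl' brZl' brC' jac semisimple_br iU) memvf.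
  by move=> /memv_addP[Y YU [Z ZU ->]]; exists Y, Z.
pose C g := forall X, X \in U -> Ad g X = X.
have C1 : C 1%g by move=> X _; exact: (Ad1 ex).
have CM g h : C g -> C h -> C (g * h)%g by move=> Cg Ch X XU; rewrite (AdM ex) Ch // Cg.
have CV g : C g -> C g^-1%g by move=> Cg X XU; rewrite -{1}(Cg X XU) (AdK ex).
have Cexp Z : Z \in orth br U -> C (e Z).
  move=> ZU X XU; have h : br Z X = 0 *: X.
    by rewrite scale0r brC' (br_ideal_orth brDl' brZl' brC' jac semisimple_br iU XU ZU) oppr0.
  by have := Ad_eigen ex h 1; rewrite scale1r mul0r expR0 scale1r.
have [Q hQ] : exists Q, forall g, C g -> `|Adm g| <= Q.
  have /choice[F hF] : forall i : 'I_n, exists yz : E * E,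
      [/\ yz.1 \in U, yz.2 \in orth br U & delta_mx 0 i = yz.1 + yz.2].
    by move=> i; have [Y [Z h]] := dec (delta_mx 0 i); exists (Y, Z).
  exists (\sum_i (`|(F i).1| + `|M| * `|(F i).2|)) => g Cg.
  have s0 i : 0 <= `|(F i).1| + `|M| * `|(F i).2| by rewrite addr_ge0 // mulr_ge0.
  apply: mx_norm_le => [|i j]; first exact: sumr_ge0.
  rewrite mxE; apply: le_trans (mx_norm_coord _ _ _) _.
  have [F1 F2 ->] := hF i; rewrite (AdD ex) (Cg _ F1).
  apply: le_trans (ler_normD _ _) _; rewrite (bigD1 i) //= -[leLHS]addr0 lerD ?sumr_ge0 //.
  rewrite lerD2l; apply: le_trans (hM _ _ F2) _; rewrite ler_wpM2r // ler_norm //.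
(* Elements approximated by [C] in the strong topology, one vector at a time. Exponentials from [U]
   act trivially and those from [orth br U] lie in [C], so all of [G] is reached. *)
pose S := [set g | forall (x : H) (d : R), 0 < d -> exists2 c, C c & rnorm (pi g x - pi c x) < d].
have SE : S = setT.
  have cS : closed S.
    move=> g cg x d d0; have d2 : 0 < d / 2 by rewrite divr_gt0.
    have [h [Sh /= gh]] := cg _ (rep_near pi g x d2).
    have [c Cc hc] := Sh x _ d2; exists c => //.
    apply: le_lt_trans (rdistD (pi h x) _ _) _; apply: lt_le_trans (ltrD gh hc) _; lra.
  have S1 : S 1%g by move=> x d d0; exists 1%g => //; rewrite subrr rnorm0.
  have SM a b : S a -> S b -> S (a * b)%g.
    move=> Sa Sb x d d0; have d2 : 0 < d / 2 by rewrite divr_gt0.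
    have [c2 Cc2 h2] := Sb x _ d2; have [c1 Cc1 h1] := Sa (pi c2 x) _ d2.
    exists (c1 * c2)%g; first exact: CM.
    apply: le_lt_trans (rdistD (pi a (pi c2 x)) _ _) _; rewrite !repM rep_dist.
    apply: lt_le_trans (ltrD h2 h1) _; lra.
  apply: (exp_generate ex) => // X; have [Y [Z [YU ZU ->]]] := dec X.
  apply: (exp_add_closed cS S1 SM) => t.
    move=> x d d0; exists 1%g => //; rewrite rep1.
    by have /UP -> := YU; rewrite subrr rnorm0.
  move=> x d d0; exists (e (t *: Z)); last by rewrite subrr rnorm0.
  by apply: Cexp; exact: rpredZ.
have [x0 x0n] := irr.1; pose psi := normalize x0.
have psi1 : rnorm psi = 1.
  by rewrite /psi /normalize rnormZ rnormCr ?invr_ge0 ?rnorm_ge0 // mulVf // rnorm_eq0.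
have d16 : 0 < 16^-1 :> R by rewrite invr_gt0.
have [rho rho0 hrho] : exists2 rho : R, 0 < rho & forall x, `|x| <= rho -> rnorm (pi (p x) psi - psi) < 16^-1.
  have pc0 : p x @[x --> (0 : E)] --> 1%g.
    have [r r0 hr] := par_cont ex.
    by have := hr 0; rewrite normr0 => /(_ r0); rewrite /prop_for /continuous_at (par0 ex).
  have /nbhs_norm0P[r /= r0 hr] := pc0 _ (rep_near1 pi psi d16).
  exists (r / 2); first by rewrite divr_gt0.
  move=> x xr; apply: (hr x) => /=; lra.
have [eps0 eps00 rig] := adm_rigidity ex killing_nd rho0.
have Q0 : 0 <= Q by apply: le_trans (hQ _ C1).
pose dl := eps0 / (2 * (n%:R * Q + 1)).
have nQ0 : 0 < n%:R * Q + 1 by rewrite ltr_wpDl // mulr_ge0.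
have dl0 : 0 < dl by rewrite divr_gt0 // mulr_gt0.
have [s [sC hs]] := bounded_net C1 dl0 hQ.
have /finite_seqP[zs zsE] := finZ.
pose L : seq H := [seq pi (c * z)%g psi | c <- s, z <- zs].
apply: (@finite_net_finite_dim _ _ _ pi irr psi psi1 (size L) (fun i => nth 0 L i) _ infH) => g.
have [c Cc hc] : exists2 c, C c & rnorm (pi g psi - pi c psi) < 16^-1.
  by have Sg : S g; [rewrite SE|exact: Sg].
have [u us hu] := hs c Cc; have Cu := sC u us.
have huc : `|Adm (u^-1 * c)%g - 1%:M| < eps0.
  have -> : Adm (u^-1 * c)%g - 1%:M = (Adm c - Adm u) *m Adm u^-1%g.
    by rewrite mulmxBl -!(AdmM ex) mulVg (Adm1 ex).
  apply: le_lt_trans (mulmx_norm _ _) _.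
  apply: le_lt_trans (_ : n%:R * (dl * Q) < _).
    by rewrite ler_wpM2l // ler_pM // hQ //; exact: CV.
  have -> : n%:R * (dl * Q) = dl * (n%:R * Q) by ring.
  have h : dl * (n%:R * Q + 1) = eps0 / 2 by rewrite /dl; field; rewrite gt_eqF.
  move: dl0 h => dl0' h; rewrite mulrDr mulr1 in h; lra.
have [x xr xE] := rig _ huc; pose z := ((p x)^-1 * (u^-1 * c))%g.
have Az : Adm z = 1%:M by rewrite (AdmM ex) xE -(AdmM ex) mulVg (Adm1 ex).
(* [Adm z = 1] makes [z] commute with all exponentials, and its commutant is closed and stable under
   products, so [z] is central. This is where the finite center enters the net. *)
have zC : group_center G z.
  have cz : closed [set g : G | (z * g)%g = (g * z)%g].
    move=> k cg; apply: (exp_hausdorff ex) => A B nA nB.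
    have cid : h @[h --> nbhs k] --> k by exact: (fun _ h => h).
    have cl : (z * h)%g @[h --> nbhs k] --> (z * k)%g by exact: (cvgMg (cvg_cst z) cid).
    have cr : (h * z)%g @[h --> nbhs k] --> (k * z)%g by exact: (cvgMg cid (cvg_cst z)).
    have hA : \forall h \near nbhs k, A (z * h)%g := cl _ nA.
    have hB : \forall h \near nbhs k, B (h * z)%g := cr _ nB.
    have [h [/= zh [/= Ah Bh]]] := cg _ (filterI hA hB).
    by exists (z * h)%g; split; [|rewrite zh].
  suff h : [set g : G | (z * g)%g = (g * z)%g] = setT.
    by move=> k; have : [set g : G | (z * g)%g = (g * z)%g] k by rewrite h.
  apply: (exp_generate ex) => //=; first by rewrite mulg1 mul1g.
    by move=> a b /= ha hb; rewrite mulgA ha -mulgA hb mulgA.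
  move=> X; have := exp_Ad ex z X 1; rewrite scale1r scale1r.
  rewrite -(mul_Adm ex z X) Az mulmx1 => h /=.
  by rewrite -{2}h mulgVK.
have zL : z \in zs by have : [set` zs] z by rewrite -zsE.
have cE : c = (u * z * p x)%g.
  have zc : (z * p x = p x * z)%g := zC (p x).
  by rewrite -mulgA zc /z !mulVKg.
have uzL : pi (u * z)%g psi \in L by apply/allpairsP; exists (u, z).
have iL : (index (pi (u * z)%g psi) L < size L)%N by rewrite index_mem.
exists (Ordinal iL) => /=; rewrite nth_index //.
apply: le_trans (rdistD (pi c psi) _ _) _.
(* Two errors of 1/16, from the density of [C] and from [p x] being near 1, stay below the 1/4
   required of the net. *)
have h2 : rnorm (pi c psi - pi (u * z)%g psi) < 16^-1.
  by rewrite cE repM rep_dist; exact: hrho.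
by have h3 := ltrD hc h2; rewrite ltW // (lt_le_trans h3) //; lra.
Qed.

Theorem ex_mixing : exists (u : R -> G) (h : nat -> G),
  [/\ forall s t, u (s + t) = (u s * u t)%g,
      forall x y (eps : R), 0 < eps -> exists T, forall t, T <= t -> rnorm (inner (pi (u t) x) y) <= eps,
      forall x y (eps : R), 0 < eps -> exists N, forall k, (N <= k)%N -> rnorm (inner (pi (h k) x) y) <= eps &
      forall t, (h k * u t * (h k)^-1)%g @[k --> \oo] --> 1%g].
Proof.
have [U UP] := exK; apply: (unbounded_mixing UP) => M.
apply: contrapT => h; apply: (bounded_contra UP); exists M => g X XU.
by rewrite leNgt; apply/negP => lt; apply: h; exists g, X.
Qed.

End MixingData.

(** * Construction of the frame *)

Section FrameBounds.
Context {R : realType} {H : hilbertType R}.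
Implicit Types (x y f : H).

(* Schur's test for the Gram matrix of the family [B]. *)
Lemma schur_bound (T : eqType) (s : seq T) (B : T -> H) (M : R) f : 0 <= M ->
  (forall p, p \in s -> \sum_(q <- s) rnorm (inner (B p) (B q)) <= M) ->
  \sum_(p <- s) rnorm (inner f (B p)) ^+ 2 <= M * rnorm f ^+ 2.
Proof.
move=> M0 hM; pose c p := inner f (B p); pose g := \sum_(p <- s) c p *: B p.
set S := \sum_(p <- s) _.
have S0 : 0 <= S by apply: sumr_ge0 => q _; exact: sqr_ge0.
have SE : S%:C = inner f g.
  rewrite /g inner_sumr raddf_sum /=; apply: eq_bigr => p _.
  by rewrite innerZr -/(c p) sqr_rnormC mulrC.
have Sg : S <= rnorm f * rnorm g.
  by have := cauchy_schwarz f g; rewrite -SE rnormCr.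
have gS : rnorm g ^+ 2 <= M * S.
  have h1 : rnorm g ^+ 2 <= \sum_(p <- s) \sum_(q <- s) rnorm (c p) * rnorm (c q) * rnorm (inner (B p) (B q)).
    rewrite -rnorm_innerxx {1}/g inner_suml; apply: le_trans (cnorm_sum _ _ _) _.
    apply: ler_sum => p _; rewrite innerZl rnormM /g inner_sumr.
    apply: le_trans (ler_wpM2l (rnorm_ge0 _) (cnorm_sum _ _ _)) _.
    rewrite mulr_sumr; apply: ler_sum => q _; rewrite innerZr rnormM rnorm_conj.
    by rewrite mulrA.
  apply: le_trans h1 _.
  apply: le_trans (_ : \sum_(p <- s) \sum_(q <- s)
     (2^-1 * (rnorm (c p) ^+ 2 * rnorm (inner (B p) (B q))) +
      2^-1 * (rnorm (c q) ^+ 2 * rnorm (inner (B q) (B p)))) <= _).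
    apply: ler_sum => p _; apply: ler_sum => q _.
    rewrite (rnorm_innerC (B q)) -mulrDr -mulrDl mulrA ler_wpM2r ?rnorm_ge0 //.
    by have := sqr_ge0 (rnorm (c p) - rnorm (c q)); lra.
  have half : \sum_(p <- s) \sum_(q <- s) 2^-1 * (rnorm (c p) ^+ 2 * rnorm (inner (B p) (B q))) <= 2^-1 * (M * S).
    rewrite /S mulr_sumr mulr_sumr !big_seq; apply: ler_sum => p ps.
    rewrite -mulr_sumr ler_wpM2l // -mulr_sumr mulrC ler_wpM2r ?sqr_ge0 //; exact: hM.
  under eq_bigr do rewrite big_split /=.
  rewrite big_split /=; have h2 := half; rewrite exchange_big /= in h2.
  apply: le_trans (lerD half h2) _; lra.
have F0 : 0 <= rnorm f by exact: rnorm_ge0.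
have [S00|Sp] := leP S 0; first by apply: le_trans S00 _; rewrite mulr_ge0 // sqr_ge0.
have h : S * S <= (M * rnorm f ^+ 2) * S.
  have h1 : S * S <= (rnorm f * rnorm g) * (rnorm f * rnorm g).
    by apply: ler_pM.
  apply: le_trans h1 _.
  have -> : rnorm f * rnorm g * (rnorm f * rnorm g) = rnorm f ^+ 2 * rnorm g ^+ 2 by ring.
  have -> : M * rnorm f ^+ 2 * S = rnorm f ^+ 2 * (M * S) by ring.
  by rewrite ler_wpM2l // sqr_ge0.
by rewrite ler_pM2r in h.
Qed.

Lemma dense_sequence : separable H -> exists v : nat -> H,
  forall x (d : R), 0 < d -> exists i, rnorm (x - v i) < d.
Proof.
move=> [D /countable_injP[c cinj] dD].
pose v i : H := xget 0 [set x | D x /\ c x = i]; exists v => x d d0.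
have [y [xy Dy]] : exists y, rnorm (x - y) < d /\ D y.
  have o : nbhs x [set y | rnorm (x - y) < d] by apply/nbhs_rnormP; exists d.
  move: o; rewrite nbhsE => -[U [oU Ux] Us].
  have [y [Uy Dy]] := dD U (ex_intro _ x Ux) oU.
  by exists y; split=> //; exact: Us.
exists (c y); rewrite /v; case: xgetP => [z _ [Dz cz]|h]; last by case: (h y).
by rewrite (cinj z y) ?mem_set.
Qed.

(** The lower half of Parseval's identity. The span of the first [i.+1] vectors contains [v i], so
    the projection of [f] onto it is at least as close to [f] as [v i] is. *)
Lemma parseval (v : nat -> H) f (d : R) :
  (forall x (d : R), 0 < d -> exists i, rnorm (x - v i) < d) -> 0 < d ->
  exists N, rnorm f ^+ 2 - d <= \sum_(k < N) rnorm (inner f (gram_schmidt v k)) ^+ 2.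
Proof.
move=> dv d0; have oe := gram_schmidt_orthosys v; set e := gram_schmidt v in oe *.
have [r r0 rd] : exists2 r : R, 0 < r & r ^+ 2 <= d.
  exists (Num.min d 1); first by rewrite lt_min d0 ltr01.
  rewrite expr2; apply: le_trans (_ : Num.min d 1 * 1 <= _).
    by rewrite ler_wpM2l ?ge_min ?lexx ?orbT // le_min ltW //= ler01.
  by rewrite mulr1 ge_min lexx.
have [i fi] := dv f r r0; exists i.+1.
have Pv : proj_sum e i.+1 (v i) = v i by rewrite [RHS]gram_schmidtE.
have PB x y : proj_sum e i.+1 (x - y) = proj_sum e i.+1 x - proj_sum e i.+1 y.
  by rewrite /proj_sum -sumrB; apply: eq_bigr => k _; rewrite innerBl scalerBl.
have h1 := pythagoras oe i.+1 f; have h2 := pythagoras oe i.+1 (f - v i).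
rewrite -(sqr_proj_sum oe).
have e1 : f - v i - proj_sum e i.+1 (f - v i) = f - proj_sum e i.+1 f.
  by rewrite PB Pv opprB addrA subrK.
rewrite e1 in h2.
have h3 : rnorm (f - v i) ^+ 2 <= d.
  apply: le_trans rd; rewrite lerXn2r ?nnegrE ?rnorm_ge0 // ltW //.
have h4 := sqr_ge0 (rnorm (proj_sum e i.+1 (f - v i))).
lra.
Qed.

End FrameBounds.

Section Stage.
Context {R : realType} {G : topologicalGroupType} {H : hilbertType R}.
Variable pi : unitary_representation G H.
Variables (u : R -> G) (h : nat -> G).
Hypothesis uM : forall s t, u (s + t) = (u s * u t)%g.
Hypothesis u_mix : forall x y (eps : R), 0 < eps ->
  exists T, forall t, T <= t -> rnorm (inner (pi (u t) x) y) <= eps.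
Hypothesis h_mix : forall x y (eps : R), 0 < eps ->
  exists N, forall k, (N <= k)%N -> rnorm (inner (pi (h k) x) y) <= eps.
Hypothesis hu1 : forall t, (h k * u t * (h k)^-1)%g @[k --> \oo] --> 1%g.

Lemma eventually_all (T : Type) (s : seq T) (P : T -> nat -> Prop) :
  (forall x, exists N, forall k, (N <= k)%N -> P x k) ->
  exists N, forall k, (N <= k)%N -> forall x, List.In x s -> P x k.
Proof.
move=> hP; elim: s => [|x s [N hN]]; first by exists 0%N.
have [N' hN'] := hP x; exists (maxn N N') => k; rewrite geq_max => /andP[k1 k2] y [<-|ys].
  exact: hN'.
exact: hN.
Qed.

(** The times [t i] are multiples of [T1 >= T], so two of them differ by at least [T]; in the
    overlap of two images [h k] cancels and mixing along [u] applies. With the [t i] fixed, a large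
    [k] gives small overlaps with the finite list [xs] and brings every [h k * u (t i) * (h k)^-1]
    close to 1. *)
Lemma stage psi e (xs : seq H) (eta : R) N : 0 < eta -> exists a (g : nat -> G),
  [/\ forall i, (i < N)%N -> rnorm (pi (g i * a^-1)%g e - e) <= eta,
      forall i x, (i < N)%N -> x \in xs -> rnorm (inner (pi (g i) psi) x) <= eta &
      forall i j, (i < N)%N -> (j < N)%N -> i != j ->
        rnorm (inner (pi (g i) psi) (pi (g j) psi)) <= eta].
Proof.
move=> eta0; have [T hT] := u_mix psi psi eta0.
pose T1 := Num.max T 1; have T10 : 0 < T1 by rewrite lt_max ltr01 orbT.
pose t (i : nat) : R := i%:R * T1.
have u0 : u 0 = 1%g by apply: (mulgI (u 0)); rewrite -uM addr0 mulg1.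
have uV s : (u s)^-1%g = u (- s) by apply: (mulgI (u s)); rewrite mulgV -uM subrr u0.
have [N1 hN1] : exists N1, forall k, (N1 <= k)%N -> forall ix, List.In ix
    [seq (i, x) | i <- iota 0 N, x <- xs] -> rnorm (inner (pi (h k * u (t ix.1))%g psi) ix.2) <= eta.
  apply: eventually_all => -[i x] /=.
  by have [N' h'] := h_mix (pi (u (t i)) psi) x eta0; exists N' => k /h'; rewrite repM.
have [N2 hN2] : exists N2, forall k, (N2 <= k)%N -> forall i, List.In i (iota 0 N) ->
    rnorm (pi (h k * u (t i) * (h k)^-1)%g e - e) <= eta.
  apply: eventually_all => i.
  have [N' _ h'] := rep_cvg pi e (hu1 (t i)) eta0.
  by exists N' => k /h'; rewrite rep1 rdistC => /ltW.
have InP (U : eqType) (x : U) (s : seq U) : x \in s -> List.In x s.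
  by elim: s => //= y s ih; rewrite in_cons => /orP[/eqP ->|/ih]; [left|right].
pose k := maxn N1 N2.
exists (h k), (fun i => (h k * u (t i))%g); split.
- by move=> i iN; apply: hN2; [rewrite leq_maxr|apply: InP; rewrite mem_iota].
- move=> i x iN xs_x; apply: (hN1 k _ (i, x)); first by rewrite leq_maxl.
  by apply: InP; apply/allpairsP; exists (i, x); rewrite mem_iota.
have lt_case i j : (i < j)%N -> rnorm (inner (pi (h k * u (t j))%g psi) (pi (h k * u (t i))%g psi)) <= eta.
  move=> ij; rewrite (repM pi (h k) (u (t j))) (repM pi (h k) (u (t i))) rep_inner.
  rewrite -(rep_inner pi (u (t i))^-1%g) -!repM mulVg rep1 uV -uM; apply: hT.
  apply: le_trans (_ : T1 <= _); first by rewrite le_max lexx.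
  rewrite addrC /t -mulrBl -[leLHS]mul1r ler_wpM2r ?(ltW T10) //.
  by rewrite -natrB 1?ltnW // ler1n subn_gt0.
move=> i j _ _; rewrite neq_ltn => /orP[ij|ji]; last exact: lt_case.
by rewrite rnorm_innerC; exact: lt_case.
Qed.

End Stage.

(** * Inductive choice of the frame elements *)

Section Construction.
Context {R : realType} {G : topologicalGroupType} {H : hilbertType R}.
Variable pi : unitary_representation G H.
Hypothesis ex_stage : forall psi e (xs : seq H) (eta : R) N, 0 < eta -> exists a (g : nat -> G),
  [/\ forall i, (i < N)%N -> rnorm (pi (g i * a^-1)%g e - e) <= eta,
      forall i x, (i < N)%N -> x \in xs -> rnorm (inner (pi (g i) psi) x) <= eta &
      forall i j, (i < N)%N -> (j < N)%N -> i != j ->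
        rnorm (inner (pi (g i) psi) (pi (g j) psi)) <= eta].
Variables (e : nat -> H) (phi0 : H) (kappa : R).
Hypothesis e1 : forall k, rnorm (e k) <= 1.
Hypothesis kappa01 : 0 < kappa <= 1.

(** The ratio 1/4 makes the terms after [geo k] add up to less than [geo k]. *)
Definition geo k : R := kappa * (4^-1) ^+ k.

Let kappa0 : 0 < kappa. Proof. by case/andP: kappa01. Qed.

Lemma geo_gt0 k : 0 < geo k.
Proof. by rewrite mulr_gt0 ?kappa0 // exprn_gt0. Qed.

Lemma geoS k : geo k = 4 * geo k.+1.
Proof. by rewrite /geo exprS; field. Qed.

Lemma geo_le k : geo k <= kappa.
Proof. by rewrite -[leRHS]mulr1 ler_wpM2l ?(ltW kappa0) // exprn_ile1 // invf_le1 // ler1n. Qed.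

Definition isqrt (N : nat) : R := (Num.sqrt N%:R)^-1.

Lemma isqrt_gt0 N : (0 < N)%N -> 0 < isqrt N.
Proof. by move=> N0; rewrite invr_gt0 sqrtr_gt0 ltr0n. Qed.

Lemma isqrt_sqr N : (0 < N)%N -> N%:R * isqrt N ^+ 2 = 1.
Proof. by move=> N0; rewrite exprVn sqr_sqrtr // mulfV // pnatr_eq0 -lt0n. Qed.

(** The state [s] holds the current partial vector and all vectors built before; the step [d] holds
    the increment, the number of new elements and these elements. The denominators [1 + W] and
    [1 + N + W] spread an error over all the vectors that it meets, earlier and new. *)
Let good k (s : H * seq H) (d : H * (nat * (nat -> G))) :=
  let W : R := (size s.2)%:R in let N := d.2.1 in let g := d.2.2 in
  [/\ (0 < N)%N, rnorm d.1 <= geo k.+1 / (1 + W),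
      forall i, (i < N)%N -> rnorm (pi (g i) d.1 - (isqrt N)%:C *: e k) <= isqrt N * geo k.+1,
      forall i x, (i < N)%N -> x \in s.2 ->
        rnorm (inner (pi (g i) s.1) x) <= kappa * geo k.+1 / (1 + N%:R + W) &
      forall i j, (i < N)%N -> (j < N)%N -> i != j ->
        rnorm (inner (pi (g i) s.1) (pi (g j) s.1)) <= kappa * geo k.+1 / (1 + N%:R + W)].

Let ex_good k s : exists d, good k s d.
Proof.
pose W : R := (size s.2)%:R; have W0 : 0 < 1 + W by rewrite ltr_pwDl.
have g0 := geo_gt0 k.+1.
pose b := geo k.+1 / (1 + W); have b0 : 0 < b by rewrite divr_gt0.
(* Large enough that [N^(-1/2)], which bounds the norm of the increment, is at most [b]. *)
pose N := (Num.truncn (b^-1 ^+ 2)).+1.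
have sN : isqrt N <= b.
  rewrite /isqrt -[leRHS]invrK lef_pV2 ?posrE ?invr_gt0 ?sqrtr_gt0 ?ltr0n //.
  rewrite -[leLHS]ger0_norm ?invr_ge0 ?(ltW b0) // -sqrtr_sqr ler_sqrt ?ler0n // ltW //.
  have /andP[_ h] : (Num.truncn (b^-1 ^+ 2))%:R <= b^-1 ^+ 2 < (Num.truncn (b^-1 ^+ 2)).+1%:R.
    by apply: truncn_itv; exact: sqr_ge0.
  exact: h.
have q0 : 0 < 1 + N%:R + W by rewrite addrAC ltr_wpDr.
pose eta := kappa * geo k.+1 / (1 + N%:R + W).
have eta0 : 0 < eta by rewrite divr_gt0 // mulr_gt0 ?kappa0.
have eta_le : eta <= geo k.+1.
  rewrite /eta ler_pdivrMr // mulrC ler_wpM2l ?(ltW g0) //.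
  have /andP[_ k1] := kappa01; apply: le_trans k1 _.
  by rewrite -addrA lerDl addr_ge0 // ler0n.
have s0 : 0 < isqrt N by exact: isqrt_gt0.
have [a [g [h1 h2 h3]]] := ex_stage s.1 (e k) s.2 N eta0.
exists ((isqrt N)%:C *: pi a^-1%g (e k), (N, g)); split => //=.
- rewrite rnormZ rnormCr ?(ltW s0) // rep_rnorm; apply: le_trans sN.
  by rewrite -[leRHS]mulr1 ler_wpM2l ?(ltW s0).
- move=> i iN; rewrite repZ -repM -scalerBr rnormZ rnormCr ?(ltW s0) //.
  by rewrite ler_wpM2l ?(ltW s0) // (le_trans (h1 i iN)).
Qed.

(** [B k i] is formed with the partial vector [psi k], the one known at stage [k]; later increments
    are treated as errors. The iteration keeps all earlier [B l j] in a list, because the next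
    elements must be chosen nearly orthogonal to them. *)
Lemma ex_construction : exists (N : nat -> nat) (g : nat -> nat -> G) (psi w : nat -> H),
  let W k : R := (\sum_(l < k) N l)%:R in let B k i := pi (g k i) (psi k) in
  [/\ psi 0%N = phi0 /\ forall k, psi k.+1 = psi k + w k,
      forall k, (0 < N k)%N,
      forall k, rnorm (w k) <= geo k.+1 / (1 + W k),
      forall k i, (i < N k)%N -> rnorm (pi (g k i) (w k) - (isqrt (N k))%:C *: e k) <= isqrt (N k) * geo k.+1 &
      forall k i l j, (i < N k)%N -> (j < N l)%N -> (l < k)%N || (l == k) && (i != j) ->
        rnorm (inner (B k i) (B l j)) <= kappa * geo k.+1 / (1 + (N k)%:R + W k)].
Proof.
have [F hF] := choice (fun ks : nat * (H * seq H) => ex_good ks.1 ks.2).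
pose S := fix S k : H * seq H := if k is k'.+1 then
   let d := F (k', S k') in
   ((S k').1 + d.1, (S k').2 ++ [seq pi (d.2.2 i) (S k').1 | i <- iota 0 d.2.1])
  else (phi0, [::]).
pose N k := (F (k, S k)).2.1; pose g k := (F (k, S k)).2.2.
pose psi k := (S k).1; pose w k := (F (k, S k)).1.
have sizeS k : size (S k).2 = (\sum_(l < k) N l)%N.
  elim: k => [|k ih]; first by rewrite big_ord0.
  by rewrite big_ord_recr /= size_cat size_map size_iota ih.
have memS l j k : (l < k)%N -> (j < N l)%N -> pi (g l j) (psi l) \in (S k).2.
  move=> lk jl; elim: k lk => // k ih; rewrite ltnS leq_eqVlt => /orP[/eqP lk|/ih h] /=.
    rewrite mem_cat; apply/orP; right; rewrite -lk; apply/mapP; exists j => //.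
    by rewrite mem_iota.
  by rewrite mem_cat h.
have P k := hF (k, S k).
exists N, g, psi, w; split => //.
- by move=> k; have [] := P k.
- by move=> k; have [_ h _ _ _] := P k; rewrite -sizeS.
- by move=> k; have [_ _ h _ _] := P k.
move=> k i l j ik jl; have [_ _ _ h1 h2] := P k; rewrite -sizeS => /orP[lk|].
  exact: h1 ik (memS _ _ _ lk jl).
by move=> /andP[/eqP lk ij]; rewrite lk in jl *; exact: h2.
Qed.

End Construction.

(** The fractions are [(delta + kappa) / eps] and [kappa / eps]; the inequality bounds the total
    squared error by [eps^2], which explains the choice of [delta] and [kappa]. *)
Lemma error_const (R : realType) : 2 * ((101 / 400) ^+ 2 + 5 * (400^-1) ^+ 2) <= 1 :> R.
Proof. lra. Qed.

Section Frame.
Context {R : realType} {G : topologicalGroupType} {H : hilbertType R}.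
Variable pi : unitary_representation G H.
Variables (v : nat -> H).
Hypothesis dense_v : forall x (d : R), 0 < d -> exists i, rnorm (x - v i) < d.
Variables (eps : R) (eps01 : 0 < eps < 1).
Let delta := eps / 4.
Let kappa := delta / 100.
Let e := gram_schmidt v.
Variables (u0 : H) (u01 : rnorm u0 = 1).
Variables (N : nat -> nat) (g : nat -> nat -> G) (psi w : nat -> H).
Let W k : R := (\sum_(l < k) N l)%:R.
Let T := (nat * nat)%type.
Let B (q : T) := pi (g q.1 q.2) (psi q.1).
Let geo' := geo kappa.
Hypotheses (psi0 : psi 0%N = delta%:C *: u0) (psiS : forall k, psi k.+1 = psi k + w k).
Hypotheses (N0 : forall k, (0 < N k)%N) (w_le : forall k, rnorm (w k) <= geo' k.+1 / (1 + W k)).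
Hypothesis gw : forall k i, (i < N k)%N ->
  rnorm (pi (g k i) (w k) - (isqrt (N k))%:C *: e k) <= isqrt (N k) * geo' k.+1.
Hypothesis BB : forall k i l j, (i < N k)%N -> (j < N l)%N -> (l < k)%N || (l == k) && (i != j) ->
  rnorm (inner (B (k, i)) (B (l, j))) <= kappa * geo' k.+1 / (1 + (N k)%:R + W k).

Let eps0 : 0 < eps. Proof. by case/andP: eps01. Qed.
Let eps1 : eps < 1. Proof. by case/andP: eps01. Qed.
Let delta0 : 0 < delta. Proof. by rewrite divr_gt0 ?eps0. Qed.
Let kappa0 : 0 < kappa. Proof. by rewrite divr_gt0 ?delta0. Qed.
Let kappa01 : 0 < kappa <= 1.
Proof. by rewrite kappa0 /kappa /delta; have := eps1; lra. Qed.
Let geo0 k : 0 < geo' k. Proof. exact: (geo_gt0 kappa01). Qed.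
Let geoS' k : geo' k = 4 * geo' k.+1. Proof. exact: geoS. Qed.
Let geo_le' k : geo' k <= kappa. Proof. exact: (geo_le kappa01). Qed.
Let W0 k : 0 <= W k. Proof. exact: ler0n. Qed.
Let W1 k : 0 < 1 + W k. Proof. by rewrite ltr_pwDl ?W0. Qed.
Let WS k : W k.+1 = W k + (N k)%:R. Proof. by rewrite /W big_ord_recr /= natrD. Qed.

Lemma W_mono m j : W m <= W (m + j).
Proof.
elim: j => [|j ih]; first by rewrite addn0.
by rewrite addnS WS; apply: le_trans ih _; rewrite lerDl ler0n.
Qed.

(** Telescoping: [geo' k - geo' k.+1] is three times [geo' k.+1], and the denominators [1 + W] do
    not decrease. *)
Lemma psi_step m j : rnorm (psi (m + j)%N - psi m) <= (geo' m - geo' (m + j)) / (1 + W m).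
Proof.
elim: j => [|j ih]; first by rewrite addn0 !subrr mul0r rnorm0.
rewrite addnS psiS addrAC; apply: le_trans (rnormD _ _) _.
apply: le_trans (lerD ih (w_le _)) _.
apply: le_trans (_ : (geo' m - geo' (m + j)) / (1 + W m) + geo' (m + j).+1 / (1 + W m) <= _).
  rewrite lerD2l ler_wpM2l ?(ltW (geo0 _)) // lef_pV2 ?posrE ?W1 // lerD2l; exact: W_mono.
rewrite -mulrDl ler_wpM2r ?invr_ge0 ?(ltW (W1 _)) //.
by have := geoS' (m + j); have := geo0 (m + j).+1; lra.
Qed.

Lemma ex_limit : exists phi : H, forall m, rnorm (phi - psi m) <= geo' m / (1 + W m).
Proof.
have bound m j : rnorm (psi (m + j)%N - psi m) <= geo' m / (1 + W m).
  apply: le_trans (psi_step m j) _; rewrite ler_wpM2r ?invr_ge0 ?(ltW (W1 _)) //.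
  by rewrite gerBl ltW ?geo0.
have geo_inv m : geo' m <= kappa * m.+1%:R^-1.
  elim: m => [|m ih]; first by rewrite /geo' /geo expr0 invr1.
  have := geoS' m; have : m.+1%:R^-1 <= 4 * m.+2%:R^-1 :> R.
    by rewrite ler_pdivlMr ?ltr0n // mulrC ler_pdivrMr ?ltr0n // -natrM ler_nat; lia.
  move=> h1 h2; have h3 : kappa * m.+1%:R^-1 <= kappa * (4 * m.+2%:R^-1) by rewrite ler_wpM2l ?(ltW kappa0).
  have h4 : kappa * (4 * m.+2%:R^-1) = 4 * (kappa * m.+2%:R^-1) by ring.
  rewrite h2 in ih; have h5 := le_trans ih h3; rewrite h4 in h5.
  by rewrite ler_pM2l in h5.
have small (d : R) : 0 < d -> exists M, forall m j, (M <= m)%N -> rnorm (psi (m + j)%N - psi m) < d.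
  move=> d0; have [M hM] := invn_lt d0; exists M => m j Mm.
  apply: le_lt_trans (bound m j) _; apply: le_lt_trans (hM m Mm).
  rewrite ler_pdivrMr ?W1 //; apply: le_trans (geo_inv m) _.
  have k1 : kappa <= 1 by case/andP: kappa01.
  have i0 : 0 <= m.+1%:R^-1 :> R by rewrite invr_ge0 ler0n.
  rewrite mulrC ler_wpM2l //; apply: le_trans k1 _; by rewrite lerDl W0.
have [phi hphi] : exists phi : H, forall d : R, 0 < d -> exists M, forall n, (M <= n)%N -> rnorm (phi - psi n) < d.
  apply: rnorm_complete => d d0; have [M hM] := small d d0; exists M => m n Mm Mn.
  have [mn|nm] := leqP m n; first by rewrite rdistC -(subnKC mn); exact: hM.
  by rewrite -(subnKC (ltnW nm)); exact: hM.
exists phi => m; apply: le_of_forall_lt => d d0; have [M hM] := hphi d d0.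
apply: le_trans (rdistD (psi (m + M)%N) _ _) _; rewrite addrC lerD ?bound // ltW //.
by apply: hM; exact: leq_addl.
Qed.

Variable phi : H.
Hypothesis phi_lim : forall m, rnorm (phi - psi m) <= geo' m / (1 + W m).

Let gam (q : T) := g q.1 q.2.
Let A (q : T) := (isqrt (N q.1))%:C *: e q.1.

(* [pi (gam q) phi] is the sum of [A q], which contributes Parseval's identity,
   of the almost orthogonal [B q], and of a remainder bounded in [tail_bound]. *)
Fixpoint idx K : seq (nat * nat) :=
  if K is k.+1 then idx k ++ [seq (k, i) | i <- iota 0 (N k)] else [::].

Lemma mem_idx K q : (q \in idx K) = (q.1 < K)%N && (q.2 < N q.1)%N.
Proof.
elim: K => [|K ih] //=; rewrite mem_cat ih; apply/idP/idP.
  move=> /orP[/andP[h ->]|/mapP[i iN ->]]; first by rewrite ltnW.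
  by move: iN; rewrite mem_iota /= ltnSn.
move=> /andP[]; rewrite ltnS leq_eqVlt => /orP[/eqP qK qN|-> ->] //.
apply/orP; right; apply/mapP; exists q.2; first by rewrite mem_iota -qK.
by rewrite -qK -surjective_pairing.
Qed.

Lemma idx_uniq K : uniq (idx K).
Proof.
elim: K => [|K ih] //=; rewrite cat_uniq ih map_inj_uniq ?iota_uniq => [|i j []//].
rewrite andbT; apply/hasPn => q /mapP[i _ ->].
by rewrite mem_idx /= ltnn.
Qed.

Lemma sum_idxS K (F : T -> R) :
  \sum_(q <- idx K.+1) F q = \sum_(q <- idx K) F q + \sum_(i <- iota 0 (N K)) F (K, i).
Proof. by rewrite /= big_cat big_map. Qed.

Let sum_block (K : nat) (F : nat -> R) (c : R) : (forall i, (i < N K)%N -> F i <= c) ->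
  \sum_(i <- iota 0 (N K)) F i <= (N K)%:R * c.
Proof.
move=> h; apply: le_trans (_ : \sum_(i <- iota 0 (N K)) c <= _).
  by rewrite !big_seq; apply: ler_sum => i; rewrite mem_iota => /h.
by rewrite big_const_seq count_predT size_iota iter_addr_0 mulr_natl.
Qed.

Lemma rnorm_phi m : rnorm (phi - psi m) <= kappa.
Proof.
apply: le_trans (phi_lim m) _; rewrite ler_pdivrMr ?W1 //; apply: le_trans (geo_le' m) _.
by rewrite -[leLHS]mulr1 ler_wpM2l ?(ltW kappa0) // lerDl W0.
Qed.

Lemma rnorm_psi0 : rnorm (psi 0%N) = delta.
Proof. by rewrite psi0 rnormZ u01 mulr1 rnormCr // ltW ?delta0. Qed.

Lemma rnorm_psi m : rnorm (psi m) <= delta + kappa.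
Proof.
have := psi_step 0 m; rewrite add0n => h.
have h1 : (geo' 0 - geo' m) / (1 + W 0) <= kappa.
  rewrite /W big_ord0 addr0 invr1 mulr1; have := geo0 m; have := geo_le' 0; lra.
have := rnormD (psi m - psi 0%N) (psi 0%N); rewrite subrK rnorm_psi0 => h2.
lra.
Qed.

Lemma rnorm_phi_ge : delta - kappa <= rnorm phi.
Proof.
have := rnormD (psi 0%N - phi) phi; rewrite subrK rnorm_psi0 => h.
have := rnorm_phi 0; rewrite rdistC => h1; lra.
Qed.

Lemma rnorm_phi_le : rnorm phi <= delta + kappa.
Proof.
have := rnormD (phi - psi 0%N) (psi 0%N); rewrite subrK rnorm_psi0 => h.
have := rnorm_phi 0 => h1; lra.
Qed.

(** The increments after stage [k] carry the denominator [1 + W k.+1], which is at least [N k] and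
    so at least its square root; the increment of stage [k] itself is moved to [A q] up to the error
    in [gw]. *)
Lemma tail_bound K q : q \in idx K -> rnorm (pi (gam q) phi - B q - A q) <= isqrt (N q.1) * (2 * geo' q.1.+1).
Proof.
rewrite mem_idx => /andP[_ qN]; case: q qN => k i /= iN; rewrite /gam /B /A /=.
have -> : pi (g k i) phi - pi (g k i) (psi k) - (isqrt (N k))%:C *: e k =
    pi (g k i) (phi - psi k.+1) + (pi (g k i) (w k) - (isqrt (N k))%:C *: e k).
  by rewrite psiS opprD (addrA phi) !repB addrA subrK.
apply: le_trans (rnormD _ _) _; rewrite rep_rnorm.
have -> : isqrt (N k) * (2 * geo' k.+1) = isqrt (N k) * geo' k.+1 + isqrt (N k) * geo' k.+1 by ring.
rewrite lerD ?gw //; apply: le_trans (phi_lim _) _.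
rewrite mulrC ler_wpM2r ?(ltW (geo0 _)) // /isqrt lef_pV2 ?posrE ?W1 ?sqrtr_gt0 ?ltr0n //.
have N1 : 1 <= (N k)%:R :> R by rewrite ler1n.
apply: le_trans (_ : (N k)%:R <= _); last by rewrite WS; have := W0 k; lra.
rewrite -[leRHS]ger0_norm ?ler0n // -sqrtr_sqr ler_sqrt ?sqr_ge0 // expr2.
by rewrite -[leLHS]mulr1 ler_wpM2l.
Qed.

(** The [N k] vectors of stage [k] contribute at most [4 geo' k.+1 ^2 |f|^2], and the telescoping
    bound [4 kappa (kappa - geo' K)] carries the sum through the induction. *)
Lemma tail_sum K f : \sum_(q <- idx K) rnorm (inner f (pi (gam q) phi - B q - A q)) ^+ 2 <=
  4 * kappa ^+ 2 * rnorm f ^+ 2.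
Proof.
apply: le_trans (_ : 4 * kappa * (kappa - geo' K) * rnorm f ^+ 2 <= _); last first.
  have h : kappa - geo' K <= kappa by rewrite gerBl ltW ?geo0.
  have k4 : 0 <= 4 * kappa by rewrite mulr_ge0 // ltW ?kappa0.
  have := ler_wpM2l k4 h; rewrite -(mulrA 4 kappa kappa) -expr2 => h2; exact: (ler_wpM2r (sqr_ge0 _) h2).
elim: K => [|K ih].
  have k1 : 0 <= 4 * kappa by rewrite mulr_ge0 // ltW ?kappa0.
  have k2 : 0 <= kappa - geo' 0 by rewrite subr_ge0; exact: geo_le'.
  by rewrite big_nil mulr_ge0 ?sqr_ge0 // mulr_ge0.
rewrite sum_idxS; apply: le_trans (lerD ih (_ : _ <= 4 * kappa * geo' K.+1 * rnorm f ^+ 2)) _; last first.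
  have k1 : 0 <= 4 * kappa by rewrite mulr_ge0 // ltW ?kappa0.
  rewrite -mulrDl ler_wpM2r ?sqr_ge0 // -mulrDr ler_wpM2l //.
  by have := geoS' K; have := geo0 K.+1; lra.
have s0 : (0 : R) <= isqrt (N K) by rewrite ltW ?isqrt_gt0.
apply: le_trans (sum_block (c := (isqrt (N K) * (2 * geo' K.+1)) ^+ 2 * rnorm f ^+ 2) _) _ => [i iN|].
  have g2 : 0 <= 2 * geo' K.+1 by rewrite pmulr_rge0 // ltW ?geo0.
  have c0 := mulr_ge0 (mulr_ge0 s0 g2) (rnorm_ge0 f).
  rewrite -exprMn lerXn2r ?nnegrE ?rnorm_ge0 ?c0 //.
  apply: le_trans (cauchy_schwarz _ _) _; rewrite mulrC ler_wpM2r ?rnorm_ge0 //.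
  by apply: (@tail_bound K.+1 (K, i)); rewrite mem_idx /= ltnSn.
rewrite mulrA ler_wpM2r ?sqr_ge0 // exprMn mulrA isqrt_sqr // mul1r exprMn expr2.
have -> : 2 * 2 * geo' K.+1 ^+ 2 = 4 * geo' K.+1 * geo' K.+1 by ring.
by rewrite ler_wpM2r ?(ltW (geo0 _)) // ler_wpM2l.
Qed.

(** The diagonal entry is at most [(delta + kappa)^2]. At stage [K] an old row receives [N K] new
    entries and a new row has fewer than [W K + N K] off-diagonal ones; either total is at most
    [kappa geo' K.+1], thanks to the denominator in [BB]. *)
Lemma row_sum K q : q \in idx K ->
  \sum_(r <- idx K) rnorm (inner (B q) (B r)) <= (delta + kappa) ^+ 2 + kappa ^+ 2.
Proof.
move=> qK; apply: le_trans (_ : (delta + kappa) ^+ 2 + kappa * (kappa - geo' K) <= _); last first.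
  by rewrite lerD2l expr2 ler_wpM2l ?(ltW kappa0) // gerBl ltW ?geo0.
elim: K qK => [|K ih] //; pose off := kappa * geo' K.+1 / (1 + (N K)%:R + W K).
have q0 : 0 < 1 + (N K)%:R + W K by rewrite addrAC ltr_wpDr ?W1.
have off0 : 0 <= off by rewrite divr_ge0 ?(ltW q0) // mulr_ge0 ?(ltW kappa0) // ltW ?geo0.
have offE : (1 + (N K)%:R + W K) * off = kappa * geo' K.+1 by rewrite mulrC divfK // gt_eqF.
have gS := geoS' K; have gS0 := geo0 K.+1.
rewrite sum_idxS /= mem_cat => /orP[qK|/mapP[i iN ->]].
  apply: le_trans (lerD (ih qK) (sum_block (c := off) _)) _ => [j jN|].
    move: qK; rewrite mem_idx => /andP[qK qN]; rewrite rnorm_innerC.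
    by case: q {ih} qK qN => k i /= kK iN; apply: BB => //; rewrite kK.
  have h : (N K)%:R * off <= kappa * geo' K.+1.
    rewrite -offE ler_wpM2r //; have := W0 K; lra.
  have h2 : kappa * geo' K.+1 <= kappa * (geo' K - geo' K.+1) by rewrite ler_wpM2l ?(ltW kappa0) //; lra.
  have -> : kappa * (kappa - geo' K.+1) = kappa * (kappa - geo' K) + kappa * (geo' K - geo' K.+1) by ring.
  lra.
rewrite mem_iota /= add0n in iN.
have h1 : \sum_(r <- idx K) rnorm (inner (B (K, i)) (B r)) <= W K * off.
  apply: le_trans (_ : \sum_(r <- idx K) off <= _).
    rewrite !big_seq; apply: ler_sum => -[l j]; rewrite mem_idx => /andP[/= lK jN].
    by apply: BB => //; rewrite lK.
  rewrite big_const_seq count_predT iter_addr_0 -mulr_natl.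
  rewrite (_ : (size (idx K))%:R = W K) // /W; congr (_%:R).
  elim: (K) => [|k ih'] /=; first by rewrite big_ord0.
  by rewrite size_cat size_map size_iota big_ord_recr ih'.
have h2 : \sum_(j <- iota 0 (N K)) rnorm (inner (B (K, i)) (B (K, j))) <= (delta + kappa) ^+ 2 + (N K)%:R * off.
  rewrite (bigD1_seq i) ?mem_iota ?iota_uniq //=; apply: lerD.
    rewrite rnorm_innerxx rep_rnorm lerXn2r ?nnegrE ?rnorm_ge0 ?rnorm_psi //.
    by rewrite addr_ge0 ?(ltW delta0) ?(ltW kappa0).
  rewrite big_mkcond /=; apply: sum_block => j jN; case: eqP => //= ji.
  by apply: BB => //; rewrite eqxx ltnn /= eq_sym; apply/eqP.
apply: le_trans (lerD h1 h2) _.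
have h3 : W K * off + (N K)%:R * off <= kappa * geo' K.+1.
  by rewrite -offE -mulrDl ler_wpM2r //; lra.
have h4 : kappa * geo' K.+1 <= kappa * (kappa - geo' K.+1).
  by rewrite ler_wpM2l ?(ltW kappa0) //; have := geo_le' K; lra.
lra.
Qed.

Lemma main_sum K f : \sum_(q <- idx K) rnorm (inner f (A q)) ^+ 2 =
  \sum_(k < K) rnorm (inner f (e k)) ^+ 2.
Proof.
elim: K => [|K ih]; first by rewrite big_nil big_ord0.
rewrite sum_idxS big_ord_recr ih /=; congr (_ + _).
rewrite /A /= big_const_seq count_predT size_iota iter_addr_0 innerZr conjc_real rnormM.
by rewrite rnormCr ?ltW ?isqrt_gt0 // exprMn -mulr_natl mulrA isqrt_sqr // mul1r.
Qed.

Definition frame_sum K f := \sum_(q <- idx K) rnorm (inner f (pi (gam q) phi)) ^+ 2.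

Lemma error_sum K f : \sum_(q <- idx K) rnorm (inner f (pi (gam q) phi - A q)) ^+ 2 <=
  eps ^+ 2 * rnorm f ^+ 2.
Proof.
have h1 := tail_sum K f.
have M0 : 0 <= (delta + kappa) ^+ 2 + kappa ^+ 2 by rewrite addr_ge0 ?sqr_ge0.
have h2 := schur_bound f M0 (@row_sum K).
apply: le_trans (_ : \sum_(q <- idx K) (2 * rnorm (inner f (B q)) ^+ 2 +
    2 * rnorm (inner f (pi (gam q) phi - B q - A q)) ^+ 2) <= _).
  apply: ler_sum => q _.
  have -> : pi (gam q) phi - A q = B q + (pi (gam q) phi - B q - A q).
    by rewrite addrCA addrA subrK.
  rewrite innerDr; set a := inner f (B q); set b := inner f _.
  apply: le_trans (_ : (rnorm a + rnorm b) ^+ 2 <= _).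
    by rewrite lerXn2r ?nnegrE ?addr_ge0 ?rnorm_ge0 // cnormD.
  by have := sqr_ge0 (rnorm a - rnorm b); lra.
rewrite big_split /= -!mulr_sumr.
have F0 := sqr_ge0 (rnorm f).
apply: le_trans (lerD (ler_wpM2l _ h2) (ler_wpM2l _ h1)) _ => //.
have -> : 2 * (((delta + kappa) ^+ 2 + kappa ^+ 2) * rnorm f ^+ 2) + 2 * (4 * kappa ^+ 2 * rnorm f ^+ 2) =
    (2 * ((delta + kappa) ^+ 2 + 5 * kappa ^+ 2)) * rnorm f ^+ 2 by ring.
rewrite ler_wpM2r //.
have -> : 2 * ((delta + kappa) ^+ 2 + 5 * kappa ^+ 2) = (2 * ((101 / 400) ^+ 2 + 5 * (400^-1) ^+ 2)) * eps ^+ 2.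
  by rewrite /kappa /delta; field.
by rewrite -[leRHS]mul1r ler_wpM2r ?sqr_ge0 // error_const.
Qed.

(* Minkowski's inequality is replaced by
   [(a + b)^2 <= (1 + eps) a^2 + (1 + 1/eps) b^2]. *)
Lemma frame_upper K f : frame_sum K f <= (1 + eps) ^+ 2 * rnorm f ^+ 2.
Proof.
have e0 := eps0.
have h1 := error_sum K f; have h2 := main_sum K f.
have h3 : \sum_(q <- idx K) rnorm (inner f (A q)) ^+ 2 <= rnorm f ^+ 2.
  by rewrite h2; exact: (bessel (gram_schmidt_orthosys v)).
apply: le_trans (_ : \sum_(q <- idx K) ((1 + eps) * rnorm (inner f (A q)) ^+ 2 +
    (1 + eps^-1) * rnorm (inner f (pi (gam q) phi - A q)) ^+ 2) <= _).
  apply: ler_sum => q _.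
  have -> : inner f (pi (gam q) phi) = inner f (pi (gam q) phi - A q) + inner f (A q).
    by rewrite -innerDr subrK.
  set b := inner f (_ - _); set a := inner f (A q).
  apply: le_trans (_ : (rnorm b + rnorm a) ^+ 2 <= _).
    by rewrite lerXn2r ?nnegrE ?addr_ge0 ?rnorm_ge0 // cnormD.
  have -> : (1 + eps) * rnorm a ^+ 2 + (1 + eps^-1) * rnorm b ^+ 2 =
    (rnorm b + rnorm a) ^+ 2 + eps * (rnorm a - eps^-1 * rnorm b) ^+ 2.
    by field; rewrite gt_eqF.
  by rewrite lerDl mulr_ge0 ?sqr_ge0 ?(ltW e0).
rewrite big_split /= -!mulr_sumr.
have c1 : 0 <= 1 + eps by lra.
have c2 : 0 <= 1 + eps^-1 by rewrite addr_ge0 // invr_ge0 ltW.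
apply: le_trans (lerD (ler_wpM2l c1 h3) (ler_wpM2l c2 h1)) _.
by rewrite le_eqVlt; apply/orP; left; apply/eqP; field; rewrite gt_eqF.
Qed.

(** The counterpart [(a - b)^2 >= (1 - eps) a^2 - (1/eps - 1) b^2] of the inequality behind
    [frame_upper] gives the factor [(1 - eps)^2]; the loss [d] comes from truncating Parseval's
    identity. *)
Lemma frame_lower f (d : R) : 0 < d -> exists K, (1 - eps) ^+ 2 * rnorm f ^+ 2 - d <= frame_sum K f.
Proof.
move=> d0; have e0 := eps0; have e1 := eps1.
have [K hK] := parseval f dense_v d0; exists K.
have h1 := error_sum K f; have h2 := main_sum K f.
rewrite -/e -h2 in hK.
apply: le_trans (_ : _ <= \sum_(q <- idx K) ((1 - eps) * rnorm (inner f (A q)) ^+ 2 -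
    (eps^-1 - 1) * rnorm (inner f (pi (gam q) phi - A q)) ^+ 2)) _; last first.
  apply: ler_sum => q _.
  have -> : inner f (pi (gam q) phi) = inner f (pi (gam q) phi - A q) + inner f (A q).
    by rewrite -innerDr subrK.
  set b := inner f (_ - _); set a := inner f (A q).
  apply: le_trans (_ : (rnorm a - rnorm b) ^+ 2 <= _).
    have -> : (1 - eps) * rnorm a ^+ 2 - (eps^-1 - 1) * rnorm b ^+ 2 =
      (rnorm a - rnorm b) ^+ 2 - eps * (rnorm a - eps^-1 * rnorm b) ^+ 2.
      by field; rewrite gt_eqF.
    by rewrite gerBl mulr_ge0 ?sqr_ge0 ?(ltW e0).
  have t1 : rnorm a - rnorm b <= rnorm (b + a).
    by have := cnormB (b + a) b; rewrite addrAC subrr add0r; lra.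
  have t2 : rnorm b - rnorm a <= rnorm (b + a).
    by have := cnormB (b + a) a; rewrite addrK; lra.
  have t3 : `|rnorm a - rnorm b| <= rnorm (b + a) by rewrite ler_norml; apply/andP; split; lra.
  by rewrite -[leLHS]real_normK ?num_real // lerXn2r ?nnegrE ?rnorm_ge0.
rewrite sumrB -!mulr_sumr.
have c1 : 0 <= 1 - eps by lra.
have c2 : 0 <= eps^-1 - 1 by rewrite subr_ge0 invf_ge1 // ltW.
have h3 := ler_wpM2l c1 hK; have h4 := ler_wpM2l c2 h1.
have h5 : (eps^-1 - 1) * (eps ^+ 2 * rnorm f ^+ 2) = (eps - eps ^+ 2) * rnorm f ^+ 2.
  by field; rewrite gt_eqF.
rewrite h5 in h4.
have h6 : 0 <= eps * d by rewrite mulr_ge0 // ltW.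
apply: le_trans (_ : (1 - eps) * (rnorm f ^+ 2 - d) - (eps - eps ^+ 2) * rnorm f ^+ 2 <= _); last lra.
have -> : (1 - eps) * (rnorm f ^+ 2 - d) - (eps - eps ^+ 2) * rnorm f ^+ 2 =
   (1 - eps) ^+ 2 * rnorm f ^+ 2 - d + eps * d by ring.
lra.
Qed.

(** Replacing [phi] by [psi q.1] and [psi r.1] costs [kappa] in norm each time, so the overlap is at
    most [kappa^2 + 2 kappa (delta + kappa)], about [delta^2 / 50], while [|phi| >= delta - kappa]
    makes the right side at least about [delta^2 / 2]. *)
Lemma separated q r : (q.2 < N q.1)%N -> (r.2 < N r.1)%N -> q != r ->
  rnorm (inner (pi (gam q) phi) (pi (gam r) phi)) < 2^-1 * rnorm phi ^+ 2.
Proof.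
move=> qN rN qr; have k0 := kappa0; have d0 := delta0.
have bb k i l j : (i < N k)%N -> (j < N l)%N -> (l < k)%N || (l == k) && (i != j) ->
    rnorm (inner (B (k, i)) (B (l, j))) <= kappa ^+ 2.
  move=> h1 h2 h3; apply: le_trans (BB h1 h2 h3) _.
  have q0 : 1 <= 1 + (N k)%:R + W k by rewrite -addrA lerDl addr_ge0 ?ler0n ?W0.
  rewrite ler_pdivrMr ?(lt_le_trans ltr01) // -[leLHS]mulr1 ler_pM //.
    by rewrite mulr_ge0 ?(ltW k0) ?(ltW (geo0 _)).
  by rewrite expr2 ler_wpM2l ?(ltW k0).
have hB : rnorm (inner (B q) (B r)) <= kappa ^+ 2.
  case: q r qN rN qr => k i [l j] /= iN jN qr.
  have [lk|kl|kl] := ltngtP l k.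
  - by apply: bb => //; rewrite lk.
  - by rewrite rnorm_innerC; apply: bb => //; rewrite kl.
  apply: bb => //; rewrite kl ltnn eqxx /=; apply: contra qr => /eqP ->.
  by rewrite kl eqxx.
have dist s : rnorm (pi (gam s) phi - B s) <= kappa by rewrite /B rep_dist rnorm_phi.
have -> : inner (pi (gam q) phi) (pi (gam r) phi) =
   inner (B q) (B r) + inner (pi (gam q) phi - B q) (B r) + inner (pi (gam q) phi) (pi (gam r) phi - B r).
  by rewrite innerBl innerBr (addrC (inner (B q) (B r))) subrK addrC subrK.
have n1 : rnorm (inner (pi (gam q) phi - B q) (B r)) <= kappa * (delta + kappa).
  apply: le_trans (cauchy_schwarz _ _) _; apply: ler_pM; rewrite ?rnorm_ge0 ?dist //.
  by rewrite rep_rnorm rnorm_psi.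
have n2 : rnorm (inner (pi (gam q) phi) (pi (gam r) phi - B r)) <= (delta + kappa) * kappa.
  apply: le_trans (cauchy_schwarz _ _) _; apply: ler_pM; rewrite ?rnorm_ge0 ?dist //.
  by rewrite rep_rnorm rnorm_phi_le.
apply: le_lt_trans (cnormD _ _) _; apply: le_lt_trans (lerD (cnormD _ _) (lexx _)) _.
apply: le_lt_trans (lerD (lerD hB n1) n2) _.
have n3 : (delta - kappa) ^+ 2 <= rnorm phi ^+ 2.
  rewrite lerXn2r ?nnegrE ?rnorm_ge0 ?rnorm_phi_ge // /kappa; lra.
apply: lt_le_trans (_ : 2^-1 * (delta - kappa) ^+ 2 <= _); last by rewrite ler_wpM2l.
have -> : kappa ^+ 2 + kappa * (delta + kappa) + (delta + kappa) * kappa = (100^-1 ^+ 2 + 2 * (100^-1 * (101/100))) * delta ^+ 2.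
  by rewrite /kappa; field.
have -> : 2^-1 * (delta - kappa) ^+ 2 = (2^-1 * (99/100) ^+ 2) * delta ^+ 2 by rewrite /kappa; field.
by rewrite ltr_pM2r ?exprn_gt0 //; lra.
Qed.

End Frame.

(** Every finite part of [J] lies in some [s K] and the terms are nonnegative, so the sums over the
    [s K] determine the supremum that defines the sum over [J]. *)
Lemma esum_eq_sup (R : realType) (T : choiceType) (J : set T) (F : T -> R)
    (s : nat -> seq T) : (forall t, 0 <= F t) ->
  (forall K, uniq (s K) /\ forall t, t \in s K -> J t) ->
  (forall l : seq T, (forall t, t \in l -> J t) -> exists K, {subset l <= s K}) ->
  (forall M : R, (forall K, \sum_(t <- s K) F t <= M) -> (\esum_(t in J) (F t)%:E <= M%:E)%E) /\
  (forall K, ((\sum_(t <- s K) F t)%:E <= \esum_(t in J) (F t)%:E)%E).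
Proof.
move=> F0 hs exh; split=> [M hM|K].
  apply: ge_ereal_sup => _ [X [/finite_seqP[l ->] lJ] <-].
  have [K lK] := exh l lJ.
  apply: (@le_trans _ _ (\sum_(t \in [set` s K]) (F t)%:E)%E).
    apply: lee_fsum_nneg_subset; [exact: finite_seq|exact: finite_seq| |].
      by move=> t; rewrite !inE /=; exact: lK.
    by move=> t _; rewrite lee_fin.
  by rewrite -fsbig_seq ?(hs K).1 // sumEFin lee_fin.
apply: esum_ge; exists [set` s K].
  by split; [exact: finite_seq|move=> t /(hs K).2].
by rewrite -fsbig_seq ?(hs K).1 // sumEFin.
Qed.

(** * Separation modulo the projective kernel *)

Section Quotient.
Context {R : realType} {G : topologicalGroupType} {H : hilbertType R}.
Variable pi : unitary_representation G H.
Variables (phi : H) (Gamma : set G).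
Hypothesis phi0 : phi != 0.
Hypothesis sep : forall a b, Gamma a -> Gamma b -> a != b ->
  rnorm (inner (pi a phi) (pi b phi)) < 2^-1 * rnorm phi ^+ 2.

Let n0 : 0 < rnorm phi. Proof. by rewrite rnorm_gt0. Qed.

Lemma sep_eq a b : Gamma a -> Gamma b ->
  2^-1 * rnorm phi ^+ 2 <= rnorm (inner (pi a phi) (pi b phi)) -> a = b.
Proof. by move=> Ga Gb h; apply/eqP; apply: contraT => /(sep Ga Gb); rewrite ltNge h. Qed.

(** If [a] and [b] agree modulo the projective kernel, [pi a phi] and [pi b phi] differ by a scalar
    of modulus 1, so their overlap is [|phi|^2]. *)
Lemma quotient_injective : {in Gamma &, injective (quotient_map (pker pi))}.
Proof.
move=> a b /set_mem Ga /set_mem Gb /quotient_map_eq[z z1 hz].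
apply: sep_eq => //; rewrite -(rep_inner pi a^-1%g) -!repM mulVg rep1 hz innerZr rnormM.
rewrite rnorm_conj rnorm_innerxx /rnorm z1 /= mul1r.
have := sqr_ge0 (rnorm phi); rewrite /rnorm; lra.
Qed.

(** The neighbourhood [V0] moves [phi] by less than [|phi| / 8]. Two elements whose classes lie in
    one translate then overlap by at least [(1 - 1/8 - 1/8) |phi|^2], so they coincide and the
    cardinality bound is 1. *)
Lemma quotient_separated (K : set G) : compact K -> nbhs 1%g K ->
  left_relatively_separated (quotient_map (pker pi) @` Gamma).
Proof.
move=> cK nK; set q := quotient_map (pker pi).
have q1 : q 1%g = 1%g by [].
have mulK : (z.1 * z.2)%g @[z --> ((1%g, 1%g) : G * G)] --> 1%g.
  by have := @mulg_continuous G (1%g, 1%g); rewrite /continuous_at /= mulg1.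
have [[A B] /= [nA nB] AB] := mulK _ nK.
have c8 : 0 < rnorm phi / 8 by rewrite divr_gt0.
pose V0 := A `&` [set g | rnorm (pi g phi - phi) < rnorm phi / 8].
have nV0 : nbhs 1%g V0 by apply: filterI => //; exact: rep_near1.
exists (q @` V0); split.
- by rewrite -q1; exact: quotient_map_nbhs.
(* [A B] lies in [K], and a point [q y0] of the closure of [q V0] has the form [q (v * b)] with [v]
   in [V0] and [b] in [B], so the closure lies in the compact set [q K]. *)
- have cq : compact (q @` K).
    by apply: continuous_compact => //; apply: continuous_subspaceT; exact: quotient_map_continuous.
  apply: (subclosed_compact (@closed_closure _ _) cq) => y cy.
  move: cy; have [y0 ->] := quotient_map_surj y; rewrite -/(q y0) => cy.
  have nB' : nbhs y0 [set z | B (z^-1 * y0)%g].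
    have c : (z^-1 * y0)%g @[z --> nbhs y0] --> 1%g.
      rewrite -(mulVg y0).
      have cid : z @[z --> nbhs y0] --> y0 by exact: (fun _ h => h).
      exact: (cvgMg (cvgVg cid) (cvg_cst y0)).
    exact: (c _ nB).
  have [_ [[v Vv <-] [z /= Bz zv]]] := cy _ (quotient_map_nbhs (pker pi) nB').
  exists (v * (z^-1 * y0))%g; first exact: (AB (v, (z^-1 * y0)%g) (conj Vv.1 Bz)).
  by rewrite /q -[LHS]quotient_mulE -/(q v) -zv /q [LHS]quotient_mulE mulVKg.
exists 1%N => x; have [y ->] := quotient_map_surj x.
set S := _ `&` _; have Sone a b : S a -> S b -> a = b.
  move=> [[g Gg <-] [_ [v Vv <-] hv]] [[g' Gg' <-] [_ [v' Vv' <-] hv']].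
  congr (q _); apply: sep_eq => //.
  have act k l : q k = q l -> exists2 z : R[i], rnorm z = 1 & pi l phi = z *: pi k phi.
    move=> /quotient_map_eq[z z1 hz]; exists z; first by rewrite /rnorm z1.
    by rewrite -{1}(mulVKg k l) repM hz repZ.
  have qy k l : (q y * q l)%g = q k -> q k = q (y * l)%g.
    by move=> <-; rewrite [LHS]quotient_mulE.
  have [z z1 hz] := act _ _ (esym (qy _ _ hv)); have [z' z'1 hz'] := act _ _ (esym (qy _ _ hv')).
  rewrite hz hz' innerZl innerZr !rnormM rnorm_conj z1 z'1 !mul1r !repM rep_inner.
  have [Vv1 Vv2] : rnorm (pi v phi - phi) < rnorm phi / 8 /\ rnorm (pi v' phi - phi) < rnorm phi / 8.
    by split; [exact: Vv.2|exact: Vv'.2].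
  clear a b; set a := pi v phi in Vv1 *; set b := pi v' phi in Vv2 *.
  have e1 : inner phi phi = inner a b - inner (a - phi) b - inner phi (b - phi).
    by rewrite innerBl innerBr !subKr.
  have nb : rnorm b = rnorm phi by exact: rep_rnorm.
  have h1 := cauchy_schwarz (a - phi) b; have h2 := cauchy_schwarz phi (b - phi).
  have h3 : rnorm phi ^+ 2 <= rnorm (inner a b) + rnorm (inner (a - phi) b) + rnorm (inner phi (b - phi)).
    rewrite -rnorm_innerxx e1; apply: le_trans (cnormB _ _) _; rewrite lerD2r; exact: cnormB.
  rewrite nb in h1.
  have h4 : rnorm (a - phi) * rnorm phi <= rnorm phi / 8 * rnorm phi by rewrite ler_wpM2r ?rnorm_ge0 // ltW.
  have h5 : rnorm phi * rnorm (b - phi) <= rnorm phi * (rnorm phi / 8) by rewrite ler_wpM2l ?rnorm_ge0 // ltW.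
  have h6 : rnorm phi / 8 * rnorm phi = 8^-1 * rnorm phi ^+ 2 by ring.
  have h7 : rnorm phi * (rnorm phi / 8) = 8^-1 * rnorm phi ^+ 2 by ring.
  have h8 := sqr_ge0 (rnorm phi).
  rewrite h6 in h4; rewrite h7 in h5.
  lra.
have [[s Ss]|nS] := pselect (exists s, S s).
  apply: (card_le_trans (_ : S #<= [set s])%card).
    by apply: subset_card_le => t St; exact: Sone.
  by have := @card_set1 _ s; rewrite card_eq_le => /andP[].
rewrite (_ : S = set0); first exact: card_ge0.
by apply/seteqP; split=> // t St; case: nS; exists t.
Qed.

End Quotient.

Section FrameOfMixing.
Context {R : realType} {G : topologicalGroupType} {H : hilbertType R}.
Variable pi : unitary_representation G H.
Variables (u : R -> G) (h : nat -> G).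
Hypothesis uM : forall s t, u (s + t) = (u s * u t)%g.
Hypothesis u_mix : forall x y (eps : R), 0 < eps ->
  exists T, forall t, T <= t -> rnorm (inner (pi (u t) x) y) <= eps.
Hypothesis h_mix : forall x y (eps : R), 0 < eps ->
  exists N, forall k, (N <= k)%N -> rnorm (inner (pi (h k) x) y) <= eps.
Hypothesis hu1 : forall t, (h k * u t * (h k)^-1)%g @[k --> \oo] --> 1%g.

Theorem frame_of_mixing (K : set G) (x0 : H) (eps : R) : compact K -> nbhs 1%g K ->
  separable H -> x0 != 0 -> 0 < eps < 1 ->
  exists (phi : H) (Gamma : set G),
    [/\ phi != 0,
        countable Gamma,
        forall f : H,
          (((1 - eps) ^+ 2 * rnorm f ^+ 2)%:E
             <= \esum_(g in Gamma) (rnorm (inner f (pi g phi)) ^+ 2)%:E)%E /\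
          (\esum_(g in Gamma) (rnorm (inner f (pi g phi)) ^+ 2)%:E
             <= ((1 + eps) ^+ 2 * rnorm f ^+ 2)%:E)%E,
        {in Gamma &, injective (quotient_map (pker pi))} &
        left_relatively_separated (quotient_map (pker pi) @` Gamma)].
Proof.
move=> cK nK sepH x00 eps01; have [v dv] := dense_sequence sepH.
have /andP[eps0 eps1] := eps01.
pose delta := eps / 4; pose kappa := delta / 100.
have delta0 : 0 < delta by rewrite divr_gt0.
have kappa01 : 0 < kappa <= 1 by rewrite divr_gt0 //= /kappa /delta; lra.
have [oe _] := gram_schmidt_orthosys v.
have e1 k : rnorm (gram_schmidt v k) <= 1 by case: (oe k) => ->; rewrite ?rnorm0.
have n1 : rnorm (normalize x0) = 1.
  by rewrite /normalize rnormZ rnormCr ?invr_ge0 ?rnorm_ge0 // mulVf // rnorm_eq0.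
have st psi e xs (eta : R) N := @stage _ _ _ pi u h uM u_mix h_mix hu1 psi e xs eta N.
have [N [g [psi [w /= [[psi0 psiS] N0 w_le gw BB]]]]] :=
  ex_construction st (delta%:C *: normalize x0) e1 kappa01.
have [phi hphi] := ex_limit eps01 psiS w_le.
have ge := rnorm_phi_ge eps01 n1 psi0 hphi.
have phi_n0 : phi != 0.
  by rewrite -rnorm_gt0; apply: lt_le_trans ge; rewrite /kappa; lra.
have up := frame_upper eps01 n1 psi0 psiS N0 w_le gw BB hphi.
have low := frame_lower dv eps01 n1 psi0 psiS N0 w_le gw BB hphi.
have sp := separated eps01 n1 psi0 psiS w_le BB hphi.
pose J : set (nat * nat) := [set q | (q.2 < N q.1)%N].
pose gam (q : nat * nat) := g q.1 q.2; pose Gamma := gam @` J.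
have sepG a b : Gamma a -> Gamma b -> a != b ->
    rnorm (inner (pi a phi) (pi b phi)) < 2^-1 * rnorm phi ^+ 2.
  move=> [q Jq <-] [r Jr <-] qr; apply: sp => //; by apply: contra qr => /eqP ->.
have gam_inj : {in J &, injective gam}.
  move=> q r /set_mem Jq /set_mem Jr qr; apply/eqP; apply: contraT => /(sp _ _ Jq Jr).
  rewrite -/(gam q) qr rnorm_innerxx rep_rnorm.
  by have := sqr_ge0 (rnorm phi); lra.
exists phi, Gamma; split => //.
- exact: (card_le_trans (card_image_le _ _) (countableP _)).
- move=> f; pose F (q : nat * nat) := rnorm (inner f (pi (gam q) phi)) ^+ 2.
  have bij : set_bij J Gamma gam by split=> // q Jq; exists q.
  (* By separation [gam] is injective on [J], so the sum over the set [Gamma] counts each pair of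
     indices once. *)
  rewrite (reindex_esum _ _ _ (fun x => (rnorm (inner f (pi x phi)) ^+ 2)%:E) bij).
  have [|||h1 h2] := @esum_eq_sup R _ J F (idx N).
  + by move=> t; exact: sqr_ge0.
  + by move=> k; split; [exact: idx_uniq|move=> t; rewrite mem_idx => /andP[]].
  + move=> l lJ; exists (\max_(q <- l) q.1).+1 => q ql; rewrite mem_idx lJ // andbT ltnS.
    exact: (@leq_bigmax_seq _ l xpredT (fun q : nat * nat => q.1) q ql isT).
  split; last by apply: h1 => k; exact: up.
  apply/lee_addgt0Pr => d d0; have [k hk] := low f d d0.
  apply: (@le_trans _ _ ((\sum_(q <- idx N k) F q)%:E + d%:E)%E); last by rewrite leeD2r.
  by rewrite -EFinD lee_fin -lerBlDr.
- exact: quotient_injective sepG.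
- exact: (quotient_separated phi_n0 sepG cK nK).
Qed.

End FrameOfMixing.

Lemma compact_nbhs1 (R : realType) n (G : topologicalGroupType)
    (br : 'rV[R]_n -> 'rV[R]_n -> 'rV[R]_n) e (Ad : G -> 'rV[R]_n -> 'rV[R]_n) p :
  exponential br e Ad p -> exists2 K : set G, compact K & nbhs 1%g K.
Proof.
move=> ex; have [d d0 pc] := par_cont ex; have d2 : 0 < d / 2 by rewrite divr_gt0.
pose B := closed_ball (0 : 'rV[R]_n) (d / 2).
have BP x : B x <-> `|x| <= d / 2 by rewrite /B closed_ballE // /closed_ball_ /= sub0r normrN.
exists (p @` B).
  apply: continuous_compact.
    apply: continuous_in_subspaceT => x /set_mem /BP xB; apply: pc; lra.
  apply: bounded_closed_compact; last exact: closed_ball_closed.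
  by exists (d / 2); split; [exact: num_real|move=> y hy x /BP /le_trans; apply; exact: ltW].
have := par_near ex d2; apply: filterS => g [a ad ->]; exists a => //.
by apply/BP; exact: ltW.
Qed.

Local Close Scope complex_scope.

Theorem theorem1p4 (R : realType) (n : nat) (G : lieGroupType R n)
    (H : hilbertType R) (pi : unitary_representation G H) :
  connected [set: G] ->
  semisimple G ->
  finite_set (group_center G) ->
  separable H ->
  infinite_dimensional H ->
  irreducible pi ->
  forall eps : R, 0 < eps < 1 ->
  exists (phi : H) (Gamma : set G),
    [/\ phi != 0,
        countable Gamma,
        forall f : H,
          (((1 - eps) ^+ 2 * rnorm f ^+ 2)%:E
             <= \esum_(g in Gamma) (rnorm (inner f (pi g phi)) ^+ 2)%:E)%E /\
          (\esum_(g in Gamma) (rnorm (inner f (pi g phi)) ^+ 2)%:E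
             <= ((1 + eps) ^+ 2 * rnorm f ^+ 2)%:E)%E,
        {in Gamma &, injective (quotient_map (pker pi))} &
        left_relatively_separated (quotient_map (pker pi) @` Gamma)].
Proof.
move=> conn ss finZ sep inf irr eps eps01.
have [c ca c1] := atlas_cover (1%g : G).
have [e [Ad [p ex]]] := lie_exponential ca c1 conn.
have [K cK nK] := compact_nbhs1 ex.
(* Semisimplicity is assumed for every chart at the identity; it is applied to the chart [c] that
   defines the bracket. *)
have [u [h [uM u_mix h_mix hu1]]] := ex_mixing ex (ss c ca c1) finZ irr inf.
have [x0 x00] := irr.1.
exact: (frame_of_mixing uM u_mix h_mix hu1 cK nK sep x00 eps01).
Qed.
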